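(* Let $\lambda=f\bar\lambda_0$, $f>0$ smooth, be a contact form on $T^1S^2$ admitting prime closed Reeb orbits $l_0,l_1$ which are the components of a Hopf link $l=l_0\cup l_1$, assumed (without loss of generality) to be in normal position, i.e. $l_i=D(L_i)$ for $i=0,1$. Let $\eta_i=2\rho(l_i)-1$, $i=0,1$, where $\rho(l_i)$ is the transverse rotation number of $l_i$. Let $(p,q)\in\mathbb{Z}\times\mathbb{Z}$ be a relatively prime pair of integers and assume that $$(1,\eta_1)<(p,q)<(\eta_0,1)\quad\text{or}\quad(\eta_0,1)<(p,q)<(1,\eta_1).$$ Then: (i) if $p+q$ is even, $\lambda$ admits a prime closed Reeb orbit $\gamma_{p,q}\subset T^1S^2\setminus l$, non-contractible in $T^1S^2$, satisfying $\mathrm{wind}_0(\gamma_{p,q})=p/2$ and $\mathrm{wind}_1(\gamma_{p,q})=q/2$; (ii) if $p+q$ is odd, $\lambda$ admits a prime closed Reeb orbit $\gamma_{p,q}\subset T^1S^2\setminus l$, contractible in $T^1S^2$, satisfying $\mathrm{wind}_0(\gamma_{p,q})=p$ and $\mathrm{wind}_1(\gamma_{p,q})=q$.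
   Context: $g_0$ is the Euclidean metric on $\mathbb{R}^3$, $T^1S^2=\{(x,v)\in\mathbb{R}^3\times\mathbb{R}^3\mid g_0(x,x)=g_0(v,v)=1,\ g_0(x,v)=0\}$, $\Pi(x,v)=x$, $\bar\lambda_0|_{(x,v)}\cdot w=g_0(v,d\Pi\cdot w)$, $\bar\xi_0=\ker\bar\lambda_0$. On the unit sphere $S^3\subset\mathbb{C}^2$ with coordinates $(z_0,z_1)=(q_0+ip_0,q_1+ip_1)$ let $\lambda_0=\frac12\sum_j(q_jdp_j-p_jdq_j)$. The double covering $D:S^3\to T^1S^2$ is $D(q_0,p_0,q_1,p_1)=(x,v)$ with $x=(q_0^2-p_0^2+q_1^2-p_1^2,\ 2(-q_0p_0+q_1p_1),\ 2(q_0p_1+p_0q_1))$ and $v=(-2(q_0p_0+q_1p_1),\ -(q_0^2-p_0^2-q_1^2+p_1^2),\ 2(q_0q_1-p_0p_1))$; it satisfies $D^*\bar\lambda_0=4\lambda_0$ and has deck group generated by $z\mapsto-z$. $L_i=\{z_i=0\}\cap S^3$, $i=0,1$. The link $D(L_0)\cup D(L_1)$ is the Hopf link in normal position; a Hopf link in $T^1S^2$ is any transverse link in $(T^1S^2,\bar\xi_0)$ transversally isotopic to it (any such link can be brought to normal position by an ambient contact isotopy). For a closed curve $\bar\alpha:[0,1]\to T^1S^2\setminus l$ (with $l$ in normal position), lift it to $\alpha=(r_0e^{i\phi_0},r_1e^{i\phi_1}):[0,1]\to S^3\setminus(L_0\cup L_1)$ with $r_j>0$ and $\phi_j$ real-valued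 continuous; $\mathrm{wind}_j(\bar\alpha)=(\phi_j(1)-\phi_j(0))/2\pi\in\frac12\mathbb{Z}$, $j=0,1$. Reeb vector field: $\lambda(X_\lambda)=1$, $d\lambda(X_\lambda,\cdot)=0$. A closed Reeb orbit is a pair $(x,T)$, $T>0$, with $x$ a $T$-periodic trajectory of $X_\lambda$; it is prime if $T$ is the minimal period. Knots tangent to $X_\lambda$ are identified with prime closed Reeb orbits. Transverse rotation number: for $(x,v)\in T^1S^2$ let $v^\perp\in T_xS^2$ be the unit vector making $\{v,v^\perp\}$ a positive orthonormal basis, and let $v^{\perp,V},v^{\perp,H}$ be its vertical and horizontal lifts (Levi-Civita connection of $g_0$). Then $\frac1{\sqrt f}\{v^{\perp,V},v^{\perp,H}\}$ is a global $d\lambda$-symplectic frame of $\bar\xi_0$. For a prime closed Reeb orbit $P=(x,T)$, $\rho(P)=T\lim_{t\to\infty}\theta(t)/(2\pi t)$, where $r(t)e^{i\theta(t)}$ represents, in this frame, any non-zero solution in $\bar\xi_0|_{x(t)}$ of the linearized Reeb flow along $x$. Order: for pairs in $\{(s,t)\in\mathbb{R}^2\mid s>0\text{ or }t>0\}$, $(s_0,t_0)<(s_1,t_1)$ means that the argument in $(-\pi,\pi)$ of $(s_1,t_1)$ is greater than that of $(s_0,t_0)$. A pair of integers $(p,q)$ is relatively prime if there is no integer $k>1$ with $(p/k,q/k)\in\mathbb{Z}\times\mathbb{Z}$. *)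

(* Defs.v *)
From HB Require Import structures.
From mathcomp Require Import all_boot all_order all_algebra.
From mathcomp Require Import all_classical all_reals all_analysis.
Import Order.TTheory GRing.Theory Num.Theory.
Import numFieldNormedType.Exports.

Set Implicit Arguments.
Unset Strict Implicit.
Unset Printing Implicit Defensive.

Local Open Scope classical_set_scope.
Local Open Scope ring_scope.

Section Calculus.
Context {R : realType} {V : normedModType R}.

(* For finite-dimensional V (the only use below, V = R^3 x R^3), this is the
   usual C^k: a map is C^(k+1) iff it is differentiable and all its directional
   derivatives are C^k. *)
Fixpoint Ck (k : nat) (f : V -> R) : Prop :=
  if k is k'.+1 then
    (forall p, differentiable f p) /\ (forall v, Ck k' ('D_v f))
  else continuous f.

Definition smooth (f : V -> R) : Prop := forall k, Ck k f.

(* Exterior derivative of the one-form lam, where lam p w is the value of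
   lam_p on w; this is d lam(u, w) = u(lam(w)) - w(lam(u)) - lam([u, w]) on
   constant vector fields u, w. *)
Definition dext (lam : V -> V -> R) (p u w : V) : R :=
  'D_u (fun y => lam y w) p - 'D_w (fun y => lam y u) p.

End Calculus.

Section Euclidean.
Context {R : realType}.

Definition vec3 (a b c : R) : 'rV[R]_3 := \row_(i < 3) [:: a; b; c]`_i.

Definition dot (u v : 'rV[R]_3) : R := \sum_(i < 3) u 0 i * v 0 i.

Definition cross (u v : 'rV[R]_3) : 'rV[R]_3 :=
  vec3 (u 0 1 * v 0 2%:R - u 0 2%:R * v 0 1)
       (u 0 2%:R * v 0 0 - u 0 0 * v 0 2%:R)
       (u 0 0 * v 0 1 - u 0 1 * v 0 0).

End Euclidean.

(* The ambient space R^3 x R^3 of T^1S^2; points are pairs (x, v). *)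
Notation V6 R := ('rV[R]_3 * 'rV[R]_3)%type.

Section UnitTangentBundle.
Context {R : realType}.

Definition T1S2 : set (V6 R) :=
  [set p | [/\ dot p.1 p.1 = 1, dot p.2 p.2 = 1 & dot p.1 p.2 = 0]].

(* w is in T_p(T^1S^2): the kernel of the differentials at p of the three
   defining functions of T^1S^2. *)
Definition tangent (p w : V6 R) : Prop :=
  [/\ dot p.1 w.1 = 0, dot p.2 w.2 = 0 & dot w.1 p.2 + dot p.1 w.2 = 0].

(* The projection Pi(x, v) = x is linear, so dPi . w = w.1. *)
Definition lambda_bar0 (p w : V6 R) : R := dot p.2 w.1.

Definition xi_bar0 (p w : V6 R) : Prop := tangent p w /\ lambda_bar0 p w = 0.

(* A smooth function on the closed submanifold T^1S^2 is the restriction of a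
   smooth f on R^3 x R^3; f lambda_bar0 and its exterior derivative are only
   ever evaluated on vectors tangent to T^1S^2, where they do not depend on the
   chosen extension. *)
Definition conformal_form (f : V6 R -> R) (p w : V6 R) : R :=
  f p * lambda_bar0 p w.

Definition reeb_vector (lam : V6 R -> V6 R -> R) (p X : V6 R) : Prop :=
  [/\ tangent p X, lam p X = 1 & forall w, tangent p w -> dext lam p X w = 0].

Definition reeb_trajectory (lam : V6 R -> V6 R -> R) (x : R -> V6 R) : Prop :=
  forall t, T1S2 (x t) /\
    exists2 X, reeb_vector lam (x t) X & is_derive t (1 : R) x X.

Definition prime_closed_orbit (lam : V6 R -> V6 R -> R) (x : R -> V6 R) (T : R)
  : Prop :=
  [/\ reeb_trajectory lam x, 0 < T, (forall t, x (t + T) = x t)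
    & forall S, 0 < S < T -> ~ (forall t, x (t + S) = x t)].

Definition reeb_flow (lam : V6 R -> V6 R -> R) (phi : R -> V6 R -> V6 R)
  : Prop :=
  forall p, T1S2 p -> phi 0 p = p /\ reeb_trajectory lam (phi^~ p).

(* dF_p . u = w for a map F of T^1S^2 to itself and u in T_p(T^1S^2), tested
   on curves in T^1S^2 with velocity u at p. *)
Definition tangent_map (F : V6 R -> V6 R) (p u w : V6 R) : Prop :=
  forall c : R -> V6 R, (forall s, T1S2 (c s)) -> c 0 = p ->
    is_derive (0 : R) (1 : R) c u -> is_derive (0 : R) (1 : R) (F \o c) w.

Definition linearized_reeb_solution (lam : V6 R -> V6 R -> R)
    (x : R -> V6 R) (Y : R -> V6 R) : Prop :=
  exists2 phi, reeb_flow lam phi &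
    forall t, tangent_map (phi t) (x 0) (Y 0) (Y t).

(* S^2 is oriented by the outward normal x, so that {v, x * v} is the positive
   orthonormal basis of T_x S^2. *)
Definition vperp (p : V6 R) : 'rV[R]_3 := cross p.1 p.2.

Definition vlift (p : V6 R) (w : 'rV[R]_3) : V6 R := (0, w).

(* The velocity at s = 0 of (c, v(s)) for a curve c in S^2 with velocity w,
   with v(s) the parallel transport of v along c. *)
Definition hlift (p : V6 R) (w : 'rV[R]_3) : V6 R := (w, - dot p.2 w *: p.1).

Definition frame1 (f : V6 R -> R) (p : V6 R) : V6 R :=
  (Num.sqrt (f p))^-1 *: vlift p (vperp p).

Definition frame2 (f : V6 R -> R) (p : V6 R) : V6 R :=
  (Num.sqrt (f p))^-1 *: hlift p (vperp p).

(* The limit does not depend on the non-zero solution Y in xi_bar0. *)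
Definition is_rotation_number (f : V6 R -> R) (x : R -> V6 R) (T rho : R)
  : Prop :=
  exists (Y : R -> V6 R) (r theta : R -> R),
    [/\ linearized_reeb_solution (conformal_form f) x Y,
        (forall t, xi_bar0 (x t) (Y t) /\ Y t != 0),
        continuous theta,
        (forall t, 0 < r t /\
           Y t = r t *: (cos (theta t) *: frame1 f (x t) +
                         sin (theta t) *: frame2 f (x t)))
      & T * (theta t / (2 * pi * t)) @[t --> +oo] --> rho].

(* The loop [0, 1] -> T^1S^2 of a closed orbit (x, T). *)
Definition loop_of (x : R -> V6 R) (T : R) : R -> V6 R := fun s => x (T * s).

(* Contractibility in T^1S^2 of a loop parametrized by [0, 1], as free
   homotopy of loops to a constant one. *)
Definition contractible (a : R -> V6 R) : Prop :=
  exists (H : R * R -> V6 R) (c : V6 R),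
    [/\ {within `[0, 1] `*` `[0, 1], continuous H},
        (forall s t, 0 <= s <= 1 -> 0 <= t <= 1 -> T1S2 (H (s, t))),
        (forall t, 0 <= t <= 1 -> H (0, t) = a t),
        (forall t, 0 <= t <= 1 -> H (1, t) = c)
      & (forall s, 0 <= s <= 1 -> H (s, 0) = H (s, 1))].

End UnitTangentBundle.

(* C^2 in the real coordinates ((q0, p0), (q1, p1)), z_j = q_j + i p_j. *)
Notation C2 R := ((R * R) * (R * R))%type.

Section DoubleCover.
Context {R : realType}.

Definition S3 : set (C2 R) :=
  [set z | z.1.1 ^+ 2 + z.1.2 ^+ 2 + z.2.1 ^+ 2 + z.2.2 ^+ 2 = 1].

Definition L0 : set (C2 R) := S3 `&` [set z | z.1 = (0, 0)].
Definition L1 : set (C2 R) := S3 `&` [set z | z.2 = (0, 0)].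

Definition Dcov (z : C2 R) : V6 R :=
  let: ((q0, p0), (q1, p1)) := z in
  (vec3 (q0 ^+ 2 - p0 ^+ 2 + q1 ^+ 2 - p1 ^+ 2)
        (2 * (- (q0 * p0) + q1 * p1))
        (2 * (q0 * p1 + p0 * q1)),
   vec3 (- 2 * (q0 * p0 + q1 * p1))
        (- (q0 ^+ 2 - p0 ^+ 2 - q1 ^+ 2 + p1 ^+ 2))
        (2 * (q0 * q1 - p0 * p1))).

Definition hopf_link : set (V6 R) := Dcov @` L0 `|` Dcov @` L1.

Definition polar (r phi : R) : R * R := (r * cos phi, r * sin phi).

(* (w0, w1) = (wind_0(a), wind_1(a)) for a curve a : [0, 1] -> T^1S^2 \ l; the
   values do not depend on the lift and the angles chosen. *)
Definition has_winds (a : R -> V6 R) (w0 w1 : R) : Prop :=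
  exists r0 phi0 r1 phi1 : R -> R,
    [/\ {within `[0, 1], continuous r0} /\ {within `[0, 1], continuous phi0},
        {within `[0, 1], continuous r1} /\ {within `[0, 1], continuous phi1},
        (forall t, 0 <= t <= 1 ->
           let z := (polar (r0 t) (phi0 t), polar (r1 t) (phi1 t)) in
           [/\ 0 < r0 t, 0 < r1 t, S3 z & Dcov z = a t]),
        w0 = (phi0 1 - phi0 0) / (2 * pi)
      & w1 = (phi1 1 - phi1 0) / (2 * pi)].

End DoubleCover.

Section ArgumentOrder.
Context {R : realType}.

Definition is_arg (a : R * R) (th : R) : Prop :=
  - pi < th < pi /\ exists2 r, 0 < r & a = polar r th.

Definition arg_domain (a : R * R) : bool := (0 < a.1) || (0 < a.2).

Definition arg_lt (a b : R * R) : Prop :=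
  [/\ arg_domain a, arg_domain b &
      exists th_a th_b, [/\ is_arg a th_a, is_arg b th_b & th_a < th_b]].

End ArgumentOrder.

Definition relatively_prime (p q : int) : Prop :=
  forall k : int, 1 < k -> ~ ((k %| p)%Z /\ (k %| q)%Z).

(* Main.v *)
(** In the coordinates z = (sin x e^(ia), cos x e^(ib)) of S^3, the Reeb flow of
    f lambda_bar0 is the flow of the 1-homogeneous Hamiltonian (I0 + I1) / 2 * U, where
    U = 1 / f and tan^2 x = I0 / I1, on the product of the torus of the angles (a, b) and
    the quadrant of the actions I0, I1 > 0. This Hamiltonian is truncated above its level
    set, extended across I0 = 0 and I1 = 0 by the linearized flow along the link, and
    corrected far away and on negative actions by a term which is convex or concave
    according to which of the two chains of inequalities holds. Its trajectories closing up
    after a translation of the angles are critical points of an action functional; for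
    the discretized functional, a linking argument resting on a discrete Poincare-Miranda
    theorem produces almost critical points, whose ultralimit is a closed trajectory of
    positive action. The signs of I0 and I1 are constant along it, and the inequalities on
    (p, q) exclude I0 <= 0 and I1 <= 0, where the angles follow the flow linearized along
    the link, whose rotation number in these coordinates is eta = 2 rho - 1. What remains
    is a Reeb trajectory off the link with the prescribed windings. *)

Require Import Defs.
From HB Require Import structures.
From mathcomp Require Import all_boot all_order all_fingroup all_algebra.
From mathcomp Require Import all_classical all_reals all_analysis.
From mathcomp Require Import ring lra zify.
Import Order.TTheory GRing.Theory Num.Theory.
Import numFieldNormedType.Exports.

Set Implicit Arguments.
Unset Strict Implicit.
Unset Printing Implicit Defensive.

Local Open Scope classical_set_scope.
Local Open Scope ring_scope.

(** * A discrete Poincare-Miranda theorem *)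

(** The Hamiltonian is singular where both actions vanish; its truncation to 0 below level 1/2
    removes this corner. Across a single axis it extends only because the link consists of Reeb
    orbits: [U_x] vanishes at both ends of the quadrant, so the derivative in [I0] has the limit
    [U / 2 + U_xx / 4] at [I0 = 0], the angular velocity of the linearized flow. For negative
    actions the correction perturbs that flow, which is why it needs a sign: it pushes the angle
    away from the translation that a closed trajectory would require. The same sign decides the
    linking: a square of constant momenta around a point in the convex case, a segment crossing a
    line in the concave one. The formula [eta = 2 rho - 1] has two sources: in the given frame the
    transverse angle is the sum of the two angles, and the angle along the link advances by [pi],
    not [2 pi], in one period. All limits are taken along one fixed ultrafilter, so no subsequence
    is ever extracted; continuity is phrased in the same way, and is then preserved by composition
    at no cost. *)

Lemma xor_eq (a b : bool) : a (+) b = false -> a = b.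
Proof. by case: a; case: b. Qed.

Section DiscretePoincareMiranda.
Variables (n k : nat).
Local Notation m := n.+1.
Implicit Types (g : 'I_m -> ('I_m -> nat) -> bool) (s : 'S_m).
Local Notation pt := ('I_m -> nat).

(** The monotone edge path of the unit cube at [v] that raises coordinate [j] in step [s j]; its
    vertices span one simplex of the Kuhn triangulation. *)
Definition lattice_path (v : pt) s (i : nat) : pt := fun j => (v j + (s j < i))%N.

Definition path_step g (W : nat -> pt) (i : 'I_m) (j : nat) : bool :=
  g i (W j.+1) (+) g i (W j).

(** The cup product modulo 2 of the coboundaries of the [g i], evaluated on the Kuhn triangulation
    of the box [[0, k]^m]. Like a degree, it depends only on the values on the faces of the box. *)
Definition cube_sum g : bool :=
  \big[addb/false]_(v : {ffun 'I_m -> 'I_k}) \big[addb/false]_(s : 'S_m)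
    \big[andb/true]_(i < m) path_step g (lattice_path (fun j => v j) s) i i.

(** Composition with the transposition of [l] and [l.+1] pairs even and odd permutations, and it
    moves only the vertex [l.+1] of the path. *)
Lemma xor_path_cancel (Phi : (nat -> pt) -> bool) (v : pt) (l : nat) :
  (l.+1 < m)%N ->
  (forall W W' : nat -> pt, (forall i, i != l.+1 -> W i = W' i) -> Phi W = Phi W') ->
  \big[addb/false]_(s : 'S_m) Phi (lattice_path v s) = false.
Proof.
move=> lm Phi_eq.
pose a := Ordinal (ltnW lm); pose b := Ordinal lm.
have ab : a != b by apply/eqP => /(congr1 val) /=; lia.
pose t := tperm a b.
have reflS : \big[addb/false]_(s : 'S_m) Phi (lattice_path v s) =
    \big[addb/false]_(s : 'S_m | odd_perm s) Phi (lattice_path v s) (+)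
    \big[addb/false]_(s : 'S_m | ~~ odd_perm s) Phi (lattice_path v s).
  by rewrite (bigID (fun s : 'S_m => odd_perm s)).
rewrite reflS.
have -> : \big[addb/false]_(s : 'S_m | ~~ odd_perm s) Phi (lattice_path v s) =
  \big[addb/false]_(s : 'S_m | odd_perm s) Phi (lattice_path v s).
  rewrite (reindex_inj (mulIg t)) /=; apply: eq_big => [s|s _].
    by rewrite odd_permM odd_tperm ab; case: (odd_perm s).
  apply: Phi_eq => i il; apply/funext => j; rewrite /lattice_path permM; congr (_ + nat_of_bool _)%N.
  rewrite /t; case: tpermP => [->|->|//] /=; lia.
exact: addbb.
Qed.

(* The r-th factor is replaced by a cochain F, evaluated at one vertex, and step l of the path is skipped. *)
Definition skip_after g (F : pt -> bool) (r : 'I_m) (l : nat) (W : nat -> pt) : bool :=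
  F (W r) && \big[andb/true]_(i < m | i != r)
    path_step g W i (if (r < i <= l)%N then i.-1 else i).

Definition skip_before g (F : pt -> bool) (r : 'I_m) (l : nat) (W : nat -> pt) : bool :=
  F (W r.+1) && \big[andb/true]_(i < m | i != r)
    path_step g W i (if (l <= i < r)%N then i.+1 else i).

(** The two sums differ only in the factor [l.+1], taken along the step [l.+1] or the step [l].
    Added together these telescope, and the total no longer sees the vertex [l.+1]. *)
Lemma skip_after_shift g F (r : 'I_m) (v : pt) (l : nat) : (r <= l)%N -> (l.+1 < m)%N ->
  \big[addb/false]_(s : 'S_m) skip_after g F r l (lattice_path v s) =
  \big[addb/false]_(s : 'S_m) skip_after g F r l.+1 (lattice_path v s).
Proof.
move=> rl lm; apply: xor_eq.
rewrite -big_split /=.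
apply: (@xor_path_cancel (fun W => skip_after g F r l W (+) skip_after g F r l.+1 W) v l lm) => W W' WW'.
pose b := Ordinal lm.
have br : b != r by apply/eqP => /(congr1 val) /=; lia.
have WE i : (i <= l)%N || (l.+1 < i)%N -> W i = W' i by move=> il; apply: WW'; lia.
rewrite /skip_after !(bigD1 (P := fun i => i != r) b br) /=.
have -> : (r < l.+1 <= l)%N = false by lia.
have -> : (r < l.+1 <= l.+1)%N by lia.
rewrite /path_step /=.
have eqA Z : \big[andb/true]_(i < m | (i != r) && (i != b))
   (g i (Z (if (r < i <= l)%N then i.-1 else i).+1) (+) g i (Z (if (r < i <= l)%N then i.-1 else i))) =
   \big[andb/true]_(i < m | (i != r) && (i != b))
   (g i (Z (if (r < i <= l.+1)%N then i.-1 else i).+1) (+) g i (Z (if (r < i <= l.+1)%N then i.-1 else i))).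
  apply: eq_bigr => i /andP[_ ib].
  have ib' : (nat_of_ord i) != l.+1 by apply: contra ib => /eqP e; apply/eqP/val_inj.
  by have -> : (r < i <= l.+1)%N = (r < i <= l)%N by lia.
rewrite !eqA.
have eqW : \big[andb/true]_(i < m | (i != r) && (i != b))
   (g i (W (if (r < i <= l.+1)%N then i.-1 else i).+1) (+) g i (W (if (r < i <= l.+1)%N then i.-1 else i))) =
   \big[andb/true]_(i < m | (i != r) && (i != b))
   (g i (W' (if (r < i <= l.+1)%N then i.-1 else i).+1) (+) g i (W' (if (r < i <= l.+1)%N then i.-1 else i))).
  apply: eq_bigr => i /andP[ir ib].
  have ib' : (nat_of_ord i) != l.+1 by apply: contra ib => /eqP e; apply/eqP/val_inj.
  have ir' : (nat_of_ord i) != r by apply: contra ir => /eqP e; apply/eqP/val_inj.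
  by case: ifP => h; rewrite !WE //; lia.
rewrite eqW (WE r) ?rl // (WE l) ?leqnn // (WE l.+2) ?ltnSn ?orbT //.
by case: (F _); case: (bigop _ _ _) => //=; rewrite ?andbT ?andbF //; case: (g b (W l.+1)); case: (g b (W' l.+1)); case: (g b (W' l)); case: (g b (W' l.+2)).
Qed.

Lemma skip_before_shift g F (r : 'I_m) (v : pt) (l : nat) : (l < r)%N ->
  \big[addb/false]_(s : 'S_m) skip_before g F r l (lattice_path v s) =
  \big[addb/false]_(s : 'S_m) skip_before g F r l.+1 (lattice_path v s).
Proof.
move=> lr; have lm : (l.+1 < m)%N by have := ltn_ord r; lia.
apply: xor_eq.
rewrite -big_split /=.
apply: (@xor_path_cancel (fun W => skip_before g F r l W (+) skip_before g F r l.+1 W) v l lm) => W W' WW'.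
pose b := Ordinal (ltnW lm).
have br : b != r by apply/eqP => /(congr1 val) /=; lia.
have WE i : (i <= l)%N || (l.+1 < i)%N -> W i = W' i by move=> il; apply: WW'; lia.
rewrite /skip_before !(bigD1 (P := fun i => i != r) b br) /=.
have -> : (l.+1 <= l < r)%N = false by lia.
have -> : (l <= l < r)%N by lia.
rewrite /path_step /=.
have eqA Z : \big[andb/true]_(i < m | (i != r) && (i != b))
   (g i (Z (if (l <= i < r)%N then i.+1 else i).+1) (+) g i (Z (if (l <= i < r)%N then i.+1 else i))) =
   \big[andb/true]_(i < m | (i != r) && (i != b))
   (g i (Z (if (l.+1 <= i < r)%N then i.+1 else i).+1) (+) g i (Z (if (l.+1 <= i < r)%N then i.+1 else i))).
  apply: eq_bigr => i /andP[_ ib].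
  have ib' : (nat_of_ord i) != l by apply: contra ib => /eqP e; apply/eqP/val_inj.
  by have -> : (l.+1 <= i < r)%N = (l <= i < r)%N by lia.
rewrite !eqA.
have eqW : \big[andb/true]_(i < m | (i != r) && (i != b))
   (g i (W (if (l.+1 <= i < r)%N then i.+1 else i).+1) (+) g i (W (if (l.+1 <= i < r)%N then i.+1 else i))) =
   \big[andb/true]_(i < m | (i != r) && (i != b))
   (g i (W' (if (l.+1 <= i < r)%N then i.+1 else i).+1) (+) g i (W' (if (l.+1 <= i < r)%N then i.+1 else i))).
  apply: eq_bigr => i /andP[ir ib].
  have ib' : (nat_of_ord i) != l by apply: contra ib => /eqP e; apply/eqP/val_inj.
  have ir' : (nat_of_ord i) != r by apply: contra ir => /eqP e; apply/eqP/val_inj.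
  by case: ifP => h; rewrite !WE //; lia.
rewrite eqW (WE r.+1) ?ltnS ?lr ?orbT // (WE l) ?leqnn // (WE l.+2) ?ltnSn ?orbT //.
by case: (F _); case: (bigop _ _ _) => //=; rewrite ?andbT ?andbF //; case: (g b (W l.+1)); case: (g b (W' l.+1)); case: (g b (W' l)); case: (g b (W' l.+2)).
Qed.

Lemma skip_afterE g F (r : 'I_m) (v : pt) :
  \big[addb/false]_(s : 'S_m) skip_after g F r r (lattice_path v s) =
  \big[addb/false]_(s : 'S_m) skip_after g F r n (lattice_path v s).
Proof.
have H d : (r + d <= n)%N -> \big[addb/false]_(s : 'S_m) skip_after g F r r (lattice_path v s) =
  \big[addb/false]_(s : 'S_m) skip_after g F r (r + d) (lattice_path v s).
  elim: d => [|d IH] h; first by rewrite addn0.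
  by rewrite IH; [rewrite addnS; apply: skip_after_shift; lia|lia].
by rewrite (H (n - r)%N); [congr bigop; apply/funext => s; rewrite subnKC // -ltnS|have := ltn_ord r; lia].
Qed.

Lemma skip_beforeE g F (r : 'I_m) (v : pt) :
  \big[addb/false]_(s : 'S_m) skip_before g F r r (lattice_path v s) =
  \big[addb/false]_(s : 'S_m) skip_before g F r 0 (lattice_path v s).
Proof.
have H d : (d <= r)%N -> \big[addb/false]_(s : 'S_m) skip_before g F r 0 (lattice_path v s) =
  \big[addb/false]_(s : 'S_m) skip_before g F r d (lattice_path v s).
  elim: d => [//|d IH] h.
  by rewrite IH; [apply: skip_before_shift|lia].
by rewrite (H r).
Qed.

(** The last step, which raises [j], is skipped, so the whole path stays in an outer face; there [F]
    vanishes if [j = r], and [g j] is constant otherwise. *)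
Lemma skip_after_face g F (r : 'I_m) (s : 'S_m) (v : pt) (j : 'I_m) :
  (forall i v, v i = 0%N -> g i v = false) -> (forall i v, v i = k -> g i v = true) ->
  (forall v : pt, v r = 0%N -> F v = false) -> (forall v : pt, v r = k -> F v = false) ->
  s j = ord_max -> v j = 0%N \/ v j = k ->
  skip_after g F r n (lattice_path v s) = false.
Proof.
move=> g0 gk F0 Fk sj vj.
have WE i : (i <= n)%N -> lattice_path v s i j = v j.
  by move=> il; rewrite /lattice_path sj /= ltnNge il addn0.
have rn : (r <= n)%N by rewrite -ltnS.
have jn : (j <= n)%N by rewrite -ltnS.
have [jr|jr] := eqVneq j r.
  by rewrite /skip_after; case: vj => vj; [rewrite F0|rewrite Fk] => //; rewrite -jr WE // jr.
have jr' : (nat_of_ord j) != r by apply: contra jr => /eqP e; apply/eqP/val_inj.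
rewrite /skip_after (bigD1 j) //= /path_step.
suff -> : g j (lattice_path v s (if (r < j <= n)%N then j.-1 else j).+1) =
          g j (lattice_path v s (if (r < j <= n)%N then j.-1 else j)) by rewrite addbb andbF.
have gE l l' : (l <= n)%N -> (l' <= n)%N -> g j (lattice_path v s l) = g j (lattice_path v s l').
  by move=> ln ln'; case: vj => vj; [rewrite !g0 // WE|rewrite !gk // WE].
by case: ifP => h; apply: gE; lia.
Qed.

(** Dropping the first step in one cube and dropping the last step in its neighbour across a common
    face leave the same path; the cyclic shift of the order of the steps matches the two. *)
Lemma skip_rotate g F (r : 'I_m) (s : 'S_m) (v : pt) :
  skip_before g F r 0 (lattice_path v (s * perm (@ordS_inj m))%g) =
  skip_after g F r n (lattice_path (fun j => v j + (s j == ord_max))%N s).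
Proof.
have WE i : (i <= n)%N -> lattice_path v (s * perm (@ordS_inj m))%g i.+1 =
   lattice_path (fun j => v j + (s j == ord_max))%N s i.
  move=> il; apply/funext => j; rewrite /lattice_path permM permE /= -addnA; congr (_ + _)%N.
  have [->|sj] := eqVneq (s j) ord_max; first by rewrite /= modnn ltnS leq0n ltnNge il.
  have sjn : (s j < n)%N.
    have := ltn_ord (s j); rewrite ltnS leq_eqVlt => /orP[/eqP e|//].
    by case/eqP: sj; apply/val_inj.
  by rewrite modn_small ?ltnS.
have rn : (r <= n)%N by rewrite -ltnS.
rewrite /skip_before /skip_after WE //; congr (_ && _).
apply: eq_bigr => i ir; have jn : (i <= n)%N by rewrite -ltnS.
have ir' : (nat_of_ord i) != r by apply: contra ir => /eqP e; apply/eqP/val_inj.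
rewrite /path_step jn andbT /=.
have [ri|ir2] := ltnP r i.
  have -> : (i < r)%N = false by lia.
  have -> : nat_of_ord i = i.-1.+1 by lia.
  by rewrite !WE //; lia.
have -> : (i < r)%N by lia.
by rewrite !WE //; lia.
Qed.

Hypothesis k_gt0 : (0 < k)%N.

(** By the Leibniz rule the difference is a product in which [g r] is replaced by [F], summed over
    boundary simplices: inner faces cancel between neighbouring cubes, and outer ones contribute
    nothing. *)
Lemma cube_sum_replace g g' (r : 'I_m) :
  (forall i v, v i = 0%N -> g i v = false) -> (forall i v, v i = k -> g i v = true) ->
  (forall i v, v i = 0%N -> g' i v = false) -> (forall i v, v i = k -> g' i v = true) ->
  (forall i, i != r -> g' i = g i) -> cube_sum g = cube_sum g'.
Proof.
move=> g0 gk g0' gk' gg'; apply: xor_eq.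
pose F v := g r v (+) g' r v.
have F0 (v : pt) : v r = 0%N -> F v = false by move=> v0; rewrite /F g0 ?g0'.
have Fk (v : pt) : v r = k -> F v = false by move=> v0; rewrite /F gk ?gk'.
pose vn (v : {ffun 'I_m -> 'I_k}) : pt := fun j => v j.
have -> : cube_sum g (+) cube_sum g' =
  \big[addb/false]_(v : {ffun 'I_m -> 'I_k}) (
    \big[addb/false]_(s : 'S_m) skip_before g F r r (lattice_path (vn v) s) (+)
    \big[addb/false]_(s : 'S_m) skip_after g F r r (lattice_path (vn v) s)).
  rewrite /cube_sum -big_split /=; apply: eq_bigr => v _; rewrite -!big_split /=.
  apply: eq_bigr => s _; rewrite (bigD1 r) //= [X in _ (+) X](bigD1 r) //=.
  have -> : \big[andb/true]_(i < m | i != r) path_step g' (lattice_path (fun j => v j) s) i i =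
     \big[andb/true]_(i < m | i != r) path_step g (lattice_path (fun j => v j) s) i i.
    by apply: eq_bigr => i ir; rewrite /path_step gg'.
  rewrite /skip_before /skip_after.
  have -> : \big[andb/true]_(i < m | i != r) path_step g (lattice_path (vn v) s) i
     (if (r <= i < r)%N then i.+1 else i) =
     \big[andb/true]_(i < m | i != r) path_step g (lattice_path (fun j => v j) s) i i.
    by apply: eq_bigr => i ir; have -> : (r <= i < r)%N = false by lia.
  have -> : \big[andb/true]_(i < m | i != r) path_step g (lattice_path (vn v) s) i
     (if (r < i <= r)%N then i.-1 else i) =
     \big[andb/true]_(i < m | i != r) path_step g (lattice_path (fun j => v j) s) i i.
    by apply: eq_bigr => i ir; have -> : (r < i <= r)%N = false by lia.
  rewrite -!andb_addl; congr andb; rewrite /path_step /F /vn.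
  by case: (g r _); case: (g r _); case: (g' r _); case: (g' r _).
rewrite big_split /=.
under eq_bigr do rewrite skip_beforeE.
under [X in _ (+) X]eq_bigr do rewrite skip_afterE.
have -> : \big[addb/false]_(v : {ffun 'I_m -> 'I_k})
     \big[addb/false]_(s : 'S_m) skip_before g F r 0 (lattice_path (vn v) s) =
  \big[addb/false]_(v : {ffun 'I_m -> 'I_k})
     \big[addb/false]_(s : 'S_m) skip_after g F r n (lattice_path (vn v) s); last exact: addbb.
under eq_bigr => v _ do rewrite (reindex_inj (mulIg (perm (@ordS_inj m)))) /=.
rewrite exchange_big [RHS]exchange_big /=; apply: eq_bigr => s _.
pose j := (s^-1 ord_max)%g.
have sj : s j = ord_max by rewrite /j permKV.
(* Passage to the next cube in direction [j]. At the last cube [ordS] wraps around to the first one,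
   and there both terms vanish by [skip_after_face]. *)
pose cyc (v : {ffun 'I_m -> 'I_k}) : {ffun 'I_m -> 'I_k} := [ffun i => if i == j then ordS (v i) else v i].
have cyc_inj : injective cyc.
  move=> v w /ffunP e; apply/ffunP => i; have := e i; rewrite !ffunE.
  by case: ifP => // _ /ordS_inj.
rewrite [RHS](reindex_inj cyc_inj) /=; apply: eq_bigr => v _.
rewrite skip_rotate.
have sE i : (s i == ord_max) = (i == j) by rewrite -sj (inj_eq perm_inj).
have [vk|vk] := eqVneq (v j).+1 k.
  rewrite (@skip_after_face g F r s _ j) ?(@skip_after_face g F r s _ j) //.
    by left; rewrite /vn ffunE eqxx /= vk modnn.
  by right; rewrite sE eqxx /vn addn1.
congr (skip_after _ _ _ _ (lattice_path _ _)); apply/funext => i.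
rewrite sE /vn ffunE; case: eqP => [->|_]; last by rewrite addn0.
by rewrite /= modn_small ?addn1 //; have := ltn_ord (v j); lia.
Qed.

(** Only the cube at the origin with the identity permutation contributes. *)
Lemma cube_sum_canonical : cube_sum (fun i v => (0 < v i)%N) = true.
Proof.
pose v0 : {ffun 'I_m -> 'I_k} := [ffun=> Ordinal k_gt0].
have stepE (v : {ffun 'I_m -> 'I_k}) (s : 'S_m) i : path_step (fun i v => (0 < v i)%N) (lattice_path (fun j => v j) s) i i =
   (v i == 0%N :> nat) && (s i == i).
  rewrite /path_step /lattice_path -(inj_eq val_inj) /= ltnS.
  by case: (v i : nat) => [|x] /=; rewrite ?addSn //= !add0n; case: (ltngtP (s i) i).
have prodE (v : {ffun 'I_m -> 'I_k}) (s : 'S_m) : (\big[andb/true]_(i < m)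
    path_step (fun i v => (0 < v i)%N) (lattice_path (fun j => v j) s) i i) =
    (v == v0) && (s == 1%g).
  under eq_bigr do rewrite stepE.
  rewrite big_andE; apply/forallP/andP => [h|[/eqP -> /eqP ->] i].
    split; apply/eqP; first by apply/ffunP => i; have /andP[/eqP e _] := h i; apply/val_inj; rewrite ffunE.
    by apply/permP => i; have /andP[_ /eqP e] := h i; rewrite perm1.
  by rewrite ffunE perm1 !eqxx.
rewrite /cube_sum (bigD1 v0) //= (bigD1 1%g) //= prodE !eqxx /=.
rewrite big1; last by move=> s s1; rewrite prodE (negPf s1) andbF.
by rewrite big1 // => v vv0; rewrite big1 // => s _; rewrite prodE (negPf vv0).
Qed.

Lemma cube_sum_true g :
  (forall i v, v i = 0%N -> g i v = false) -> (forall i v, v i = k -> g i v = true) ->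
  cube_sum g = true.
Proof.
move=> g0 gk; pose G d : 'I_m -> pt -> bool := fun i v => if (i < d)%N then (0 < v i)%N else g i v.
have G0 d i v : v i = 0%N -> G d i v = false by move=> vi; rewrite /G vi; case: ifP => // _; rewrite g0.
have Gk d i v : v i = k -> G d i v = true by move=> vi; rewrite /G vi; case: ifP => // _; rewrite gk.
have GE d : (d <= m)%N -> cube_sum g = cube_sum (G d).
  elim: d => [|d IH] dm; first by congr cube_sum; apply/funext => i; apply/funext => v; rewrite /G ltn0.
  rewrite IH 1?ltnW //; apply: (@cube_sum_replace _ _ (Ordinal dm)); [exact: G0|exact: Gk|exact: G0|exact: Gk|].
  move=> i id; apply/funext => v; rewrite /G.
  have id' : (nat_of_ord i) != d by apply: contra id => /eqP e; apply/eqP/val_inj.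
  by have -> : (i < d.+1)%N = (i < d)%N by lia.
rewrite (GE m) // -cube_sum_canonical; congr cube_sum.
by apply/funext => i; apply/funext => v; rewrite /G ltn_ord.
Qed.

(** A nonzero sum has a nonzero term: a path inside one cube along whose [i]-th step [g i] changes
    value, for every [i]. *)
Lemma discrete_poincare_miranda g :
  (forall i v, v i = 0%N -> g i v = false) -> (forall i v, v i = k -> g i v = true) ->
  exists v : 'I_m -> nat, (forall j, (v j < k)%N) /\ forall i, exists w w' : pt,
    [/\ (forall j, v j <= w j <= (v j).+1)%N, (forall j, v j <= w' j <= (v j).+1)%N,
        g i w = false & g i w' = true].
Proof.
move=> g0 gk; have := cube_sum_true g0 gk.
have [[v /existsP[s /forallP h]]|no] := pselect (exists v : {ffun 'I_m -> 'I_k},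
   [exists s : 'S_m, [forall i, path_step g (lattice_path (fun j => v j) s) i i]]).
  move=> _; exists (fun j => v j); split => // i.
  have := h i; rewrite /path_step.
  have bnd l j : (v j <= lattice_path (fun j => v j) s l j <= (v j).+1)%N.
    by rewrite /lattice_path; case: (s j < l)%N; lia.
  case e1 : (g i (lattice_path _ s i.+1)); case e2 : (g i (lattice_path _ s i)) => //= _.
    by exists (lattice_path (fun j => v j) s i), (lattice_path (fun j => v j) s i.+1).
  by exists (lattice_path (fun j => v j) s i.+1), (lattice_path (fun j => v j) s i).
rewrite /cube_sum big1 // => v _; rewrite big1 // => s _.
apply/negbTE/negP; rewrite big_andE => h; apply: no; exists v; apply/existsP; exists s; exact: h.
Qed.
End DiscretePoincareMiranda.

(** * Ultralimits and linking *)

Lemma nat_ultrafilter : exists G : set_system nat, UltraFilter G /\ eventually `<=` G.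
Proof. exact: (@ultraFilterLemma _ eventually). Qed.

(** One ultrafilter finer than [eventually], fixed once: every bounded sequence converges along
    it. *)
Definition ultra : set_system nat := sval (cid nat_ultrafilter).

#[global] Instance ultra_ultra : UltraFilter ultra.
Proof. by rewrite /ultra; case: cid => G []. Qed.

#[global] Instance ultra_proper_filter : ProperFilter ultra.
Proof. exact: ultra_proper. Qed.

Lemma ultra_eventually : eventually `<=` ultra.
Proof. by rewrite /ultra; case: cid => G []. Qed.

Lemma archi_bound (R : realType) (x : R) : exists k : nat, x < k%:R.
Proof. by exists (Num.trunc x).+1; exact: truncnS_gt. Qed.

Section UltraLimits.
Variable R : realType.
Implicit Types (u v : nat -> R) (l : R).

Lemma ultra_cvg_eventually u l : u @ \oo --> l -> u @ ultra --> l.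
Proof. by move=> ul A /ul; exact: ultra_eventually. Qed.

Lemma ultra_bounded_cvg u (a b : R) : (forall n, a <= u n <= b) ->
  exists2 l, a <= l <= b & u @ ultra --> l.
Proof.
move=> ub; have UU : UltraFilter (u @ ultra).
  split; first exact: fmap_proper_filter.
  move=> G PG sub; apply/seteqP; split => // A GA.
  have [UA|UA] := in_ultra_setVsetC (u @^-1` A) ultra_ultra; first exact: UA.
  have /filter_ex[x [//]] : G (A `&` ~` A) by apply: filterI => //; apply: sub.
have := @segment_compact R a b; rewrite compact_ultra.
move=> /(_ (u @ ultra) UU) H; case: H; first by have : ultra (u @^-1` `[a, b]) by apply: filterE => n; rewrite /= in_itv /=; exact: ub.
by move=> l [/= lab ul]; exists l => //; move: lab; rewrite in_itv.
Qed.

Lemma ultra_cvg_near u v l (C : R) : u @ ultra --> l ->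
  (forall n, `|v n - u n| <= C / n.+1%:R) -> v @ ultra --> l.
Proof.
move=> ul vu; have C0 : (fun n => C / n.+1%:R : R) @ ultra --> (0 : R).
  apply: ultra_cvg_eventually; rewrite -(mulr0 C); apply: cvgM; first exact: cvg_cst.
  exact: cvg_harmonic.
have d0 : (fun n => v n - u n) @ ultra --> (0 : R).
  apply: (@squeeze_cvgr _ ultra _ R (fun n => - (C / n.+1%:R)) (fun n => C / n.+1%:R) (fun n => v n - u n)) => //.
    by apply: filterE => n; rewrite -ler_norml.
  by rewrite -oppr0; apply: cvgN.
rewrite -[l]add0r; apply: cvg_trans (cvgD d0 ul).
by apply: near_eq_cvg; apply: filterE => n /=; rewrite subrK.
Qed.

Lemma ultra_cvg_unique u l l' : u @ ultra --> l -> u @ ultra --> l' -> l = l'.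
Proof. by move=> ul ul'; apply: (cvg_unique _ ul ul'). Qed.

(** Continuity for the product topology, tested only on limits along [ultra]. For finite [T] it
    gives back the epsilon form, see [ucont_eps]. *)
Definition ucont (T : Type) (h : (T -> R) -> R) := forall (w : nat -> T -> R) (w0 : T -> R),
  (forall i, (fun n => w n i) @ ultra --> w0 i) -> (fun n => h (w n)) @ ultra --> h w0.

Lemma ucont_cst T c : ucont (fun _ : T -> R => c).
Proof. by move=> w w0 _; exact: cvg_cst. Qed.

Lemma ucont_proj T i : ucont (fun z : T -> R => z i).
Proof. by move=> w w0; exact. Qed.

Lemma ucontD T (f g : (T -> R) -> R) : ucont f -> ucont g -> ucont (fun z => f z + g z).
Proof. by move=> fc gc w w0 h; apply: cvgD; [exact: fc|exact: gc]. Qed.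

Lemma ucontB T (f g : (T -> R) -> R) : ucont f -> ucont g -> ucont (fun z => f z - g z).
Proof. by move=> fc gc w w0 h; apply: cvgB; [exact: fc|exact: gc]. Qed.

Lemma ucontN T (f : (T -> R) -> R) : ucont f -> ucont (fun z => - f z).
Proof. by move=> fc w w0 h; apply: cvgN; exact: fc. Qed.

Lemma ucontM T (f g : (T -> R) -> R) : ucont f -> ucont g -> ucont (fun z => f z * g z).
Proof. by move=> fc gc w w0 h; apply: cvgM; [exact: fc|exact: gc]. Qed.

Lemma ucontV T (f : (T -> R) -> R) : (forall z, f z != 0) -> ucont f -> ucont (fun z => (f z)^-1).
Proof. by move=> f0 fc w w0 h; apply: cvgV => //; exact: fc. Qed.

Lemma ucont_norm T (f : (T -> R) -> R) : ucont f -> ucont (fun z => `|f z|).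
Proof. by move=> fc w w0 h; apply: cvg_norm; exact: fc. Qed.

Lemma ucont_sum T (I : Type) (r : seq I) (P : pred I) (f : I -> (T -> R) -> R) :
  (forall i, ucont (f i)) -> ucont (fun z => \sum_(i <- r | P i) f i z).
Proof.
move=> fc; elim: r => [|i r IH].
  by under eq_fun do rewrite big_nil; exact: ucont_cst.
under eq_fun do rewrite big_cons; case: (P i) => //.
by apply: ucontD.
Qed.

Lemma ucont_comp (T S : Type) (f : (S -> R) -> R) (d : (T -> R) -> S -> R) :
  ucont f -> (forall i, ucont (fun z => d z i)) -> ucont (fun z => f (d z)).
Proof. by move=> fc dc w w0 h; apply: fc => i; exact: dc. Qed.

(** The cubes found on finer and finer grids shrink to a point along [ultra], and both weak signs of
    each [h i] persist in the limit. *)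
Lemma poincare_miranda (n : nat) (lo hi : 'I_n.+1 -> R) (h : ('I_n.+1 -> R) -> 'I_n.+1 -> R) :
  (forall i, lo i < hi i) -> (forall i, ucont (fun w => h w i)) ->
  (forall w i, (forall j, lo j <= w j <= hi j) -> w i = lo i -> h w i <= 0) ->
  (forall w i, (forall j, lo j <= w j <= hi j) -> w i = hi i -> 0 <= h w i) ->
  exists2 w, (forall j, lo j <= w j <= hi j) & forall i, h w i = 0.
Proof.
move=> lohi hc hlo hhi.
pose pnt (k : nat) (v : 'I_n.+1 -> nat) : 'I_n.+1 -> R :=
  fun i => lo i + (hi i - lo i) * ((v i)%:R / k.+1%:R).
(* The values on the two faces are imposed, because [h] only has a weak sign there. *)
pose g (k : nat) (i : 'I_n.+1) (v : 'I_n.+1 -> nat) : bool :=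
  (v i != 0%N) && ((v i == k.+1) || (0 < h (pnt k v) i)).
have pnt_box k (v : 'I_n.+1 -> nat) : (forall j, v j <= k.+1)%N -> forall j, lo j <= pnt k v j <= hi j.
  move=> vk j; have k0 : (0 : R) < k.+1%:R by [].
  have t0 : 0 <= (v j)%:R / k.+1%:R :> R by rewrite divr_ge0.
  have t1 : (v j)%:R / k.+1%:R <= 1 :> R by rewrite ler_pdivrMr // mul1r ler_nat.
  have := lohi j; move: t0 t1; rewrite /pnt; set t := _ / _ => t0 t1 lh; apply/andP; split; nra.
have step k : exists z : ('I_n.+1 -> R) * (('I_n.+1 -> 'I_n.+1 -> R) * ('I_n.+1 -> 'I_n.+1 -> R)),
    (forall j, lo j <= z.1 j <= hi j) /\
    forall i, [/\ (forall j, `|z.2.1 i j - z.1 j| <= (hi j - lo j) / k.+1%:R),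
        (forall j, `|z.2.2 i j - z.1 j| <= (hi j - lo j) / k.+1%:R),
        h (z.2.1 i) i <= 0 & 0 <= h (z.2.2 i) i].
  have [//|i v vi|i v vi|v [vk /choice[a /choice[b ab]]]] := @discrete_poincare_miranda n k.+1 _ (g k).
  - by rewrite /g vi.
  - by rewrite /g vi eqxx.
  have dist (w : 'I_n.+1 -> nat) j : (v j <= w j <= (v j).+1)%N ->
      `|pnt k w j - pnt k v j| <= (hi j - lo j) / k.+1%:R.
    move=> vw; have -> : pnt k w j - pnt k v j = (hi j - lo j) / k.+1%:R * ((w j - v j)%N)%:R.
      by rewrite /pnt natrB; [ring|lia].
    have lh := lohi j; have c0 : 0 <= (hi j - lo j) / k.+1%:R by rewrite divr_ge0 // subr_ge0 ltW.
    rewrite ger0_norm; last by apply: mulr_ge0.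
    rewrite ler_piMr // -[leRHS]/(1%:R) ler_nat; lia.
  exists (pnt k v, (fun i => pnt k (a i), fun i => pnt k (b i))); split.
    by apply: pnt_box => j; apply: ltnW.
  move=> i /=; have [va vb gf gt] := ab i; split.
  - by move=> j; apply: dist.
  - by move=> j; apply: dist.
  - have abox : forall j, lo j <= pnt k (a i) j <= hi j.
      by apply: pnt_box => j; have := va j; have := vk j; lia.
    move: gf; rewrite /g; have [ai0 _|_ /=] := eqVneq (a i i) 0%N.
      by apply: hlo => //; rewrite /pnt ai0 mul0r mulr0 addr0.
    by move=> /negbT; rewrite negb_or -leNgt => /andP[].
  have bbox : forall j, lo j <= pnt k (b i) j <= hi j.
    by apply: pnt_box => j; have := vb j; have := vk j; lia.
  move: gt; rewrite /g => /andP[_ /orP[/eqP bik|/ltW //]].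
  by apply: hhi => //; rewrite /pnt bik divff // mulr1 addrC subrK.
have [z zP] := choice step.
have wl i : exists l, lo i <= l <= hi i /\ (fun k => (z k).1 i) @ ultra --> l.
  have [k|l lb zl] := @ultra_bounded_cvg (fun k => (z k).1 i) (lo i) (hi i); last by exists l.
  by have [+ _] := zP k; apply.
have [w wP] := choice wl; exists w => [j|i]; first by have [] := wP j.
apply/eqP; rewrite eq_le; apply/andP; split.
  apply: (@cvgr_to_le _ ultra _ R (fun k => h ((z k).2.1 i) i)); last first.
    by apply: filterE => k; have [_ /(_ i)[]] := zP k.
  apply: (hc i (fun k => (z k).2.1 i)) => j; apply: ultra_cvg_near (wP j).2 _ => k.
  by have [_ /(_ i)[+ _ _ _]] := zP k; apply.
apply: (@cvgr_to_ge _ ultra _ R (fun k => h ((z k).2.2 i) i)); last first.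
  by apply: filterE => k; have [_ /(_ i)[]] := zP k.
apply: (hc i (fun k => (z k).2.2 i)) => j; apply: ultra_cvg_near (wP j).2 _ => k.
by have [_ /(_ i)[_ + _ _]] := zP k; apply.
Qed.

Lemma poincare_miranda_fin (S : finType) (lo hi : S -> R) (h : (S -> R) -> S -> R) :
  (forall i, lo i < hi i) -> (forall i, ucont (fun w => h w i)) ->
  (forall w i, (forall j, lo j <= w j <= hi j) -> w i = lo i -> h w i <= 0) ->
  (forall w i, (forall j, lo j <= w j <= hi j) -> w i = hi i -> 0 <= h w i) ->
  exists2 w, (forall j, lo j <= w j <= hi j) & forall i, h w i = 0.
Proof.
move=> lohi hc hlo hhi; case e : #|S| => [|n].
  have noS (i : S) : False by have := enum_rank i; rewrite e => -[].
  by exists lo => j; case: (noS j).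
pose f (i : 'I_n.+1) : S := enum_val (cast_ord (esym e) i).
pose r (i : S) : 'I_n.+1 := cast_ord e (enum_rank i).
have fK i : r (f i) = i by rewrite /f /r enum_valK cast_ordKV.
have rK i : f (r i) = i by rewrite /f /r cast_ordK enum_rankK.
have [i|i|w i wb wi|w i wb wi|w wb wh] :=
  @poincare_miranda n (lo \o f) (hi \o f) (fun w i => h (w \o r) (f i)).
- exact: lohi.
- apply: (ucont_comp (f := fun z => h z (f i))) => // j; exact: ucont_proj.
- by apply: hlo => [j|] /=; [have := wb (r j); rewrite /= rK|rewrite fK].
- by apply: hhi => [j|] /=; [have := wb (r j); rewrite /= rK|rewrite fK].
exists (w \o r) => [j|i]; first by have := wb (r j); rewrite /= rK.
by have := wh (r i); rewrite rK.
Qed.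

(* Approximate descent along grad F, slowed down below level alpha / 2 so that the boundary of the box does not move; were there no almost critical point, the box would be pushed below alpha and miss the linking set P = w0. *)
Lemma linking_minimax (T S : finType) (F : (T -> R) -> R) (grad : (T -> R) -> T -> R)
    (lo hi w0 : S -> R) (d : (S -> R) -> T -> R) (P : (T -> R) -> S -> R)
    (alpha B : R) :
  ucont F -> (forall i, ucont (fun z => grad z i)) ->
  (forall eta : R, 0 < eta -> exists2 h0 : R, 0 < h0 & forall (h : R) z w, 0 < h -> h <= h0 ->
     (forall i, `|w i| <= h) ->
     F (fun i => z i + w i) <= F z + \sum_i grad z i * w i + eta * h) ->
  (forall i, ucont (fun w => d w i)) -> (forall i, ucont (fun z => P z i)) ->
  (forall i, lo i < w0 i < hi i) -> (forall w, P (d w) = w) ->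
  (forall w i, (forall j, lo j <= w j <= hi j) -> w i = lo i \/ w i = hi i -> F (d w) <= 0) ->
  (forall w, (forall j, lo j <= w j <= hi j) -> F (d w) <= B) ->
  0 < alpha -> (forall z, P z = w0 -> alpha <= F z) ->
  forall eps : R, 0 < eps -> exists2 z, alpha / 2 <= F z & forall i, `|grad z i| <= eps.
Proof.
move=> Fc gc Fu dc Pc w0P Pd Fbd FB a0 Fa eps eps0.
apply: contrapT => no.
have big z : alpha / 2 <= F z -> exists i, eps < `|grad z i|.
  move=> Fz; apply: contrapT => nobig; apply: no; exists z => // i.
  by rewrite leNgt; apply/negP => h; apply: nobig; exists i.
pose pos (x : R) := (x + `|x|) / 2.
have pos_ge0 (x : R) : 0 <= pos x by rewrite /pos; have := ler_norm (- x); rewrite normrN; lra.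
have pos_le x : x <= pos x by rewrite /pos; have := ler_norm x; lra.
have pos_0 (x : R) : x <= 0 -> pos x = 0 by move=> x0; rewrite /pos ler0_norm // subrr mul0r.
(* A factor in [[0, 1]] that vanishes below level [alpha / 2], in particular on the boundary of the
   box. *)
pose om z := pos (F z - alpha / 2) / (1 + pos (F z - alpha / 2)).
have om_ge0 z : 0 <= om z by rewrite /om divr_ge0 ?addr_ge0 ?pos_ge0.
have om_lt1 z : om z <= 1.
  by rewrite /om ler_pdivrMr ?mul1r ?lerDr // ltr_pwDl ?pos_ge0.
(* Since [t ^+ 2 / (1 + t)] increases with [t], the rate of descent is at least [c] wherever some
   partial derivative exceeds [eps]; the first-order expansion is used with error [c / 2], half of
   this gain. *)
pose c := eps ^+ 2 / (1 + eps).
have c0 : 0 < c by rewrite /c divr_gt0 ?exprn_gt0 ?addr_gt0.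
have [h0 h0_gt0 Fh] := Fu (c / 2) (divr_gt0 c0 (ltr0n _ 2)).
pose clip (x : R) := x / (1 + `|x|).
have den (x : R) : 0 < 1 + `|x| by rewrite ltr_pwDl.
pose psi z : T -> R := fun i => z i + - (h0 * om z * clip (grad z i)).
have psi_fix z : F z <= alpha / 2 -> psi z = z.
  move=> Fz; apply/funext => i; rewrite /psi /om pos_0 ?mul0r ?mulr0 ?mul0r ?oppr0 ?addr0 //; lra.
have psi_dec z : alpha / 2 <= F z -> F (psi z) <= F z - h0 * om z * (c / 2).
  move=> Fz; have := om_ge0 z; rewrite le_eqVlt => /predU1P[om0|om0].
    have -> : psi z = z by apply/funext => i; rewrite /psi -om0 mulr0 mul0r oppr0 addr0.
    by rewrite -om0 mulr0 mul0r subr0.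
  have ho : 0 < h0 * om z by rewrite mulr_gt0.
  apply: le_trans (Fh (h0 * om z) z (fun i => - (h0 * om z * clip (grad z i))) ho _ _) _.
  - by rewrite ler_piMr // ltW.
  - move=> i; rewrite normrN normrM (ger0_norm (ltW ho)) ler_piMr ?ltW //.
    by rewrite /clip normrM normfV (gtr0_norm (den _)) ltr_pdivrMr // mul1r ltrDr.
  have [i0 gi0] := big z Fz.
  have -> : \sum_i grad z i * - (h0 * om z * clip (grad z i)) =
      - (h0 * om z) * \sum_i (grad z i) ^+ 2 / (1 + `|grad z i|).
    by rewrite mulr_sumr; apply: eq_bigr => i _; rewrite /clip; field; exact: lt0r_neq0.
  have cs : c <= \sum_i (grad z i) ^+ 2 / (1 + `|grad z i|).
    rewrite (bigD1 i0) //= -[leLHS]addr0; apply: lerD; last first.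
      by apply: sumr_ge0 => i _; rewrite divr_ge0 ?sqr_ge0 ?ltW.
    rewrite -(real_normK (num_real (grad z i0))); set x := `|grad z i0| in gi0 *.
    have x0 : 0 < 1 + x by rewrite ltr_pwDl // ltW // (lt_trans eps0).
    rewrite /c ler_pdivrMr ?addr_gt0 // mulrAC ler_pdivlMr //.
    have h1 : 0 <= (x - eps) * (x + eps) by apply: mulr_ge0; lra.
    have h2 : 0 <= eps * x * (x - eps) by apply: mulr_ge0; [apply: mulr_ge0; lra|lra].
    lra.
  nra.
have psi_le z : F (psi z) <= F z.
  have [Fz|/ltW Fz] := leP (alpha / 2) (F z); last by rewrite psi_fix.
  apply: le_trans (psi_dec z Fz) _; rewrite gerBl; apply: mulr_ge0; [apply: mulr_ge0 => //; exact: ltW|lra].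
(* The value of [om] at level [3 * alpha / 4]: above this level each step lowers [F] by at least
   [del]. *)
pose o0 := (alpha / 4) / (1 + alpha / 4).
have o00 : 0 < o0 by rewrite /o0 divr_gt0; lra.
pose del := h0 * o0 * (c / 2).
have del0 : 0 < del by rewrite /del; apply: mulr_gt0; [exact: mulr_gt0|lra].
have psi_del z : 3 * alpha / 4 <= F z -> F (psi z) <= F z - del.
  move=> Fz; apply: le_trans (psi_dec z _) _; first lra.
  rewrite lerD2l lerN2 /del; apply: ler_wpM2r; first lra.
  apply: ler_wpM2l; first exact: ltW.
  have := pos_le (F z - alpha / 2); rewrite /o0 /om; set x := pos _ => xp.
  rewrite ler_pdivrMr; last lra.
  rewrite mulrAC ler_pdivlMr; last lra.
  nra.
have iter_le k z : F z <= B -> F (iter k psi z) <= Num.max (3 * alpha / 4) (B - k%:R * del).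
  move=> FzB; elim: k => [|k IH]; first by rewrite mul0r subr0 le_max FzB orbT.
  rewrite iterS le_max; have [h|/ltW h] := leP (3 * alpha / 4) (F (iter k psi z)).
    apply/orP; case: (leP (3 * alpha / 4) (B - k%:R * del)) IH => _ IH.
      by right; apply: le_trans (psi_del _ h) _; rewrite -natr1; lra.
    by left; exact: le_trans (psi_le _) IH.
  by rewrite (le_trans (psi_le _) h).
have [k kB] : exists k : nat, B - k%:R * del < alpha.
  have [k kB] := archi_bound ((B - alpha) / del); exists k.
  by move: (kB); rewrite ltr_pdivrMr //; lra.
(* After [k] steps the whole box lies below [alpha], but its boundary has not moved, so its
   projection by [P] still covers [w0]. A zero of [H] is thus a point of the linking set below
   [alpha]. *)
pose H (w : S -> R) i := P (iter k psi (d w)) i - w0 i.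
have psic i : ucont (fun z => psi z i).
  apply: ucontD; first exact: ucont_proj.
  apply: ucontN; apply: ucontM; first apply: ucontM; first exact: ucont_cst.
  - have pc : ucont (fun z => pos (F z - alpha / 2)).
      apply: ucontM; last exact: ucont_cst.
      have Fac : ucont (fun z => F z - alpha / 2) by apply: ucontB => //; exact: ucont_cst.
      by apply: ucontD => //; apply: ucont_norm.
    apply: ucontM => //; apply: ucontV; last by apply: ucontD => //; exact: ucont_cst.
    by move=> z; rewrite lt0r_neq0 // ltr_pwDl ?pos_ge0.
  apply: ucontM => //; apply: ucontV => [z|]; first exact: lt0r_neq0.
  by apply: ucontD; [exact: ucont_cst|apply: ucont_norm].
have iterc j i : ucont (fun w => iter j psi (d w) i).
  elim: j i => [//|j IH] i; apply: (ucont_comp (f := fun z => psi z i)) => //.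
have [i|i|w i wb wi|w i wb wi|w wb Hw] := @poincare_miranda_fin S lo hi H.
- by have /andP[] := w0P i; exact: lt_trans.
- apply: ucontB; last exact: ucont_cst.
  by apply: (ucont_comp (f := fun z => P z i)).
- have Fw : F (d w) <= 0 by apply: (Fbd w i) => //; left.
  have -> : H w i = w i - w0 i.
    rewrite /H; have -> : iter k psi (d w) = d w; last by rewrite Pd.
    by elim: (k) => //= j ->; apply: psi_fix; lra.
  by rewrite wi subr_le0; have /andP[/ltW] := w0P i.
- have Fw : F (d w) <= 0 by apply: (Fbd w i) => //; right.
  have -> : H w i = w i - w0 i.
    rewrite /H; have -> : iter k psi (d w) = d w; last by rewrite Pd.
    by elim: (k) => //= j ->; apply: psi_fix; lra.
  by rewrite wi subr_ge0; have /andP[_ /ltW] := w0P i.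
have := Fa (iter k psi (d w)) _; have := iter_le k (d w) (FB w wb).
set y := F _ => yle ale.
have /ale : P (iter k psi (d w)) = w0 by apply/funext => i; apply/eqP; rewrite -subr_eq0; apply/eqP; exact: Hw.
move: yle; rewrite le_max => /orP[]; lra.
Qed.
End UltraLimits.

(** * The discrete action functional *)

Section DiscreteAction.
Variables (R : realType) (K : (bool -> R) -> (bool -> R) -> R).
Variables (Kq Kp : (bool -> R) -> (bool -> R) -> bool -> R) (c : bool -> R).

Definition ucont2 (f : (bool -> R) -> (bool -> R) -> R) :=
  ucont (fun z : bool * bool -> R => f (fun j => z (false, j)) (fun j => z (true, j))).

Hypothesis K_ucont : ucont2 K.
Hypothesis Kq_ucont : forall j, ucont2 (fun q p => Kq q p j).
Hypothesis Kp_ucont : forall j, ucont2 (fun q p => Kp q p j).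
Hypothesis K_unif : forall eta : R, 0 < eta -> exists2 h0 : R, 0 < h0 &
  forall (h : R) q p dq dp, 0 < h -> h <= h0 ->
    (forall j, `|dq j| <= h) -> (forall j, `|dp j| <= h) ->
    K q p + \sum_j Kq q p j * dq j + \sum_j Kp q p j * dp j - eta * h <=
    K (fun j => q j + dq j) (fun j => p j + dp j).

Variable n : nat.
Local Notation N := n.+1.
Local Notation omax := (@ord_max n).
Local Notation state := ('I_N * (bool * bool) -> R).
Implicit Types z : state.

Definition posz z (k : 'I_N) (j : bool) : R := z (k, (false, j)).
Definition momz z (k : 'I_N) (j : bool) : R := z (k, (true, j)).

(** The translation [c] sits in the step from the last node to the first: a cyclic sequence then
    encodes positions with [q (t + 1) = q t + c]. *)
Definition incr z (k : 'I_N) (j : bool) : R :=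
  posz z (ordS k) j - posz z k j + (k == omax)%:R * c j.

Definition action z : R :=
  \sum_k (\sum_j momz z k j * incr z k j - K (posz z k) (momz z k) / N%:R).

Definition action_grad z (i : 'I_N * (bool * bool)) : R :=
  let: (k, (b, j)) := i in
  if b then incr z k j - Kp (posz z k) (momz z k) j / N%:R
  else momz z (ord_pred k) j - momz z k j - Kq (posz z k) (momz z k) j / N%:R.

Lemma sum_state (f : 'I_N * (bool * bool) -> R) :
  \sum_i f i = \sum_k (\sum_j f (k, (true, j)) + \sum_j f (k, (false, j))).
Proof.
have -> : \sum_i f i = \sum_(i : 'I_N * (bool * bool)) f (i.1, i.2) by apply: eq_bigr => -[].
rewrite -(pair_bigA _ (fun k b => f (k, b))) /=; apply: eq_bigr => k _.
have -> : \sum_b f (k, b) = \sum_(b : bool * bool) f (k, (b.1, b.2)) by apply: eq_bigr => -[].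
by rewrite -(pair_bigA _ (fun a b => f (k, (a, b)))) /= big_bool.
Qed.

Lemma sum_by_parts (p q : 'I_N -> R) :
  \sum_k p k * (q (ordS k) - q k) = \sum_k (p (ord_pred k) - p k) * q k.
Proof.
under eq_bigr do rewrite mulrBr; rewrite sumrB.
under [RHS]eq_bigr do rewrite mulrBl; rewrite sumrB; congr (_ - _).
rewrite [RHS](reindex_inj (@ordS_inj N)) /=; apply: eq_bigr => k _.
by rewrite ordSK.
Qed.

(** [K] enters the action with a minus sign, so the lower bound [K_unif] on its increments is
    exactly what this upper bound requires. *)
Lemma action_unif (eta : R) : 0 < eta -> exists2 h0 : R, 0 < h0 & forall (h : R) z (w : state),
  0 < h -> h <= h0 -> (forall i, `|w i| <= h) ->
  action (fun i => z i + w i) <= action z + \sum_i action_grad z i * w i + eta * h.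
Proof.
move=> eta0; have [h1 h10 Kh] := K_unif (divr_gt0 eta0 (ltr0n _ 2)).
have N0 : (0 : R) < N%:R by [].
(* At each node the quadratic term is at most [4 * h ^+ 2], and [h <= eta / (8 * N)] makes this at
   most [eta * h / (2 * N)]; the other half of the error goes to [K]. *)
exists (Num.min h1 (eta / (8 * N%:R))) => [|h z w h0].
  by rewrite lt_min h10 divr_gt0 // mulr_gt0.
rewrite le_min => /andP[hh1]; rewrite ler_pdivlMr ?mulr_gt0 // => hN wh.
have -> : action (fun i => z i + w i) = \sum_k (
    \sum_j momz z k j * incr z k j + \sum_j momz w k j * incr z k j
    + \sum_j momz z k j * (posz w (ordS k) j - posz w k j)
    + \sum_j momz w k j * (posz w (ordS k) j - posz w k j)
    - K (fun j => posz z k j + posz w k j) (fun j => momz z k j + momz w k j) / N%:R).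
  apply: eq_bigr => k _; congr (_ - _); rewrite -!big_split /=; apply: eq_bigr => j _.
  by rewrite /incr /momz /posz; ring.
have -> : \sum_i action_grad z i * w i = \sum_k (\sum_j momz w k j * incr z k j
    + \sum_j momz z k j * (posz w (ordS k) j - posz w k j)
    - (\sum_j Kq (posz z k) (momz z k) j * posz w k j
       + \sum_j Kp (posz z k) (momz z k) j * momz w k j) / N%:R).
  rewrite sum_state; under [RHS]eq_bigr => k _ do rewrite addrAC; rewrite !big_split /=.
  have -> : \sum_k \sum_j momz z k j * (posz w (ordS k) j - posz w k j) =
      \sum_k \sum_j (momz z (ord_pred k) j - momz z k j) * posz w k j.
    rewrite exchange_big [RHS]exchange_big /=; apply: eq_bigr => j _.
    exact: (sum_by_parts (fun k => momz z k j) (fun k => posz w k j)).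
  rewrite -!big_split /=; apply: eq_bigr => k _; rewrite !big_bool /posz /momz /=; ring.
rewrite /action -big_split /=.
have -> : eta * h = \sum_(k < N) (eta * h / N%:R).
  by rewrite sumr_const card_ord -[RHS]mulr_natr divfK ?lt0r_neq0.
rewrite -big_split /=; apply: ler_sum => k _.
have := Kh h (posz z k) (momz z k) (posz w k) (momz w k) h0 hh1
  (fun j => wh (k, (false, j))) (fun j => wh (k, (true, j))).
set K1 := K _ _; set K2 := K _ _; set S1 := \sum_j _ * posz w k j; set S2 := \sum_j _ * momz w k j.
move=> Kle; set A := \sum_j momz z k j * incr z k j; set B := \sum_j momz w k j * incr z k j.
set C := \sum_j momz z k j * (_ - _); set D := \sum_j momz w k j * (_ - _).
have Dle : D <= 4 * h ^+ 2.
  have -> : 4 * h ^+ 2 = \sum_(j : bool) (2 * h ^+ 2) by rewrite big_bool /=; ring.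
  apply: ler_sum => j _; apply: le_trans (ler_norm _) _; rewrite normrM.
  have h2 := wh (k, (true, j)); have h3 := wh (ordS k, (false, j)); have h4 := wh (k, (false, j)).
  have h5 : `|posz w (ordS k) j - posz w k j| <= 2 * h.
    by apply: le_trans (ler_normB _ _) _; rewrite /posz; lra.
  have := normr_ge0 (momz w k j); have := normr_ge0 (posz w (ordS k) j - posz w k j); rewrite /momz in h2 *.
  nra.
have D2 : D <= eta / 2 * h / N%:R.
  apply: le_trans Dle _; rewrite ler_pdivlMr //; nra.
have K2le : - K2 / N%:R <= - K1 / N%:R - (S1 + S2) / N%:R + eta / 2 * h / N%:R.
  rewrite -mulrBl -mulrDl ler_pM2r ?invr_gt0 //; lra.
have -> : eta * h / N%:R = eta / 2 * h / N%:R + eta / 2 * h / N%:R by field; exact: lt0r_neq0.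
move: (N%:R^-1 : R) K2le D2 => iN K2le D2; lra.
Qed.

Lemma ucont2_posmom (f : (bool -> R) -> (bool -> R) -> R) (k : 'I_N) :
  ucont2 f -> ucont (fun z => f (posz z k) (momz z k)).
Proof.
move=> fc; apply: (ucont_comp (d := fun z (i : bool * bool) => z (k, i)) fc) => i; exact: ucont_proj.
Qed.

Lemma incr_ucont k j : ucont (fun z => incr z k j).
Proof.
by apply: ucontD; [apply: ucontB; exact: ucont_proj|exact: ucont_cst].
Qed.

Lemma action_ucont : ucont action.
Proof.
apply: ucont_sum => k; apply: ucontB.
  by apply: ucont_sum => j; apply: ucontM; [exact: ucont_proj|exact: incr_ucont].
by apply: ucontM; [exact: ucont2_posmom|exact: ucont_cst].
Qed.

Lemma action_grad_ucont i : ucont (fun z => action_grad z i).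
Proof.
case: i => k [[] j] /=; apply: ucontB.
- exact: incr_ucont.
- by apply: ucontM; [exact: (@ucont2_posmom (fun q p => Kp q p j))|exact: ucont_cst].
- by apply: ucontB; exact: ucont_proj.
- by apply: ucontM; [exact: (@ucont2_posmom (fun q p => Kq q p j))|exact: ucont_cst].
Qed.

Variables (D : finType) (L : (D -> R) -> bool -> R) (PJ : (bool -> R) -> D -> R).
Variables (dlo dhi dw : D -> R) (alpha C C' : R).
Hypothesis L_ucont : forall j, ucont (fun w => L w j).
Hypothesis PJ_ucont : forall i, ucont (fun p => PJ p i).
Hypothesis PJL : forall w, PJ (L w) = w.
Hypothesis dwP : forall i, dlo i < dw i < dhi i.
Hypothesis alpha_gt0 : 0 < alpha.
Hypothesis link_low : forall q p, PJ p = dw -> alpha <= \sum_j p j * c j - K q p.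
Hypothesis link_bnd : forall w i, (forall j, dlo j <= w j <= dhi j) -> w i = dlo i \/ w i = dhi i ->
  forall q v, \sum_j L w j * c j - K q (fun j => L w j + v j) <= C * \sum_j v j ^+ 2.
Hypothesis link_upp : forall w, (forall j, dlo j <= w j <= dhi j) ->
  forall q v, \sum_j L w j * c j - K q (fun j => L w j + v j) <= C' * (1 + \sum_j v j ^+ 2).

(** The box consists of paths with momenta [L w + J], where the fluctuation [J] vanishes at the last
    node, and with positions [- kap] times the partial sums of [J]: the pairing of momenta and
    increments then contributes [- kap] times the sum of squares of [J], and fluctuations become
    descending directions. On the linking set the momenta are constant, the increments of the
    positions add up to [c], and [link_low] applies at every node. *)
Lemma action_almost_critical (eps : R) : 0 < eps ->
  exists2 z, alpha / 2 <= action z & forall i, `|action_grad z i| <= eps.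
Proof.
pose S := (('I_n * bool) + D)%type.
(* On a face where a fluctuation is 1 or -1 the sum of squares [S2] is at least 1, so the positive
   part of [C'] times [1 + S2] is at most twice that part times [S2]; on a face of the parameter box
   the bound is [C] times [S2]. This [kap] absorbs both. *)
pose kap : R := Num.max 0 C + 2 * Num.max 0 C'.
have C0 : 0 <= Num.max 0 C by rewrite le_max lexx.
have C'0 : 0 <= Num.max 0 C' by rewrite le_max lexx.
have CC : C <= Num.max 0 C by rewrite le_max lexx orbT.
have CC' : C' <= Num.max 0 C' by rewrite le_max lexx orbT.
have kap0 : 0 <= kap by rewrite /kap; lra.
pose Lw (w : S -> R) : D -> R := fun i => w (inr i).
pose Jw (w : S -> R) (k : 'I_N) (j : bool) : R :=
  if unlift omax k is Some k' then w (inl (k', j)) else 0.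
pose d (w : S -> R) (i : 'I_N * (bool * bool)) : R := let: (k, (b, j)) := i in
  if b then L (Lw w) j + Jw w k j else - kap * \sum_(i < N | (i < k)%N) Jw w i j.
pose P z (i : S) : R := match i with
  | inl (k', j) => momz z (lift omax k') j - momz z omax j
  | inr i => PJ (momz z omax) i end.
pose lo (i : S) : R := if i is inr i then dlo i else -1.
pose hi (i : S) : R := if i is inr i then dhi i else 1.
pose w0 (i : S) : R := if i is inr i then dw i else 0.
have Jmax (w : S -> R) j : Jw w omax j = 0 by rewrite /Jw unlift_none.
have Jlift (w : S -> R) k j : Jw w (lift omax k) j = w (inl (k, j)) by rewrite /Jw liftK.
have incrE (w : S -> R) k j : incr (d w) k j = - kap * Jw w k j +
    (k == omax)%:R * (c j + kap * \sum_(i < N) Jw w i j).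
  rewrite /incr /posz /=; have [->|kn] := eqVneq k omax.
    have J1 := Jmax w j; rewrite J1 /= modnn big_pred0 // mulr0 mul1r [X in _ = _ + _ * (_ + _ * X)](bigD1 omax) //= J1 add0r.
    have -> : \sum_(i < N | (i < n)%N) Jw w i j = \sum_(i < N | i != omax) Jw w i j.
      by apply: eq_bigl => i; rewrite -(inj_eq val_inj) /= neq_ltn; have := ltn_ord i; lia.
    rewrite mul1r; ring.
  have kn' : (k < n)%N.
    have : nat_of_ord k != n by apply: contra kn => /eqP h; apply/eqP/val_inj.
    by have := ltn_ord k; lia.
  rewrite !mul0r !addr0 modn_small ?ltnS // (bigD1 k) //=.
  have -> : \sum_(i < N | (i < k.+1)%N && (i != k)) Jw w i j = \sum_(i < N | (i < k)%N) Jw w i j.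
    by apply: eq_bigl => i; rewrite -(inj_eq val_inj) /= ltnS; lia.
  ring.
(* The terms linear in [J] cancel: the positions jump back in the last step, where [J] vanishes. *)
have actE (w : S -> R) : action (d w) = - kap * (\sum_(k < N) \sum_j Jw w k j ^+ 2) +
    \sum_(k < N) (\sum_j L (Lw w) j * c j -
      K (posz (d w) k) (fun j => L (Lw w) j + Jw w k j)) / N%:R.
  have N0 : (N%:R : R) != 0 by [].
  have -> : \sum_(k < N) (\sum_j L (Lw w) j * c j - K (posz (d w) k) (fun j => L (Lw w) j + Jw w k j)) / N%:R =
     \sum_j L (Lw w) j * c j - \sum_(k < N) K (posz (d w) k) (fun j => L (Lw w) j + Jw w k j) / N%:R.
    under eq_bigr do rewrite mulrBl; rewrite sumrB; congr (_ - _).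
    by rewrite sumr_const card_ord -[LHS]mulr_natr divfK.
  rewrite /action sumrB addrA; congr (_ - _).
  under eq_bigr => k _ do under eq_bigr => j _ do rewrite incrE.
  rewrite exchange_big /= [in RHS]exchange_big /= mulr_sumr -big_split /=; apply: eq_bigr => j _.
  have -> : \sum_(k < N) momz (d w) k j * (- kap * Jw w k j + (k == omax)%:R * (c j + kap * \sum_(i < N) Jw w i j)) =
    \sum_(k < N) (- kap * Jw w k j ^+ 2 - kap * L (Lw w) j * Jw w k j) +
    \sum_(k < N) (k == omax)%:R * (momz (d w) k j * (c j + kap * \sum_(i < N) Jw w i j)).
    rewrite -big_split /=; apply: eq_bigr => k _; rewrite /momz /=; ring.
  rewrite [X in _ + X](bigD1 omax) //= [X in _ + (_ + X)]big1; last first.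
    by move=> k /negPf ->; rewrite mul0r.
  have J1 := Jmax w j; rewrite eqxx mul1r addr0 /momz /= J1 big_split /= -mulr_sumr sumrN -mulr_sumr; ring.
have sumJ (w : S -> R) : \sum_(k < N) (C' * (1 + \sum_j Jw w k j ^+ 2)) / N%:R <=
     Num.max 0 C' * (1 + \sum_(k < N) \sum_j Jw w k j ^+ 2).
  have N0 : (0 : R) < N%:R by [].
  have sq k : 0 <= \sum_j Jw w k j ^+ 2 by apply: sumr_ge0 => j _; exact: sqr_ge0.
  have -> : Num.max 0 C' * (1 + \sum_(k < N) \sum_j Jw w k j ^+ 2) =
    \sum_(k < N) Num.max 0 C' * (N%:R^-1 + \sum_j Jw w k j ^+ 2).
    by rewrite -mulr_sumr big_split /= sumr_const card_ord -(mulr_natr (N%:R^-1)) mulVf ?lt0r_neq0.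
  apply: ler_sum => k _; rewrite mulrDr mulr1 mulrDl mulrDr; apply: lerD.
    by rewrite ler_pM2r ?invr_gt0.
  rewrite -mulrA; apply: le_trans (ler_wpM2r _ CC') _; first by rewrite divr_ge0.
  apply: ler_wpM2l => //; rewrite ler_pdivrMr // ler_peMr //.
  by rewrite -[leLHS]/(1%:R) ler_nat.
move: eps; apply: (@linking_minimax R _ S action action_grad lo hi w0 d P alpha (Num.max 0 C')).
- exact: action_ucont.
- exact: action_grad_ucont.
- exact: action_unif.
- have Jc k j : ucont (fun w => Jw w k j).
    by rewrite /Jw; case: (unlift omax k) => [k'|]; [exact: ucont_proj|exact: ucont_cst].
  case=> k [[] j] /=.
    apply: ucontD => //; apply: (ucont_comp (f := fun w => L w j) (d := Lw)) => // i; exact: ucont_proj.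
  apply: ucontM; first exact: ucont_cst.
  by apply: ucont_sum.
- case=> [[k j]|i] /=; first by apply: ucontB; exact: ucont_proj.
  by apply: (ucont_comp (f := fun p => PJ p i) (d := fun z => momz z omax)) => // j; exact: ucont_proj.
- by case=> [[k j]|i] /=; [rewrite ltrN10 ltr01|exact: dwP].
- move=> w; apply/funext => -[[k j]|i] /=; first by have J1 := Jmax w j; have J2 := Jlift w k j; rewrite /momz /= J1 J2; ring.
  have -> : momz (d w) omax = L (Lw w) by apply/funext => j; have J1 := Jmax w j; rewrite /momz /= J1 addr0.
  by rewrite PJL.
- move=> w i wb wi; have wbD j : dlo j <= Lw w j <= dhi j by exact: (wb (inr j)).
  rewrite actE; set S2 := \sum_(k < N) \sum_j _.
  have S20 : 0 <= S2 by apply: sumr_ge0 => k _; apply: sumr_ge0 => j _; exact: sqr_ge0.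
  case: i wi => [[k j]|i] /= wi.
    have S21 : 1 <= S2.
      have J2 := Jlift w k j; rewrite /S2 (bigD1 (lift omax k)) //= (bigD1 j) //= J2.
      have -> : w (inl (k, j)) ^+ 2 = 1 by case: wi => ->; rewrite ?sqrrN expr1n.
      by rewrite -addrA lerDl addr_ge0 //; apply: sumr_ge0 => ? _; [exact: sqr_ge0|apply: sumr_ge0 => ? _; exact: sqr_ge0].
    apply: (@le_trans _ _ (- kap * S2 + Num.max 0 C' * (1 + S2))).
      rewrite lerD2l; apply: le_trans (sumJ w); apply: ler_sum => l _.
      by rewrite ler_pM2r ?invr_gt0 //; apply: link_upp.
    rewrite /kap; nra.
  apply: (@le_trans _ _ (- kap * S2 + Num.max 0 C * S2)); last by rewrite /kap; nra.
  rewrite lerD2l /S2 mulr_sumr; apply: ler_sum => l _.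
  have sq : 0 <= \sum_j Jw w l j ^+ 2 by apply: sumr_ge0 => j _; exact: sqr_ge0.
  rewrite ler_pdivrMr //; apply: le_trans (link_bnd (i := i) wbD wi _ _) _.
  apply: le_trans (ler_wpM2r sq CC) _.
  by rewrite ler_peMr ?mulr_ge0 // -[leLHS]/(1%:R) ler_nat.
- move=> w wb; have wbD j : dlo j <= Lw w j <= dhi j by exact: (wb (inr j)).
  rewrite actE; set S2 := \sum_(k < N) \sum_j _.
  have S20 : 0 <= S2 by apply: sumr_ge0 => k _; apply: sumr_ge0 => j _; exact: sqr_ge0.
  apply: (@le_trans _ _ (- kap * S2 + Num.max 0 C' * (1 + S2))); last by rewrite /kap; nra.
  rewrite lerD2l; apply: le_trans (sumJ w); apply: ler_sum => l _.
  by rewrite ler_pM2r ?invr_gt0 //; apply: link_upp.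
- exact: alpha_gt0.
move=> z Pz; have pzE k : momz z k = momz z omax.
  apply/funext => j; case: (unliftP omax k) => [k' ->|-> //].
  by have := congr1 (fun f => f (inl (k', j))) Pz; rewrite /P /w0 => /eqP; rewrite subr_eq0 => /eqP.
have PJz : PJ (momz z omax) = dw by apply/funext => i; have := congr1 (fun f => f (inr i)) Pz.
have -> : action z = \sum_(k < N) (\sum_j momz z omax j * c j - K (posz z k) (momz z omax)) / N%:R.
  have N0 : (N%:R : R) != 0 by [].
  under [RHS]eq_bigr do rewrite mulrBl.
  rewrite /action !sumrB; congr (_ - _); last by apply: eq_bigr => k _; rewrite pzE.
  rewrite sumr_const card_ord -[RHS]mulr_natr divfK //.
  rewrite exchange_big /=; apply: eq_bigr => j _.
  under eq_bigr => k _ do rewrite pzE.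
  rewrite -mulr_sumr; congr (_ * _); rewrite /incr big_split /= sumrB.
  rewrite [X in _ - X](reindex_inj (@ordS_inj N)) /= subrr add0r (bigD1 omax) //= eqxx mul1r big1 ?addr0 //.
  by move=> k /negPf ->; rewrite mul0r.
have -> : alpha = \sum_(k < N) alpha / N%:R by rewrite sumr_const card_ord -[RHS]mulr_natr divfK.
by apply: ler_sum => k _; rewrite ler_pM2r ?invr_gt0 //; exact: link_low.
Qed.
End DiscreteAction.

(** * Ultralimits of discrete trajectories *)

Section EulerLimit.
Variable R : realType.

Lemma diff_quotE (f : R -> R) (s l h : R) : h != 0 ->
  l - h^-1 *: ((f \o shift s) (h *: (1 : R)) - f s) = - (f (s + h) - f s - h * l) / h.
Proof.
move=> h0; have -> : (f \o shift s) (h *: (1 : R)) = f (s + h).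
  by rewrite /= /shift /= [h *: (1 : R)]mulr1 addrC.
have -> : h^-1 *: (f (s + h) - f s) = h^-1 * (f (s + h) - f s) by [].
by field.
Qed.

Lemma is_derive_eps (f : R -> R) (s l : R) :
  (forall e : R, 0 < e -> exists2 d : R, 0 < d & forall h, `|h| < d -> `|f (s + h) - f s - h * l| <= e * `|h|) ->
  is_derive s (1 : R) f l.
Proof.
move=> H; have cv : h^-1 *: ((f \o shift s) (h *: (1 : R)) - f s) @[h --> (0 : R)^'] --> l.
  apply/cvgrPdist_le => e e0; have [d d0 hd] := H e e0.
  near=> h; have h0 : h != 0 by near: h; exact: nbhs_dnbhs_neq.
  have -> : l - h^-1 *: ((f \o shift s) (h *: (1 : R)) - f s) = - (f (s + h) - f s - h * l) / h.
    exact: diff_quotE.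
  rewrite normrM normrN normfV ler_pdivrMr ?normr_gt0 //; apply: hd.
  by near: h; apply: dnbhs0_lt.
by split; [apply/cvg_ex; exists l|exact: (cvg_lim (@Rhausdorff R) cv)].
Unshelve. all: by end_near. Qed.

Lemma is_derive_epsP (f : R -> R) (s l : R) : is_derive s (1 : R) f l ->
  forall e : R, 0 < e -> exists2 d : R, 0 < d & forall h, `|h| < d -> `|f (s + h) - f s - h * l| <= e * `|h|.
Proof.
move=> [df dv] e e0; have cv : h^-1 *: ((f \o shift s) (h *: (1 : R)) - f s) @[h --> (0 : R)^'] --> l.
  by rewrite -dv; exact: df.
move/cvgrPdist_le : cv => /(_ e e0) [d /= d0 hd]; exists d => // h hd1.
have [->|h0] := eqVneq h 0; first by rewrite addr0 subrr mul0r subr0 normr0 mulr0.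
have := hd h; rewrite /= sub0r normrN => /(_ hd1 h0).
have -> : l - h^-1 *: ((f \o shift s) (h *: (1 : R)) - f s) = - (f (s + h) - f s - h * l) / h.
  exact: diff_quotE.
by rewrite normrM normrN normfV ler_pdivrMr ?normr_gt0.
Qed.

Lemma int_drift (x : int -> R) (a : int) (m : nat) (v e : R) :
  (forall j : nat, (j < m)%N -> `|x (a + j%:Z + 1) - x (a + j%:Z) - v| <= e) ->
  `|x (a + m%:Z) - x a - m%:R * v| <= m%:R * e.
Proof.
elim: m => [|m IH] h; first by rewrite addr0 subrr !mul0r subr0 normr0.
have := h m (ltnSn m); have := IH (fun j jm => h j (ltnW jm)).
have -> : a + m.+1%:Z = a + m%:Z + 1 by rewrite -addrA -PoszD addn1.
rewrite -natr1 => h1 h2.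
have -> : x (a + m%:Z + 1) - x a - (m%:R + 1) * v = (x (a + m%:Z) - x a - m%:R * v) +
  (x (a + m%:Z + 1) - x (a + m%:Z) - v) by ring.
by apply: le_trans (ler_normD _ _) _; rewrite mulrDl mul1r lerD.
Qed.

Lemma ucont_eps (T : finType) (f : (T -> R) -> R) (y : T -> R) (e : R) : ucont f -> 0 < e ->
  exists2 r : R, 0 < r & forall z, (forall j, `|z j - y j| <= r) -> `|f z - f y| <= e.
Proof.
move=> fc e0; apply: contrapT => no.
have /choice[z zP] : forall n : nat, exists z : T -> R, (forall j, `|z j - y j| <= n.+1%:R^-1) /\ e < `|f z - f y|.
  move=> n; apply: contrapT => non; apply: no; exists n.+1%:R^-1 => // z zy.
  by rewrite leNgt; apply/negP => h; apply: non; exists z.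
have fz : (fun n => f (z n)) @ ultra --> f y.
  apply: fc => j; apply: (@ultra_cvg_near _ (fun=> y j) _ _ 1); first exact: cvg_cst.
  by move=> n; rewrite div1r; have [] := zP n.
move/cvgrPdist_le : fz => /(_ e e0) /filter_ex[n /=]; rewrite distrC leNgt.
by have [_ ->] := zP n.
Qed.

Variables (T : finType) (x : nat -> int -> T -> R) (y : nat -> int -> T -> T -> R).
Variables (V : (T -> R) -> T -> R) (B C D : R).
Hypothesis V_ucont : forall i, ucont (fun y => V y i).
Hypothesis V_bounded : forall n k i, `|V (y n k i) i| <= C.
Hypothesis xy_close : forall n k i j, `|y n k i j - x n k j| <= D / n.+1%:R.
Hypothesis x0_bounded : forall n i, `|x n 0 i| <= B.
Hypothesis x_step : forall n k i,
  `|x n (k + 1) i - x n k i - V (y n k i) i / n.+1%:R| <= n.+1%:R ^- 2.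

Let node n (t : R) : int := Num.floor (t * n.+1%:R).

Lemma euler_speed n k i : `|x n (k + 1) i - x n k i| <= (C + 1) / n.+1%:R.
Proof.
have N0 : (0 : R) < n.+1%:R by [].
have N1 : (1 : R) <= n.+1%:R by rewrite -[leLHS]/(1%:R) ler_nat.
have := x_step n k i; have := V_bounded n k i.
set v := V _ _; set d := _ - x n k i => vC hd.
have -> : d = (d - v / n.+1%:R) + v / n.+1%:R by rewrite subrK.
apply: le_trans (ler_normD _ _) _; rewrite mulrDl mul1r addrC; apply: lerD.
  by rewrite normrM normfV (gtr0_norm N0) ler_pM2r ?invr_gt0.
by apply: le_trans hd _; rewrite lef_pV2 ?posrE ?exprn_gt0 // ler_eXnr.
Qed.

Lemma euler_lip n (k l : int) i : k <= l -> `|x n l i - x n k i| <= (l - k)%:~R * ((C + 1) / n.+1%:R).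
Proof.
move=> kl; pose m := `|l - k|%N.
have lE : l = k + m%:Z by rewrite /m gez0_abs ?subr_ge0 //; ring.
have := @int_drift (fun k => x n k i) k m 0 ((C + 1) / n.+1%:R).
rewrite mulr0 subr0 -lE (_ : l - k = m%:Z) -?pmulrn; last by rewrite lE addrAC subrr add0r.
by apply => j _; rewrite subr0; exact: euler_speed.
Qed.

Lemma node_itv n t : (node n t)%:~R <= t * n.+1%:R < (node n t)%:~R + 1.
Proof. by rewrite /node ge_floor -intrD1 floorD1_gt. Qed.

Lemma node_le n s t : s <= t -> node n s <= node n t.
Proof. by move=> st; apply: le_floor; rewrite ler_pM2r. Qed.

Lemma C_ge0 (i : T) : 0 <= C.
Proof. by apply: le_trans (V_bounded 0 0 i). Qed.

Lemma euler_lipR n s t i : s <= t ->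
  `|x n (node n t) i - x n (node n s) i| <= (t - s + n.+1%:R^-1) * (C + 1).
Proof.
move=> st; apply: le_trans (euler_lip n i (node_le n st)) _.
have C0 := C_ge0 i; have N0 : (0 : R) < n.+1%:R by [].
rewrite mulrCA mulrC; apply: ler_wpM2r; first lra.
rewrite ler_pdivrMr // mulrDl mulVf ?lt0r_neq0 // intrD mulrNz.
have /andP[h1 h2] := node_itv n t; have /andP[h3 h4] := node_itv n s; lra.
Qed.

Lemma euler_bounded n t i : `|x n (node n t) i| <= B + (`|t| + 1) * (C + 1).
Proof.
have C0 := C_ge0 i.
have node0 : node n 0 = 0 by rewrite /node mul0r floor0.
have hV : n.+1%:R^-1 <= 1 :> R by rewrite invf_le1 // -[leLHS]/(1%:R) ler_nat.
have -> : x n (node n t) i = x n 0 i + (x n (node n t) i - x n (node n 0) i) by rewrite node0 addrC subrK.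
apply: le_trans (ler_normD _ _) _; apply: lerD => //.
have [t0|t0] := leP 0 t.
  apply: le_trans (euler_lipR n i t0) _; rewrite ger0_norm // subr0; apply: ler_wpM2r; [lra|by rewrite lerD2l].
rewrite distrC; apply: le_trans (euler_lipR n i (ltW t0)) _; rewrite ltr0_norm // sub0r; apply: ler_wpM2r; [lra|by rewrite lerD2l].
Qed.

(** The field is evaluated at [y], within [O(1 / n)] of the discrete trajectory [x]. Increments of
    [x] between two nodes are compared with [V (X s)] times the elapsed time; this inequality
    survives the limit and is already the definition of the derivative, so no integral equation is
    needed. *)
Lemma euler_limit : exists X : R -> T -> R,
  (forall t i, is_derive t (1 : R) (fun t => X t i) (V (X t) i)) /\
  (forall t i, (fun n => x n (Num.floor (t * n.+1%:R)) i) @ ultra --> X t i).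
Proof.
have /choice[X0 X0P] : forall ti : R * T, exists l : R, (fun n => x n (node n ti.1) ti.2) @ ultra --> l.
  move=> [t i]; pose M := B + (`|t| + 1) * (C + 1).
  have [n|l _ hl] := @ultra_bounded_cvg _ (fun n => x n (node n t) i) (- M) M; last by exists l.
  by rewrite -ler_norml; exact: euler_bounded.
pose X t i := X0 (t, i).
have XP t i : (fun n => x n (node n t) i) @ ultra --> X t i by exact: (X0P (t, i)).
exists X; split => // s i; apply: is_derive_eps => e e0.
have C0 := C_ge0 i.
have [r r0 Vr] := ucont_eps (X s) (@V_ucont i) (divr_gt0 e0 (ltr0n _ 2)).
(* During time [h] the trajectory moves by at most [r / 4]; the other three quarters of [r] cover
   the rounding to nodes, the convergence at [s] and the distance between [x] and [y]. *)
exists (r / (4 * (C + 1))); first by rewrite divr_gt0 // mulr_gt0 //; lra.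
move=> h; rewrite ltr_pdivlMr; last by rewrite mulr_gt0 //; lra.
move=> hr; pose v := V (X s) i.
have nodeC t : (fun n => (node n t)%:~R / n.+1%:R : R) @ ultra --> t.
  apply: (@ultra_cvg_near _ (fun=> t) _ _ 1); first exact: cvg_cst.
  move=> n; have N0 : (0 : R) < n.+1%:R by [].
  have -> : (node n t)%:~R / n.+1%:R - t = ((node n t)%:~R - t * n.+1%:R) / n.+1%:R by field; exact: lt0r_neq0.
  rewrite normrM normfV (gtr0_norm N0) ler_pM2r ?invr_gt0 // ler_norml.
  have /andP[h1 h2] := node_itv n t; apply/andP; split; lra.
have nodeD : (fun n => (node n (s + h))%:~R / n.+1%:R - (node n s)%:~R / n.+1%:R : R) @ ultra --> h.
  have E : (s : R) + h - s = h by ring.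
  by rewrite -{2}E; exact: cvgB (nodeC (s + h)) (nodeC s).
pose u n : R := `|x n (node n (s + h)) i - x n (node n s) i -
   ((node n (s + h))%:~R / n.+1%:R - (node n s)%:~R / n.+1%:R) * v|.
pose w n : R := e * `|(node n (s + h))%:~R / n.+1%:R - (node n s)%:~R / n.+1%:R|.
have uC : u @ ultra --> `|X (s + h) i - X s i - h * v|.
  apply: cvg_norm; apply: cvgB; first by apply: cvgB; exact: XP.
  apply: cvgM; last exact: cvg_cst.
  exact: nodeD.
have wC : w @ ultra --> e * `|h|.
  apply: cvgM; first exact: cvg_cst.
  by apply: cvg_norm; exact: nodeD.
have near1 : ultra [set n | forall j, `|x n (node n s) j - X s j| <= r / 4].
  have r2 : 0 < r / 4 by lra.
  have : forall j, \forall n \near ultra, `|x n (node n s) j - X s j| <= r / 4.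
    by move=> j; move/cvgrPdist_le : (XP s j) => /(_ _ r2); apply: filterS => n; rewrite distrC.
  by move/filter_forall.
have near2 : ultra [set n | [/\ n.+1%:R^-1 * (C + 1) <= r / 4, n.+1%:R^-1 * D <= r / 4 & n.+1%:R^-1 <= e / 2 :> R]].
  have c1 : (fun n => n.+1%:R^-1 * (C + 1) : R) @ ultra --> (0 : R).
    rewrite -(mul0r (C + 1)); apply: cvgM; last exact: cvg_cst.
    by apply: ultra_cvg_eventually; exact: cvg_harmonic.
  have c3 : (fun n => n.+1%:R^-1 * D : R) @ ultra --> (0 : R).
    rewrite -(mul0r D); apply: cvgM; last exact: cvg_cst.
    by apply: ultra_cvg_eventually; exact: cvg_harmonic.
  have c2 : (fun n => n.+1%:R^-1 : R) @ ultra --> (0 : R) by apply: ultra_cvg_eventually; exact: cvg_harmonic.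
  have r4 : 0 < r / 4 by lra.
  have e2 : 0 < e / 2 by lra.
  move/cvgrPdist_le : c1 => /(_ _ r4) N1; move/cvgrPdist_le : c2 => /(_ _ e2) N2.
  move/cvgrPdist_le : c3 => /(_ _ r4) N3.
  near=> n; split; apply: le_trans (ler_norm _) _; rewrite -normrN -sub0r; near: n; assumption.
(* between the two nodes the discrete trajectory stays close to X s, where V varies little *)
have key n : (forall j, `|x n (node n s) j - X s j| <= r / 4) ->
    n.+1%:R^-1 * (C + 1) <= r / 4 -> n.+1%:R^-1 * D <= r / 4 -> n.+1%:R^-1 <= e / 2 ->
    forall a b : int, (a = node n s /\ b = node n (s + h)) \/ (b = node n s /\ a = node n (s + h)) -> a <= b ->
    `|x n b i - x n a i - (b - a)%:~R / n.+1%:R * v| <= (b - a)%:~R * (e / n.+1%:R).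
  move=> h1 h2 hD h3 a b hab ab; pose m := `|b - a|%N; have N0 : (0 : R) < n.+1%:R by [].
  have bE : b = a + m%:Z by rewrite /m gez0_abs ?subr_ge0 //; ring.
  have baE : b - a = m%:Z by rewrite bE addrAC subrr add0r.
  have := @int_drift (fun k => x n k i) a m (v / n.+1%:R) (e / n.+1%:R).
  have mE : (b - a)%:~R = m%:R :> R by rewrite baE -pmulrn.
  have mvE : (b - a)%:~R / n.+1%:R * v = m%:R * (v / n.+1%:R) by rewrite mE mulrAC mulrA.
  rewrite -bE -mvE -mE; apply.
  move=> j jm; set k := a + j%:Z.
  have kab : a <= k /\ k <= b by split; [rewrite /k lerDl|rewrite bE /k lerD2l lez_nat ltnW].
  have width : (b - a)%:~R <= `|h| * n.+1%:R + 1.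
    rewrite intrD mulrNz.
    have /andP[g1 g2] := node_itv n s; have /andP[g3 g4] := node_itv n (s + h).
    have := ler_norm h; have := ler_norm (- h); rewrite normrN.
    case: hab => -[-> ->]; nra.
  have xk l : `|y n k i l - X s l| <= r.
    have -> : y n k i l - X s l = (y n k i l - x n k l) + ((x n k l - x n (node n s) l) + (x n (node n s) l - X s l)) by ring.
    apply: le_trans (ler_normD _ _) _.
    have -> : r = r / 4 + (r / 4 + r / 4 + r / 4) by lra.
    apply: lerD; first by apply: le_trans (xy_close n k i l) _; rewrite mulrC.
    apply: le_trans (ler_normD _ _) _.
    have : `|x n k l - x n (node n s) l| <= (b - a)%:~R * ((C + 1) / n.+1%:R).
      have C1 : 0 <= (C + 1) / n.+1%:R by rewrite divr_ge0 //; lra.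
      case: hab => -[<- _].
        apply: le_trans (euler_lip n l kab.1) _; apply: ler_wpM2r => //.
        by rewrite ler_int lerD2r kab.2.
      rewrite distrC; apply: le_trans (euler_lip n l kab.2) _; apply: ler_wpM2r => //.
      by rewrite ler_int lerD2l lerN2 kab.1.
    move: width; have -> : (C + 1) / n.+1%:R = n.+1%:R^-1 * (C + 1) by rewrite mulrC.
    have : n.+1%:R * (n.+1%:R^-1) = 1 :> R by rewrite divff ?lt0r_neq0.
    have := h1 l; have : 0 <= n.+1%:R^-1 :> R by rewrite ltW // invr_gt0.
    move=> iN0 hl NN W h4.
    move: (n.+1%:R^-1 : R) h2 iN0 NN h4 => iN h2 iN0; move: (n.+1%:R : R) N0 W => N N0 W NN h4.
    have h5 : (b - a)%:~R * (iN * (C + 1)) <= (`|h| * N + 1) * (iN * (C + 1)).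
      by apply: ler_wpM2r => //; apply: mulr_ge0 => //; lra.
    apply: lerD => //; apply: le_trans h4 _; apply: le_trans h5 _.
    have -> : (`|h| * N + 1) * (iN * (C + 1)) = (N * iN) * (`|h| * (C + 1)) + iN * (C + 1) by ring.
    rewrite NN; lra.
  have := Vr (y n k i) xk; have := x_step n k i.
  have -> : n.+1%:R ^- 2 = n.+1%:R^-1 * n.+1%:R^-1 :> R by rewrite expr2 invfM.
  have : 0 < n.+1%:R^-1 :> R by rewrite invr_gt0.
  move: (n.+1%:R^-1 : R) h3 => iN h3 iN0.
  rewrite -/v; set d := _ - x n k i; set vk := V (y n k i) i => g1 g2.
  have -> : d - v * iN = (d - vk * iN) + (vk - v) * iN by ring.
  apply: le_trans (ler_normD _ _) _; rewrite normrM (gtr0_norm iN0).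
  have : `|vk - v| * iN <= e / 2 * iN by apply: ler_wpM2r => //; exact: ltW.
  nra.
apply: (ler_cvg_to uC wC); near=> n.
have h1 : forall j, `|x n (node n s) j - X s j| <= r / 4 by near: n; exact: near1.
have [h2 hD h3] : [/\ n.+1%:R^-1 * (C + 1) <= r / 4, n.+1%:R^-1 * D <= r / 4 & n.+1%:R^-1 <= e / 2 :> R] by near: n; exact: near2.
rewrite /u /w -mulrBl -intrB; set dd := _ / _.
have [hh|/ltW hh] := leP (node n s) (node n (s + h)).
  have ab : 0 <= (node n (s + h) - node n s)%:~R :> R by rewrite ler0z subr_ge0.
  apply: le_trans (key n h1 h2 hD h3 _ _ (or_introl (conj erefl erefl)) hh) _.
  by rewrite /dd ger0_norm ?divr_ge0 // mulrCA.
have ab : 0 <= (node n s - node n (s + h))%:~R :> R by rewrite ler0z subr_ge0.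
have -> : x n (node n (s + h)) i - x n (node n s) i - dd * v =
   - (x n (node n s) i - x n (node n (s + h)) i - (node n s - node n (s + h))%:~R / n.+1%:R * v).
  by rewrite /dd !intrB; ring.
rewrite normrN; apply: le_trans (key n h1 h2 hD h3 _ _ (or_intror (conj erefl erefl)) hh) _.
have -> : dd = - ((node n s - node n (s + h))%:~R / n.+1%:R) by rewrite /dd -mulNr -intrN opprB.
by rewrite normrN ger0_norm ?divr_ge0 // mulrCA.
Unshelve. all: by end_near. Qed.
End EulerLimit.

Lemma mulr_natr_sum_const (R : realType) (a : R) n : a * n.+1%:R = \sum_(k < n.+1) a.
Proof. by rewrite sumr_const card_ord mulr_natr. Qed.

Section PeriodicIndex.
Variables (R : realType) (n : nat).
Local Notation N := n.+1.

Definition int_ord (k : int) : 'I_N := inord `|(k %% N)%Z|%N.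

Lemma int_ordE k : (nat_of_ord (int_ord k))%:Z = (k %% N)%Z.
Proof.
rewrite /int_ord inordK; first by rewrite gez0_abs // modz_ge0.
by rewrite -ltz_nat gez0_abs ?modz_ge0 // ltz_mod.
Qed.

(** The quotient grows exactly when the residue wraps around, which is where [incr] adds [c]; a
    cyclic sequence is unwound in this way. *)
Lemma int_ord_succ k : int_ord (k + 1) = ordS (int_ord k) /\
  ((k + 1) %/ N)%Z = (k %/ N)%Z + (int_ord k == ord_max)%:Z.
Proof.
have kE : k = (k %/ N)%Z * N%:Z + (nat_of_ord (int_ord k))%:Z by rewrite int_ordE -divz_eq.
have k1E : k + 1 = (k %/ N)%Z * N%:Z + (nat_of_ord (int_ord k)).+1%:Z.
  by rewrite {1}kE -addrA -PoszD addn1.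
have [rmax|rmax] := eqVneq (int_ord k) ord_max.
  move: k1E; rewrite rmax /= => k1E.
  have k1E' : k + 1 = ((k %/ N)%Z + 1) * N%:Z + 0 by rewrite k1E; ring.
  split; last by rewrite k1E' divzMDl // div0z addr0.
  apply/val_inj/eqP; rewrite -eqz_nat /= modnn; apply/eqP.
  by rewrite int_ordE k1E' addr0 modzMl.
have r1 : ((int_ord k).+1 < N)%N.
  have : nat_of_ord (int_ord k) != n by apply: contra rmax => /eqP h; apply/eqP/val_inj.
  by have := ltn_ord (int_ord k); lia.
split; last first.
  by rewrite k1E divzMDl // [X in _ + X = _]divz_small ?addr0 //.
apply/val_inj/eqP; rewrite -eqz_nat /=; apply/eqP.
by rewrite int_ordE k1E modzMDl modz_small ?modn_small.
Qed.
End PeriodicIndex.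

(** * Closed trajectories of a Hamiltonian periodic in the positions *)

Section ClosedOrbits.
Variables (R : realType) (K : (bool -> R) -> (bool -> R) -> R).
Variables (Kq Kp : (bool -> R) -> (bool -> R) -> bool -> R) (c : bool -> R).
Hypothesis K_ucont : ucont2 K.
Hypothesis Kq_ucont : forall j, ucont2 (fun q p => Kq q p j).
Hypothesis Kp_ucont : forall j, ucont2 (fun q p => Kp q p j).
Hypothesis K_unif : forall eta : R, 0 < eta -> exists2 h0 : R, 0 < h0 &
  forall (h : R) q p dq dp, 0 < h -> h <= h0 ->
    (forall j, `|dq j| <= h) -> (forall j, `|dp j| <= h) ->
    K q p + \sum_j Kq q p j * dq j + \sum_j Kp q p j * dp j - eta * h <=
    K (fun j => q j + dq j) (fun j => p j + dp j).

(** Invariance under [2 pi] allows the initial positions to be moved into a bounded set; invariance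
    under [c] allows the cyclic sequence to be unwound. *)
Definition lattice_inv (f : (bool -> R) -> R) :=
  (forall q (m : bool -> int), f (fun j => q j + (m j)%:~R * (2 * pi)) = f q) /\
  (forall q (m : int), f (fun j => q j + m%:~R * c j) = f q).

Hypothesis K_inv : forall p, lattice_inv (fun q => K q p).
Hypothesis Kq_inv : forall p j, lattice_inv (fun q => Kq q p j).
Hypothesis Kp_inv : forall p j, lattice_inv (fun q => Kp q p j).

Variables (Cq rho sig : R).
Hypothesis Kq_bounded : forall q p j, `|Kq q p j| <= Cq.
Hypothesis Kp_bounded : forall r : R, exists C : R,
  forall q p, (forall j, `|p j| <= r) -> forall j, `|Kp q p j| <= C.
Hypothesis Kp_right : forall q p j, rho <= p j -> `|c j| + 2 <= Kp q p j.
Hypothesis sig1 : sig = 1 \/ sig = -1.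
Hypothesis Kp_left : forall q p j, p j <= - rho -> `|c j| + 2 <= sig * Kp q p j.

Variables (D : finType) (L : (D -> R) -> bool -> R) (PJ : (bool -> R) -> D -> R).
Variables (dlo dhi dw : D -> R) (alpha C C' : R).
Hypothesis L_ucont : forall j, ucont (fun w => L w j).
Hypothesis PJ_ucont : forall i, ucont (fun p => PJ p i).
Hypothesis PJL : forall w, PJ (L w) = w.
Hypothesis dwP : forall i, dlo i < dw i < dhi i.
Hypothesis alpha_gt0 : 0 < alpha.
Hypothesis link_low : forall q p, PJ p = dw -> alpha <= \sum_j p j * c j - K q p.
Hypothesis link_bnd : forall w i, (forall j, dlo j <= w j <= dhi j) -> w i = dlo i \/ w i = dhi i ->
  forall q v, \sum_j L w j * c j - K q (fun j => L w j + v j) <= C * \sum_j v j ^+ 2.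
Hypothesis link_upp : forall w, (forall j, dlo j <= w j <= dhi j) ->
  forall q v, \sum_j L w j * c j - K q (fun j => L w j + v j) <= C' * (1 + \sum_j v j ^+ 2).

Let M : R := `|rho| + Cq + 1.

Lemma Cq_ge0 : 0 <= Cq.
Proof. by apply: le_trans (Kq_bounded (fun=> 0) (fun=> 0) true). Qed.

(** Each component of the momentum varies by at most [Cq + 1] along the loop. If it were large at
    the first node, it would lie beyond [rho] on one side at all nodes, where [Kp], up to the sign
    [sig], is at least [|c| + 2]; but the mean of [Kp] is within 1 of [c]. *)
Lemma approx_orbit_bounded n (z : 'I_n.+1 * (bool * bool) -> R) (eps : R) :
  eps * n.+1%:R <= 1 -> (forall i, `|action_grad Kq Kp c z i| <= eps) ->
  forall k j, `|momz z k j| <= M + Cq + 1.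
Proof.
move=> epsN gz; have C0 := Cq_ge0; have N0 : (0 : R) < n.+1%:R by [].
pose N : R := n.+1%:R.
have Nlem : (n%:R : R) <= N by rewrite ler_nat.
have eps0 : 0 <= eps by apply: le_trans (gz (ord0, (true, true))).
have stepI j k : `|momz z (ordS k) j - momz z k j| <= Cq / N + eps.
  have := gz (ordS k, (false, j)); rewrite /= ordSK; set K1 := Kq _ _ _ => h.
  have -> : momz z (ordS k) j - momz z k j = - ((momz z k j - momz z (ordS k) j - K1 / n.+1%:R) + K1 / n.+1%:R) by ring.
  rewrite normrN; apply: le_trans (ler_normD _ _) _; rewrite addrC; apply: lerD => //.
  by rewrite normrM normfV (gtr0_norm N0) ler_pM2r ?invr_gt0 //; exact: Kq_bounded.
have farI j (k : 'I_n.+1) : `|momz z k j - momz z ord0 j| <= Cq + 1.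
  have H (m : nat) (mn : (m < n.+1)%N) : `|momz z (Ordinal mn) j - momz z ord0 j| <= m%:R * (Cq / N + eps).
    elim: m mn => [|m IH] mn; first by rewrite (_ : Ordinal mn = ord0) ?subrr ?normr0 ?mul0r //; exact: val_inj.
    have := stepI j (Ordinal (ltnW mn)); have := IH (ltnW mn).
    have -> : ordS (Ordinal (ltnW mn)) = Ordinal mn by apply/val_inj; rewrite /= modn_small.
    rewrite -natr1 mulrDl mul1r => h1 h2.
    have -> : momz z (Ordinal mn) j - momz z ord0 j = (momz z (Ordinal (ltnW mn)) j - momz z ord0 j)
      + (momz z (Ordinal mn) j - momz z (Ordinal (ltnW mn)) j) by ring.
    by apply: le_trans (ler_normD _ _) _; exact: lerD.
  case: k => m mn; apply: le_trans (H m mn) _.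
  apply: (@le_trans _ _ (N * (Cq / N + eps))).
    by apply: ler_wpM2r; [rewrite addr_ge0 // divr_ge0 // ltW|rewrite ler_nat ltnW].
  rewrite mulrDr mulrC divfK ?lt0r_neq0 // lerD2l mulrC //.
have avg j : `|c j - (\sum_(k < n.+1) Kp (posz z k) (momz z k) j) / N| <= 1.
  have -> : c j - (\sum_(k < n.+1) Kp (posz z k) (momz z k) j) / N =
     \sum_(k < n.+1) (incr c z k j - Kp (posz z k) (momz z k) j / N).
    rewrite sumrB mulr_suml; congr (_ - _); rewrite /incr big_split /= sumrB.
    rewrite [X in X - _ + _](_ : _ = \sum_(k < n.+1) posz z k j); last first.
      by rewrite [RHS](reindex_inj (@ordS_inj n.+1)).
    rewrite subrr add0r (bigD1 ord_max) //= eqxx mul1r big1 ?addr0 // => k /negPf ->.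
    by rewrite mul0r.
  apply: le_trans (ler_norm_sum _ _ _) _; apply: le_trans epsN.
  rewrite mulr_natr_sum_const.
  apply: ler_sum => k _; exact: (gz (k, (true, j))).
have first_bounded j : `|momz z ord0 j| <= M.
  rewrite leNgt; apply/negP => big.
  have rn := ler_norm rho; have c1 := ler_norm (c j); have c2 := ler_norm (- c j).
  rewrite normrN in c2.
  have [pos|neg] := leP 0 (momz z ord0 j).
    rewrite ger0_norm // in big.
    have all k : `|c j| + 2 <= Kp (posz z k) (momz z k) j.
      apply: Kp_right; have := farI j k; rewrite ler_norml => /andP[h _].
      by rewrite /M in big; lra.
    have : `|c j| + 2 <= (\sum_(k < n.+1) Kp (posz z k) (momz z k) j) / N.
      rewrite ler_pdivlMr // mulr_natr_sum_const; apply: ler_sum => k _; exact: all.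
    by have := avg j; rewrite ler_norml; set A := _ / N => /andP[h1 h2] h3; lra.
  rewrite ltr0_norm // in big.
  have all k : `|c j| + 2 <= sig * Kp (posz z k) (momz z k) j.
    apply: Kp_left; have := farI j k; rewrite ler_norml => /andP[_ h].
    by rewrite /M in big; lra.
  have : `|c j| + 2 <= sig * ((\sum_(k < n.+1) Kp (posz z k) (momz z k) j) / N).
    rewrite mulrA ler_pdivlMr // mulr_natr_sum_const mulr_sumr; apply: ler_sum => k _; exact: all.
  by have := avg j; rewrite ler_norml; set A := _ / N => /andP[h1 h2] h3; case: sig1 h3 => ->; lra.
move=> k j; have -> : momz z k j = momz z ord0 j + (momz z k j - momz z ord0 j) by ring.
apply: le_trans (ler_normD _ _) _; rewrite -addrA; exact: lerD.
Qed.

Lemma int_ord_shift n (k : int) : int_ord n (k + n.+1%:Z) = int_ord n k /\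
  ((k + n.+1%:Z) %/ n.+1)%Z = (k %/ n.+1)%Z + 1.
Proof.
split; first by apply/val_inj/eqP; rewrite -eqz_nat; apply/eqP; rewrite !int_ordE modzDr.
by rewrite divzDr // divzz.
Qed.

(** Positivity of the action is recorded as a bound on [p * Kp - K] at time 0, which passes to the
    limit pointwise: the origin of time is put at a node where this quantity is large. *)
Theorem hamiltonian_closed_orbit : exists X : R -> bool * bool -> R,
  [/\ forall t j, is_derive t (1 : R) (fun t => X t (false, j))
         (Kp (fun j => X t (false, j)) (fun j => X t (true, j)) j),
      forall t j, is_derive t (1 : R) (fun t => X t (true, j))
         (- Kq (fun j => X t (false, j)) (fun j => X t (true, j)) j),
      forall t j, X (t + 1) (false, j) = X t (false, j) + c j,
      forall t j, X (t + 1) (true, j) = X t (true, j)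
    & alpha / 4 <= \sum_j X 0 (true, j) * Kp (fun j => X 0 (false, j)) (fun j => X 0 (true, j)) j
        - K (fun j => X 0 (false, j)) (fun j => X 0 (true, j))].
Proof.
have C0 := Cq_ge0.
pose Im := M + Cq + 1.
have Im0 : 0 <= Im by rewrite /Im /M; have := normr_ge0 rho; lra.
have [CP0 CP0P] := Kp_bounded Im.
pose CP := Num.max 0 CP0.
have CPP q p : (forall j, `|p j| <= Im) -> forall j, `|Kp q p j| <= CP.
  by move=> h j; rewrite le_max CP0P // orbT.
have CP_ge0 : 0 <= CP by rewrite le_max lexx.
(* Momenta times the residual gradient, summed over the nodes, cost at most
   [2 * Im * e0 <= alpha / 8]. As the action is at least [alpha / 2], some node must carry
   [alpha / 4]. *)
pose e0 := Num.min 1 (alpha / (16 * (Im + 1))).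
have e00 : 0 < e0 by rewrite lt_min ltr01 divr_gt0 // mulr_gt0 //; lra.
have e01 : e0 <= 1 by rewrite ge_min lexx.
have e0a : 2 * Im * e0 <= alpha / 8.
  have : e0 * (16 * (Im + 1)) <= alpha.
    by rewrite -ler_pdivlMr ?ge_min ?lexx ?orbT // mulr_gt0 //; lra.
  nra.
pose eps n : R := e0 * n.+1%:R ^- 2.
have N1 n : (1 : R) <= n.+1%:R by rewrite -[leLHS]/(1%:R) ler_nat.
have Ni n : 0 < n.+1%:R^-1 :> R by rewrite invr_gt0.
have epsN2 n : eps n <= n.+1%:R ^- 2.
  by rewrite /eps ler_piMl // invr_ge0 exprn_ge0.
have N2 n : n.+1%:R ^- 2 <= n.+1%:R^-1 :> R.
  by rewrite lef_pV2 ?posrE ?exprn_gt0 // ler_eXnr.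
have eps0 n : 0 < eps n by rewrite /eps mulr_gt0 // invr_gt0 exprn_gt0.
have epsN n : eps n * n.+1%:R <= e0.
  rewrite /eps -mulrA ler_piMr ?(ltW e00) // expr2 invfM -mulrA mulVf ?mulr1 ?invf_le1 //.
have zex : forall n, exists z : 'I_n.+1 * (bool * bool) -> R,
    alpha / 2 <= action K c z /\ forall i, `|action_grad Kq Kp c z i| <= eps n.
  move=> n; have [z z1 z2] := action_almost_critical K_ucont Kq_ucont Kp_ucont K_unif n L_ucont PJ_ucont
     PJL dwP alpha_gt0 link_low link_bnd link_upp (eps0 n).
  by exists z.
pose z n := sval (cid (zex n)); have zP n : alpha / 2 <= action K c (z n) /\ forall i, `|action_grad Kq Kp c (z n) i| <= eps n := svalP (cid (zex n)).
have zI n k j : `|momz (z n) k j| <= Im.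
  apply: (@approx_orbit_bounded _ _ (eps n)); last by have [] := zP n.
  exact: le_trans (epsN n) e01.
pose W q p := \sum_j p j * Kp q p j - K q p.
have kex : forall n, exists k : 'I_n.+1, alpha / 4 <= W (posz (z n) k) (momz (z n) k).
  move=> n; apply: contrapT => no.
  have allW k : W (posz (z n) k) (momz (z n) k) <= alpha / 4.
    by rewrite leNgt; apply/negP => h; apply: no; exists k; exact: ltW.
  have [az gz] := zP n; move: az; rewrite leNgt => /negP; apply.
  have -> : action K c (z n) = \sum_k (W (posz (z n) k) (momz (z n) k) / n.+1%:R +
      \sum_j momz (z n) k j * action_grad Kq Kp c (z n) (k, (true, j))).
    apply: eq_bigr => k _; rewrite /W !big_bool /=; ring.
  have lt_strict : \sum_k (W (posz (z n) k) (momz (z n) k) / n.+1%:R +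
      \sum_j momz (z n) k j * action_grad Kq Kp c (z n) (k, (true, j))) <=
      \sum_(k < n.+1) (alpha / 4 / n.+1%:R + 2 * Im * eps n).
    apply: ler_sum => k _; apply: lerD; first by rewrite ler_pM2r.
    have -> : 2 * Im * eps n = \sum_(j : bool) Im * eps n by rewrite big_bool /=; ring.
    apply: ler_sum => j _; apply: le_trans (ler_norm _) _; rewrite normrM.
    by apply: ler_pM => //; exact: zI.
  apply: le_lt_trans lt_strict _; rewrite sumr_const card_ord -[ltLHS]mulr_natr mulrDl divfK //.
  have : 2 * Im * eps n * n.+1%:R <= 2 * Im * e0.
    by rewrite -mulrA; apply: ler_wpM2l => //; apply: mulr_ge0.
  have a0 := alpha_gt0; lra.
pose k0 n := sval (cid (kex n)); have k0P n : alpha / 4 <= W (posz (z n) (k0 n)) (momz (z n) (k0 n)) := svalP (cid (kex n)).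
pose kk n (k : int) : 'I_n.+1 := int_ord n ((k0 n)%:Z + k).
(* Whole turns are subtracted so that the initial positions stay bounded in [n]. *)
pose m n j : int := Num.floor (posz (z n) (k0 n) j / (2 * pi)).
pose Q n (k : int) j : R := posz (z n) (kk n k) j + (((k0 n)%:Z + k) %/ n.+1)%Z%:~R * c j - (m n j)%:~R * (2 * pi).
(* The discrete equation reads [p_k - p_(k-1) = - Kq (q_k, p_k) / N] up to [eps]. Hence [x] stores
   the momentum of the preceding node, and [y] the point [(q_k, p_k)] where the field is
   evaluated. *)
pose x n (k : int) (i : bool * bool) : R :=
  if i.1 then momz (z n) (ord_pred (kk n k)) i.2 else Q n k i.2.
pose y n (k : int) (i0 i : bool * bool) : R :=
  if i.1 then momz (z n) (kk n k) i.2 else Q n k i.2.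
pose V (X : bool * bool -> R) (i : bool * bool) : R :=
  if i.1 then - Kq (fun j => X (false, j)) (fun j => X (true, j)) i.2
  else Kp (fun j => X (false, j)) (fun j => X (true, j)) i.2.
have Qinv (f : (bool -> R) -> R) n k : lattice_inv f -> f (Q n k) = f (posz (z n) (kk n k)).
  move=> [f1 f2]; rewrite -[RHS](f2 _ (((k0 n)%:Z + k) %/ n.+1)%Z) -[RHS](f1 _ (fun j => - m n j)).
  by congr f; apply/funext => j; rewrite /Q mulrNz mulNr.
have kkS n k : kk n (k + 1) = ordS (kk n k) /\
    (((k0 n)%:Z + (k + 1)) %/ n.+1)%Z = (((k0 n)%:Z + k) %/ n.+1)%Z + (kk n k == ord_max)%:Z.
  by rewrite /kk addrA; exact: int_ord_succ.
have kk0 n : kk n 0 = k0 n /\ (((k0 n)%:Z + 0) %/ n.+1)%Z = 0.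
  rewrite /kk addr0; split; last by rewrite divz_small //; rewrite absz_nat; have := ltn_ord (k0 n); lia.
  apply/val_inj/eqP; rewrite -eqz_nat; apply/eqP; rewrite int_ordE modz_small //.
  by have := ltn_ord (k0 n); lia.
have xy n k i j : `|y n k i j - x n k j| <= (Cq + 1) / n.+1%:R.
  case: j => [[] j]; rewrite /x /y /=; last by rewrite subrr normr0 divr_ge0 // addr_ge0.
  have [_ /(_ (kk n k, (false, j)))] := zP n; rewrite /=; set K1 := Kq _ _ _ => h.
  have -> : momz (z n) (kk n k) j - momz (z n) (ord_pred (kk n k)) j =
    - ((momz (z n) (ord_pred (kk n k)) j - momz (z n) (kk n k) j - K1 / n.+1%:R) + K1 / n.+1%:R) by ring.
  rewrite normrN; apply: le_trans (ler_normD _ _) _; rewrite addrC mulrDl mul1r; apply: lerD.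
    by rewrite normrM normfV (gtr0_norm (ltr0Sn R n)) ler_pM2r //; exact: Kq_bounded.
  by apply: le_trans h _; apply: le_trans (epsN2 n) _.
have [i|n k i|n k i j|n i|n k i|X [XV Xlim]] :=
  @euler_limit R _ x y V (2 * pi + Im) (CP + Cq) (Cq + 1).
- case: i => [[] j]; first by apply: ucontN; exact: (@Kq_ucont j).
  exact: (@Kp_ucont j).
- case: i => [[] j]; rewrite /V /=.
    by rewrite normrN; apply: le_trans (Kq_bounded _ _ _) _; rewrite lerDr.
  by apply: le_trans (CPP _ _ _ _) _; [move=> j'; exact: zI|rewrite lerDl].
- exact: xy.
- case: i => [[] j]; rewrite /x /=.
    by apply: le_trans (zI _ _ _) _; rewrite lerDr mulr_ge0 // pi_ge0.
  apply: (@le_trans _ _ (2 * pi)); last by rewrite lerDl.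
  have [k1 k2] := kk0 n; rewrite /Q k1 k2 mul0r addr0 /m.
  have pp : 0 < 2 * pi :> R by rewrite mulr_gt0 // pi_gt0.
  set r := posz _ _ _; have rE : r = r / (2 * pi) * (2 * pi) by rewrite divfK // lt0r_neq0.
  have h1 : (Num.floor (r / (2 * pi)))%:~R <= r / (2 * pi) by exact: ge_floor.
  have h2 : r / (2 * pi) < (Num.floor (r / (2 * pi)))%:~R + 1 by rewrite -intrD1 floorD1_gt.
  rewrite {1}rE -mulrBl ger0_norm; last by rewrite mulr_ge0 ?subr_ge0 // ltW.
  by rewrite ler_piMl ?(ltW pp) //; lra.
- case: i => [[] j]; rewrite /x /V /y /=.
    have [_ /(_ (kk n k, (false, j)))] := zP n; rewrite /= (kkS n k).1 ordSK.
    rewrite (Qinv (fun q => Kq q _ j)) //; set K1 := Kq _ _ _ => h.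
    apply: le_trans (epsN2 n); apply: le_trans h; rewrite -normrN.
    by rewrite le_eqVlt; apply/orP; left; apply/eqP; congr `| _ |; ring.
  have [_ /(_ (kk n k, (true, j)))] := zP n; rewrite /= => h.
  rewrite (Qinv (fun q => Kp q _ j)) // /Q (kkS n k).1 (kkS n k).2.
  apply: le_trans (epsN2 n); apply: le_trans h; rewrite /incr intrD.
  rewrite le_eqVlt; apply/orP; left; apply/eqP; congr `| _ |.
  by case: (kk n k == ord_max); rewrite /=; ring.
have xper n k : x n (k + n.+1%:Z) = (fun i => x n k i + (if i.1 then 0 else c i.2)).
  have [e1 e2] := int_ord_shift n ((k0 n)%:Z + k).
  apply/funext => -[[] j]; rewrite /x /Q /kk /= addrA e1 ?addr0 // e2 intrD; ring.
have floorS n t : Num.floor ((t + 1) * n.+1%:R) = Num.floor (t * n.+1%:R : R) + n.+1%:Z.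
  apply: floor_def; rewrite mulrDl mul1r -addrA [n.+1%:Z + 1]addrC addrA intrD intrD.
  by rewrite -!pmulrn lerD2r ltrD2r ge_floor floorD1_gt.
have yC i : (fun n => y n 0 (true, true) i) @ ultra --> X 0 i.
  have := Xlim 0 i; under eq_fun do rewrite mul0r floor0.
  move=> xc; apply: (@ultra_cvg_near _ _ _ _ (Cq + 1) xc) => n.
  exact: xy.
exists X; split => [t j|t j|t j|t j|].
- exact: (XV t (false, j)).
- exact: (XV t (true, j)).
- have h1 := Xlim (t + 1) (false, j); have h2 := Xlim t (false, j).
  apply: (ultra_cvg_unique h1); under eq_fun do rewrite floorS xper /=.
  by apply: cvgD => //; exact: cvg_cst.
- have h1 := Xlim (t + 1) (true, j); have h2 := Xlim t (true, j).
  by apply: (ultra_cvg_unique h1); under eq_fun do rewrite floorS xper /= addr0.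
have Wc : ucont2 W.
  apply: ucontB => //; apply: ucont_sum => j.
  by apply: ucontM; [exact: ucont_proj|exact: (@Kp_ucont j)].
have := Wc (fun n => y n 0 (true, true)) (X 0) yC => Wlim.
apply: (@cvgr_to_ge _ ultra _ R _ _ _ Wlim); apply: filterE => n.
change (alpha / 4 <= W (Q n 0) (momz (z n) (kk n 0))).
have := k0P n; rewrite -(kk0 n).1 /W (Qinv (fun q => K q _)) // !big_bool /=.
have QE j p : Kp (Q n 0) p j = Kp (posz (z n) (kk n 0)) p j by exact: (Qinv (fun q => Kp q p j)).
by rewrite !QE.
Qed.
End ClosedOrbits.

(** * Calculus in one variable *)

Section Calculus1.
Variable R : realType.
Implicit Types f g df : R -> R.

Lemma derive_cont f s l : is_derive s (1 : R) f l -> {for s, continuous f}.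
Proof. by move=> [d _]; apply: differentiable_continuous; exact/derivable1_diffP. Qed.

Lemma mean_value f df (x y : R) : (forall t, is_derive t (1 : R) f (df t)) ->
  exists2 c, `|c - x| <= `|y - x| & f y - f x = df c * (y - x).
Proof.
move=> fd; have fc a b : {within `[a, b], continuous f}.
  by apply: continuous_subspaceT => t; exact: derive_cont (fd t).
have [xy|yx] := leP x y.
  have [c] := MVT_segment xy (fun t _ => fd t) (fc x y); rewrite in_itv /= => /andP[h1 h2] e.
  by exists c => //; rewrite !ger0_norm ?subr_ge0 // lerD2r.
have [c] := MVT_segment (ltW yx) (fun t _ => fd t) (fc y x); rewrite in_itv /= => /andP[h1 h2] e.
exists c; first by rewrite !ler0_norm ?subr_le0 ?(ltW yx) // lerN2 lerD2r.
by rewrite -opprB e -mulrN opprB.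
Qed.

Lemma derive0_cst f : (forall t, is_derive t (1 : R) f 0) -> forall x y, f x = f y.
Proof.
move=> fd x y; have [c _ /eqP] := mean_value y x fd.
by rewrite mul0r subr_eq0 => /eqP.
Qed.

Lemma derive_ge0_mono f df : (forall t, is_derive t (1 : R) f (df t)) -> (forall t, 0 <= df t) ->
  forall x y, x <= y -> f x <= f y.
Proof.
move=> fd d0 x y xy; have [c _ e] := mean_value x y fd.
by rewrite -subr_ge0 e mulr_ge0 // subr_ge0.
Qed.

Lemma derive_uniq f s l l' : is_derive s (1 : R) f l -> is_derive s (1 : R) f l' -> l = l'.
Proof. by move=> [_ <-] [_ <-]. Qed.

Lemma is_derive_conv f g s l m : is_derive s (1 : R) f l -> (forall t, f t = g t) -> l = m ->
  is_derive s (1 : R) g m.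
Proof. by move=> fd /funext <- <-. Qed.

Lemma der_add f g s l m : is_derive s (1 : R) f l -> is_derive s (1 : R) g m ->
  is_derive s (1 : R) (fun t => f t + g t) (l + m).
Proof. by move=> fd gd; exact: is_deriveD. Qed.

Lemma der_opp f s l : is_derive s (1 : R) f l -> is_derive s (1 : R) (fun t => - f t) (- l).
Proof. by move=> fd; exact: is_deriveN. Qed.

Lemma der_sub f g s l m : is_derive s (1 : R) f l -> is_derive s (1 : R) g m ->
  is_derive s (1 : R) (fun t => f t - g t) (l - m).
Proof. by move=> fd gd; exact: is_deriveB. Qed.

Lemma der_mul f g s l m : is_derive s (1 : R) f l -> is_derive s (1 : R) g m ->
  is_derive s (1 : R) (fun t => f t * g t) (l * g s + f s * m).
Proof.
by move=> fd gd; apply: (is_derive_conv (is_deriveM fd gd)) => //; rewrite /GRing.scale /= addrC mulrC [in X in X + _]mulrC.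
Qed.

Lemma der_cst (c s : R) : is_derive s (1 : R) (fun=> c) 0.
Proof. exact: is_derive_cst. Qed.

Lemma der_id (s : R) : is_derive s (1 : R) (fun t => t) 1.
Proof. exact: is_derive_id. Qed.

Lemma der_cmul (c : R) f s l : is_derive s (1 : R) f l -> is_derive s (1 : R) (fun t => c * f t) (c * l).
Proof. by move=> fd; apply: (is_derive_conv (der_mul (der_cst c s) fd)) => //; rewrite mul0r add0r. Qed.

Lemma der_comp f g (s l m : R) : is_derive s (1 : R) f l -> is_derive (f s) (1 : R) g m ->
  is_derive s (1 : R) (fun t => g (f t)) (m * l).
Proof. by move=> fd gd; exact: is_derive1_comp. Qed.

Lemma is_derive_shift f df (c : R) : (forall t, is_derive t (1 : R) f (df t)) ->
  forall t, is_derive t (1 : R) (fun t => f (t + c)) (df (t + c)).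
Proof.
move=> fd t; apply: is_derive_eps => e e0; have [d d0 hd] := is_derive_epsP (fd (t + c)) e0.
by exists d => // h /hd; rewrite (addrAC t h c).
Qed.

Lemma is_derive_scale f df (c : R) : (forall t, is_derive t (1 : R) f (df t)) ->
  forall t, is_derive t (1 : R) (fun t => f (c * t)) (c * df (c * t)).
Proof.
move=> fd t; have [d1 d2] := fd (c * t).
have [/= -> | c0] := eqVneq c 0.
  rewrite mul0r; apply: (is_derive_conv (der_cst (f 0) t)) => [u|] //; by rewrite mul0r.
apply: is_derive_eps => e e0.
have nc : 0 < `|c| by rewrite normr_gt0.
have [d d0 hd] := is_derive_epsP (fd (c * t)) (divr_gt0 e0 (nc : 0 < `|c|)).
exists (d / `|c|); first by rewrite divr_gt0.
move=> h; rewrite ltr_pdivlMr // => hh; have := hd (c * h); rewrite normrM mulrC hh => /(_ isT).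
rewrite -mulrDr; have -> : e / `|c| * (`|h| * `|c|) = e * `|h|.
  by field; exact: lt0r_neq0.
by have -> : h * (c * df (c * t)) = c * h * df (c * t) by ring.
Qed.

(* one-sided derivatives with a common limit *)
Lemma is_derive_glue f df :
  (forall s, s != 0 -> is_derive s (1 : R) f (df s)) ->
  (forall e : R, 0 < e -> exists2 d : R, 0 < d & forall s, `|s| < d -> `|f s - f 0| <= e) ->
  (forall e : R, 0 < e -> exists2 d : R, 0 < d & forall s, `|s| < d -> `|df s - df 0| <= e) ->
  is_derive 0 (1 : R) f (df 0).
Proof.
move=> fd fc dfc; have fcont : continuous f.
  move=> s; have [->|s0] := eqVneq s 0; last exact: derive_cont (fd s s0).
  apply/cvgrPdist_le => e e0; have [d d0 hd] := fc e e0.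
  apply/nbhs_ballP; exists d => //= t; rewrite /ball /= sub0r normrN distrC; exact: hd.
have fc' a b : {within `[a, b], continuous f} by apply: continuous_subspaceT => t; exact: fcont.
apply: is_derive_eps => e e0; have [d d0 hd] := dfc e e0; exists d => // h hhd.
rewrite add0r; have [->|h0] := eqVneq h 0; first by rewrite subrr mul0r subr0 normr0 mulr0.
suff [c ch fh] : exists2 c, `|c| <= `|h| & f h - f 0 = df c * h.
  rewrite fh (mulrC h) -mulrBl normrM; apply: ler_wpM2r => //; apply: hd.
  exact: le_lt_trans ch hhd.
have [h1|h1] : 0 < h \/ h < 0 by case: (ltgtP h 0) h0 => //; [right|left].
  have [t|c] := @MVT _ f df 0 h h1 _ (fc' 0 h).
    by rewrite in_itv /= => /andP[t0 _]; apply: fd; rewrite gt_eqF.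
  rewrite in_itv /= => /andP[c0 ch]; rewrite subr0 => e1; exists c => //.
  by rewrite !gtr0_norm // ltW.
have [t|c] := @MVT _ f df h 0 h1 _ (fc' h 0).
  by rewrite in_itv /= => /andP[_ t0]; apply: fd; rewrite lt_eqF.
rewrite in_itv /= => /andP[hc c0] e1; exists c; first by rewrite !ltr0_norm // lerN2 ltW.
by rewrite -opprB e1 sub0r mulrN opprK.
Qed.

Definition pos (s : R) : R := (s + `|s|) / 2.

Lemma pos_ge0 s : 0 <= pos s.
Proof. by rewrite /pos; have := ler_norm (- s); rewrite normrN; lra. Qed.

Lemma pos_id s : 0 <= s -> pos s = s.
Proof. by move=> s0; rewrite /pos ger0_norm //; lra. Qed.

Lemma pos_eq0 s : s <= 0 -> pos s = 0.
Proof. by move=> s0; rewrite /pos ler0_norm // subrr mul0r. Qed.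

Lemma pos_ge s : s <= pos s.
Proof. by rewrite /pos; have := ler_norm s; lra. Qed.

Lemma is_derive_pos_sq s : is_derive s (1 : R) (fun s => pos s ^+ 2) (2 * pos s).
Proof.
apply: is_derive_eps => e e0; exists e => // h he.
have := pos_ge0 s; have := pos_ge0 (s + h).
have nh := normr_ge0 h.
have H : `|pos (s + h) ^+ 2 - pos s ^+ 2 - h * (2 * pos s)| <= `|h| ^+ 2.
  have [s0|s0] := leP 0 s; have [sh|sh] := leP 0 (s + h).
  - rewrite !pos_id //; have -> : (s + h) ^+ 2 - s ^+ 2 - h * (2 * s) = h ^+ 2 by ring.
    by rewrite normrX.
  - rewrite (pos_id s0) (pos_eq0 (ltW sh)) expr0n /= sub0r real_normK ?num_real // ler_norml; apply/andP; split; nra.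
  - rewrite (pos_id sh) (pos_eq0 (ltW s0)) expr0n /= mulr0 mulr0 !subr0 real_normK ?num_real // ler_norml; apply/andP; split; nra.
  - by rewrite (pos_eq0 (ltW sh)) (pos_eq0 (ltW s0)) expr0n /= !mulr0 !subr0 normr0 sqr_ge0.
by move=> _ _; apply: le_trans H _; rewrite expr2; apply: ler_wpM2r => //; exact: ltW.
Qed.

Lemma expR_le_mono (f df : R -> R) (C : R) :
  (forall t, is_derive t (1 : R) f (df t)) -> (forall t, df t <= C * f t) ->
  forall s t, s <= t -> f t <= f s * expR (C * (t - s)).
Proof.
move=> fd h s t st.
pose F u := - (f u * expR (- C * u)).
have Fd u : is_derive u (1 : R) F ((C * f u - df u) * expR (- C * u)).
  have fu := fd u.
  have eu : is_derive u (1 : R) (fun u => expR (- C * u)) (- C * expR (- C * u)).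
    apply: (@is_derive_scale expR expR) => v; exact: is_derive_expR.
  apply: is_derive_eq; rewrite /GRing.scale /=; ring.
have : F s <= F t by apply: (derive_ge0_mono Fd) => // u; rewrite mulr_ge0 ?expR_ge0 // subr_ge0.
rewrite /F lerN2.
rewrite !mulNr !expRN; have et := expR_gt0 (C * t); rewrite ler_pdivrMr // => /le_trans; apply.
by rewrite mulrBr expRD expRN -mulrA [(expR _)^-1 * _]mulrC.
Qed.

(** Applied to [f ^+ 2], which is differentiable and obeys a linear inequality; the case [t < s]
    follows by reversing time. *)
Lemma gronwall f df (C : R) : (forall t, is_derive t (1 : R) f (df t)) ->
  (forall t, `|df t| <= C * `|f t|) ->
  forall s t, `|f t| <= `|f s| * expR (C * `|t - s|).
Proof.
move=> fd h s t.
have sqd u : is_derive u (1 : R) (fun u => f u ^+ 2) (2 * f u * df u).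
  by apply: (is_derive_conv (der_mul (fd u) (fd u))) => [v|]; ring.
have bnd u : `|2 * f u * df u| <= 2 * C * f u ^+ 2.
  rewrite !normrM [`|2|]ger0_norm // -(real_normK (num_real (f u))).
  have := h u; have := normr_ge0 (f u); have := normr_ge0 (df u); nra.
suff H : f t ^+ 2 <= (`|f s| * expR (C * `|t - s|)) ^+ 2.
  rewrite -(ler_sqr (x := `|f t|)) ?nnegrE ?mulr_ge0 ?expR_ge0 // real_normK ?num_real //.
have -> : (`|f s| * expR (C * `|t - s|)) ^+ 2 = f s ^+ 2 * expR (2 * C * `|t - s|).
  by rewrite exprMn real_normK ?num_real // [expR (C * _) ^+ 2]expr2 -expRD; congr (_ * expR _); ring.
have [st|ts] := leP s t.
  rewrite ger0_norm ?subr_ge0 //; apply: (expR_le_mono sqd) => // u.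
  by apply: le_trans (ler_norm _) (bnd u).
rewrite ltr0_norm ?subr_lt0 // opprB.
have sqd' u : is_derive u (1 : R) (fun u => f (- 1 * u) ^+ 2) (- 1 * (2 * f (- 1 * u) * df (- 1 * u))).
  by apply: (@is_derive_scale (fun u => f u ^+ 2)).
have := @expR_le_mono _ _ (2 * C) sqd' _ (- s) (- t) _.
have -> : -1 * - t = t by ring.
have -> : -1 * - s = s by ring.
have -> : - t - - s = s - t by ring.
apply; last by rewrite lerN2 ltW.
move=> u; rewrite mulN1r; set v := -1 * u; apply: le_trans (ler_norm _) _; rewrite normrN; exact: bnd.
Qed.

Lemma gronwall0 f df (C s : R) : (forall t, is_derive t (1 : R) f (df t)) ->
  (forall t, `|df t| <= C * `|f t|) -> f s = 0 -> forall t, f t = 0.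
Proof.
move=> fd h fs t; have := gronwall fd h s t; rewrite fs normr0 mul0r => h1.
by apply/eqP; rewrite -normr_eq0; apply/eqP/le_anti; rewrite h1 normr_ge0.
Qed.

(** The square of the positive part of [f] is differentiable, vanishes at 0 and obeys a linear
    differential inequality. *)
Lemma comparison0 f df (C : R) : (forall t, is_derive t (1 : R) f (df t)) ->
  (forall t, df t <= C * `|f t|) -> f 0 <= 0 -> forall t, 0 <= t -> f t <= 0.
Proof.
move=> fd h f0 t t0.
have pd u : is_derive u (1 : R) (fun u => pos (f u) ^+ 2) (2 * pos (f u) * df u).
  have fu := fd u; have pu := is_derive_pos_sq (f u).
  exact: (der_comp (g := fun s => pos s ^+ 2)).
have bnd u : 2 * pos (f u) * df u <= 2 * C * pos (f u) ^+ 2.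
  have [fu|fu] := leP (f u) 0; first by rewrite pos_eq0 // expr0n /= !(mulr0, mul0r).
  have := h u; rewrite pos_id ?(ltW fu) // gtr0_norm //; nra.
have := expR_le_mono pd bnd t0; rewrite (pos_eq0 f0) expr0n /= mul0r => h1.
have : pos (f t) ^+ 2 = 0 by apply/le_anti; rewrite h1 sqr_ge0.
move/eqP; rewrite sqrf_eq0 => /eqP e; rewrite -e; exact: pos_ge.
Qed.

Lemma ivt f (a b v : R) : continuous f -> f a <= v -> v <= f b -> exists c, f c = v.
Proof.
move=> fc av vb; have fc' x y : {within `[x, y], continuous f} by exact: continuous_subspaceT.
have [ab|/ltW ba] := leP a b.
  have [|c _ e] := @IVT _ f a b v ab (fc' a b); last by exists c.
  by rewrite ge_min av le_max vb orbT.
have [|c _ e] := @IVT _ f b a v ba (fc' b a); last by exists c.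
by rewrite ge_min av orbT le_max vb.
Qed.

(** A zero of [f] would force [f] to vanish identically. *)
Lemma gronwall_sign f df (C : R) : (forall t, is_derive t (1 : R) f (df t)) ->
  (forall t, `|df t| <= C * `|f t|) -> (forall t, 0 < f t) \/ (forall t, f t <= 0).
Proof.
move=> fd h; have [|no] := pselect (forall t, f t <= 0); [by right|left=> t].
have [s fs] : exists s, 0 < f s.
  by apply: contrapT => nos; apply: no => s; rewrite leNgt; apply/negP => fs; apply: nos; exists s.
rewrite ltNge; apply/negP => ft.
have fc : continuous f by move=> x; exact: derive_cont (fd x).
have [c fc0] := ivt fc ft (ltW fs).
by have := gronwall0 fd h fc0 s; move: fs; rewrite lt_neqAle eq_sym => /andP[/eqP].
Qed.

Lemma ultra_cvg_eq (u v : nat -> R) (l : R) : ultra [set n | u n = v n] -> v @ ultra --> l -> u @ ultra --> l.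
Proof.
by move=> uv vl; apply: cvg_trans vl; apply: near_eq_cvg; apply: filterS uv => n /= ->.
Qed.

Lemma ultra_cvg_lt (u : nat -> R) (l a : R) : u @ ultra --> l -> l < a -> ultra [set n | u n < a].
Proof. by move=> ul la; apply: (cvgr_lt l). Qed.

Lemma ultra_cvg_gt (u : nat -> R) (l a : R) : u @ ultra --> l -> a < l -> ultra [set n | a < u n].
Proof. by move=> ul la; apply: (cvgr_gt l). Qed.

Lemma ultra_cvg_le (u : nat -> R) (l a : R) : u @ ultra --> l -> ultra [set n | u n <= a] -> l <= a.
Proof. by move=> ul ua; exact: (@cvgr_to_le _ ultra _ R u). Qed.

Lemma ultra_cvg_ge (u : nat -> R) (l a : R) : u @ ultra --> l -> ultra [set n | a <= u n] -> a <= l.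
Proof. by move=> ul ua; exact: (@cvgr_to_ge _ ultra _ R u). Qed.

Lemma ultra_cvg_comp f (u : nat -> R) (l : R) : {for l, continuous f} -> u @ ultra --> l -> (f \o u) @ ultra --> f l.
Proof. by move=> fc ul; exact: cvg_comp ul fc. Qed.

(* The sequential form of continuity suffices for the epsilon form. *)
Lemma ultra_cont_eps f (s : R) :
  (forall u : nat -> R, u @ ultra --> s -> (f \o u) @ ultra --> f s) ->
  forall e : R, 0 < e -> exists2 d : R, 0 < d & forall t, `|t - s| < d -> `|f t - f s| <= e.
Proof.
move=> fc e e0; apply: contrapT => no.
have /choice[u uP] : forall n : nat, exists t : R, `|t - s| <= n.+1%:R^-1 /\ e < `|f t - f s|.
  move=> n; apply: contrapT => non; apply: no; exists n.+1%:R^-1; first by rewrite invr_gt0.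
  by move=> t /ltW ts; rewrite leNgt; apply/negP => h; apply: non; exists t.
have us : u @ ultra --> s.
  apply: (@ultra_cvg_near _ (fun=> s) _ _ 1); first exact: cvg_cst.
  by move=> n; rewrite div1r; have [] := uP n.
move/cvgrPdist_le : (fc u us) => /(_ e e0) /filter_ex[n /=]; rewrite distrC leNgt.
by have [_ ->] := uP n.
Qed.

Lemma is_derive_glue_ultra f df :
  (forall s, s != 0 -> is_derive s (1 : R) f (df s)) ->
  (forall u : nat -> R, u @ ultra --> (0 : R) -> (f \o u) @ ultra --> f 0) ->
  (forall u : nat -> R, u @ ultra --> (0 : R) -> (df \o u) @ ultra --> df 0) ->
  forall s, is_derive s (1 : R) f (df s).
Proof.
move=> fd fc dfc s; have [->|] := eqVneq s 0; last exact: fd.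
apply: is_derive_glue => // e e0.
  by have [d d0 hd] := ultra_cont_eps fc e0; exists d => // t ht; apply: hd; rewrite subr0.
by have [d d0 hd] := ultra_cont_eps dfc e0; exists d => // t ht; apply: hd; rewrite subr0.
Qed.

Definition unif4 (F : R -> R -> R -> R -> R) := forall e : R, 0 < e -> exists2 d : R, 0 < d &
  forall a b p r a' b' p' r', `|a' - a| <= d -> `|b' - b| <= d -> `|p' - p| <= d -> `|r' - r| <= d ->
    `|F a' b' p' r' - F a b p r| <= e.

(** The variables are changed one at a time, each with the mean value theorem; uniform continuity of
    the partial derivatives makes the error uniform in the base point. *)
Lemma first_order4 (F Fa Fb Fp Fr : R -> R -> R -> R -> R) :
  (forall a b p r, is_derive a (1 : R) (fun a => F a b p r) (Fa a b p r)) ->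
  (forall a b p r, is_derive b (1 : R) (fun b => F a b p r) (Fb a b p r)) ->
  (forall a b p r, is_derive p (1 : R) (fun p => F a b p r) (Fp a b p r)) ->
  (forall a b p r, is_derive r (1 : R) (fun r => F a b p r) (Fr a b p r)) ->
  unif4 Fa -> unif4 Fb -> unif4 Fp -> unif4 Fr ->
  forall eta : R, 0 < eta -> exists2 h0 : R, 0 < h0 & forall h a b p r da db dp dr : R,
    h <= h0 -> `|da| <= h -> `|db| <= h -> `|dp| <= h -> `|dr| <= h ->
    `|F (a + da) (b + db) (p + dp) (r + dr) - F a b p r -
      (Fa a b p r * da + Fb a b p r * db + Fp a b p r * dp + Fr a b p r * dr)| <= eta * h.
Proof.
move=> Da Db Dp Dr Ua Ub Up Ur eta eta0.
have eta4 : 0 < eta / 4 by lra.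
have [d1 d10 H1] := Ua _ eta4; have [d2 d20 H2] := Ub _ eta4.
have [d3 d30 H3] := Up _ eta4; have [d4 d40 H4] := Ur _ eta4.
exists (Num.min (Num.min d1 d2) (Num.min d3 d4)); first by rewrite !lt_min d10 d20 d30 d40.
move=> h a b p r da db dp dr; rewrite !le_min => /andP[/andP[hd1 hd2] /andP[hd3 hd4]] ha hb hp hr.
have h0 : 0 <= h by apply: le_trans ha.
have z0 (x : R) : `|x - x| <= h by rewrite subrr normr0.
have sub (x y : R) : x + y - x = y by ring.
have [c1 c1h e1] := mean_value a (a + da) (fun a => Da a (b + db) (p + dp) (r + dr)).
have [c2 c2h e2] := mean_value b (b + db) (fun b => Db a b (p + dp) (r + dr)).
have [c3 c3h e3] := mean_value p (p + dp) (fun p => Dp a b p (r + dr)).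
have [c4 c4h e4] := mean_value r (r + dr) (fun r => Dr a b p r).
rewrite !sub in c1h c2h c3h c4h e1 e2 e3 e4.
have -> : F (a + da) (b + db) (p + dp) (r + dr) - F a b p r -
      (Fa a b p r * da + Fb a b p r * db + Fp a b p r * dp + Fr a b p r * dr) =
   ((Fa c1 (b + db) (p + dp) (r + dr) - Fa a b p r) * da + (Fb a c2 (p + dp) (r + dr) - Fb a b p r) * db)
   + ((Fp a b c3 (r + dr) - Fp a b p r) * dp + (Fr a b p c4 - Fr a b p r) * dr).
  by move: e1 e2 e3 e4; lra.
have bnd (x y : R) : `|x| <= eta / 4 -> `|y| <= h -> `|x * y| <= eta / 4 * h.
  by move=> hx hy; rewrite normrM; apply: ler_pM.
have g1 : `|(Fa c1 (b + db) (p + dp) (r + dr) - Fa a b p r) * da| <= eta / 4 * h.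
  apply: bnd => //; apply: H1; rewrite ?sub; [exact: le_trans c1h (le_trans ha hd1)|exact: le_trans hb hd1|exact: le_trans hp hd1|exact: le_trans hr hd1].
have g2 : `|(Fb a c2 (p + dp) (r + dr) - Fb a b p r) * db| <= eta / 4 * h.
  apply: bnd => //; apply: H2; rewrite ?sub; [exact: le_trans (z0 a) hd2|exact: le_trans c2h (le_trans hb hd2)|exact: le_trans hp hd2|exact: le_trans hr hd2].
have g3 : `|(Fp a b c3 (r + dr) - Fp a b p r) * dp| <= eta / 4 * h.
  apply: bnd => //; apply: H3; rewrite ?sub; [exact: le_trans (z0 a) hd3|exact: le_trans (z0 b) hd3|exact: le_trans c3h (le_trans hp hd3)|exact: le_trans hr hd3].
have g4 : `|(Fr a b p c4 - Fr a b p r) * dr| <= eta / 4 * h.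
  apply: bnd => //; apply: H4; [exact: le_trans (z0 a) hd4|exact: le_trans (z0 b) hd4|exact: le_trans (z0 p) hd4|exact: le_trans c4h (le_trans hr hd4)].
apply: le_trans (ler_normD _ _) _; apply: le_trans (lerD (ler_normD _ _) (ler_normD _ _)) _.
lra.
Qed.

Lemma der_comp4 (F Fa Fb Fp Fr : R -> R -> R -> R -> R) :
  (forall a b p r, is_derive a (1 : R) (fun a => F a b p r) (Fa a b p r)) ->
  (forall a b p r, is_derive b (1 : R) (fun b => F a b p r) (Fb a b p r)) ->
  (forall a b p r, is_derive p (1 : R) (fun p => F a b p r) (Fp a b p r)) ->
  (forall a b p r, is_derive r (1 : R) (fun r => F a b p r) (Fr a b p r)) ->
  unif4 Fa -> unif4 Fb -> unif4 Fp -> unif4 Fr ->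
  forall (a b p r : R -> R) (t a' b' p' r' : R),
  is_derive t (1 : R) a a' -> is_derive t (1 : R) b b' -> is_derive t (1 : R) p p' -> is_derive t (1 : R) r r' ->
  is_derive t (1 : R) (fun t => F (a t) (b t) (p t) (r t))
    (Fa (a t) (b t) (p t) (r t) * a' + Fb (a t) (b t) (p t) (r t) * b' +
     Fp (a t) (b t) (p t) (r t) * p' + Fr (a t) (b t) (p t) (r t) * r').
Proof.
move=> Da Db Dp Dr Ua Ub Up Ur a b p r t a' b' p' r' ad bd pd rd.
set A := Fa _ _ _ _; set B := Fb _ _ _ _; set C := Fp _ _ _ _; set D := Fr _ _ _ _.
apply: is_derive_eps => e e0.
pose L := 1 + `|a'| + `|b'| + `|p'| + `|r'|.
have L1 : 1 <= L by rewrite /L; have := normr_ge0 a'; have := normr_ge0 b'; have := normr_ge0 p'; have := normr_ge0 r'; lra.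
have [La Lb Lp Lr] : [/\ `|a'| <= L - 1, `|b'| <= L - 1, `|p'| <= L - 1 & `|r'| <= L - 1].
  by clear; rewrite /L; have := normr_ge0 a'; have := normr_ge0 b'; have := normr_ge0 p'; have := normr_ge0 r'; split; lra.
pose Q := 1 + `|A| + `|B| + `|C| + `|D|.
have Q1 : 1 <= Q by rewrite /Q; have := normr_ge0 A; have := normr_ge0 B; have := normr_ge0 C; have := normr_ge0 D; lra.
have e2 : 0 < e / 2 / L by rewrite !divr_gt0 //; lra.
have [h0 h00 H] := first_order4 Da Db Dp Dr Ua Ub Up Ur e2.
pose k := Num.min 1 (e / 2 / Q).
have k0 : 0 < k by rewrite lt_min ltr01 !divr_gt0 //; lra.
have k1 : k <= 1 by rewrite ge_min lexx.
have kQ : k * Q <= e / 2 by rewrite -ler_pdivlMr ?ge_min ?lexx ?orbT //; lra.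
have [d1 d10 Ha] := is_derive_epsP ad k0; have [d2 d20 Hb] := is_derive_epsP bd k0.
have [d3 d30 Hp] := is_derive_epsP pd k0; have [d4 d40 Hr] := is_derive_epsP rd k0.
exists (Num.min (h0 / L) (Num.min (Num.min d1 d2) (Num.min d3 d4))).
  by rewrite !lt_min d10 d20 d30 d40 divr_gt0 //; lra.
move=> h; rewrite !lt_min => /andP[hL /andP[/andP[hd1 hd2] /andP[hd3 hd4]]].
have {}Ha := Ha h hd1; have {}Hb := Hb h hd2; have {}Hp := Hp h hd3; have {}Hr := Hr h hd4.
rewrite ltr_pdivlMr in hL; last lra.
have nh := normr_ge0 h.
set da := a (t + h) - a t in Ha; set db := b (t + h) - b t in Hb.
set dp := p (t + h) - p t in Hp; set dr := r (t + h) - r t in Hr.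
have sp (x x' : R) : `|x - h * x'| <= k * `|h| -> `|x'| <= L - 1 -> `|x| <= `|h| * L.
  clear -nh k1 => hx hx'; have -> : x = (x - h * x') + h * x' by ring.
  apply: le_trans (ler_normD _ _) _; rewrite normrM; nra.
have := H (`|h| * L) (a t) (b t) (p t) (r t) da db dp dr (ltW hL) (sp _ _ Ha La) (sp _ _ Hb Lb) (sp _ _ Hp Lp) (sp _ _ Hr Lr).
have -> : a t + da = a (t + h) by rewrite /da; ring.
have -> : b t + db = b (t + h) by rewrite /db; ring.
have -> : p t + dp = p (t + h) by rewrite /dp; ring.
have -> : r t + dr = r (t + h) by rewrite /dr; ring.
rewrite -/A -/B -/C -/D.
have -> : e / 2 / L * (`|h| * L) = e / 2 * `|h| by field; exact: lt0r_neq0 (lt_le_trans ltr01 L1).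
set X := F _ _ _ _; set Y := F _ _ _ _ => h1.
have -> : X - Y - h * (A * a' + B * b' + C * p' + D * r') =
   (X - Y - (A * da + B * db + C * dp + D * dr)) +
   (A * (da - h * a') + B * (db - h * b') + (C * (dp - h * p') + D * (dr - h * r'))) by ring.
apply: le_trans (ler_normD _ _) _.
have m1 (x y : R) : `|y| <= k * `|h| -> `|x * y| <= `|x| * (k * `|h|) by move=> hy; rewrite normrM; apply: ler_wpM2l.
have h2 : `|A * (da - h * a') + B * (db - h * b') + (C * (dp - h * p') + D * (dr - h * r'))| <= k * Q * `|h|.
  apply: le_trans (ler_normD _ _) _; apply: le_trans (lerD (ler_normD _ _) (ler_normD _ _)) _.
  have := m1 A _ Ha; have := m1 B _ Hb; have := m1 C _ Hp; have := m1 D _ Hr.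
  have kh : 0 <= k * `|h| by apply: mulr_ge0 => //; exact: ltW.
  have -> : k * Q * `|h| = Q * (k * `|h|) by ring.
  clear -kh; rewrite /Q; move: (k * `|h|) kh => K K0; nra.
by apply: le_trans (lerD h1 (le_trans h2 (ler_wpM2r nh kQ))) _; rewrite -mulrDl -splitr.
Qed.
End Calculus1.

(** * The latitude as a function of the two actions *)

Section Chi.
Variable R : realType.
Implicit Types p r : R.

(** The angle in [[0, pi / 2]] with [sin x ^+ 2 = p / (p + r)]. At [p = r = 0] the division by 0
    makes it [pi / 2]. *)
Definition chi p r : R := acos (Num.sqrt (r / (p + r))).

Lemma chi_arg p r : 0 <= p -> 0 <= r -> 0 < p + r -> 0 <= Num.sqrt (r / (p + r)) <= 1.
Proof.
move=> p0 r0 S0; rewrite sqrtr_ge0 /= -[leRHS]sqrtr1 ler_sqrt //.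
by rewrite ler_pdivrMr // mul1r lerDr.
Qed.

Lemma cos_chi p r : 0 <= p -> 0 <= r -> 0 < p + r -> cos (chi p r) = Num.sqrt (r / (p + r)).
Proof.
move=> p0 r0 S0; rewrite /chi acosK // in_itv /=.
by have /andP[h1 h2] := chi_arg p0 r0 S0; rewrite h2 andbT; apply: le_trans h1; lra.
Qed.

Lemma chi_itv p r : 0 <= p -> 0 <= r -> 0 < p + r -> 0 <= chi p r <= pi / 2.
Proof.
move=> p0 r0 S0; have /andP[h1 h2] := chi_arg p0 r0 S0.
have hb : -1 <= Num.sqrt (r / (p + r)) <= 1 by rewrite h2 andbT; apply: le_trans h1; lra.
have a0 := acos_ge0 hb; have api := acos_lepi hb.
rewrite /chi a0 /= leNgt; apply/negP => h.
have e := cos_chi p0 r0 S0; have pp := pi_gt0 R.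
have : 0 < sin (chi p r - pi / 2) by apply: sin_gt0_pi; rewrite /chi; apply/andP; split; lra.
have : cos (chi p r) = - sin (chi p r - pi / 2) by rewrite -cosDpihalf subrK.
rewrite e => e2 s0; lra.
Qed.

Lemma cos2_chi p r : 0 <= p -> 0 <= r -> 0 < p + r -> (p + r) * cos (chi p r) ^+ 2 = r.
Proof.
move=> p0 r0 S0; rewrite cos_chi // sqr_sqrtr; first by rewrite mulrC divfK // lt0r_neq0.
by rewrite divr_ge0 // ltW.
Qed.

Lemma sin2_chi p r : 0 <= p -> 0 <= r -> 0 < p + r -> (p + r) * sin (chi p r) ^+ 2 = p.
Proof. by move=> p0 r0 S0; rewrite sin2cos2 mulrBr mulr1 cos2_chi // addrK. Qed.

Lemma sin_chi_ge0 p r : 0 <= p -> 0 <= r -> 0 < p + r -> 0 <= sin (chi p r).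
Proof.
move=> p0 r0 S0; have /andP[h1 h2] := chi_itv p0 r0 S0; have pp := pi_gt0 R.
by apply: sin_ge0_pi; apply/andP; split; lra.
Qed.

Lemma cos_chi_ge0 p r : 0 <= p -> 0 <= r -> 0 < p + r -> 0 <= cos (chi p r).
Proof. by move=> p0 r0 S0; rewrite cos_chi // sqrtr_ge0. Qed.

Lemma sin_chi_gt0 p r : 0 < p -> 0 <= r -> 0 < sin (chi p r).
Proof.
move=> p0 r0; have S0 : 0 < p + r by lra.
rewrite lt_neqAle sin_chi_ge0 ?(ltW p0) // andbT; apply/eqP => e.
by have := sin2_chi (ltW p0) r0 S0; rewrite -e expr0n mulr0 => e0; move: p0; rewrite -e0 ltxx.
Qed.

Lemma cos_chi_gt0 p r : 0 <= p -> 0 < r -> 0 < cos (chi p r).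
Proof.
move=> p0 r0; have S0 : 0 < p + r by lra.
rewrite lt_neqAle cos_chi_ge0 ?(ltW r0) // andbT; apply/eqP => e.
by have := cos2_chi p0 (ltW r0) S0; rewrite -e expr0n mulr0 => e0; move: r0; rewrite -e0 ltxx.
Qed.

Lemma chi_p0 p : 0 < p -> chi p 0 = pi / 2.
Proof. by move=> p0; rewrite /chi mul0r sqrtr0 acos0. Qed.

Lemma chi_0r r : 0 < r -> chi 0 r = 0.
Proof. by move=> r0; rewrite /chi add0r divff ?lt0r_neq0 // sqrtr1 acos1. Qed.

Lemma cos_pihalfB (x : R) : cos (pi / 2 - x) = sin x.
Proof. by rewrite -cosN opprB cosBpihalf. Qed.

Lemma sin_pihalfB (x : R) : sin (pi / 2 - x) = cos x.
Proof. by rewrite -[in LHS]opprB sinN sinBpihalf opprK. Qed.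

Lemma chi_uniq p r x : 0 <= p -> 0 <= r -> 0 < p + r -> 0 <= x <= pi / 2 ->
  cos x = cos (chi p r) -> x = chi p r.
Proof.
move=> p0 r0 S0 /andP[x0 x1] e; have /andP[h1 h2] := chi_itv p0 r0 S0; have pp := pi_gt0 R.
by apply: cos_inj => //; rewrite in_itv /=; apply/andP; split; lra.
Qed.

Lemma chi_swap p r : 0 <= p -> 0 <= r -> 0 < p + r -> chi r p = pi / 2 - chi p r.
Proof.
move=> p0 r0 S0; have S0' : 0 < r + p by rewrite addrC.
have /andP[h1 h2] := chi_itv p0 r0 S0.
apply/esym/chi_uniq => //; first by apply/andP; split; lra.
rewrite cos_pihalfB; apply/eqP; rewrite -(eqrXn2 (n := 2)) ?sin_chi_ge0 ?cos_chi_ge0 //.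
have e1 := sin2_chi p0 r0 S0; have e2 := cos2_chi r0 p0 S0'; rewrite (addrC r) in e2.
by apply/eqP; apply: (mulfI (lt0r_neq0 S0)); rewrite e1 e2.
Qed.

(** The angles stay in the compact quadrant; their limit has the cosine of [chi p0 r0], and the
    cosine is injective there. *)
Lemma chi_ucont (p r : nat -> R) p0 r0 : (forall n, 0 <= p n) -> (forall n, 0 <= r n) -> 0 < p0 + r0 ->
  p @ ultra --> p0 -> r @ ultra --> r0 -> (fun n => chi (p n) (r n)) @ ultra --> chi p0 r0.
Proof.
move=> pn rn S0 pc rc.
have pp := pi_gt0 R.
have p00 : 0 <= p0 by apply: ultra_cvg_ge pc _; exact: filterE.
have r00 : 0 <= r0 by apply: ultra_cvg_ge rc _; exact: filterE.
have Sc : (fun n => p n + r n) @ ultra --> p0 + r0 by exact: cvgD.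
have S_near := ultra_cvg_gt Sc S0.
pose x n := if 0 < p n + r n then chi (p n) (r n) else 0.
have xE : ultra [set n | chi (p n) (r n) = x n] by apply: filterS S_near => n /= h; rewrite /x h.
have [n|l l01 xl] := @ultra_bounded_cvg _ x 0 (pi / 2).
  by rewrite /x; case: ifP => h; [exact: chi_itv|rewrite lexx /=; lra].
suff -> : chi p0 r0 = l by exact: ultra_cvg_eq xE xl.
apply/esym/chi_uniq => //; rewrite cos_chi //.
have c1 := ultra_cvg_comp (@continuous_cos R l) xl.
have c2 : (fun n => Num.sqrt (r n / (p n + r n))) @ ultra --> Num.sqrt (r0 / (p0 + r0)).
  apply: (ultra_cvg_comp (f := Num.sqrt) (u := fun n => r n / (p n + r n))); first exact: sqrt_continuous.
  by apply: cvgM => //; apply: cvgV => //; exact: lt0r_neq0.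
apply: ultra_cvg_unique c1 _; apply: ultra_cvg_eq c2; apply: filterS S_near => n /= h.
by rewrite /x h cos_chi.
Qed.

Lemma chi_derive p r : 0 < p -> 0 < r ->
  is_derive p (1 : R) (fun p => chi p r) (cos (chi p r) / (2 * sin (chi p r) * (p + r))).
Proof.
move=> p0 r0; have S0 : 0 < p + r by lra.
have s0 := sin_chi_gt0 p0 (ltW r0); have c0 := cos_chi_gt0 (ltW p0) r0.
have cE := cos_chi (ltW p0) (ltW r0) S0.
pose y : R := Num.sqrt (r / (p + r)).
have y0 : 0 < y by rewrite /y -cE.
have q0 : 0 < r / (p + r) by rewrite divr_gt0.
have y1 : -1 < y < 1.
  apply/andP; split; first lra.
  rewrite /y -[ltRHS]sqrtr1 ltr_sqrt // ltr_pdivrMr // mul1r; lra.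
have d1 : is_derive p (1 : R) (fun p => p + r) 1.
  by apply: (is_derive_conv (der_add (der_id p) (der_cst r p))) => //; rewrite addr0.
have d2 : is_derive p (1 : R) (fun p => r / (p + r)) (- r / (p + r) ^+ 2).
  have dv : is_derive p (1 : R) (fun p => (p + r)^-1) (- (p + r) ^- 2 *: 1).
    by apply: is_deriveV; exact: lt0r_neq0.
  by apply: (is_derive_conv (der_cmul r dv)) => //; rewrite /GRing.scale /= mulr1 mulrN mulNr.
have d3 := der_comp d2 (is_derive1_sqrt q0).
have d4 := der_comp d3 (is_derive1_acos y1).
apply: (is_derive_conv d4) => //.
have -> : Num.sqrt (1 - y ^+ 2) = sin (chi p r) by rewrite -sin_acos //; apply/andP; split; lra.
rewrite -cE.
have e : r = (p + r) * cos (chi p r) ^+ 2 by rewrite cos2_chi // ltW.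
have -> : - r / (p + r) ^+ 2 = - cos (chi p r) ^+ 2 / (p + r).
  rewrite {1}e; field; exact: lt0r_neq0.
field; rewrite !lt0r_neq0 //.
Qed.
End Chi.

(** * Truncation functions *)

Section Step.
Variable R : realType.

Lemma pos_ucont (u : nat -> R) l : u @ ultra --> l -> (fun n => pos (u n)) @ ultra --> pos l.
Proof. by move=> ul; apply: cvgM; [apply: cvgD => //; exact: cvg_norm|exact: cvg_cst]. Qed.

(** A quadratic spline of class [C^1] rising from 0 at [h = 1 / 2] to [M] at [h = 1], with knots
    [1 / 2], [3 / 4] and [1]; its derivative is a tent of height [4 * M]. *)
Definition step (M h : R) : R :=
  M * (2 * pos (2 * h - 1) ^+ 2 - 4 * pos (2 * h - 3 / 2) ^+ 2 + 2 * pos (2 * h - 2) ^+ 2).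

Definition dstep (M h : R) : R :=
  M * (8 * pos (2 * h - 1) - 16 * pos (2 * h - 3 / 2) + 8 * pos (2 * h - 2)).

Lemma step_derive M h : is_derive h (1 : R) (step M) (dstep M h).
Proof.
have D (c : R) : is_derive h (1 : R) (fun h => pos (2 * h - c) ^+ 2) (2 * pos (2 * h - c) * 2).
  apply: (der_comp (g := fun s => pos s ^+ 2) _ (is_derive_pos_sq _)).
  apply: (is_derive_conv (der_sub (der_cmul 2 (der_id h)) (der_cst c h))) => //; ring.
apply: (is_derive_conv (der_cmul M (der_add (der_sub (der_cmul 2 (D 1)) (der_cmul 4 (D (3 / 2)))) (der_cmul 2 (D 2))))) => //.
by rewrite /dstep; ring.
Qed.

Lemma step_low M h : h <= 1 / 2 -> step M h = 0 /\ dstep M h = 0.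
Proof.
by move=> hh; rewrite /step /dstep !pos_eq0 ?expr0n /= ?(mulr0, subr0, addr0) //; lra.
Qed.

Lemma step_high M h : 1 <= h -> step M h = M /\ dstep M h = 0.
Proof. by move=> hh; rewrite /step /dstep !pos_id; [split; field|lra|lra|lra]. Qed.

Lemma dstep_mid h : 1 / 2 < h -> h < 1 -> 0 < dstep 1 h.
Proof.
move=> h1 h2; rewrite /dstep mul1r (pos_id (s := 2 * h - 1)) ?(pos_eq0 (s := 2 * h - 2)); try lra.
by have [h3|h3] := leP 0 (2 * h - 3 / 2); rewrite ?(pos_id h3) ?(pos_eq0 (ltW h3)); lra.
Qed.

Lemma dstepE M h : dstep M h = M * dstep 1 h.
Proof. by rewrite /dstep mul1r. Qed.

Lemma stepE M h : step M h = M * step 1 h.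
Proof. by rewrite /step mul1r. Qed.

Lemma dstep1_bnd h : 0 <= dstep 1 h <= 4.
Proof.
have [h1|h1] := leP h (1 / 2); first by have [_ ->] := step_low 1 h1; rewrite lexx /=; lra.
have [h2|h2] := leP 1 h; first by have [_ ->] := step_high 1 h2; rewrite lexx /=; lra.
rewrite (ltW (dstep_mid h1 h2)) /= /dstep mul1r (pos_id (s := 2 * h - 1)) ?(pos_eq0 (s := 2 * h - 2)); try lra.
by have [h3|h3] := leP 0 (2 * h - 3 / 2); rewrite ?(pos_id h3) ?(pos_eq0 (ltW h3)); lra.
Qed.

Lemma step1_bnd h : 0 <= step 1 h <= 1.
Proof.
have mono := derive_ge0_mono (step_derive 1) (fun h => proj1 (andP (dstep1_bnd h))).
apply/andP; split.
  have [h1|h1] := leP h (1 / 2); first by have [-> _] := step_low 1 h1.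
  by have [e _] := step_low 1 (lexx (1 / 2)); rewrite -[leLHS]e; apply: mono; exact: ltW.
have [h2|h2] := leP 1 h; first by have [-> _] := step_high 1 h2.
by have [e _] := step_high 1 (lexx 1); rewrite -[leRHS]e; apply: mono; exact: ltW.
Qed.

(** Recovers conservation of the Hamiltonian from conservation of its truncation. *)
Lemma step1_inj h1 h2 : 0 < step 1 h1 < 1 -> step 1 h1 = step 1 h2 -> h1 = h2.
Proof.
move=> h01 e.
have inside h : 0 < step 1 h < 1 -> 1 / 2 < h < 1.
  move=> /andP[g0 g1]; apply/andP; split; rewrite ltNge; apply/negP => hh.
    by move: g0; have [-> _] := step_low 1 hh; rewrite ltxx.
  by move: g1; have [-> _] := step_high 1 hh; rewrite ltxx.
have /andP[a1 a2] := inside _ h01; have /andP[b1 b2] : 1 / 2 < h2 < 1 by apply: inside; rewrite -e.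
have lem x y : 1 / 2 < x -> x < y -> y < 1 -> step 1 x <> step 1 y.
  move=> x0 xy y1 exy.
  have fc : {within `[x, y], continuous (step 1)}.
    by apply: continuous_subspaceT => t; exact: derive_cont (step_derive 1 t).
  have [c] := MVT xy (fun t _ => step_derive 1 t) fc; rewrite in_itv /= => /andP[c1 c2].
  rewrite exy subrr => /esym/eqP; rewrite mulf_eq0 subr_eq0 (gt_eqF xy) orbF => /eqP d0.
  by have := @dstep_mid c; rewrite d0 ltxx => h; apply: notF; apply: h; lra.
by case: (ltgtP h1 h2) => // lt; [case: (lem h1 h2)|case: (lem h2 h1)].
Qed.

Lemma dstep_ucont M (u : nat -> R) l : u @ ultra --> l -> (fun n => dstep M (u n)) @ ultra --> dstep M l.
Proof.
move=> ul; have D (c : R) : (fun n => pos (2 * u n - c)) @ ultra --> pos (2 * l - c).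
  by apply: pos_ucont; apply: cvgB; [apply: cvgM => //|]; exact: cvg_cst.
apply: cvgM; first exact: cvg_cst.
by apply: cvgD; [apply: cvgB|]; (apply: cvgM; [exact: cvg_cst|exact: D]).
Qed.

Lemma step_ucont M (u : nat -> R) l : u @ ultra --> l -> (fun n => step M (u n)) @ ultra --> step M l.
Proof.
by move=> ul; apply: ultra_cvg_comp ul; exact: derive_cont (step_derive M l).
Qed.

(* A C^1 truncation of min(s, 0), up to a kink at 0 absorbed in the gluing of the Hamiltonian. *)
Definition bet (d s : R) : R := pos (d - pos (- s)) ^+ 2 / (2 * d) - d / 2.
(** The derivative of [bet] on the negative side only. For [s >= 0] it equals 1, although [bet] is
    constant there: [HamP] uses it as a factor valid on both sides of 0. *)
Definition dbet (d s : R) : R := pos (d - pos (- s)) / d.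

Variables (d : R) (d0 : 0 < d).

Lemma bet_nneg s : 0 <= s -> bet d s = 0.
Proof.
move=> s0; have d0' := d0; rewrite /bet (pos_eq0 (s := - s)) ?subr0 ?pos_id ?(ltW d0) //; last lra.
by field; exact: lt0r_neq0.
Qed.

Lemma bet_derive (s : R) : s < 0 -> is_derive s (1 : R) (bet d) (dbet d s).
Proof.
move=> s0; have d0' := d0.
have D : is_derive s (1 : R) (fun s => pos (d + s) ^+ 2 / (2 * d) - d / 2) (dbet d s).
  have D1 : is_derive s (1 : R) (fun s => pos (d + s) ^+ 2) (2 * pos (d + s) * 1).
    apply: (der_comp (g := fun s => pos s ^+ 2) _ (is_derive_pos_sq _)).
    by apply: (is_derive_conv (der_add (der_cst d s) (der_id s))) => //; rewrite add0r.
  apply: (is_derive_conv (der_sub (der_mul D1 (der_cst (2 * d)^-1 s)) (der_cst (d / 2) s))) => //.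
  rewrite /dbet (pos_id (s := - s)) ?opprK; [field; exact: lt0r_neq0|lra].
apply: is_derive_eps => e e0; have [r r0 hr] := is_derive_epsP D e0.
exists (Num.min r (- s)); first by rewrite lt_min r0; lra.
move=> h; rewrite lt_min => /andP[h1 h2]; have := hr h h1.
have hn := ler_norm h.
by rewrite /bet !(pos_id (s := - _)) ?opprK //; lra.
Qed.

Lemma bet_bnd s : `|bet d s| <= d / 2 /\ `|bet d s| <= `|s|.
Proof.
have d0' := d0; have [s0|s0] := leP 0 s; first by rewrite bet_nneg // normr0; split => //; lra.
have -> : `|s| = - s by exact: ltr0_norm.
rewrite /bet (pos_id (s := - s)) ?opprK //; last lra.
have [ds|ds] := leP 0 (d + s).
  rewrite pos_id //; have e : (d + s) ^+ 2 / (2 * d) - d / 2 = s * (1 + s / (2 * d)) by field; exact: lt0r_neq0.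
  have h1 : s / (2 * d) <= 0 by rewrite ler_pdivrMr ?mul0r; lra.
  have h2 : - (1 / 2) <= s / (2 * d) by rewrite ler_pdivlMr; lra.
  rewrite e ler0_norm; last by rewrite pmulr_lle0 ?(ltW s0) //; lra.
  split; last by nra.
  rewrite -e opprB lerBlDr lerDl divr_ge0 ?sqr_ge0 //; lra.
by rewrite pos_eq0 ?(ltW ds) // expr0n /= mul0r sub0r normrN gtr0_norm; [split; lra|lra].
Qed.

Lemma dbet_bnd s : 0 <= dbet d s <= 1.
Proof.
have d0' := d0; rewrite /dbet divr_ge0 ?pos_ge0 ?(ltW d0) //= ler_pdivrMr // mul1r.
have h := pos_ge0 (- s); have [ds|ds] := leP 0 (d - pos (- s)); first by rewrite pos_id //; lra.
by rewrite pos_eq0 ?(ltW ds) // ltW.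
Qed.

Lemma dbet_near s : s <= 0 -> 1 - dbet d s <= `|s| / d.
Proof.
move=> s0; have d0' := d0; rewrite /dbet (pos_id (s := - s)) ?opprK ?ler0_norm //; last lra.
have h := pos_ge (d + s); rewrite lerBlDr -mulrDl ler_pdivlMr // mul1r; lra.
Qed.

Lemma bet_ucont (u : nat -> R) l : u @ ultra --> l -> (fun n => bet d (u n)) @ ultra --> bet d l.
Proof.
move=> ul; have h : (fun n => pos (d - pos (- u n))) @ ultra --> pos (d - pos (- l)).
  by apply: pos_ucont; apply: cvgB; [exact: cvg_cst|apply: pos_ucont; exact: cvgN].
by apply: cvgB; [apply: cvgM; [apply: cvgM|]|] => //; exact: cvg_cst.
Qed.

Lemma dbet_ucont (u : nat -> R) l : u @ ultra --> l -> (fun n => dbet d (u n)) @ ultra --> dbet d l.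
Proof.
move=> ul; apply: cvgM; last exact: cvg_cst.
by apply: pos_ucont; apply: cvgB; [exact: cvg_cst|apply: pos_ucont; exact: cvgN].
Qed.

Lemma bet_far s : s <= - d -> bet d s = bet d (- d) /\ dbet d s = 0.
Proof.
move=> sd; have d0' := d0; rewrite /bet /dbet !(pos_id (s := - _)) ?opprK; try lra.
by rewrite !(pos_eq0 (s := d + _)) ?(pos_eq0 (s := d - d)) ?mul0r; try lra.
Qed.
End Step.

(** * Angular profiles of the contact form *)

Section Compactness.
Variable R : realType.
Implicit Types (F : R -> R -> R -> R -> R) (a b p r x : R).

Definition ucont4 F := forall (a b p r : nat -> R) a0 b0 p0 r0,
  a @ ultra --> a0 -> b @ ultra --> b0 -> p @ ultra --> p0 -> r @ ultra --> r0 ->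
  (fun n => F (a n) (b n) (p n) (r n)) @ ultra --> F a0 b0 p0 r0.

Definition per4 F (u v : R) := forall a b p r, F (a + u) (b + v) p r = F a b p r.

Definition clamp (lo hi s : R) := Num.max lo (Num.min hi s).

Lemma clamp_itv lo hi s : lo <= hi -> lo <= clamp lo hi s <= hi.
Proof. by move=> lh; rewrite /clamp le_max lexx /= ge_max lh ge_min lexx. Qed.

Lemma clamp_id lo hi s : lo <= s -> s <= hi -> clamp lo hi s = s.
Proof. by move=> ls sh; rewrite /clamp min_r // max_r. Qed.

Lemma clamp_lip lo hi s t : `|clamp lo hi s - clamp lo hi t| <= `|s - t|.
Proof.
rewrite /clamp /Order.max /Order.min.
have := ler_norm (s - t); have := ler_norm (- (s - t)); rewrite normrN => h1 h2.
by rewrite ler_norml; (repeat case: ifP) => *; apply/andP; split; lra.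
Qed.

Lemma red_angle a : exists k : int, 0 <= a + k%:~R * (2 * pi) <= 2 * pi.
Proof.
have pp := pi_gt0 R; have p2 : (0 : R) < 2 * pi by lra.
exists (- Num.floor (a / (2 * pi))).
have h1 := floor_le (a / (2 * pi)); have h2 := floorD1_gt (a / (2 * pi)).
rewrite ler_pdivlMr // in h1; rewrite ltr_pdivrMr // intrD mulrDl mul1r in h2.
rewrite mulrNz mulNr; apply/andP; split; lra.
Qed.

Lemma per4_int F u v (k : int) : per4 F u v -> per4 F (k%:~R * u) (k%:~R * v).
Proof.
move=> per; have P (n : nat) : per4 F (n%:R * u) (n%:R * v).
  elim: n => [|n IH] a b p r; first by rewrite !mul0r !addr0.
  by rewrite -natr1 !mulrDl !mul1r !addrA per IH.
case: k => n a b p r; first exact: P.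
rewrite NegzE (_ : (- n.+1%:Z)%:~R = - n.+1%:R :> R) ?mulrNz // !mulNr.
by rewrite -(P n.+1 (a - n.+1%:R * u)) !subrK.
Qed.

Section Compact4.
Variables (F : R -> R -> R -> R -> R) (lo hi : R).
Hypotheses (lohi : lo <= hi) (Fc : ucont4 F) (Fa : per4 F (2 * pi) 0) (Fb : per4 F 0 (2 * pi)).
Hypotheses (Fp : forall a b p r, F a b (clamp lo hi p) r = F a b p r).
Hypotheses (Fr : forall a b p r, F a b p (clamp lo hi r) = F a b p r).

(** Whole turns and clamping bring arbitrary arguments into a compact box, where they converge along
    [ultra]; [red4] says that [F] does not notice. *)
Lemma reduce4 (z : nat -> R * R * R * R) : exists (k l : nat -> int) (a0 b0 p0 r0 : R),
  [/\ (fun n => (z n).1.1.1 + (k n)%:~R * (2 * pi)) @ ultra --> a0,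
      (fun n => (z n).1.1.2 + (l n)%:~R * (2 * pi)) @ ultra --> b0,
      (fun n => clamp lo hi (z n).1.2) @ ultra --> p0 &
      (fun n => clamp lo hi (z n).2) @ ultra --> r0].
Proof.
have /choice[k kP] := fun n => red_angle (z n).1.1.1.
have /choice[l lP] := fun n => red_angle (z n).1.1.2.
have [a0 _ ac] := ultra_bounded_cvg kP; have [b0 _ bc] := ultra_bounded_cvg lP.
have [p0 _ pc] := ultra_bounded_cvg (fun n => clamp_itv (z n).1.2 lohi).
have [r0 _ rc] := ultra_bounded_cvg (fun n => clamp_itv (z n).2 lohi).
by exists k, l, a0, b0, p0, r0.
Qed.

Lemma red4 a b p r (k l : int) : F a b p r =
  F (a + k%:~R * (2 * pi)) (b + l%:~R * (2 * pi)) (clamp lo hi p) (clamp lo hi r).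
Proof.
rewrite Fp Fr; have h1 := per4_int k Fa a b p r; have h2 := per4_int l Fb (a + k%:~R * (2 * pi)) b p r.
by rewrite mulr0 addr0 in h1; rewrite mulr0 addr0 in h2; rewrite h2 h1.
Qed.

Lemma compact4_bounded : exists2 C : R, 0 <= C & forall a b p r, `|F a b p r| <= C.
Proof.
apply: contrapT => no.
have /choice[z zP] : forall n : nat, exists z : R * R * R * R, n%:R < `|F z.1.1.1 z.1.1.2 z.1.2 z.2|.
  move=> n; apply: contrapT => non; apply: no; exists n%:R => // a b p r; rewrite leNgt; apply/negP => h.
  by apply: non; exists (a, b, p, r).
have [k [l [a0 [b0 [p0 [r0 [ac bc pc rc]]]]]]] := reduce4 z.
have h := ultra_cvg_comp (@norm_continuous R R _) (@Fc _ _ _ _ _ _ _ _ ac bc pc rc).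
have [m mP] := archi_bound (`|F a0 b0 p0 r0| + 1).
have h0 : `|F a0 b0 p0 r0| < `|F a0 b0 p0 r0| + 1 by rewrite ltrDl.
have h1 := ultra_cvg_lt h h0.
have {}h1 : ultra [set n | `|F (z n).1.1.1 (z n).1.1.2 (z n).1.2 (z n).2| < `|F a0 b0 p0 r0| + 1].
  by apply: filterS h1 => n /=; rewrite -red4.
have h2 : ultra [set n | (m <= n)%N] by apply: ultra_eventually; exact: nbhs_infty_ge.
have h12 : ultra ([set n | `|F (z n).1.1.1 (z n).1.1.2 (z n).1.2 (z n).2| < `|F a0 b0 p0 r0| + 1] `&` [set n | (m <= n)%N]).
  by apply: filterI.
have /filter_ex[n [/= h3 h4]] := h12.
have : (m%:R : R) <= n%:R by rewrite ler_nat.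
have := zP n; lra.
Qed.

(** The whole turns that make the first of two close sequences of arguments converge are also
    applied to the second, so both have the same limit. *)
Lemma compact4_unif : unif4 F.
Proof.
move=> e e0; apply: contrapT => no.
have /choice[z zP] : forall n : nat, exists z : (R * R * R * R) * (R * R * R * R),
    [/\ [/\ `|z.2.1.1.1 - z.1.1.1.1| <= n.+1%:R^-1, `|z.2.1.1.2 - z.1.1.1.2| <= n.+1%:R^-1,
     `|z.2.1.2 - z.1.1.2| <= n.+1%:R^-1 & `|z.2.2 - z.1.2| <= n.+1%:R^-1] &
    e < `|F z.2.1.1.1 z.2.1.1.2 z.2.1.2 z.2.2 - F z.1.1.1.1 z.1.1.1.2 z.1.1.2 z.1.2|].
  move=> n; apply: contrapT => non; apply: no; exists n.+1%:R^-1; first by rewrite invr_gt0.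
  move=> a b p r a' b' p' r' ha hb hp hr; rewrite leNgt; apply/negP => h.
  by apply: non; exists ((a, b, p, r), (a', b', p', r')).
have [k [l [a0 [b0 [p0 [r0 [ac bc pc rc]]]]]]] := reduce4 (fun n => (z n).1).
have near (u v : nat -> R) x : u @ ultra --> x -> (forall n, `|v n - u n| <= n.+1%:R^-1) -> v @ ultra --> x.
  by move=> ux vu; apply: (ultra_cvg_near (C := 1) ux) => n; rewrite div1r.
have ac' : (fun n => (z n).2.1.1.1 + (k n)%:~R * (2 * pi)) @ ultra --> a0.
  by apply: near ac _ => n; rewrite opprD addrACA subrr addr0; have [[]] := zP n.
have bc' : (fun n => (z n).2.1.1.2 + (l n)%:~R * (2 * pi)) @ ultra --> b0.
  by apply: near bc _ => n; rewrite opprD addrACA subrr addr0; have [[]] := zP n.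
have pc' : (fun n => clamp lo hi (z n).2.1.2) @ ultra --> p0.
  by apply: near pc _ => n; apply: le_trans (clamp_lip _ _ _ _) _; have [[]] := zP n.
have rc' : (fun n => clamp lo hi (z n).2.2) @ ultra --> r0.
  by apply: near rc _ => n; apply: le_trans (clamp_lip _ _ _ _) _; have [[]] := zP n.
have hB : (fun n => F ((z n).2.1.1.1 + (k n)%:~R * (2 * pi)) ((z n).2.1.1.2 + (l n)%:~R * (2 * pi)) (clamp lo hi (z n).2.1.2) (clamp lo hi (z n).2.2)
    - F ((z n).1.1.1.1 + (k n)%:~R * (2 * pi)) ((z n).1.1.1.2 + (l n)%:~R * (2 * pi)) (clamp lo hi (z n).1.1.2) (clamp lo hi (z n).1.2)) @ ultra
    --> F a0 b0 p0 r0 - F a0 b0 p0 r0 by apply: cvgB; exact: Fc.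
have := ultra_cvg_comp (@norm_continuous R R _) hB; rewrite subrr normr0 => h.
have /filter_ex[n /=] := ultra_cvg_lt h e0.
by rewrite -!red4 => h1; have [_] := zP n => h2; move: (lt_trans h1 h2); rewrite ltxx.
Qed.
End Compact4.

Definition ucont3 (F : R -> R -> R -> R) := forall (a b x : nat -> R) a0 b0 x0,
  a @ ultra --> a0 -> b @ ultra --> b0 -> x @ ultra --> x0 ->
  (fun n => F (a n) (b n) (x n)) @ ultra --> F a0 b0 x0.

Definition per3 (F : R -> R -> R -> R) (u v : R) := forall a b x, F (a + u) (b + v) x = F a b x.

Lemma clamp_idem (lo hi : R) s : lo <= hi -> clamp lo hi (clamp lo hi s) = clamp lo hi s.
Proof. by move=> lh; have /andP[h1 h2] := clamp_itv s lh; rewrite clamp_id. Qed.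

Lemma compact3_bounded (F : R -> R -> R -> R) : ucont3 F -> per3 F (2 * pi) 0 -> per3 F 0 (2 * pi) ->
  exists2 C : R, 0 <= C & forall a b x, `|x| <= 2 -> `|F a b x| <= C.
Proof.
move=> Fc Fa Fb; pose G (a b p r : R) := F a b (clamp (- 2) 2 p).
have l22 : (-2 : R) <= 2 by lra.
have [|||||C C0 CP] := @compact4_bounded G (- 2) 2 l22.
- move=> a b p r a0 b0 p0 r0 ac bc pc _; apply: Fc => //.
  rewrite /clamp; apply: (ultra_cvg_comp (f := clamp (- 2) 2)) pc.
  apply/cvgrPdist_le => e e0; apply/nbhs_ballP; exists e => //= t; rewrite /ball /= => h.
  by apply: le_trans (clamp_lip _ _ _ _) _; exact: ltW.
- by move=> a b p r; exact: Fa.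
- by move=> a b p r; exact: Fb.
- by move=> a b p r; rewrite /G clamp_idem.
- by [].
exists C => // a b x; rewrite ler_norml => /andP[x1 x2].
by have := CP a b x 0; rewrite /G clamp_id.
Qed.
End Compactness.

Section Profile.
Variable R : realType.

(** [pU] stands for [1 / f] in the angles [a], [b] and the latitude [x]; the other fields are the
    derivatives that enter the extended Hamiltonian and its gradient. *)
Record profile := Profile { pU : R -> R -> R -> R; pA : R -> R -> R -> R; pB : R -> R -> R -> R;
  pX : R -> R -> R -> R; pXX : R -> R -> R -> R; pXXA : R -> R -> R -> R; pXXB : R -> R -> R -> R }.

(** The circle of [a] collapses at [x = 0] and that of [b] at [x = pi / 2], whence [U_0] and [U_pi];
    [X_0] and [X_pi] express that the two components of the link are Reeb orbits. *)
Record good (P : profile) : Prop := Good {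
  dA : forall a b x, is_derive a (1 : R) (fun a => pU P a b x) (pA P a b x);
  dB : forall a b x, is_derive b (1 : R) (fun b => pU P a b x) (pB P a b x);
  dX : forall a b x, is_derive x (1 : R) (fun x => pU P a b x) (pX P a b x);
  dXX : forall a b x, is_derive x (1 : R) (fun x => pX P a b x) (pXX P a b x);
  dXXA : forall a b x, is_derive a (1 : R) (fun a => pXX P a b x) (pXXA P a b x);
  dXXB : forall a b x, is_derive b (1 : R) (fun b => pXX P a b x) (pXXB P a b x);
  cU : ucont3 (pU P); cA : ucont3 (pA P); cB : ucont3 (pB P); cX : ucont3 (pX P);
  cXX : ucont3 (pXX P); cXXA : ucont3 (pXXA P); cXXB : ucont3 (pXXB P);
  perU_a : per3 (pU P) (2 * pi) 0; perU_b : per3 (pU P) 0 (2 * pi);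
  U_gt0 : forall a b x, 0 < pU P a b x;
  X_0 : forall a b, pX P a b 0 = 0;
  X_pi : forall a b, pX P a b (pi / 2) = 0;
  U_0 : forall a a' b, pU P a b 0 = pU P a' b 0;
  U_pi : forall a b b', pU P a b (pi / 2) = pU P a b' (pi / 2) }.

Definition flip (F : R -> R -> R -> R) a b x := F b a (pi / 2 - x).

(** Exchange of the two circles: every fact about [x = 0] then also serves at [x = pi / 2]. *)
Definition swap P := Profile (flip (pU P)) (flip (pB P)) (flip (pA P))
  (fun a b x => - flip (pX P) a b x) (flip (pXX P)) (flip (pXXB P)) (flip (pXXA P)).

Lemma flipK F : flip (flip F) = F.
Proof. by apply/funext => a; apply/funext => b; apply/funext => x; rewrite /flip opprB addrC subrK. Qed.

Lemma swapK P : swap (swap P) = P.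
Proof.
case: P => u a b x xx xa xb; rewrite /swap /= !flipK; congr Profile.
apply/funext => s; apply/funext => t; apply/funext => y; rewrite /flip opprK opprB addrC subrK //.
Qed.

Lemma flip_ucont F : ucont3 F -> ucont3 (flip F).
Proof. by move=> Fc a b x a0 b0 x0 ac bc xc; apply: Fc => //; apply: cvgB => //; exact: cvg_cst. Qed.

Lemma flip_derive F F' : (forall a b x, is_derive x (1 : R) (fun x => F a b x) (F' a b x)) ->
  forall a b x, is_derive x (1 : R) (fun x => flip F a b x) (- flip F' a b x).
Proof.
move=> Fd a b x; rewrite /flip.
have h := der_comp (der_sub (der_cst (pi / 2) x) (der_id x)) (Fd b a (pi / 2 - x)).
by apply: (is_derive_conv h) => //; rewrite sub0r mulrN1.
Qed.

Lemma good_swap P : good P -> good (swap P).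
Proof.
move=> g; split; rewrite /=.
- by move=> a b x; exact: dB g _ _ _.
- by move=> a b x; exact: dA g _ _ _.
- exact: flip_derive (dX g).
- move=> a b x; apply: (is_derive_conv (der_opp (flip_derive (dXX g) a b x))) => //; exact: opprK.
- by move=> a b x; exact: dXXB g _ _ _.
- by move=> a b x; exact: dXXA g _ _ _.
- exact: flip_ucont (cU g).
- exact: flip_ucont (cB g).
- exact: flip_ucont (cA g).
- by move=> a b x a0 b0 x0 ac bc xc; apply: cvgN; exact: (flip_ucont (cX g)).
- exact: flip_ucont (cXX g).
- exact: flip_ucont (cXXB g).
- exact: flip_ucont (cXXA g).
- by move=> a b x; exact: perU_b g _ _ _.
- by move=> a b x; exact: perU_a g _ _ _.
- by move=> a b x; exact: U_gt0 g _ _ _.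
- by move=> a b; rewrite /flip subr0 (X_pi g) oppr0.
- by move=> a b; rewrite /flip subrr (X_0 g) oppr0.
- by move=> a a' b; rewrite /flip subr0; exact: U_pi g _ _ _.
- by move=> a b b'; rewrite /flip subrr; exact: U_0 g _ _ _.
Qed.

Section Shift.
Variables (P : profile) (g : good P) (u v : R) (per : per3 (pU P) u v).

Lemma per_x F F' : (forall a b x, is_derive x (1 : R) (fun x => F a b x) (F' a b x)) -> per3 F u v -> per3 F' u v.
Proof.
move=> Fd Fp a b x; apply: derive_uniq (Fd a b x).
by apply: (is_derive_conv (Fd (a + u) (b + v) x)) => // t; exact: Fp.
Qed.

Lemma per_a F F' : (forall a b x, is_derive a (1 : R) (fun a => F a b x) (F' a b x)) -> per3 F u v -> per3 F' u v.
Proof.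
move=> Fd Fp a b x; apply: derive_uniq (Fd a b x).
have h := is_derive_shift u (fun t => Fd t (b + v) x) a.
by apply: (is_derive_conv h) => // t; exact: Fp.
Qed.

Lemma per_b F F' : (forall a b x, is_derive b (1 : R) (fun b => F a b x) (F' a b x)) -> per3 F u v -> per3 F' u v.
Proof.
move=> Fd Fp a b x; apply: derive_uniq (Fd a b x).
have h := is_derive_shift v (fun t => Fd (a + u) t x) b.
by apply: (is_derive_conv h) => // t; exact: Fp.
Qed.

Lemma perA : per3 (pA P) u v. Proof. exact: per_a (dA g) per. Qed.
Lemma perB : per3 (pB P) u v. Proof. exact: per_b (dB g) per. Qed.
Lemma perX : per3 (pX P) u v. Proof. exact: per_x (dX g) per. Qed.
Lemma perXX : per3 (pXX P) u v. Proof. exact: per_x (dXX g) perX. Qed.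
Lemma perXXA : per3 (pXXA P) u v. Proof. exact: per_a (dXXA g) perXX. Qed.
Lemma perXXB : per3 (pXXB P) u v. Proof. exact: per_b (dXXB g) perXX. Qed.
Lemma per_swap : per3 (pU (swap P)) v u.
Proof. by move=> a b x; rewrite /= /flip per. Qed.
End Shift.

Lemma pi_half_le2 : (pi : R) / 2 <= 2.
Proof. by have /andP[_] := pihalf_02 R; lra. Qed.

Section ProfileBounds.
Variables (P : profile) (g : good P).

Lemma U_lower : exists2 c : R, 0 < c & forall a b x, `|x| <= 2 -> c <= pU P a b x.
Proof.
have [|||C C0 CP] := @compact3_bounded R (fun a b x => (pU P a b x)^-1).
- by move=> a b x a0 b0 x0 ac bc xc; apply: cvgV; [exact: lt0r_neq0 (U_gt0 g _ _ _)|exact: (cU g)].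
- by move=> a b x; rewrite (perU_a g).
- by move=> a b x; rewrite (perU_b g).
exists (C + 1)^-1; first by rewrite invr_gt0; lra.
move=> a b x hx; have u0 := U_gt0 g a b x; have := CP a b x hx.
rewrite gtr0_norm ?invr_gt0 // => h; rewrite -[leRHS]invrK lef_pV2 ?posrE ?invr_gt0 //; lra.
Qed.

Lemma profile_bounds : exists2 C : R, 0 <= C & forall a b x, `|x| <= 2 ->
  [/\ [/\ `|pU P a b x| <= C, `|pA P a b x| <= C & `|pX P a b x| <= C],
    `|pXX P a b x| <= C, `|pXXA P a b x| <= C & `|pXXB P a b x| <= C].
Proof.
have bnd F : ucont3 F -> per3 F (2 * pi) 0 -> per3 F 0 (2 * pi) -> _ := @compact3_bounded R F.
have [c1 p1 h1] := bnd _ (cU g) (perU_a g) (perU_b g).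
have [c2 p2 h2] := bnd _ (cA g) (perA g (perU_a g)) (perA g (perU_b g)).
have [c3 p3 h3] := bnd _ (cX g) (perX g (perU_a g)) (perX g (perU_b g)).
have [c4 p4 h4] := bnd _ (cXX g) (perXX g (perU_a g)) (perXX g (perU_b g)).
have [c5 p5 h5] := bnd _ (cXXA g) (perXXA g (perU_a g)) (perXXA g (perU_b g)).
have [c6 p6 h6] := bnd _ (cXXB g) (perXXB g (perU_a g)) (perXXB g (perU_b g)).
exists (c1 + c2 + c3 + c4 + c5 + c6); first by rewrite !addr_ge0.
move=> a b x hx; have := h1 a b x hx; have := h2 a b x hx; have := h3 a b x hx.
have := h4 a b x hx; have := h5 a b x hx; have := h6 a b x hx.
by move=> *; split; [split|..]; lra.
Qed.

(** The difference of [U] at [a + h] and at [a] vanishes at [x = 0] together with its first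
    derivative in [x], and its second derivative is at most [C * |h|] because [U_xxa] is bounded. *)
Lemma A_quadratic : exists2 C : R, 0 <= C & forall a b x, `|x| <= 2 -> `|pA P a b x| <= C * x ^+ 2.
Proof.
have [C C0 CP] := profile_bounds; exists C => // a b x hx.
have key h : `|pU P (a + h) b x - pU P a b x| <= `|h| * (C * x ^+ 2).
  pose D y := pU P (a + h) b y - pU P a b y; pose D1 y := pX P (a + h) b y - pX P a b y.
  pose D2 y := pXX P (a + h) b y - pXX P a b y.
  have [c1 hc1 e1] := mean_value 0 x (fun y => der_sub (dX g (a + h) b y) (dX g a b y) : is_derive y (1 : R) D (D1 y)).
  have [c2 hc2 e2] := mean_value 0 c1 (fun y => der_sub (dXX g (a + h) b y) (dXX g a b y) : is_derive y (1 : R) D1 (D2 y)).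
  have [c3 hc3 e3] := mean_value a (a + h) (fun t => dXXA g t b c2).
  rewrite /D (U_0 g (a + h) a) !subr0 subrr subr0 /D1 in e1.
  rewrite /D1 !(X_0 g) subrr !subr0 in e2.
  rewrite !subr0 in hc1 hc2.
  have n3 : `|pXXA P c3 b c2| <= C by have [] := CP c3 b c2 (le_trans hc2 (le_trans hc1 hx)).
  have ah : a + h - a = h by ring.
  rewrite /D2 e3 ah in e2.
  rewrite e1 e2 !normrM -[x ^+ 2]real_normK ?num_real // expr2.
  rewrite mulrA [_ * `|h|]mulrC -!mulrA; apply: ler_wpM2l => //; apply: ler_pM => //.
  exact: ler_wpM2r.
apply/ler_addgt0Pr => e e0; have [d d0 hd] := is_derive_epsP (dA g a b x) e0.
have h0 : 0 < d / 2 by lra.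
have nd : `|d / 2| = d / 2 by rewrite gtr0_norm.
have := hd (d / 2); rewrite nd => /(_ ltac:(lra)) h1; have := key (d / 2); rewrite nd => h2.
have : `|d / 2 * pA P a b x| <= d / 2 * (C * x ^+ 2 + e).
  have -> : d / 2 * pA P a b x = (pU P (a + d / 2) b x - pU P a b x) - (pU P (a + d / 2) b x - pU P a b x - d / 2 * pA P a b x) by ring.
  by apply: le_trans (ler_normB _ _) _; rewrite mulrDr [d / 2 * e]mulrC; apply: lerD.
by rewrite normrM gtr0_norm // ler_pM2l.
Qed.

End ProfileBounds.

Lemma sin_jordan (x : R) : 0 <= x <= pi / 2 -> x <= 4 * sin x.
Proof.
move=> /andP[x0 x1]; have pp := pi_gt0 R.
have half (y : R) : `|y| <= pi / 4 -> 1 / 2 <= cos y.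
  rewrite ler_norml => /andP[y0 y1].
  have c0 : 0 <= cos y by apply: cos_ge0_pihalf; apply/andP; split; lra.
  have c1 : 0 <= cos (y + y) by apply: cos_ge0_pihalf; apply/andP; split; lra.
  have : cos (y + y) = 2 * cos y ^+ 2 - 1 by rewrite cosD -!expr2 sin2cos2; ring.
  nra.
pose y := x / 2.
have [c hc] := mean_value 0 y (fun t => is_derive_sin t); rewrite sin0 !subr0 => e.
have {}hc : `|c| <= `|y| by rewrite -[c]subr0 -[y in leRHS]subr0.
have yy : `|y| <= pi / 4 by rewrite ger0_norm /y; lra.
have xy : x = y + y by rewrite /y; field.
have h1 := half y yy; have h2 := half c (le_trans hc yy).
have y0 : 0 <= y by rewrite /y; lra.
have h3 : 1 / 4 <= cos c * cos y by nra.
rewrite {2}xy sinD e {1}xy; nra.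
Qed.

(** The angular velocity of [a] in the flow linearized along [x = 0]: the limit, as [p] tends to 0,
    of the derivative in [p] of [(p + r) / 2 * U]. *)
Definition b0 P a b := pU P a b 0 / 2 + pXX P a b 0 / 4.
Definition b0A P a b := pA P a b 0 / 2 + pXXA P a b 0 / 4.
Definition b0B P a b := pB P a b 0 / 2 + pXXB P a b 0 / 4.

Lemma b0_dA P : good P -> forall a b, is_derive a (1 : R) (fun a => b0 P a b) (b0A P a b).
Proof.
move=> g a b; have D := der_add (der_cmul 2^-1 (dA g a b 0)) (der_cmul 4^-1 (dXXA g a b 0)).
by apply: (is_derive_conv D) => [t|]; rewrite /b0 /b0A; ring.
Qed.

Lemma b0_dB P : good P -> forall a b, is_derive b (1 : R) (fun b => b0 P a b) (b0B P a b).
Proof.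
move=> g a b; have D := der_add (der_cmul 2^-1 (dB g a b 0)) (der_cmul 4^-1 (dXXB g a b 0)).
by apply: (is_derive_conv D) => [t|]; rewrite /b0 /b0B; ring.
Qed.

Lemma b0_bound P : good P -> exists2 C : R, 0 <= C & forall a b, `|b0 P a b| <= C /\ `|b0A P a b| <= C.
Proof.
move=> g; have [C C0 CP] := profile_bounds g; exists C => // a b.
have [|[h1 h2 _] h3 h4 _] := CP a b 0; first by rewrite normr0.
have B (x y : R) : `|x| <= C -> `|y| <= C -> `|x / 2 + y / 4| <= C.
  by rewrite !ler_norml => /andP[? ?] /andP[? ?]; apply/andP; split; lra.
by split; apply: B.
Qed.

End Profile.

(** * The extended Hamiltonian *)

Section Hamiltonian.
Variable R : realType.
Implicit Types (P : profile R) (a b p r : R).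

Lemma is_derive_local (f h : R -> R) (s l e : R) : 0 < e -> (forall t, `|t - s| < e -> f t = h t) ->
  is_derive s (1 : R) f l -> is_derive s (1 : R) h l.
Proof.
move=> e0 fh D; apply: is_derive_eps => u u0; have [r r0 hr] := is_derive_epsP D u0.
exists (Num.min r e); first by rewrite lt_min r0 e0.
move=> t; rewrite lt_min => /andP[t1 t2]; have := hr t t1.
rewrite !fh //; first by rewrite subrr normr0.
by have -> : s + t - s = t by ring.
Qed.

Lemma ultra_squeeze0 (u v : nat -> R) : (forall n, `|v n| <= u n) -> u @ ultra --> (0 : R) -> v @ ultra --> (0 : R).
Proof.
move=> uv u0; apply/cvgrPdist_le => e e0.
have h : ultra [set n | u n < e] by apply: ultra_cvg_lt u0 e0.
by apply: filterS h => n /= h; rewrite sub0r normrN; apply: le_trans (uv n) (ltW h).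
Qed.

Lemma chi_range p r : 0 <= p -> 0 <= r -> 0 <= chi p r <= pi / 2.
Proof.
move=> p0 r0; have [S0|S0] := ltP 0 (p + r); first exact: chi_itv.
have r00 : r = 0 by lra.
have pp := pi_gt0 R.
by rewrite /chi r00 mul0r sqrtr0 acos0; apply/andP; split; lra.
Qed.

Lemma small_angle (x : R) : 0 <= x <= pi / 2 -> `|x| <= 2.
Proof. by move=> /andP[x0 x1]; have := pi_half_le2 R; rewrite ger0_norm //; lra. Qed.

(** As [bet d] is at most [d / 2], this choice of [d] keeps each extension term below [1 / 8]; on
    negative actions the Hamiltonian then stays below [1 / 2], where [step] begins. *)
Record adm P (d u0 u1 : R) : Prop := Adm {
  adm_good : good P; adm_d : 0 < d;
  adm_b0 : forall a b, d * `|b0 P a b| <= 1 / 4;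
  adm_b1 : forall a b, d * `|b0 (swap P) a b| <= 1 / 4;
  adm_u0 : 0 < u0; adm_u1 : 0 < u1;
  adm_low : forall a b x, 0 <= x <= pi / 2 -> u0 <= pU P a b x;
  adm_upp : forall a b x, 0 <= x <= pi / 2 -> pU P a b x <= u1 }.

Lemma adm_swap P d u0 u1 : adm P d u0 u1 -> adm (swap P) d u0 u1.
Proof.
case=> g d0 h0 h1 u00 u10 low upp; split => //; first exact: good_swap.
- by rewrite swapK.
- by move=> a b x /andP[x0 x1]; apply: low; apply/andP; split; lra.
- by move=> a b x /andP[x0 x1]; apply: upp; apply/andP; split; lra.
Qed.

Lemma adm_exists P : good P -> exists d u0 u1, adm P d u0 u1.
Proof.
move=> g; have [C C0 CP] := b0_bound g; have [C' C0' CP'] := b0_bound (good_swap g).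
have [u0 u00 low] := U_lower g; have [u1 u10 upp] := profile_bounds g.
pose d := (4 * (C + C' + 1))^-1.
have D0 : 0 < 4 * (C + C' + 1) by lra.
have d0 : 0 < d by rewrite invr_gt0.
have bnd x : `|x| <= C + C' + 1 -> d * `|x| <= 1 / 4.
  by move=> h; rewrite /d mulrC ler_pdivrMr //; lra.
exists d, u0, (u1 + 1); split => //.
- by move=> a b; apply: bnd; have [h _] := CP a b; lra.
- by move=> a b; apply: bnd; have [h _] := CP' a b; lra.
- by lra.
- by move=> a b x /small_angle; exact: low.
- by move=> a b x /small_angle hx; have [[h _ _] _ _ _] := upp a b x hx; have := ler_norm (pU P a b x); lra.
Qed.

(** For [p < 0 < r] the first term is [r / 2] times [U] at [x = 0], and [bet d p * b0] continues it
    in [p]: with matching slope at [p = 0], and flat below [- d]. The last term does the same across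
    [r = 0]. *)
Definition Ham P d a b p r := (pos p + pos r) / 2 * pU P a b (chi (pos p) (pos r)) +
  bet d p * b0 P a b + bet d r * b0 (swap P) b a.

Definition HamA P d a b p r := (pos p + pos r) / 2 * pA P a b (chi (pos p) (pos r)) +
  bet d p * b0A P a b + bet d r * b0B (swap P) b a.

(* The quotient U_x / sin x, extended by its limit U_xx at x = 0. *)
Definition qx P a b x := if x == 0 then pXX P a b 0 else pX P a b x / sin x.

(** One formula on both sides of [p = 0]: for [p > 0] the factor [dbet] is 1; for [p <= 0 < r] the
    latitude is 0 and the bracket equals [b0]. *)
Definition HamP P d a b p r := let x := chi (pos p) (pos r) in
  dbet d p * (pU P a b x / 2 + qx P a b x * cos x / 4).

Lemma Ham_swap P d a b p r : Ham (swap P) d b a r p = Ham P d a b p r.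
Proof.
rewrite /Ham swapK (addrC (pos r)) addrAC; congr (_ + _ + _).
have p0 := pos_ge0 p; have r0 := pos_ge0 r.
have [S0|S0] := ltP 0 (pos p + pos r); first by rewrite /= /flip chi_swap // opprB addrCA subrr addr0.
by have -> : pos p + pos r = 0; [lra|rewrite !mul0r].
Qed.

Section Adm.
Variables (P : profile R) (d u0 u1 : R) (h : adm P d u0 u1).
Let g := adm_good h.

Lemma bet_b0 (s a b : R) : `|bet d s * b0 P a b| <= 1 / 8 /\ `|bet d s * b0 (swap P) a b| <= 1 / 8.
Proof.
have d0 := adm_d h; have [hb _] := bet_bnd d0 s.
have nb := normr_ge0 (bet d s).
by split; rewrite normrM; [have := adm_b0 h a b|have := adm_b1 h a b]; nra.
Qed.

Lemma Ham_nonpos a b p r : p <= 0 -> r <= 0 -> Ham P d a b p r <= 1 / 4.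
Proof.
move=> p0 r0; rewrite /Ham (pos_eq0 p0) (pos_eq0 r0) addr0 !mul0r add0r.
have [h1 _] := bet_b0 p a b; have [_ h2] := bet_b0 r b a.
move: (ler_norm (bet d p * b0 P a b)) (ler_norm (bet d r * b0 (swap P) b a)); lra.
Qed.

Lemma Ham_upper a b p r : Ham P d a b p r <= (pos p + pos r) / 2 * u1 + 1 / 4.
Proof.
have [h1 _] := bet_b0 p a b; have [_ h2] := bet_b0 r b a.
have p0 := pos_ge0 p; have r0 := pos_ge0 r.
have := adm_upp h a b (chi_range p0 r0); rewrite /Ham.
move: (ler_norm (bet d p * b0 P a b)) (ler_norm (bet d r * b0 (swap P) b a)); nra.
Qed.

(** The origin of the threshold [4 / u0]: beyond it the first term of [Ham] is at least 2, so the
    truncation is saturated. *)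
Lemma Ham_high a b p r : 4 / u0 <= p -> 1 <= Ham P d a b p r.
Proof.
move=> hp; have [h1 _] := bet_b0 p a b; have [_ h2] := bet_b0 r b a.
have p0 := pos_ge0 p; have r0 := pos_ge0 r.
have u00 := adm_u0 h.
have := adm_low h a b (chi_range p0 r0); rewrite /Ham => hU.
have pp : 4 / u0 <= pos p by apply: le_trans (pos_ge p).
rewrite ler_pdivrMr // in pp.
have : 2 <= (pos p + pos r) / 2 * pU P a b (chi (pos p) (pos r)) by nra.
move: (ler_norm (- (bet d p * b0 P a b))) (ler_norm (- (bet d r * b0 (swap P) b a))); rewrite !normrN; lra.
Qed.

Lemma wt_ucont F : ucont3 F -> (exists2 C : R, 0 <= C & forall a b x, `|x| <= 2 -> `|F a b x| <= C) ->
  ucont4 (fun a b p r => (pos p + pos r) / 2 * F a b (chi (pos p) (pos r))).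
Proof.
move=> Fc [C C0 CP] a b p r a0 b0 p0 r0 ac bc pc rc.
have pc' := pos_ucont pc; have rc' := pos_ucont rc.
have wc : (fun n => (pos (p n) + pos (r n)) / 2) @ ultra --> (pos p0 + pos r0) / 2.
  by apply: cvgM; [exact: cvgD|exact: cvg_cst].
have p00 := pos_ge0 p0; have r00 := pos_ge0 r0.
have [S0|S0] := ltP 0 (pos p0 + pos r0).
  apply: cvgM => //; apply: Fc => //; apply: chi_ucont => // n; exact: pos_ge0.
have e : pos p0 + pos r0 = 0 by lra.
rewrite e mul0r in wc; rewrite e !mul0r.
apply: (@ultra_squeeze0 (fun n => (pos (p n) + pos (r n)) / 2 * C)).
  move=> n; rewrite normrM ger0_norm; last by rewrite divr_ge0 ?addr_ge0 ?pos_ge0.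
  apply: ler_wpM2l; first by rewrite divr_ge0 ?addr_ge0 ?pos_ge0.
  by apply: CP; apply: small_angle; apply: chi_range; exact: pos_ge0.
by rewrite -[X in _ --> X](mul0r C); apply: cvgM => //; exact: cvg_cst.
Qed.

Lemma b0_ucont Q (a b : nat -> R) (a0 c0 : R) : good Q -> a @ ultra --> a0 -> b @ ultra --> c0 ->
  [/\ (fun n => b0 Q (a n) (b n)) @ ultra --> b0 Q a0 c0, (fun n => b0A Q (a n) (b n)) @ ultra --> b0A Q a0 c0 &
   (fun n => b0B Q (a n) (b n)) @ ultra --> b0B Q a0 c0].
Proof.
move=> gQ ac bc; have zc : (fun _ : nat => 0 : R) @ ultra --> (0 : R) by exact: cvg_cst.
by split; (apply: cvgD; (apply: cvgM; last exact: cvg_cst)); [exact: (cU gQ)|exact: (cXX gQ)|exact: (cA gQ)|exact: (cXXA gQ)|exact: (cB gQ)|exact: (cXXB gQ)].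
Qed.

Lemma Ham_ucont : ucont4 (Ham P d).
Proof.
move=> a b p r a0 b0 p0 r0 ac bc pc rc; have d0 := adm_d h.
have [B1 _ _] := b0_ucont g ac bc; have [B2 _ _] := b0_ucont (good_swap g) bc ac.
apply: cvgD; first apply: cvgD.
- apply: (wt_ucont (cU g)) => //; have [C C0 CP] := profile_bounds g; exists C => // s t x /CP H; by have [[]] := H s t.
- by apply: cvgM => //; exact: bet_ucont.
- by apply: cvgM => //; exact: bet_ucont.
Qed.

Lemma HamA_ucont : ucont4 (HamA P d).
Proof.
move=> a b p r a0 b0 p0 r0 ac bc pc rc; have d0 := adm_d h.
have [_ B1 _] := b0_ucont g ac bc; have [_ _ B2] := b0_ucont (good_swap g) bc ac.
apply: cvgD; first apply: cvgD.
- apply: (wt_ucont (cA g)) => //; have [C C0 CP] := profile_bounds g; exists C => // s t x /CP H; by have [[]] := H s t.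
- by apply: cvgM => //; exact: bet_ucont.
- by apply: cvgM => //; exact: bet_ucont.
Qed.

(** At [x = 0] the numerator and the denominator are both written by the mean value theorem, as
    [U_xx] and [cos] at intermediate points times [x]. *)
Lemma qx_ucont (a b x : nat -> R) (a0 c0 x0 : R) : (forall n, 0 <= x n <= pi / 2) ->
  a @ ultra --> a0 -> b @ ultra --> c0 -> x @ ultra --> x0 ->
  (fun n => qx P (a n) (b n) (x n)) @ ultra --> qx P a0 c0 x0.
Proof.
move=> x01 ac bc xc; have pp := pi_gt0 R.
have x00 : 0 <= x0 by apply: ultra_cvg_ge xc _; apply: filterE => n /=; have /andP[] := x01 n.
have x0p : x0 <= pi / 2 by apply: ultra_cvg_le xc _; apply: filterE => n /=; have /andP[] := x01 n.
have [x0z|x0n] := eqVneq x0 0; last first.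
  have x0pos : 0 < x0 by rewrite lt_neqAle eq_sym x0n.
  have s0 : 0 < sin x0 by apply: sin_gt0_pi; apply/andP; split; lra.
  rewrite /qx (negPf x0n).
  have xn := ultra_cvg_gt xc x0pos.
  have hc : (fun n => pX P (a n) (b n) (x n) / sin (x n)) @ ultra --> pX P a0 c0 x0 / sin x0.
    apply: cvgM; first exact: (cX g).
    apply: cvgV; first exact: lt0r_neq0.
    exact: ultra_cvg_comp (@continuous_sin R x0) xc.
  by apply: ultra_cvg_eq hc; apply: filterS xn => n /= xpos; rewrite gt_eqF.
have /choice[c cP] : forall n, exists c : R * R, [/\ `|c.1| <= `|x n|, `|c.2| <= `|x n|,
    pX P (a n) (b n) (x n) = pXX P (a n) (b n) c.1 * x n & sin (x n) = cos c.2 * x n].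
  move=> n; have [c1 hc1 e1] := mean_value 0 (x n) (fun t => dXX g (a n) (b n) t).
  have [c2 hc2 e2] := mean_value 0 (x n) (fun t => is_derive_sin t).
  rewrite (X_0 g) in e1; rewrite sin0 in e2; rewrite !subr0 in hc1 hc2 e1 e2.
  by exists (c1, c2).
have xn0 : (fun n => `|x n|) @ ultra --> (0 : R).
  by have := ultra_cvg_comp (@norm_continuous R R _) xc; rewrite x0z normr0.
have c1c : (fun n => (c n).1) @ ultra --> (0 : R) by apply: ultra_squeeze0 xn0 => n; have [] := cP n.
have c2c : (fun n => (c n).2) @ ultra --> (0 : R) by apply: ultra_squeeze0 xn0 => n; have [] := cP n.
have hc : (fun n => pXX P (a n) (b n) (c n).1 / cos (c n).2) @ ultra --> pXX P a0 c0 0 / cos 0.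
  apply: cvgM; first exact: (cXX g).
  apply: cvgV; first by rewrite cos0 oner_neq0.
  exact: ultra_cvg_comp (@continuous_cos R 0) c2c.
rewrite cos0 divr1 in hc; rewrite /qx x0z eqxx.
apply: ultra_cvg_eq hc; apply: filterE => n /=; have [n1 n2 e1 e2] := cP n.
have [xz|xn] := eqVneq (x n) 0.
  rewrite xz normr0 !normr_le0 in n1 n2; by rewrite (eqP n1) (eqP n2) cos0 divr1.
have cn : cos (c n).2 != 0.
  apply/eqP => z; move: e2; rewrite z mul0r; have /andP[h1 h2] := x01 n => s0.
  have : 0 < sin (x n) by apply: sin_gt0_pi; rewrite lt_neqAle eq_sym xn h1 /=; lra.
  by rewrite s0 ltxx.
by rewrite e1 e2; field; rewrite xn cn.
Qed.

Definition Gf M a b p r := step M (Ham P d a b p r).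
Definition GA M a b p r := dstep M (Ham P d a b p r) * HamA P d a b p r.
Definition GP M a b p r := dstep M (Ham P d a b p r) * HamP P d a b p r.

Lemma Gf_ucont M : ucont4 (Gf M).
Proof. by move=> a b p r a0 b0 p0 r0 ac bc pc rc; apply: step_ucont; exact: Ham_ucont. Qed.

Lemma GA_ucont M : ucont4 (GA M).
Proof.
move=> a b p r a0 b0 p0 r0 ac bc pc rc.
by apply: cvgM; [apply: dstep_ucont; exact: Ham_ucont|exact: HamA_ucont].
Qed.

(** Where neither action is positive the latitude has no limit, but there [Ham] is below [1 / 2], so
    that the factor [dstep] vanishes nearby. *)
Lemma GP_ucont M : ucont4 (GP M).
Proof.
move=> a b p r a0 b0 p0 r0 ac bc pc rc; have d0 := adm_d h.
have Hc := Ham_ucont ac bc pc rc.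
have pc' := pos_ucont pc; have rc' := pos_ucont rc.
have p00 := pos_ge0 p0; have r00 := pos_ge0 r0.
have [S0|S0] := ltP 0 (pos p0 + pos r0).
  have xc := chi_ucont (fun n => pos_ge0 (p n)) (fun n => pos_ge0 (r n)) S0 pc' rc'.
  apply: cvgM; first exact: dstep_ucont.
  apply: cvgM; first exact: dbet_ucont.
  apply: cvgD; apply: cvgM; try exact: cvg_cst; first exact: (cU g).
  apply: cvgM; last exact: ultra_cvg_comp (@continuous_cos R _) xc.
  by apply: qx_ucont => // n; apply: chi_range; exact: pos_ge0.
have p0n : p0 <= 0 by have := pos_ge p0; lra.
have r0n : r0 <= 0 by have := pos_ge r0; lra.
have H0 := Ham_nonpos a0 b0 p0n r0n.
have H1 : Ham P d a0 b0 p0 r0 < 1 / 2 by lra.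
have near := ultra_cvg_lt Hc H1.
rewrite /GP; have [_ ->] := step_low M (ltW H1); rewrite mul0r.
apply: (@ultra_cvg_eq _ _ (fun=> 0)); last exact: cvg_cst.
by apply: filterS near => n /= /ltW hn; have [_ ->] := step_low M hn; rewrite mul0r.
Qed.

Lemma Gf_dA M a b p r : is_derive a (1 : R) (fun a => Gf M a b p r) (GA M a b p r).
Proof.
apply: (der_comp (g := step M) _ (step_derive M _)).
have D1 := der_cmul ((pos p + pos r) / 2) (dA g a b (chi (pos p) (pos r))).
have D2 := der_cmul (bet d p) (b0_dA g a b).
have D3 := der_cmul (bet d r) (b0_dB (good_swap g) b a).
exact: der_add (der_add D1 D2) D3.
Qed.

Lemma chi_derive0 p r : 0 < p -> 0 <= r ->
  is_derive p (1 : R) (fun p => chi p r) (cos (chi p r) / (2 * sin (chi p r) * (p + r))).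
Proof.
move=> p0; rewrite le_eqVlt => /predU1P[<-|r0]; last exact: chi_derive.
rewrite chi_p0 // cos_pihalf mul0r; apply: (is_derive_local p0 _ (der_cst (pi / 2) p)).
move=> t; rewrite ltr_norml => /andP[h1 h2]; rewrite chi_p0 //; lra.
Qed.

Lemma Ham_dP a b p r : p != 0 -> 0 < p \/ 0 < r -> is_derive p (1 : R) (fun p => Ham P d a b p r) (HamP P d a b p r).
Proof.
move=> pn pr; have d0 := adm_d h; have r0 := pos_ge0 r.
have cst := der_cst (bet d r * b0 (swap P) b a) p.
have [p0|p0|pz] := ltgtP p 0; last by rewrite pz eqxx in pn.
- have {}pr : 0 < r by case: pr => //; lra.
  have np : 0 < - p by lra.
  have D1 := der_cst (pos r / 2 * pU P a b 0) p.
  have D2 := der_mul (bet_derive d0 p0) (der_cst (b0 P a b) p).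
  have D := der_add (der_add D1 D2) cst.
  have rp : pos r = r by rewrite pos_id // ltW.
  apply: (is_derive_local np (f := _) _ (is_derive_conv D (fun t => erefl) _)).
    move=> t; rewrite ltr_norml => /andP[h1 h2].
    by rewrite /Ham (pos_eq0 (s := t)); [rewrite add0r rp chi_0r|lra].
  rewrite /HamP (pos_eq0 (ltW p0)) rp chi_0r // cos0 /qx eqxx /b0; ring.
- have D1 : is_derive p (1 : R) (fun p => (p + pos r) / 2) (1 / 2).
    apply: (is_derive_conv (der_cmul 2^-1 (der_add (der_id p) (der_cst (pos r) p)))) => [t|]; ring.
  have D2 := der_comp (chi_derive0 p0 r0) (dX g a b _).
  have D := der_add (der_mul D1 D2) cst.
  apply: (is_derive_local p0 (f := _) _ (is_derive_conv D (fun t => erefl) _)).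
    move=> t; rewrite ltr_norml => /andP[h1 h2].
    have t0 : 0 <= t by lra.
    by rewrite /Ham (pos_id t0) (bet_nneg d0 t0) mul0r addr0.
  have s0 := sin_chi_gt0 p0 r0.
  rewrite /HamP (pos_id (ltW p0)) /qx.
  have -> : (chi p (pos r) == 0) = false by apply/eqP => z; rewrite z sin0 ltxx in s0.
  have -> : dbet d p = 1.
    by rewrite /dbet (pos_eq0 (s := - p)) ?subr0 ?pos_id ?divff ?lt0r_neq0 // ?ltW //; lra.
  by field; rewrite !lt0r_neq0 //; lra.
Qed.

(** The formula for [Ham] changes at [p = 0]. The derivative computed on either side is continuous
    across, and this glues the two pieces. *)
Lemma Gf_dP M a b p r : is_derive p (1 : R) (fun p => Gf M a b p r) (GP M a b p r).
Proof.
apply: (@is_derive_glue_ultra _ (fun p => Gf M a b p r) (fun p => GP M a b p r)).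
- move=> s sn; have [pr|npr] := pselect (0 < s \/ 0 < r).
    by apply: (der_comp (g := step M) _ (step_derive M _)); exact: Ham_dP.
  have s0 : s < 0 by case: (ltgtP s 0) sn => // ? _; exfalso; apply: npr; left.
  have r0 : r <= 0 by rewrite leNgt; apply/negP => r0; apply: npr; right.
  have low t : t <= 0 -> Ham P d a b t r <= 1 / 2 by move=> t0; have := Ham_nonpos a b t0 r0; lra.
  have ns : 0 < - s by lra.
  have -> : GP M a b s r = 0 by rewrite /GP; have [_ ->] := step_low M (low s (ltW s0)); rewrite mul0r.
  apply: (is_derive_local ns _ (der_cst 0 s)) => t; rewrite ltr_norml => /andP[h1 h2].
  have t0 : t <= 0 by lra.
  by rewrite /Gf; have [-> _] := step_low M (low t t0).
- by move=> u uc; apply: Gf_ucont => //; exact: cvg_cst.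
- by move=> u uc; apply: GP_ucont => //; exact: cvg_cst.
Qed.

Lemma norm_le_sum_bool (c : bool -> R) j : `|c j| <= `|c false| + `|c true|.
Proof. by case: j; rewrite ?lerDl ?lerDr. Qed.

Lemma pos_le_norm (y : R) : pos y <= `|y|.
Proof. by rewrite /pos; have := ler_norm y; lra. Qed.

Lemma sqr_le16 (y s : R) : 0 <= y -> y <= 4 * s -> y ^+ 2 <= 16 * s ^+ 2.
Proof. by move=> y0 ys; nra. Qed.

(** With this bound Gronwall's inequality fixes the sign of [p] along a trajectory. The first term
    is [O(p)] because [U_a = O(x ^+ 2)] and [(p + r) * sin x ^+ 2 = p]. For [r < 0] the last term
    does not vanish with [p], but [dstep] is then nonzero only where [p * (2 * u1) >= 1]. *)
Lemma GA_linear M : 0 <= M -> exists2 C : R, 0 <= C & forall a b p r, `|GA M a b p r| <= C * `|p|.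
Proof.
move=> M0; have d0 := adm_d h.
have [C1 C10 CP1] := A_quadratic g; have [C2 C20 CP2] := profile_bounds g.
have [C3 C30 CP3] := b0_bound g.
have [C5 C50 CP5] := profile_bounds (good_swap g).
have [C4 C40 CP4] : exists2 C4 : R, 0 <= C4 & forall a b, `|b0B (swap P) b a| <= C4.
  exists (C2 + C5); first by rewrite addr_ge0.
  move=> a b; have pp := pi_gt0 R.
  have [|[_ h1 _] _ _ _] := CP2 a b (pi / 2 - 0); first by apply: small_angle; apply/andP; split; lra.
  have [|_ _ _ h2] := CP5 b a 0; first by rewrite normr0.
  rewrite /b0B [pB _ _ _ _]/=/flip; apply: le_trans (ler_normD _ _) _.
  by rewrite !normrM [`|2^-1|]ger0_norm // [`|4^-1|]ger0_norm //; lra.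
have ds z : `|dstep M z| <= 4 * M.
  by rewrite dstepE normrM ger0_norm // mulrC; apply: ler_wpM2r => //; have /andP[h1 h2] := dstep1_bnd z; rewrite ger0_norm.
have u10 := adm_u1 h.
pose C := 16 * C1 + C3 + d * C4 * (2 * u1).
have dC : 0 <= d * C4 * (2 * u1) by rewrite !mulr_ge0 // ltW.
exists (4 * M * C); first by rewrite !mulr_ge0 //; rewrite /C; lra.
move=> a b p r; rewrite /GA normrM.
have -> : 4 * M * C * `|p| = 4 * M * (C * `|p|) by rewrite -!mulrA.
have [low|high] := leP (Ham P d a b p r) (1 / 2).
  by have [_ ->] := step_low M low; rewrite normr0 mul0r !mulr_ge0 //; rewrite /C; lra.
apply: ler_pM => //.
have p0 := pos_ge0 p; have r0 := pos_ge0 r.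
have t1 : `|(pos p + pos r) / 2 * pA P a b (chi (pos p) (pos r))| <= 16 * C1 * `|p|.
  have x01 := chi_range p0 r0.
  have w0 : 0 <= (pos p + pos r) / 2 by rewrite divr_ge0 ?addr_ge0.
  have [S0|S0] := ltP 0 (pos p + pos r); last first.
    by have -> : pos p + pos r = 0; [lra|rewrite !mul0r normr0 !mulr_ge0].
  have s2 := sin2_chi p0 r0 S0; have := sin_jordan x01.
  have := CP1 a b _ (small_angle x01); have /andP[x0 _] := x01; set x := chi _ _ in s2 x0 * => hA hx.
  have pn := pos_le_norm p.
  have hx2 : x ^+ 2 <= 16 * sin x ^+ 2 := sqr_le16 x0 hx.
  rewrite normrM ger0_norm //.
  have k1 : C1 * x ^+ 2 <= C1 * (16 * sin x ^+ 2) by apply: ler_wpM2l.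
  have k2 : (pos p + pos r) / 2 * `|pA P a b x| <= (pos p + pos r) / 2 * (C1 * (16 * sin x ^+ 2)).
    by apply: ler_wpM2l => //; exact: le_trans hA k1.
  apply: le_trans k2 _.
  have -> : (pos p + pos r) / 2 * (C1 * (16 * sin x ^+ 2)) = 8 * C1 * pos p by rewrite -[in RHS]s2; field.
  nra.
have t2 : `|bet d p * b0A P a b| <= C3 * `|p|.
  have [_ hb] := bet_bnd d0 p; have [_ h3] := CP3 a b.
  by rewrite normrM mulrC; apply: ler_pM.
have t3 : `|bet d r * b0B (swap P) b a| <= d * C4 * (2 * u1) * `|p|.
  have [rp|rn] := leP 0 r; first by rewrite bet_nneg // mul0r normr0 mulr_ge0.
  have Hu := Ham_upper a b p r; rewrite (pos_eq0 (ltW rn)) addr0 in Hu.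
  have pu : 1 <= `|p| * (2 * u1).
    have pn := pos_le_norm p.
    nra.
  have [hb _] := bet_bnd d0 r.
  have hB := CP4 a b.
  rewrite normrM -!mulrA; have -> : C4 * (2 * (u1 * `|p|)) = C4 * (`|p| * (2 * u1)) by ring.
  apply: ler_pM => //; first lra.
  nra.
have -> : C * `|p| = 16 * C1 * `|p| + C3 * `|p| + d * C4 * (2 * u1) * `|p| by rewrite /C; ring.
by apply: le_trans (ler_normD _ _) _; apply: lerD => //; apply: le_trans (ler_normD _ _) _; exact: lerD.
Qed.

Section Period.
Variables (u v : R) (per : per3 (pU P) u v).

Lemma b0_per a b : [/\ b0 P (a + u) (b + v) = b0 P a b, b0A P (a + u) (b + v) = b0A P a b &
  b0B P (a + u) (b + v) = b0B P a b].
Proof.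
by rewrite /b0 /b0A /b0B per (perA g per) (perB g per) (perXX g per) (perXXA g per) (perXXB g per).
Qed.
End Period.

Lemma Ham_per u v : per3 (pU P) u v -> [/\ per4 (Ham P d) u v, per4 (HamA P d) u v & per4 (HamP P d) u v].
Proof.
move=> per; have per' := per_swap per.
have b0s a b : b0 (swap P) (b + v) (a + u) = b0 (swap P) b a.
  by rewrite /b0 per' (perXX (good_swap g) per').
have b0Bs a b : b0B (swap P) (b + v) (a + u) = b0B (swap P) b a.
  by rewrite /b0B (perB (good_swap g) per') (perXXB (good_swap g) per').
split=> a b p r; have [e1 e2 e3] := b0_per per a b.
- by rewrite /Ham per e1 b0s.
- by rewrite /HamA (perA g per) e2 b0Bs.
- by rewrite /HamP /qx per (perX g per) (perXX g per).
Qed.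

Lemma G_per M u v : per3 (pU P) u v -> [/\ per4 (Gf M) u v, per4 (GA M) u v & per4 (GP M) u v].
Proof.
move=> per; have [h1 h2 h3] := Ham_per per.
by split=> a b p r; rewrite /Gf /GA /GP h1 ?h2 ?h3.
Qed.

Lemma Ham_highR a b p r : 4 / u0 <= r -> 1 <= Ham P d a b p r.
Proof.
move=> hr; have h1 := bet_b0 p a b; have h2 := bet_b0 r b a.
have p0 := pos_ge0 p; have r0 := pos_ge0 r.
have u00 := adm_u0 h.
have := adm_low h a b (chi_range p0 r0); rewrite /Ham => hU.
have pp : 4 / u0 <= pos r by apply: le_trans (pos_ge r).
rewrite ler_pdivrMr // in pp.
have : 2 <= (pos p + pos r) / 2 * pU P a b (chi (pos p) (pos r)) by nra.
move: (ler_norm (- (bet d p * b0 P a b))) (ler_norm (- (bet d r * b0 (swap P) b a))); rewrite !normrN.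
by case: h1 h2 => h1 _ [_ h2]; lra.
Qed.

Local Notation rho := (4 / u0).

Lemma rho_gt0 : 0 < rho. Proof. by rewrite divr_gt0 // (adm_u0 h). Qed.

Lemma clamp_low (s : R) : s <= - d -> clamp (- d) rho s = - d.
Proof.
move=> sd; have d0 := adm_d h; have r0 := rho_gt0.
have e : s <= rho by lra.
by rewrite /clamp (min_r e) max_l.
Qed.

Lemma clamp_high (s : R) : rho <= s -> clamp (- d) rho s = rho.
Proof. move=> sr; have d0 := adm_d h; have r0 := rho_gt0.
have e : - d <= rho by lra.
by rewrite /clamp (min_l sr) max_r. Qed.

Lemma Ham_low s : s <= - d -> [/\ pos s = pos (- d), bet d s = bet d (- d) & dbet d s = dbet d (- d)].
Proof.
move=> sd; have d0 := adm_d h; have [e1 e2] := bet_far d0 sd; have [e3 e4] := bet_far d0 (lexx (- d)).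
by rewrite e1 e2 e4 !pos_eq0 //; lra.
Qed.

(** Below [- d] the extension is flat, above [4 / u0] the truncation is saturated: compactness
    arguments apply to the gradient although the momenta are unbounded. *)
Lemma G_clampP M a b p r : GA M a b (clamp (- d) rho p) r = GA M a b p r /\ GP M a b (clamp (- d) rho p) r = GP M a b p r.
Proof.
have [pl|pl] := leP p (- d).
  by rewrite (clamp_low pl) /GA /GP /Ham /HamA /HamP; have [-> -> ->] := Ham_low pl.
have [ph|ph] := leP rho p; last by rewrite clamp_id // ltW.
rewrite (clamp_high ph) /GA /GP.
have [_ ->] := step_high M (Ham_high a b r ph); have [_ ->] := step_high M (Ham_high a b r (lexx rho)).
by rewrite !mul0r.
Qed.

Lemma G_clampR M a b p r : GA M a b p (clamp (- d) rho r) = GA M a b p r /\ GP M a b p (clamp (- d) rho r) = GP M a b p r.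
Proof.
have [pl|pl] := leP r (- d).
  by rewrite (clamp_low pl) /GA /GP /Ham /HamA /HamP; have [-> -> _] := Ham_low pl.
have [ph|ph] := leP rho r; last by rewrite clamp_id // ltW.
rewrite (clamp_high ph) /GA /GP.
have [_ ->] := step_high M (Ham_highR a b p ph); have [_ ->] := step_high M (Ham_highR a b p (lexx rho)).
by rewrite !mul0r.
Qed.

Lemma lohi : - d <= rho. Proof. by have d0 := adm_d h; have r0 := rho_gt0; lra. Qed.

Lemma GA_compact M : unif4 (GA M) /\ exists2 C : R, 0 <= C & forall a b p r, `|GA M a b p r| <= C.
Proof.
have [_ pa _] := G_per M (perU_a g); have [_ pb _] := G_per M (perU_b g).
split; [apply: (compact4_unif lohi)|apply: (compact4_bounded lohi)] => //; try exact: GA_ucont.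
- by move=> a b p r; have [] := G_clampP M a b p r.
- by move=> a b p r; have [] := G_clampR M a b p r.
- by move=> a b p r; have [] := G_clampP M a b p r.
- by move=> a b p r; have [] := G_clampR M a b p r.
Qed.

Lemma GP_compact M : unif4 (GP M) /\ exists2 C : R, 0 <= C & forall a b p r, `|GP M a b p r| <= C.
Proof.
have [_ _ pa] := G_per M (perU_a g); have [_ _ pb] := G_per M (perU_b g).
split; [apply: (compact4_unif lohi)|apply: (compact4_bounded lohi)] => //; try exact: GP_ucont.
- by move=> a b p r; have [] := G_clampP M a b p r.
- by move=> a b p r; have [] := G_clampR M a b p r.
- by move=> a b p r; have [] := G_clampP M a b p r.
- by move=> a b p r; have [] := G_clampR M a b p r.
Qed.

Lemma Gf_bnd M a b p r : 0 <= M -> 0 <= Gf M a b p r <= M.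
Proof.
move=> M0; rewrite /Gf stepE; have /andP[h1 h2] := step1_bnd (Ham P d a b p r).
by rewrite mulr_ge0 //= ler_piMr.
Qed.
End Adm.
End Hamiltonian.

Lemma sum_bool (R : realType) (F : bool -> R) : \sum_j F j = F false + F true.
Proof. by rewrite big_bool addrC. Qed.

(** * The Hamiltonian with its correction *)

Section Orbits.
Variable R : realType.
Variables (P : profile R) (d u0 u1 : R) (h : adm P d u0 u1).
Let g := adm_good h.
Let h' := adm_swap h.
Local Notation rho := (4 / u0).

(** Quadratic growth beyond the threshold, and on negative momenta the correction with the sign of
    [sg]. It vanishes on [[0, 4 / u0]], where the Reeb dynamics takes place. *)
Definition kf (sg s : R) := pos (s - rho) ^+ 2 / 2 + sg / 2 * pos (- s) ^+ 2.
Definition dkf (sg s : R) := pos (s - rho) - sg * pos (- s).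

(** Convex terms lie above their tangents; the quadratic loss pays for the concave one, present when
    [sg < 0]. *)
Lemma kf_lower sg s v : kf sg s + dkf sg s * v - `|sg| / 2 * v ^+ 2 <= kf sg (s + v).
Proof.
have sq (x y : R) : 0 <= pos (x + y) ^+ 2 - pos x ^+ 2 - 2 * pos x * y <= y ^+ 2.
  have := pos_ge0 x; have := pos_ge0 (x + y).
  have [x0|x0] := leP 0 x; have [y0|y0] := leP 0 (x + y).
  - by rewrite !pos_id // => _ _; apply/andP; split; nra.
  - by rewrite (pos_id x0) (pos_eq0 (ltW y0)) => _ _; apply/andP; split; nra.
  - by rewrite (pos_id y0) (pos_eq0 (ltW x0)) => _ _; apply/andP; split; nra.
  - by rewrite (pos_eq0 (ltW x0)) (pos_eq0 (ltW y0)) => _ _; apply/andP; split; nra.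
have /andP[h1 _] := sq (s - rho) v; have /andP[h2 h3] := sq (- s) (- v).
rewrite /kf /dkf (addrAC s v) opprD; set A := pos (s - rho + v) in h1 *; set B := pos (- s - v) in h2 h3 *.
set T := B ^+ 2 - pos (- s) ^+ 2 - 2 * pos (- s) * - v in h2 h3.
have hT : - (`|sg| / 2 * v ^+ 2) <= sg / 2 * T.
  rewrite sqrrN in h3.
  have n0 := normr_ge0 sg; have n1 := ler_norm sg; have n2 := ler_norm (- sg); rewrite normrN in n2.
  have n3 : 0 <= `|sg| * (v ^+ 2 - T) by rewrite mulr_ge0 // subr_ge0.
  have n4 : 0 <= (`|sg| + sg) * T by rewrite mulr_ge0 //; lra.
  nra.
have -> : B ^+ 2 = T + pos (- s) ^+ 2 + 2 * pos (- s) * - v by rewrite /T; ring.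
nra.
Qed.

Lemma kf_ucont sg (s : nat -> R) l : s @ ultra --> l ->
  (fun n => kf sg (s n)) @ ultra --> kf sg l /\ (fun n => dkf sg (s n)) @ ultra --> dkf sg l.
Proof.
move=> sc; have c1 : (fun n => pos (s n - rho)) @ ultra --> pos (l - rho).
  by apply: pos_ucont; apply: cvgB => //; exact: cvg_cst.
have c2 : (fun n => pos (- s n)) @ ultra --> pos (- l) by apply: pos_ucont; exact: cvgN.
split; last by apply: cvgB => //; apply: cvgM => //; exact: cvg_cst.
apply: cvgD; first by apply: cvgM; [exact: cvgM|exact: cvg_cst].
by apply: cvgM; [exact: cvg_cst|exact: cvgM].
Qed.

Variables (c : bool -> R) (per : per3 (pU P) (c false) (c true)).

Definition KK M sg (q p : bool -> R) := Gf P d M (q false) (q true) (p false) (p true) + kf sg (p false) + kf sg (p true).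
Definition KKq M (q p : bool -> R) (j : bool) := if j then GA (swap P) d M (q true) (q false) (p true) (p false)
  else GA P d M (q false) (q true) (p false) (p true).
Definition KKp M sg (q p : bool -> R) (j : bool) := (if j then GP (swap P) d M (q true) (q false) (p true) (p false)
  else GP P d M (q false) (q true) (p false) (p true)) + dkf sg (p j).

Lemma ucont2_4 F : ucont4 F -> ucont2 (fun q p : bool -> R => F (q false) (q true) (p false) (p true)).
Proof. by move=> Fc w w0 wc; apply: Fc; exact: wc. Qed.

Lemma ucont2_4' F : ucont4 F -> ucont2 (fun q p : bool -> R => F (q true) (q false) (p true) (p false)).
Proof. by move=> Fc w w0 wc; apply: Fc; exact: wc. Qed.

Lemma KK_ucont M sg : [/\ ucont2 (KK M sg), forall j, ucont2 (fun q p => KKq M q p j) &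
  forall j, ucont2 (fun q p => KKp M sg q p j)].
Proof.
have e1 := ucont2_4 (@Gf_ucont _ _ _ _ _ h M); have e2 := ucont2_4 (@GA_ucont _ _ _ _ _ h M); have e3 := ucont2_4 (@GP_ucont _ _ _ _ _ h M).
have e2' := ucont2_4' (@GA_ucont _ _ _ _ _ h' M); have e3' := ucont2_4' (@GP_ucont _ _ _ _ _ h' M).
split.
- move=> w w0 wc; apply: cvgD; first apply: cvgD; first exact: e1.
    by have [] := kf_ucont sg (wc (true, false)).
  by have [] := kf_ucont sg (wc (true, true)).
- by case; [exact: e2'|exact: e2].
- move=> j w w0 wc; apply: cvgD; last by have [] := kf_ucont sg (wc (true, j)).
  by case: j; [exact: e3'|exact: e3].
Qed.

Lemma Gf_swap M a b p r : Gf (swap P) d M b a r p = Gf P d M a b p r.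
Proof. by rewrite /Gf Ham_swap. Qed.

Lemma Gf_dB M a b p r : is_derive b (1 : R) (fun b => Gf P d M a b p r) (GA (swap P) d M b a r p).
Proof. by apply: (is_derive_conv (Gf_dA h' M b a r p)) => // t; rewrite Gf_swap. Qed.

Lemma Gf_dR M a b p r : is_derive r (1 : R) (fun r => Gf P d M a b p r) (GP (swap P) d M b a r p).
Proof. by apply: (is_derive_conv (Gf_dP h' M b a r p)) => // t; rewrite Gf_swap. Qed.

Lemma unif4_flip F : unif4 F -> unif4 (fun a b p r : R => F b a r p).
Proof. by move=> Fu e /Fu[dl dl0 H]; exists dl => // a b p r a' b' p' r' *; exact: H. Qed.

Lemma KK_unif M sg : forall eta : R, 0 < eta -> exists2 h0 : R, 0 < h0 &
  forall (s : R) (q p dq dp : bool -> R), 0 < s -> s <= h0 -> (forall j, `|dq j| <= s) -> (forall j, `|dp j| <= s) ->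
    KK M sg q p + \sum_j KKq M q p j * dq j + \sum_j KKp M sg q p j * dp j - eta * s <=
    KK M sg (fun j => q j + dq j) (fun j => p j + dp j).
Proof.
move=> eta eta0; have e2 : 0 < eta / 2 by lra.
have [h0 h00 H] := first_order4 (Gf_dA h M) (Gf_dB M) (Gf_dP h M) (Gf_dR M) (GA_compact h M).1
  (unif4_flip (GA_compact h' M).1) (GP_compact h M).1 (unif4_flip (GP_compact h' M).1) e2.
have n0 := normr_ge0 sg.
have k0 : 0 < 2 * (`|sg| + 1) by lra.
exists (Num.min h0 (eta / (2 * (`|sg| + 1)))); first by rewrite lt_min h00 divr_gt0.
move=> s q p dq dp s0; rewrite le_min ler_pdivlMr // => /andP[s1 s2] hq hp.
have := H s (q false) (q true) (p false) (p true) (dq false) (dq true) (dp false) (dp true) s1 (hq _) (hq _) (hp _) (hp _).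
rewrite ler_norml => /andP[h1 _].
have k1 := kf_lower sg (p false) (dp false); have k2 := kf_lower sg (p true) (dp true).
have sq j : `|sg| / 2 * dp j ^+ 2 <= `|sg| / 2 * s ^+ 2.
  apply: ler_wpM2l; first by rewrite divr_ge0.
  by rewrite -(real_normK (num_real (dp j))) ler_sqr ?nnegrE // ltW.
have q1 := sq false; have q2 := sq true.
have k3 : `|sg| * s ^+ 2 <= eta / 2 * s by nra.
by rewrite !sum_bool /KK /KKq /KKp; lra.
Qed.

Lemma lattice_inv4 F : per4 F (2 * pi) 0 -> per4 F 0 (2 * pi) -> per4 F (c false) (c true) ->
  forall x y : R, lattice_inv c (fun q => F (q false) (q true) x y).
Proof.
move=> F1 F2 F3 x y; split=> q m; last exact: per4_int F3 _ _ _ _.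
have e1 := per4_int (m false) F1 (q false) (q true) x y.
have e2 := per4_int (m true) F2 (q false + (m false)%:~R * (2 * pi)) (q true) x y.
by rewrite mulr0 addr0 in e1; rewrite mulr0 addr0 in e2; rewrite e2 e1.
Qed.

Lemma lattice_inv4' F : per4 F (2 * pi) 0 -> per4 F 0 (2 * pi) -> per4 F (c true) (c false) ->
  forall x y : R, lattice_inv c (fun q => F (q true) (q false) x y).
Proof.
move=> F1 F2 F3 x y; have := @lattice_inv4 (fun a b p r => F b a r p) _ _ _ y x.
by apply => a b p r; [exact: F2|exact: F1|exact: F3].
Qed.

Lemma lattice_inv_cstD (f : (bool -> R) -> R) k : lattice_inv c f -> lattice_inv c (fun q => f q + k).
Proof. by move=> [f1 f2]; split=> q m; rewrite ?f1 ?f2. Qed.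

Lemma KK_inv M sg : [/\ forall p, lattice_inv c (KK M sg ^~ p), forall p j, lattice_inv c (fun q => KKq M q p j) &
  forall p j, lattice_inv c (fun q => KKp M sg q p j)].
Proof.
have pa := perU_a g; have pb := perU_b g.
have [A1 B1 C1] := G_per h M pa; have [A2 B2 C2] := G_per h M pb; have [A3 B3 C3] := G_per h M per.
have [_ B1' C1'] := G_per h' M (per_swap pa); have [_ B2' C2'] := G_per h' M (per_swap pb); have [_ B3' C3'] := G_per h' M (per_swap per).
split=> p.
- by do 2 apply: lattice_inv_cstD; exact: lattice_inv4.
- by case; [exact: lattice_inv4'|exact: lattice_inv4].
- by move=> j; apply: lattice_inv_cstD; case: j; [exact: lattice_inv4'|exact: lattice_inv4].
Qed.

Lemma GP_zero_high M a b p r : rho <= p -> GP P d M a b p r = 0.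
Proof. by move=> hp; rewrite /GP; have [_ ->] := step_high M (Ham_high h a b r hp); rewrite mul0r. Qed.

Lemma GP_zero_low M a b p r : p <= - d -> GP P d M a b p r = 0.
Proof.
by move=> hp; rewrite /GP /HamP; have [_ ->] := bet_far (adm_d h) hp; rewrite mul0r mulr0.
Qed.
End Orbits.

(** The last inequality, [K < p * K_p] at time 0, is what is kept of the positivity of the action;
    it serves to exclude trajectories moved by the correction alone. *)
Definition K_orbit (R : realType) (P : profile R) (d u0 M sg c0 c1 : R) :=
  exists a b p r : R -> R, [/\
    [/\ forall t, is_derive t (1 : R) a (GP P d M (a t) (b t) (p t) (r t) + dkf u0 sg (p t)),
        forall t, is_derive t (1 : R) b (GP (swap P) d M (b t) (a t) (r t) (p t) + dkf u0 sg (r t)),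
        forall t, is_derive t (1 : R) p (- GA P d M (a t) (b t) (p t) (r t)) &
        forall t, is_derive t (1 : R) r (- GA (swap P) d M (b t) (a t) (r t) (p t))],
    [/\ forall t, a (t + 1) = a t + c0, forall t, b (t + 1) = b t + c1,
        forall t, p (t + 1) = p t & forall t, r (t + 1) = r t] &
    Gf P d M (a 0) (b 0) (p 0) (r 0) + kf u0 sg (p 0) + kf u0 sg (r 0) <
      p 0 * (GP P d M (a 0) (b 0) (p 0) (r 0) + dkf u0 sg (p 0)) +
      r 0 * (GP (swap P) d M (b 0) (a 0) (r 0) (p 0) + dkf u0 sg (r 0))].

(** * The two linking configurations *)

Section ClosedOrbit.
Variable R : realType.
Variables (P : profile R) (d u0 u1 : R) (h : adm P d u0 u1).
Let g := adm_good h.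
Let h' := adm_swap h.
Local Notation rho := (4 / u0).
Local Notation kf := (kf u0).
Local Notation dkf := (dkf u0).
Local Notation KK := (KK P d u0).
Local Notation KKq := (KKq P d).
Local Notation KKp := (KKp P d u0).
Variables (c : bool -> R) (per : per3 (pU P) (c false) (c true)).

Lemma u01 : u0 <= u1.
Proof.
have pp := pi_gt0 R; have z0 : 0 <= (pi / 4 : R) <= pi / 2 by apply/andP; split; lra.
exact: le_trans (adm_low h 0 0 z0) (adm_upp h 0 0 z0).
Qed.

Lemma dkf_bounds (eps sg : R) : 1 <= sg -> eps = 1 \/ eps = -1 -> let B := rho + d + `|c false| + `|c true| + 2 in
  [/\ forall r : R, exists C : R, forall s, `|s| <= r -> `|dkf (eps * sg) s| <= C,
      forall s, B <= s -> `|c false| + `|c true| + 2 <= dkf (eps * sg) s &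
      forall s, s <= - B -> `|c false| + `|c true| + 2 <= - eps * dkf (eps * sg) s].
Proof.
move=> sg1 e1 B; have r0 := rho_gt0 h; have d0 := adm_d h.
have n0 := normr_ge0 (c false); have n1 := normr_ge0 (c true).
have ee : eps * eps = 1 by case: e1 => ->; ring.
split.
- move=> r; exists (r + rho + sg * r) => s hs; have r0' : 0 <= r by apply: le_trans hs.
  have ps (x : R) : 0 <= pos x <= `|x| by rewrite pos_ge0 /= /pos; have := ler_norm x; lra.
  have /andP[p0 p1] := ps (s - rho); have /andP[p2 p3] := ps (- s); rewrite normrN in p3.
  have p4 : `|s - rho| <= r + rho.
    by apply: le_trans (ler_normB _ _) _; rewrite [`|rho|]ger0_norm ?(ltW r0) // lerD2r.
  apply: le_trans (ler_normB _ _) _; apply: lerD; first by rewrite ger0_norm //; exact: le_trans p4.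
  have -> : `|eps * sg * pos (- s)| = sg * pos (- s).
    have s0 : 0 <= sg * pos (- s) by rewrite mulr_ge0 //; lra.
    by case: e1 => ->; rewrite -mulrA ?mulN1r ?normrN ?mul1r ger0_norm.
  by apply: ler_wpM2l; [lra|exact: le_trans hs].
- move=> s hs; rewrite /B in hs; rewrite /dkf (pos_id (s := s - rho)) ?(pos_eq0 (s := - s)); lra.
- move=> s hs; rewrite /B in hs; rewrite /dkf (pos_id (s := - s)) ?(pos_eq0 (s := s - rho)); try lra.
  have -> : - eps * (0 - eps * sg * - s) = sg * - s by rewrite -[RHS]mul1r -ee; ring.
  nra.
Qed.

Lemma KK_orbit (M sg eps : R) (D : finType) (L : (D -> R) -> bool -> R) (PJ : (bool -> R) -> D -> R)
  (dlo dhi dw : D -> R) (alpha C C' : R) : 1 <= sg -> eps = 1 \/ eps = -1 ->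
  (forall j : bool, ucont (L^~ j)) -> (forall i : D, ucont (PJ^~ i)) ->
  (forall w : D -> R, PJ (L w) = w) -> (forall i : D, dlo i < dw i < dhi i) -> 0 < alpha ->
  (forall q p : bool -> R, PJ p = dw -> alpha <= \sum_j p j * c j - KK M (eps * sg) q p) ->
  (forall (w : D -> R) (i : D), (forall j : D, dlo j <= w j <= dhi j) -> w i = dlo i \/ w i = dhi i ->
   forall q v : bool -> R, \sum_j L w j * c j - KK M (eps * sg) q (fun j => L w j + v j) <= C * \sum_j v j ^+ 2) ->
  (forall w : D -> R, (forall j : D, dlo j <= w j <= dhi j) ->
   forall q v : bool -> R, \sum_j L w j * c j - KK M (eps * sg) q (fun j => L w j + v j) <= C' * (1 + \sum_j v j ^+ 2)) ->
  K_orbit P d u0 M (eps * sg) (c false) (c true).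
Proof.
move=> sg1 e1 H1 H2 H3 H4 al0 H5 H6 H7.
have [U1 U2 U3] := KK_ucont h M (eps * sg); have [I1 I2 I3] := @KK_inv _ _ _ _ _ h c per M (eps * sg).
have [_ [CA CA0 CAP]] := GA_compact h M; have [_ [CA' CA0' CAP']] := GA_compact h' M.
have [_ [CP CP0 CPP]] := GP_compact h M; have [_ [CP' CP0' CPP']] := GP_compact h' M.
have [D1 D2 D3] := dkf_bounds sg1 e1.
have r0 := rho_gt0 h; have d0 := adm_d h; have n0 := normr_ge0 (c false); have n1 := normr_ge0 (c true).
have cj j : `|c j| <= `|c false| + `|c true| := norm_le_sum_bool c j.
have bq q p j : `|KKq M q p j| <= CA + CA'.
  by case: j; [apply: le_trans (CAP' _ _ _ _) _|apply: le_trans (CAP _ _ _ _) _]; lra.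
have bp r : exists C : R, forall q p, (forall j : bool, `|p j| <= r) -> forall j, `|KKp M (eps * sg) q p j| <= C.
  have [C0 C0P] := D1 r; exists (CP + CP' + C0) => q p hp j.
  apply: le_trans (ler_normD _ _) _; apply: lerD; last exact: C0P.
  by case: j; [apply: le_trans (CPP' _ _ _ _) _|apply: le_trans (CPP _ _ _ _) _]; lra.
have br q p j : rho + d + `|c false| + `|c true| + 2 <= p j -> `|c j| + 2 <= KKp M (eps * sg) q p j.
  move=> hj; have := D2 _ hj; have := cj j; rewrite /KKp.
  have -> : (if j then GP (swap P) d M (q true) (q false) (p true) (p false)
    else GP P d M (q false) (q true) (p false) (p true)) = 0.
    by case: j hj => hj; [apply: (GP_zero_high h')|apply: (GP_zero_high h)]; lra.
  lra.
have bl q p j : p j <= - (rho + d + `|c false| + `|c true| + 2) -> `|c j| + 2 <= - eps * KKp M (eps * sg) q p j.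
  move=> hj; have := D3 _ hj; have := cj j; rewrite /KKp.
  have -> : (if j then GP (swap P) d M (q true) (q false) (p true) (p false)
    else GP P d M (q false) (q true) (p false) (p true)) = 0.
    by case: j hj => hj; [apply: (GP_zero_low h')|apply: (GP_zero_low h)]; lra.
  rewrite add0r; lra.
have se : - eps = 1 \/ - eps = -1 by case: e1 => ->; [right|left; rewrite opprK].
have [X [X1 X2 X3 X4 X5]] := hamiltonian_closed_orbit U1 U2 U3 (KK_unif h M (eps * sg)) I1 I2 I3 bq bp br se bl
  H1 H2 H3 H4 al0 H5 H6 H7.
exists (fun t => X t (false, false)), (fun t => X t (false, true)), (fun t => X t (true, false)), (fun t => X t (true, true)).
split; [split=> t|split=> t|] => //.
have a0 : 0 < alpha / 4 by lra.
move: X5; rewrite sum_bool /KK /KKp => X5.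
by rewrite -subr_gt0; apply: lt_le_trans a0 _; apply: le_trans X5 _; lra.
Qed.

Let B := (rho + 1) * (`|c false| + `|c true|).

Lemma B_ge0 : 0 <= B.
Proof. by have r0 := rho_gt0 h; rewrite /B mulr_ge0 ?addr_ge0 // ltW // addr_gt0. Qed.

Lemma sum_le_B (w : bool -> R) : (forall j, `|w j| <= rho + 1) -> \sum_j w j * c j <= B.
Proof.
move=> hw; have r0 := rho_gt0 h.
have k j : w j * c j <= (rho + 1) * `|c j|.
  by apply: le_trans (ler_norm _) _; rewrite normrM; apply: ler_wpM2r.
by rewrite sum_bool /B mulrDr lerD.
Qed.

Lemma pos_sq_le (x y : R) : x <= y -> 0 <= y -> pos x ^+ 2 <= y ^+ 2.
Proof.
move=> xy y0; have [x0|x0] := leP 0 x; first by rewrite pos_id // ler_sqr ?nnegrE.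
by rewrite pos_eq0 ?(ltW x0) // expr0n sqr_ge0.
Qed.

(** The origin of the constant [(2 * u1)^-1]: by [Ham_upper] such small momenta keep [Ham] at most
    [1 / 2]. *)
Lemma small_step (M a b p r : R) : 0 <= M -> pos p + pos r <= (2 * u1)^-1 -> Gf P d M a b p r = 0.
Proof.
move=> M0 hs; have u10 := adm_u1 h; have Hu := Ham_upper h a b p r.
have : (pos p + pos r) * (2 * u1) <= 1 by rewrite -ler_pdivlMr ?div1r //; lra.
move=> h1; have hl : Ham P d a b p r <= 1 / 2 by lra.
by rewrite /Gf; have [-> _] := step_low M hl.
Qed.

Lemma delta_le_rho : (2 * u1)^-1 < rho.
Proof.
have u10 := adm_u1 h; have u00 := adm_u0 h; have u_le := u01.
rewrite -div1r ltr_pdivrMr; last lra.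
have : rho * u0 = 4 by rewrite divfK // lt0r_neq0.
have r0 := rho_gt0 h; nra.
Qed.

Lemma kf_ge0 sg s : 0 <= sg -> 0 <= kf sg s.
Proof. by move=> s0; rewrite /kf; have := sqr_ge0 (pos (s - rho)); have := sqr_ge0 (pos (- s)); nra. Qed.

(** The box is the square [[-1, rho + 1]^2] of constant momenta, linked with one point near the
    origin on an axis where [c] is positive; at this point [K] vanishes. On the lower faces the
    convex correction exceeds the pairing with [c], on the upper faces the plateau [M] does. *)
Lemma convex_orbit (M sg : R) : B <= M -> 1 <= sg -> 8 * B <= sg -> 0 < c false \/ 0 < c true ->
  K_orbit P d u0 M sg (c false) (c true).
Proof.
move=> BM sg1 Bsg cpos; have B0 := B_ge0; have r0 := rho_gt0 h.
have M0 : 0 <= M by lra.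
have [j0 cj0] : exists j0, 0 < c j0 by case: cpos => ?; [exists false|exists true].
pose e : R := (2 * u1)^-1.
have e0 : 0 < e by rewrite invr_gt0; have := adm_u1 h; lra.
have er : e < rho := delta_le_rho.
have Kge0 q p : 0 <= KK M (1 * sg) q p.
  have /andP[G0 _] := @Gf_bnd _ P d M (q false) (q true) (p false) (p true) M0.
  have k0 s : 0 <= kf (1 * sg) s by rewrite mul1r; apply: kf_ge0; lra.
  by rewrite /KK; have := k0 (p false); have := k0 (p true); lra.
have sqB (v : bool -> R) i (x : R) : 0 <= x -> x <= v i ^+ 2 -> x <= \sum_j v j ^+ 2.
  move=> x0; rewrite sum_bool; have := sqr_ge0 (v true); have := sqr_ge0 (v false).
  by case: i; lra.
rewrite -[sg]mul1r.
apply: (@KK_orbit M sg 1 _ (fun w => w) (fun p => p) (fun=> - 1) (fun=> rho + 1)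
  (fun j => if j == j0 then e else 0) (e * c j0) (4 * B) B); rewrite ?mulr_gt0 //; first by left.
- by move=> j; exact: ucont_proj.
- by move=> j; exact: ucont_proj.
- by move=> j; case: ifP => _; apply/andP; split; lra.
- move=> q p pE; have e' : pos e = e by rewrite pos_id // ltW.
  have z' : pos (0 : R) = 0 by rewrite pos_id.
  have kz x : 0 <= x -> x <= rho -> kf (1 * sg) x = 0.
    by move=> x0 xr; rewrite /kf (pos_eq0 (s := x - rho)) ?(pos_eq0 (s := - x)) ?expr0n /= ?mul0r ?mulr0 ?addr0 //; lra.
  rewrite sum_bool /KK pE; rewrite small_step //; last first.
    by case: (j0); rewrite /= e' z' ?addr0 ?add0r.
  by case: (j0) cj0 => cj0 /=; rewrite !kz ?(ltW er) ?(ltW e0) ?(ltW r0) // mul0r; lra.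
- move=> w i box wi q v.
  have wB : \sum_j w j * c j <= B.
    by apply: sum_le_B => j; rewrite ler_norml; have /andP[] := box j; lra.
  suff : B <= KK M (1 * sg) q (fun j => w j + v j) \/ B <= 4 * B * \sum_j v j ^+ 2.
    have := Kge0 q (fun j => w j + v j).
    have S0 : 0 <= \sum_j v j ^+ 2 by apply: sumr_ge0 => *; exact: sqr_ge0.
    have BS : 0 <= 4 * B * \sum_j v j ^+ 2 by apply: mulr_ge0 => //; apply: mulr_ge0.
    by move=> h1 [h2|h2]; lra.
  have big (x : R) : 1 / 4 <= x -> B <= 4 * B * x by move=> hx; nra.
  have /andP[G0 _] := @Gf_bnd _ P d M (q false) (q true) (w false + v false) (w true + v true) M0.
  have k0 s : 0 <= kf (1 * sg) s by rewrite mul1r; apply: kf_ge0; lra.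
  case: wi => wi.
    (* A fluctuation at most [1 / 2] leaves the momentum below [- 1 / 2], where the correction is at
       least [sg / 8 >= B]; a larger one is paid for by [4 * B * v i ^+ 2]. *)
    have [vi|vi] := leP (v i) (1 / 2); last first.
      by right; apply: big; apply: (sqB v i) => //; nra.
    left; have : B <= kf (1 * sg) (w i + v i).
      rewrite wi mul1r /kf; have p1 := sqr_ge0 (pos (- 1 + v i - rho)).
      rewrite (pos_id (s := - (-1 + v i))); last lra.
      have : 1 / 4 <= (- (-1 + v i)) ^+ 2 by nra.
      nra.
    by rewrite /KK; have := k0 (w false + v false); have := k0 (w true + v true); case: (i); lra.
  have [vi|vi] := leP (-1) (v i); last first.
    by right; apply: big; apply: (sqB v i) => //; nra.
  left; have GM : Gf P d M (q false) (q true) (w false + v false) (w true + v true) = M.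
    suff hh : 1 <= Ham P d (q false) (q true) (w false + v false) (w true + v true).
      by rewrite /Gf; have [-> _] := step_high M hh.
    by case: (i) vi wi => vi wi; [apply: (Ham_highR h)|apply: (Ham_high h)]; rewrite wi; lra.
  by rewrite /KK GM; have := k0 (w false + v false); have := k0 (w true + v true); lra.
- move=> w box q v.
  have wB : \sum_j w j * c j <= B.
    by apply: sum_le_B => j; rewrite ler_norml; have /andP[] := box j; lra.
  have := Kge0 q (fun j => w j + v j); have : 0 <= \sum_j v j ^+ 2 by apply: sumr_ge0 => *; exact: sqr_ge0.
  nra.
Qed.

Let dl := (4 * u1)^-1.

(** The box is the diagonal segment from 0 to [rho + 1], linked with the line of momenta whose
    pairing with [c] is a small positive number. On that line [K <= 0]: if one momentum is negative,
    the concave correction outweighs whatever the other contributes; if both are nonnegative, they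
    are too small for the truncation to be reached. *)
Lemma concave_orbit (M sg : R) : B <= M -> 1 <= sg -> 0 < c false -> 0 < c true ->
  (2 * M / dl ^+ 2 + 1) * ((c false / c true) ^+ 2 + (c true / c false) ^+ 2) <= sg ->
  K_orbit P d u0 M (- sg) (c false) (c true).
Proof.
move=> BM sg1 c0 c1 Hsg; have B0 := B_ge0; have r0 := rho_gt0 h.
have M0 : 0 <= M by lra.
have dl0 : 0 < dl by rewrite invr_gt0; have := adm_u1 h; lra.
have dl2 : 2 * dl = (2 * u1)^-1 by rewrite /dl; field; exact: lt0r_neq0 (adm_u1 h).
have dlr : 2 * dl < rho by rewrite dl2; exact: delta_le_rho.
(* With this [e] a point of the line with nonnegative coordinates has both of them at most [dl]. *)
pose e : R := dl * Num.min (c false) (c true) / (c false + c true).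
have mn : 0 < Num.min (c false) (c true) by rewrite lt_min c0 c1.
have e0 : 0 < e by rewrite divr_gt0 ?mulr_gt0 ?addr_gt0.
have cs : 0 < c false + c true by rewrite addr_gt0.
have eE : e * (c false + c true) = dl * Num.min (c false) (c true) by rewrite divfK ?lt0r_neq0.
have e1 : e < rho.
  have : Num.min (c false) (c true) <= c false by rewrite ge_min lexx.
  nra.
have Klow q p : Gf P d M (q false) (q true) (p false) (p true) - sg / 2 * \sum_j pos (- p j) ^+ 2 <= KK M (- sg) q p.
  rewrite sum_bool /KK /kf; have := sqr_ge0 (pos (p false - rho)); have := sqr_ge0 (pos (p true - rho)); lra.
have sqv (w : R) (v : bool -> R) : 0 <= w -> \sum_j pos (- (w + v j)) ^+ 2 <= \sum_j v j ^+ 2.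
  move=> w0; apply: ler_sum => j _; rewrite -[leRHS]sqrrN.
  have [vj|vj] := leP 0 (v j); first by rewrite pos_eq0 ?expr0n ?sqr_ge0 //; lra.
  by apply: pos_sq_le; lra.
have kz x : 0 <= x -> x <= rho -> kf (- sg) x = 0.
  by move=> x0 xr; rewrite /kf (pos_eq0 (s := x - rho)) ?(pos_eq0 (s := - x)) ?expr0n /= ?mul0r ?mulr0 ?addr0 //; lra.
have al : 0 < e * (c false + c true) by rewrite mulr_gt0.
rewrite -[- sg]mulN1r.
apply: (@KK_orbit M sg (-1) _ (fun w _ => w tt) (fun p _ => (p false * c false + p true * c true) / (c false + c true))
  (fun=> 0) (fun=> rho + 1) (fun _ : unit => e) (e * (c false + c true)) (B + sg) (B + sg)) => //; first by right.
- by move=> j; exact: ucont_proj.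
- move=> j; apply: ucontM; last exact: ucont_cst.
  by apply: ucontD; apply: ucontM; try exact: ucont_proj; exact: ucont_cst.
- move=> w; apply/funext => -[]; rewrite -mulrDr mulfK //; exact: lt0r_neq0.
- by move=> j; apply/andP; split; lra.
- clear Klow sqv e1 e0 mn BM B0 => q p /(congr1 (fun f => f tt)) line.
  have {}line : p false * c false + p true * c true = e * (c false + c true).
    by rewrite -line divfK // lt0r_neq0.
  rewrite sum_bool line mulN1r.
  suff : KK M (- sg) q p <= 0 by lra.
  have mf : Num.min (c false) (c true) <= c false by rewrite ge_min lexx.
  have mt : Num.min (c false) (c true) <= c true by rewrite ge_min lexx orbT.
  have /andP[G0 GM] := @Gf_bnd _ P d M (q false) (q true) (p false) (p true) M0.
  (* The line lets [y] exceed [dl] by at most [tau], proportional to [- x]. Both the truncated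
     Hamiltonian and the growth term in [y] are then bounded by multiples of [tau ^+ 2], hence of
     [x ^+ 2]; the lower bound required of [sg] is the resulting constant. *)
  have key (x y cx cy s : R) : 0 < cx -> 0 < cy -> x < 0 -> x * cx + y * cy <= dl * cy ->
      0 <= y -> (2 * M / dl ^+ 2 + 1) * (cx / cy) ^+ 2 <= sg -> 0 <= s -> s <= M -> (y <= 2 * dl -> s = 0) ->
      s + kf (- sg) x + kf (- sg) y <= 0.
    clear line mf mt G0 GM eE cs al kz Hsg dl2 c0 c1 => cx0 cy0 x0 xy y0 hsg s0 sM sz.
    pose tau := cx / cy * - x.
    have tau0 : 0 < tau by rewrite mulr_gt0 ?divr_gt0 ?oppr_gt0.
    have ytau : y <= dl + tau.
      have -> : dl + tau = (dl * cy - x * cx) / cy by rewrite /tau; field; exact: lt0r_neq0.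
      by rewrite ler_pdivlMr //; lra.
    have s_le : s <= M * tau ^+ 2 / dl ^+ 2.
      have [h1|h1] := leP y (2 * dl).
        by rewrite sz //; apply: divr_ge0; [apply: mulr_ge0 => //|]; exact: sqr_ge0.
      rewrite ler_pdivlMr ?exprn_gt0 //; apply: ler_pM => //; first exact: sqr_ge0.
      by rewrite ler_sqr ?nnegrE; lra.
    have ky : kf (- sg) y <= tau ^+ 2 / 2.
      rewrite /kf (pos_eq0 (s := - y)) ?expr0n /= ?mulr0 ?addr0; last lra.
      by rewrite ler_pM2r ?invr_gt0 //; apply: pos_sq_le; lra.
    have kx : kf (- sg) x = - (sg / 2 * x ^+ 2).
      rewrite /kf (pos_eq0 (s := x - rho)) ?(pos_id (s := - x)) ?sqrrN; [|lra|lra].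
      by rewrite expr0n /= mul0r add0r mulNr mulNr.
    have h2 : (2 * M / dl ^+ 2 + 1) * (cx / cy) ^+ 2 * x ^+ 2 <= sg * x ^+ 2 by apply: ler_wpM2r; [exact: sqr_ge0|].
    have h3 : (2 * M / dl ^+ 2 + 1) * (cx / cy) ^+ 2 * x ^+ 2 = 2 * (M * tau ^+ 2 / dl ^+ 2) + tau ^+ 2.
      by rewrite /tau; field; rewrite !lt0r_neq0.
    rewrite kx; lra.
  have k0 : 0 <= 2 * M / dl ^+ 2 + 1.
    by apply: addr_ge0 => //; apply: divr_ge0; [apply: mulr_ge0|exact: sqr_ge0].
  have q1 := sqr_ge0 (c false / c true); have q2 := sqr_ge0 (c true / c false).
  rewrite /KK; have [p0|p0] : p false < 0 \/ 0 <= p false by case: ltrP; [left|right].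
    have p1 : 0 <= p true by rewrite leNgt; apply/negP => p1; nra.
    apply: (key _ _ (c false) (c true)) => //; [nra|nra|].
    by move=> h1; apply: small_step => //; rewrite (pos_eq0 (ltW p0)) add0r pos_id // -dl2.
  have [p1|p1] : p true < 0 \/ 0 <= p true by case: ltrP; [left|right].
    rewrite addrAC; apply: (key _ _ (c true) (c false)) => //; [nra|nra|].
    by move=> h1; apply: small_step => //; rewrite (pos_eq0 (ltW p1)) addr0 pos_id // -dl2.
  have h0 : p false <= dl by rewrite -(ler_pM2r c0); nra.
  have h1 : p true <= dl by rewrite -(ler_pM2r c1); nra.
  clear mf mt q1 q2 k0 key cs eE al.
  by rewrite !kz ?small_step ?addr0 // ?pos_id // -?dl2; lra.
- clear kz dl0 dl2 dlr eE e0 e1 mn cs al Hsg => w i box wi q v; rewrite mulN1r.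
  have /andP[w0 w1] := box tt.
  have wB : \sum_j w tt * c j <= B.
    by apply: (sum_le_B (w := fun=> w tt)) => j; rewrite ger0_norm.
  have := Klow q (fun j => w tt + v j); have := sqv (w tt) v w0.
  have /andP[G0 _] := @Gf_bnd _ P d M (q false) (q true) (w tt + v false) (w tt + v true) M0.
  set S := \sum_j v j ^+ 2 => hS hK.
  have S0 : 0 <= S by apply: sumr_ge0 => *; exact: sqr_ge0.
  have hK' : Gf P d M (q false) (q true) (w tt + v false) (w tt + v true) - sg / 2 * S <= KK M (- sg) q (fun j => w tt + v j).
    by apply: le_trans hK; rewrite lerD2l lerN2; apply: ler_wpM2l => //; lra.
  case: i wi => -[] wi.
    have -> : \sum_j w tt * c j = 0 by rewrite wi big1 // => *; rewrite mul0r.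
    nra.
  have [vi|vi] := leP (-1) (v false).
    have GM : Gf P d M (q false) (q true) (w tt + v false) (w tt + v true) = M.
      suff hh : 1 <= Ham P d (q false) (q true) (w tt + v false) (w tt + v true).
        by rewrite /Gf; have [-> _] := step_high M hh.
      by apply: (Ham_high h); rewrite wi; lra.
    rewrite GM in hK'; nra.
  have : 1 <= S by rewrite /S sum_bool; have := sqr_ge0 (v true); nra.
  nra.
- clear kz dl0 dl2 dlr eE e0 e1 mn cs al Hsg => w box q v; rewrite mulN1r.
  have /andP[w0 w1] := box tt.
  have wB : \sum_j w tt * c j <= B.
    by apply: (sum_le_B (w := fun=> w tt)) => j; rewrite ger0_norm.
  have := Klow q (fun j => w tt + v j); have := sqv (w tt) v w0.
  have /andP[G0 _] := @Gf_bnd _ P d M (q false) (q true) (w tt + v false) (w tt + v true) M0.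
  set S := \sum_j v j ^+ 2 => hS hK.
  have S0 : 0 <= S by apply: sumr_ge0 => *; exact: sqr_ge0.
  have hK' : Gf P d M (q false) (q true) (w tt + v false) (w tt + v true) - sg / 2 * S <= KK M (- sg) q (fun j => w tt + v j).
    by apply: le_trans hK; rewrite lerD2l lerN2; apply: ler_wpM2l => //; lra.
  nra.
Qed.
End ClosedOrbit.

(** * Orbits meeting the boundary *)

Section StepStrict.
Variable R : realType.

Lemma step1_lt (x y : R) : 1 / 2 <= x -> x < y -> y <= 1 -> step 1 x < step 1 y.
Proof.
move=> x0 xy y1.
have fc : {within `[x, y], continuous (step 1)}.
  by apply: continuous_subspaceT => t; exact: derive_cont (step_derive 1 t).
have [c] := MVT xy (fun t _ => step_derive 1 t) fc; rewrite in_itv /= => /andP[c1 c2] e.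
rewrite -subr_gt0 e mulr_gt0 ?subr_gt0 //; apply: dstep_mid; lra.
Qed.

Lemma dstep_neq0 (h : R) : dstep 1 h != 0 -> [/\ 1 / 2 < h, h < 1, 0 < dstep 1 h & 0 < step 1 h < 1].
Proof.
move=> dn; have h1 : 1 / 2 < h by rewrite ltNge; apply/negP => /(step_low 1)[_ e]; rewrite e eqxx in dn.
have h2 : h < 1 by rewrite ltNge; apply/negP => /(step_high 1)[_ e]; rewrite e eqxx in dn.
split => //; first exact: dstep_mid.
have [e1 _] := step_low 1 (lexx (1 / 2 : R)); have [e2 _] := step_high 1 (lexx (1 : R)).
have l1 : step 1 (1 / 2) < step 1 h by apply: step1_lt => //; lra.
have l2 : step 1 h < step 1 1 by apply: step1_lt => //; lra.
by rewrite e1 in l1; rewrite e2 in l2; rewrite l1.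
Qed.

Lemma cst_increment (a : R -> R) (k c : R) : (forall t, is_derive t (1 : R) a k) -> a 1 = a 0 + c -> k = c.
Proof. by move=> ad e; have [_ _] := mean_value 0 1 ad; rewrite e subr0 mulr1 => <-; ring. Qed.
End StepStrict.

Section Dynamics.
Variable R : realType.
Implicit Types (P : profile R).

Definition flow P (d u0 M s : R) (a b p r : R -> R) := [/\
  forall t : R, is_derive t (1 : R) a (GP P d M (a t) (b t) (p t) (r t) + dkf u0 s (p t)),
  forall t : R, is_derive t (1 : R) b (GP (swap P) d M (b t) (a t) (r t) (p t) + dkf u0 s (r t)),
  forall t : R, is_derive t (1 : R) p (- GA P d M (a t) (b t) (p t) (r t)) &
  forall t : R, is_derive t (1 : R) r (- GA (swap P) d M (b t) (a t) (r t) (p t))].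

Lemma flow_swap P d u0 M s a b p r : flow P d u0 M s a b p r -> flow (swap P) d u0 M s b a r p.
Proof. by case=> *; split; rewrite ?swapK. Qed.

Lemma flow_sign P d u0 u1 M s a b p r : adm P d u0 u1 -> 0 <= M -> flow P d u0 M s a b p r ->
  (forall t, 0 < p t) \/ (forall t, p t <= 0).
Proof.
move=> h M0 [_ _ pd _]; have [C C0 CP] := GA_linear h M0.
by apply: (gronwall_sign pd) => t; rewrite normrN; exact: CP.
Qed.

(* Hamilton's equations on a level set, in the angles and x = chi(p, r). *)
Definition interior_orbit P (a b x : R -> R) := forall t : R, [/\ 0 < x t, x t < pi / 2,
  is_derive t (1 : R) a (pU P (a t) (b t) (x t) / 2 + pX P (a t) (b t) (x t) * (cos (x t) / sin (x t)) / 4),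
  is_derive t (1 : R) b (pU P (a t) (b t) (x t) / 2 - pX P (a t) (b t) (x t) * (sin (x t) / cos (x t)) / 4) &
  is_derive t (1 : R) x (pB P (a t) (b t) (x t) * (sin (x t) / cos (x t)) / 4 - pA P (a t) (b t) (x t) * (cos (x t) / sin (x t)) / 4)].

(* The boundary flow on x = 0, with the angle a as a function of the angle b. *)
Definition boundary_rotation P (eta : R) := exists Th : R -> R,
  (forall y : R, is_derive y (1 : R) Th (b0 P (Th y) y / (pU P 0 y 0 / 2))) /\
  forall e : R, 0 < e -> exists Y : R, forall y, Y <= y -> `|Th y - eta * y| <= e * y.

Section Cases.
Variables (P : profile R) (d u0 u1 : R) (h : adm P d u0 u1).
Let g := adm_good h.
Let h' := adm_swap h.
Local Notation rho := (4 / u0).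
Variables (M sg eps : R) (M0 : 0 < M) (sg1 : 1 <= sg) (eps1 : eps = 1 \/ eps = -1).
Variables (a b p r : R -> R) (fl : flow P d u0 M (eps * sg) a b p r).
Variables (c0 c1 : R) (ac : forall t, a (t + 1) = a t + c0) (bc : forall t, b (t + 1) = b t + c1).
Hypotheses (pc : forall t, p (t + 1) = p t) (rc : forall t, r (t + 1) = r t).
Hypothesis W0 : Gf P d M (a 0) (b 0) (p 0) (r 0) + kf u0 (eps * sg) (p 0) + kf u0 (eps * sg) (r 0) <
      p 0 * (GP P d M (a 0) (b 0) (p 0) (r 0) + dkf u0 (eps * sg) (p 0)) +
      r 0 * (GP (swap P) d M (b 0) (a 0) (r 0) (p 0) + dkf u0 (eps * sg) (r 0)).
Hypothesis Mbig : (rho + `|c0| + `|c1|) * (`|c0| + `|c1|) <= M.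
Let H t := Ham P d (a t) (b t) (p t) (r t).

Lemma G_dstep0 t : dstep 1 (H t) = 0 -> [/\ GA P d M (a t) (b t) (p t) (r t) = 0,
  GP P d M (a t) (b t) (p t) (r t) = 0, GA (swap P) d M (b t) (a t) (r t) (p t) = 0 &
  GP (swap P) d M (b t) (a t) (r t) (p t) = 0].
Proof. by move=> z; rewrite /GA /GP !Ham_swap dstepE -/(H t) z mulr0 !mul0r. Qed.

Lemma frozen : (forall t, dstep 1 (H t) = 0) -> [/\ forall t, p t = p 0, forall t, r t = r 0,
  dkf u0 (eps * sg) (p 0) = c0 & dkf u0 (eps * sg) (r 0) = c1].
Proof.
move=> z; case: fl => ad bd pd rd.
have pE t : p t = p 0.
  by apply: derive0_cst => s; have := pd s; have [-> _ _ _] := G_dstep0 (z s); rewrite oppr0.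
have rE t : r t = r 0.
  by apply: derive0_cst => s; have := rd s; have [_ _ -> _] := G_dstep0 (z s); rewrite oppr0.
split => //.
  apply: (@cst_increment _ a); last by rewrite -(ac 0) add0r.
  by move=> t; have := ad t; have [_ -> _ _] := G_dstep0 (z t); rewrite add0r pE.
apply: (@cst_increment _ b); last by rewrite -(bc 0) add0r.
by move=> t; have := bd t; have [_ _ _ ->] := G_dstep0 (z t); rewrite add0r rE.
Qed.

Lemma frozen_action : (forall t, dstep 1 (H t) = 0) ->
  Gf P d M (a 0) (b 0) (p 0) (r 0) + kf u0 (eps * sg) (p 0) + kf u0 (eps * sg) (r 0) < p 0 * c0 + r 0 * c1.
Proof.
move=> z; have [_ _ e1 e2] := frozen z; have W := W0.
by have [_ e3 _ e4] := G_dstep0 (z 0); rewrite e3 e4 !add0r e1 e2 in W.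
Qed.

(** The share of one momentum in the action of a frozen trajectory; [frozen_high] plays the sum of
    two such bounds against the plateau [M]. *)
Lemma term_bound s c : dkf u0 (eps * sg) s = c -> s * c - kf u0 (eps * sg) s <= rho * `|c| + `|c| ^+ 2.
Proof.
move=> e; have r0 := rho_gt0 h; have sg1' := sg1; have n0 := normr_ge0 c.
have nc := ler_norm c; have nc2 : `|c| ^+ 2 = c ^+ 2 by rewrite real_normK ?num_real.
have rn : 0 <= rho * `|c| by rewrite mulr_ge0 // ltW.
have [s0|s0] := leP 0 s; last first.
  move: e; rewrite /dkf /kf (pos_eq0 (s := s - rho)) ?(pos_id (s := - s)); [|lra|lra].
  rewrite expr0n /= mul0r !add0r => e.
  have e' : c = eps * sg * s by rewrite -e; ring.
  have : s * c - eps * sg / 2 * (- s) ^+ 2 = s * c / 2 by rewrite e'; field.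
  move=> ->; have e2 : c ^+ 2 = sg * (eps * (s * c)).
    by rewrite expr2 {1}e'; ring.
  have : s * c <= c ^+ 2.
    have q0 : 0 <= sg * s ^+ 2 by apply: mulr_ge0; [lra|exact: sqr_ge0].
    have qE : s * c = eps * (sg * s ^+ 2) by rewrite e'; ring.
    rewrite e2 qE; case: eps1 => ->; nra.
  have := sqr_ge0 c; rewrite nc2; lra.
have k0 : kf u0 (eps * sg) s = pos (s - rho) ^+ 2 / 2.
  by rewrite /kf (pos_eq0 (s := - s)) ?expr0n /= ?mulr0 ?addr0 //; lra.
have dE : pos (s - rho) = c by rewrite -e /dkf (pos_eq0 (s := - s)) ?mulr0 ?subr0 //; lra.
rewrite k0 dE nc2; have [sr|sr] := leP s rho.
  have z : c = 0 by rewrite -dE pos_eq0 //; lra.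
  by rewrite z normr0 !mulr0 expr0n mul0r subr0 addr0.
have sE : s = rho + c by rewrite -dE pos_id; lra.
by rewrite sE; nra.
Qed.

Lemma frozen_high : (forall t, dstep 1 (H t) = 0) -> 1 <= H 0 -> False.
Proof.
move=> z H1; have := frozen_action z; have [_ _ e1 e2] := frozen z.
have -> : Gf P d M (a 0) (b 0) (p 0) (r 0) = M by rewrite /Gf; have [-> _] := step_high M H1.
have := term_bound e1; have := term_bound e2; have := Mbig.
have n0 := normr_ge0 c0; have n1 := normr_ge0 c1; nra.
Qed.

(** [Ham] stays below the truncation and only the correction acts, so the inequality at time 0
    becomes [0 < eps * sg * (p ^+ 2 + r ^+ 2) / 2]. This is absurd for [eps = -1]; for [eps = 1] the
    velocities [sg * p] and [sg * r] are nonpositive, while a coordinate of [c] is positive. *)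
Lemma both_nonpos : (forall t, p t <= 0) -> (forall t, r t <= 0) ->
  (eps = 1 -> 0 < c0 \/ 0 < c1) -> False.
Proof.
move=> p0 r0 cpos.
have low t : H t <= 1 / 2 by have := Ham_nonpos h (a t) (b t) (p0 t) (r0 t); rewrite -/(H t); lra.
have z t : dstep 1 (H t) = 0 by have [_ ->] := step_low 1 (low t).
have := frozen_action z; have [_ _ e1 e2] := frozen z.
have -> : Gf P d M (a 0) (b 0) (p 0) (r 0) = 0 by rewrite /Gf; have [-> _] := step_low M (low 0).
have rho0 := rho_gt0 h; have := p0 0; have := r0 0; rewrite -e1 -e2 /kf /dkf => hr hp.
rewrite !(pos_eq0 (s := _ - rho)) ?(pos_id (s := - p 0)) ?(pos_id (s := - r 0)); try lra.
have k : 0 <= p 0 ^+ 2 + r 0 ^+ 2 by rewrite addr_ge0 ?sqr_ge0.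
have sg1' := sg1; case: eps1 cpos => eE cpos; rewrite eE; last by nra.
move=> _; case: (cpos eE); rewrite -?e1 -?e2 /dkf eE.
  rewrite (pos_eq0 (s := _ - rho)) ?(pos_id (s := - p 0)); try lra; nra.
rewrite (pos_eq0 (s := _ - rho)) ?(pos_id (s := - r 0)); try lra; nra.
Qed.

Lemma HamA_pos x y s t : 0 < s -> 0 < t -> HamA P d x y s t = (s + t) / 2 * pA P x y (chi s t).
Proof.
move=> s0 t0; rewrite /HamA !bet_nneg ?(ltW s0) ?(ltW t0) ?(adm_d h) // !mul0r !addr0.
by rewrite !pos_id // ltW.
Qed.

Lemma HamP_pos x y s t : 0 < s -> 0 < t ->
  HamP P d x y s t = pU P x y (chi s t) / 2 + pX P x y (chi s t) * (cos (chi s t) / sin (chi s t)) / 4.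
Proof.
move=> s0 t0; rewrite /HamP !pos_id ?(ltW s0) ?(ltW t0) //.
have d0 := adm_d h; have si := sin_chi_gt0 s0 (ltW t0).
have -> : dbet d s = 1.
  by rewrite /dbet (pos_eq0 (s := - s)) ?subr0 ?pos_id ?divff ?lt0r_neq0 // ?ltW //; lra.
rewrite /qx; have -> : (chi s t == 0) = false by apply/eqP => z; rewrite z sin0 ltxx in si.
by field; exact: lt0r_neq0.
Qed.

(** For positive momenta the correction acts only beyond [rho], and there the truncation is
    saturated and its derivatives vanish. *)
Lemma energy_cst : (forall t, 0 < p t) -> (forall t, 0 < r t) ->
  forall t, Gf P d M (a t) (b t) (p t) (r t) = Gf P d M (a 0) (b 0) (p 0) (r 0).
Proof.
move=> p0 r0 t; case: fl => ad bd pd rd.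
apply: (@derive0_cst _ (fun t => Gf P d M (a t) (b t) (p t) (r t))) => s.
have D := der_comp4 (Gf_dA h M) (Gf_dB h M) (Gf_dP h M) (Gf_dR h M) (GA_compact h M).1
  (unif4_flip (GA_compact h' M).1) (GP_compact h M).1 (unif4_flip (GP_compact h' M).1) (ad s) (bd s) (pd s) (rd s).
apply: (is_derive_conv D) => //.
have dk x : 0 < x -> x <= rho -> dkf u0 (eps * sg) x = 0.
  by move=> x0 xr; rewrite /dkf !pos_eq0 ?mulr0 ?subr0 //; lra.
have z1 : GA P d M (a s) (b s) (p s) (r s) * dkf u0 (eps * sg) (p s) = 0.
  have [ps|ps] := leP (p s) rho; first by rewrite (dk _ (p0 s) ps) mulr0.
  by rewrite /GA; have [_ ->] := step_high M (Ham_high h (a s) (b s) (r s) (ltW ps)); rewrite !mul0r.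
have z2 : GA (swap P) d M (b s) (a s) (r s) (p s) * dkf u0 (eps * sg) (r s) = 0.
  have [rs|rs] := leP (r s) rho; first by rewrite (dk _ (r0 s) rs) mulr0.
  by rewrite /GA; have [_ ->] := step_high M (Ham_high h' (b s) (a s) (p s) (ltW rs)); rewrite !mul0r.
rewrite -[RHS](addr0 0) -{1}z1 -z2; ring.
Qed.

(** Below level 1 the momenta lie in [(0, rho)], where the correction vanishes as well: nothing
    moves, and [c] would be 0. *)
Lemma low_frozen : (forall t, 0 < p t) -> (forall t, 0 < r t) -> (0 < c0 \/ 0 < c1) ->
  (forall t, dstep 1 (H t) = 0) -> False.
Proof.
move=> p0 r0 cpos z; have [H1|H1] := leP 1 (H 0); first exact: frozen_high z H1.
have [_ _ e1 e2] := frozen z.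
have lt_rho x (y : R) : (rho <= x -> 1 <= H 0) -> 0 < x -> dkf u0 (eps * sg) x = y -> y = 0.
  move=> hx x0 <-; have xr : x < rho by rewrite ltNge; apply/negP => /hx; lra.
  by rewrite /dkf !pos_eq0 ?mulr0 ?subr0 //; lra.
have z0 : c0 = 0 by apply: lt_rho e1 => //; exact: (Ham_high h).
have z1 : c1 = 0 by apply: lt_rho e2 => //; exact: (Ham_highR h).
by case: cpos; rewrite ?z0 ?z1 ltxx.
Qed.

(** At some instant [dstep] is nonzero. Conservation of the truncation then fixes the value of
    [Ham], and the trajectory is one of [Ham] itself, run at the constant speed
    [T = dstep M (H t0)]; dividing time by this speed turns the period 1 into [T]. *)
Lemma interior_case : (forall t, 0 < p t) -> (forall t, 0 < r t) -> (0 < c0 \/ 0 < c1) ->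
  exists (a' b' x' : R -> R) (T : R), [/\ 0 < T, interior_orbit P a' b' x', forall t, a' (t + T) = a' t + c0,
    forall t, b' (t + T) = b' t + c1 & forall t, x' (t + T) = x' t].
Proof.
move=> p0 r0 cpos.
have [t0 t0P] : exists t0, dstep 1 (H t0) != 0.
  by apply: contrapT => no; apply: (low_frozen p0 r0 cpos) => t; apply/eqP/negPn/negP => dn; apply: no; exists t.
have [h1 h2 d0 s01] := dstep_neq0 t0P.
have HE t : H t = H t0.
  apply/esym/step1_inj => //; have := energy_cst p0 r0 t; rewrite -(energy_cst p0 r0 t0) /Gf !(stepE M).
  by move/(mulfI (lt0r_neq0 M0)).
pose T := dstep M (H t0).
have T0 : 0 < T by rewrite /T dstepE mulr_gt0.
have pr t : p t < rho.
  by rewrite ltNge; apply/negP => /(Ham_high h (a t) (b t) (r t)); rewrite -/(H t) HE; lra.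
have rr t : r t < rho.
  by rewrite ltNge; apply/negP => /(Ham_highR h (a t) (b t) (p t)); rewrite -/(H t) HE; lra.
have dk x : 0 < x -> x < rho -> dkf u0 (eps * sg) x = 0.
  by move=> x0 xr; rewrite /dkf !pos_eq0 ?mulr0 ?subr0 //; lra.
case: fl => ad bd pd rd.
pose i := T^-1.
have i0 : 0 < i by rewrite invr_gt0.
have iT : i * T = 1 by rewrite mulVf // lt0r_neq0.
pose x t := chi (p t) (r t).
have S0 t : 0 < p t + r t by rewrite addr_gt0.
have xs t : 0 < sin (x t) by apply: sin_chi_gt0 => //; exact: ltW.
have xc t : 0 < cos (x t) by apply: cos_chi_gt0 => //; exact: ltW.
have xswap t : chi (r t) (p t) = pi / 2 - x t by apply: chi_swap => //; exact: ltW.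
have adE t : is_derive t (1 : R) a (T * (pU P (a t) (b t) (x t) / 2 + pX P (a t) (b t) (x t) * (cos (x t) / sin (x t)) / 4)).
  have := ad t; rewrite (dk _ (p0 t) (pr t)) addr0 /GP -/(H t) HE HamP_pos //.
have bdE t : is_derive t (1 : R) b (T * (pU P (a t) (b t) (x t) / 2 - pX P (a t) (b t) (x t) * (sin (x t) / cos (x t)) / 4)).
  have := bd t; rewrite (dk _ (r0 t) (rr t)) addr0 /GP Ham_swap -/(H t) HE.
  have si := sin_chi_gt0 (r0 t) (ltW (p0 t)); rewrite xswap sin_pihalfB in si.
  rewrite /HamP !pos_id ?ltW // xswap.
  have -> : dbet d (r t) = 1.
    have dd := adm_d h; have rt := r0 t.
    by rewrite /dbet (pos_eq0 (s := - r t)) ?subr0 ?pos_id ?divff ?lt0r_neq0 // ?ltW //; lra.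
  rewrite /qx; have -> : (pi / 2 - x t == 0) = false.
    by apply/eqP => z; have := xc t; rewrite -sin_pihalfB z sin0 ltxx.
  rewrite /= /flip sin_pihalfB cos_pihalfB opprB addrCA subrr addr0 => D.
  apply: (is_derive_conv D) => //; rewrite /T; field; exact: lt0r_neq0.
have pdE t : is_derive t (1 : R) p (- (T * ((p t + r t) / 2 * pA P (a t) (b t) (x t)))).
  by have := pd t; rewrite /GA -/(H t) HE HamA_pos.
have rdE t : is_derive t (1 : R) r (- (T * ((p t + r t) / 2 * pB P (a t) (b t) (x t)))).
  have := rd t; rewrite /GA Ham_swap -/(H t) HE /HamA !bet_nneg ?ltW ?(adm_d h) // !mul0r !addr0.
  by rewrite !pos_id ?ltW // xswap /= /flip opprB addrCA subrr addr0 (addrC (r t)).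
have xdE t : is_derive t (1 : R) x (T * (pB P (a t) (b t) (x t) * (sin (x t) / cos (x t)) / 4 - pA P (a t) (b t) (x t) * (cos (x t) / sin (x t)) / 4)).
  pose y s := r s / (p s + r s).
  have dS := der_add (pdE t) (rdE t).
  have dV : is_derive t (1 : R) (fun s => (p s + r s)^-1) (- (p t + r t) ^- 2 *: (- (T * ((p t + r t) / 2 * pA P (a t) (b t) (x t))) + - (T * ((p t + r t) / 2 * pB P (a t) (b t) (x t))))).
    by apply: is_deriveV; exact: lt0r_neq0.
  have dy := der_mul (rdE t) dV.
  have y0 : 0 < r t / (p t + r t) by rewrite divr_gt0.
  have d3 := der_comp dy (is_derive1_sqrt y0).
  have cE : Num.sqrt (r t / (p t + r t)) = cos (x t) by rewrite /x cos_chi ?ltW.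
  have y1 : -1 < Num.sqrt (r t / (p t + r t)) < 1.
    apply/andP; split; first by rewrite cE; apply: lt_trans (xc t); lra.
    rewrite -[ltRHS]sqrtr1 ltr_sqrt // ltr_pdivrMr // mul1r; have := p0 t; lra.
  have d4 := der_comp d3 (is_derive1_acos y1).
  apply: (is_derive_conv d4) => //.
  have -> : Num.sqrt (1 - Num.sqrt (r t / (p t + r t)) ^+ 2) = sin (x t).
    by rewrite -sin_acos //; apply/andP; split; have /andP[] := y1; lra.
  rewrite cE /GRing.scale /=.
  have rE : r t = (p t + r t) * cos (x t) ^+ 2 by rewrite /x cos2_chi ?ltW.
  have pE : p t = (p t + r t) * sin (x t) ^+ 2 by rewrite /x sin2_chi ?ltW.
  have cs1 : cos (x t) ^+ 2 + sin (x t) ^+ 2 = 1 by exact: cos2Dsin2.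
  have S1 := lt0r_neq0 (S0 t); set S := p t + r t in rE S1 *.
  set C := cos (x t) in rE cs1 *; set D := sin (x t) in cs1 *.
  have C0 : C != 0 by exact: lt0r_neq0 (xc t).
  have D0 : D != 0 by exact: lt0r_neq0 (xs t).
  set A := pA _ _ _ _; set B := pB _ _ _ _.
  have CE : C ^+ 2 = 1 - D ^+ 2 by lra.
  have e1 : B * (D / C) / 4 - A * (C / D) / 4 = (B * D ^+ 2 - A * C ^+ 2) / (4 * C * D).
    by field; rewrite C0 D0.
  have e2 : - (T * (S / 2 * B)) / S + r t * (- S ^- 2 * (- (T * (S / 2 * A)) + - (T * (S / 2 * B)))) =
    T / 2 * (A * C ^+ 2 - B * D ^+ 2).
    rewrite rE; have -> : D ^+ 2 = 1 - C ^+ 2 by lra.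
    by field.
  rewrite e1 e2; field; rewrite C0 D0 //.
exists (fun t => a (i * t)), (fun t => b (i * t)), (fun t => x (i * t)), T; split => //.
- move=> t; have [x0 x1] : 0 < x (i * t) /\ x (i * t) < pi / 2.
    have /andP[k1 k2] := chi_range (ltW (p0 (i * t))) (ltW (r0 (i * t))).
    split; rewrite lt_neqAle ?k1 ?k2 andbT; apply/eqP => z.
      by have := xs (i * t); rewrite -z sin0 ltxx.
    by have := xc (i * t); rewrite z cos_pihalf ltxx.
  have k (y : R) : i * (T * y) = y by rewrite mulrA iT mul1r.
  split => //.
  + by have := is_derive_scale i adE t; rewrite k.
  + by have := is_derive_scale i bdE t; rewrite k.
  + by have := is_derive_scale i xdE t; rewrite k.
- by move=> t; rewrite mulrDr iT ac.
- by move=> t; rewrite mulrDr iT bc.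
- by move=> t; rewrite mulrDr iT /x pc rc.
Qed.

(** For [p <= 0 < r] the angle [b] follows the link and [a] the flow linearized along it, up to a
    perturbation that lowers the derivative of [eps * a]. Comparison with the boundary flow [Th]
    over many periods bounds the mean advance of [eps * a] by [eps * eta * c1], against the
    hypothesis. *)
Lemma mixed_case eta : boundary_rotation P eta -> (forall t, p t <= 0) -> (forall t, 0 < r t) -> M / d ^+ 2 <= sg ->
  (0 < c1 -> eps * (eta * c1) < eps * c0) -> (c1 <= 0 -> 0 < eps * c0) -> False.
Proof.
move=> [Th [Thd ThY]] p0 r0 sgM hc1 hc0; case: fl => ad bd pd rd.
have dd := adm_d h; have rho0 := rho_gt0 h; have sg1' := sg1; have M0' := M0.
have ee : eps * eps = 1 by case: eps1 => ->; ring.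
(* This quantity is conserved, because beyond [rho] the derivative of the truncation vanishes. Hence
   [r] stays on one side of [rho], and the far side is excluded by [frozen_high]. *)
have qE t : pos (r t - rho) ^+ 2 = pos (r 0 - rho) ^+ 2.
  apply: (@derive0_cst _ (fun t => pos (r t - rho) ^+ 2)) => s.
  have D := der_comp (der_sub (rd s) (der_cst rho s)) (is_derive_pos_sq (r s - rho)).
  apply: (is_derive_conv D) => //.
  have [rs|rs] := leP (r s) rho; first by rewrite pos_eq0 ?mulr0 ?mul0r //; lra.
  by rewrite /GA; have [_ ->] := step_high M (Ham_high h' (b s) (a s) (p s) (ltW rs)); rewrite mul0r !oppr0 addr0 mulr0.
have [rhi|rlo] := ltP rho (r 0).
  have rh t : rho < r t.
    rewrite ltNge; apply/negP => rt; have := qE t; rewrite (pos_eq0 (s := r t - rho)) ?(pos_id (s := r 0 - rho)); [|lra|lra].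
    rewrite expr0n /= => /esym/eqP; rewrite sqrf_eq0 => /eqP; lra.
  apply: frozen_high; last exact: (Ham_highR h _ _ _ (ltW rhi)).
  by move=> t; have [_ ->] := step_high 1 (Ham_highR h (a t) (b t) (p t) (ltW (rh t))).
have rlow t : r t <= rho.
  rewrite leNgt; apply/negP => rt; have := qE t; rewrite (pos_id (s := r t - rho)) ?(pos_eq0 (s := r 0 - rho)); [|lra|lra].
  rewrite expr0n /= => /eqP; rewrite sqrf_eq0 => /eqP; lra.
pose m t := dstep M (H t).
have m01 t : 0 <= m t <= 4 * M.
  rewrite /m dstepE; have /andP[k1 k2] := dstep1_bnd (H t).
  by rewrite mulr_ge0 ?(ltW M0) //= mulrC; apply: ler_wpM2r => //; exact: ltW.
pose u t := pU P 0 (b t) 0 / 2.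
have u_gt0 t : 0 < u t by rewrite divr_gt0 // (U_gt0 g).
have bdE t : is_derive t (1 : R) b (m t * u t).
  have := bd t; rewrite /dkf (pos_eq0 (s := r t - rho)) ?(pos_eq0 (s := - r t)) ?mulr0 ?subr0 ?addr0; try by [have := r0 t; lra|have := rlow t; lra].
  rewrite /GP Ham_swap -/(H t) -/(m t) /HamP (pos_eq0 (p0 t)) (pos_id (ltW (r0 t))) chi_p0 //.
  rewrite cos_pihalf mulr0 mul0r addr0 /= /flip subrr.
  have -> : dbet d (r t) = 1.
    by rewrite /dbet (pos_eq0 (s := - r t)) ?subr0 ?pos_id ?divff ?lt0r_neq0 // ?ltW //; have := r0 t; lra.
  by rewrite mul1r (U_0 g (a t) 0).
have adE t : is_derive t (1 : R) a (m t * (dbet d (p t) * b0 P (a t) (b t)) + eps * sg * p t).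
  have := ad t; rewrite /dkf (pos_eq0 (s := p t - rho)) ?(pos_id (s := - p t)); try by have := p0 t; lra.
  rewrite /GP -/(H t) -/(m t) /HamP (pos_eq0 (p0 t)) (pos_id (ltW (r0 t))) chi_0r // cos0 /qx eqxx mulr1 -/(b0 P (a t) (b t)) => D.
  by apply: (is_derive_conv D) => //; ring.
(* Flattening the extension changes the velocity of [a] by at most [M / d ^+ 2 * |p|]; the
   correction lowers the velocity of [eps * a] by [sg * |p|], which is at least as much. *)
have slow t : eps * (m t * (dbet d (p t) * b0 P (a t) (b t)) + eps * sg * p t) <= eps * (m t * b0 P (a t) (b t)).
  have pn : `|p t| = - p t by rewrite ler0_norm.
  have /andP[m0 m4] := m01 t; have nb := dbet_near dd (p0 t); have /andP[_ db1] := dbet_bnd dd (p t).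
  have bb := adm_b0 h (a t) (b t); set v := b0 P (a t) (b t) in bb *.
  have -> : eps * (m t * (dbet d (p t) * v) + eps * sg * p t) =
    eps * (m t * v) - eps * (m t * ((1 - dbet d (p t)) * v)) + (eps * eps) * sg * p t by ring.
  rewrite ee mul1r.
  have k1 : `|eps * (m t * ((1 - dbet d (p t)) * v))| <= M / d ^+ 2 * `|p t|.
    have -> : `|eps * (m t * ((1 - dbet d (p t)) * v))| = m t * ((1 - dbet d (p t)) * `|v|).
      rewrite normrM (normrM (m t)) (normrM (1 - _)) (ger0_norm m0) [`|1 - _|]ger0_norm ?subr_ge0 //.
      by case: eps1 => ->; rewrite ?normrN normr1 mul1r.
    have k2 : m t * ((1 - dbet d (p t)) * `|v|) <= 4 * M * (`|p t| / d * (1 / 4 / d)).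
      apply: ler_pM => //; first by rewrite mulr_ge0 // subr_ge0.
      apply: ler_pM => //; first by rewrite subr_ge0.
      by rewrite ler_pdivlMr // mulrC.
    apply: le_trans k2 _; rewrite le_eqVlt; apply/orP; left; apply/eqP; field; exact: lt0r_neq0.
  have k3 : M / d ^+ 2 * `|p t| <= sg * `|p t| by apply: ler_wpM2r.
  have k4 := ler_norm (- (eps * (m t * ((1 - dbet d (p t)) * v)))); rewrite normrN in k4.
  have k5 := le_trans k4 (le_trans k1 k3); rewrite pn in k5.
  by move: (eps * (m t * v)) (eps * (m t * ((1 - dbet d (p t)) * v))) k5 => X Y k5; lra.
have bmono s t : s <= t -> b s <= b t.
  by apply: (derive_ge0_mono bdE) => w; have /andP[k _] := m01 w; rewrite mulr_ge0 // ltW.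
have ad_eps t : is_derive t (1 : R) (fun t => eps * a t) (eps * (m t * (dbet d (p t) * b0 P (a t) (b t)) + eps * sg * p t)).
  exact: der_cmul.
(* If [c1 <= 0], the nondecreasing angle [b] is constant, which forces [m = 0], and then [eps * a]
   cannot increase. *)
have [c1pos|c1neg] := ltP 0 c1; last first.
  have bloc (s t : R) : s <= t -> t <= s + 1 -> b t = b s.
    move=> st ts; apply/le_anti/andP; split; last exact: bmono.
    by apply: le_trans (bmono _ _ ts) _; rewrite bc; lra.
  have m0 t : m t = 0.
    have D : is_derive t (1 : R) b 0.
      apply: (is_derive_local ltr01 _ (der_cst (b t) t)) => s; rewrite ltr_norml => /andP[s1 s2].
      by have [ts|ts] := leP t s; [rewrite (bloc t s) //; lra|rewrite (bloc s t) //; lra].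
    have /eqP := derive_uniq (bdE t) D; rewrite mulf_eq0 => /orP[/eqP //|/eqP z].
    by have := u_gt0 t; rewrite z ltxx.
  have := hc0 c1neg; suff : eps * a 1 <= eps * a 0 by rewrite -(add0r 1) ac mulrDr; lra.
  rewrite -lerN2; apply: (@derive_ge0_mono _ (fun t => - (eps * a t)) _ (fun t => der_opp (ad_eps t))) => // t.
  by have := slow t; rewrite m0 !mul0r mulr0; lra.
have [C C0 CP] := b0_bound g.
(* A lift of the boundary flow that starts ahead of [a] in the direction of [eps]; by comparison it
   stays ahead. *)
have [k kP] : exists k : int, eps * a 0 <= eps * (Th (b 0) + k%:~R * (2 * pi)).
  have pp := pi_gt0 R; have [n nP] := archi_bound (`|a 0 - Th (b 0)|).
  have n2 : `|a 0 - Th (b 0)| <= n%:R * (2 * pi).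
    have : (1 : R) <= 2 * pi by have := pihalf_ge1 R; lra.
    have : (0 : R) <= n%:R by []. nra.
  case: eps1 => ->; [exists n%:Z|exists (- n%:Z)]; rewrite ?mulrNz; move: n2; rewrite ler_norml => /andP[] *; lra.
pose D t := eps * a t - eps * (Th (b t) + k%:~R * (2 * pi)).
have perb y z : b0 P (y + k%:~R * (2 * pi)) z = b0 P y z.
  have perk : per3 (pU P) (k%:~R * (2 * pi)) 0.
    move=> x1 x2 x3; have := @per4_int _ (fun a b p _ => pU P a b p) (2 * pi) 0 k (fun a b p _ => perU_a g a b p) x1 x2 x3 0.
    by rewrite mulr0.
  by have [e1 _ _] := b0_per h perk y z; rewrite addr0 in e1.
have Dd t : is_derive t (1 : R) D (eps * (m t * (dbet d (p t) * b0 P (a t) (b t)) + eps * sg * p t) -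
    eps * (m t * b0 P (Th (b t) + k%:~R * (2 * pi)) (b t))).
  have D1 := der_comp (bdE t) (Thd (b t)).
  have D2 := der_cmul eps (der_add D1 (der_cst (k%:~R * (2 * pi)) t)).
  apply: (is_derive_conv (der_sub (ad_eps t) D2)) => //.
  rewrite perb -/(u t); congr (_ - eps * _); rewrite addr0; field; exact: lt0r_neq0.
have Dle t : 0 <= t -> D t <= 0.
  apply: (comparison0 (C := 4 * M * C) Dd); last by rewrite /D; lra.
  move=> s; have := slow s; have /andP[m0 m4] := m01 s.
  have [w _ wE] := mean_value (Th (b s) + k%:~R * (2 * pi)) (a s) (fun y => b0_dA g y (b s)).
  have [_ wC] := CP w (b s).
  have -> : `|D s| = `|a s - (Th (b s) + k%:~R * (2 * pi))|.
    rewrite /D -mulrBr normrM; case: eps1 => ->; by rewrite ?normrN normr1 mul1r.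
  set z := a s - _ in wE *.
  have k1 : eps * (m s * b0 P (a s) (b s)) - eps * (m s * b0 P (Th (b s) + k%:~R * (2 * pi)) (b s)) <= 4 * M * C * `|z|.
    rewrite -!mulrBr wE; apply: le_trans (ler_norm _) _; rewrite normrM (normrM (m s)) (normrM (b0A _ _ _)) (ger0_norm m0).
    have -> : `|eps| = 1 by case: eps1 => ->; rewrite ?normrN normr1.
    by rewrite mul1r -(mulrA (4 * M)); apply: ler_pM => //; exact: ler_wpM2r.
  lra.
have aN n : a n%:R = a 0 + n%:R * c0.
  by elim: n => [|n IH]; [rewrite mul0r addr0|rewrite -natr1 ac IH; ring].
have bN n : b n%:R = b 0 + n%:R * c1.
  by elim: n => [|n IH]; [rewrite mul0r addr0|rewrite -natr1 bc IH; ring].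
(* The strict gap of the hypothesis grows to [n * ka] after [n] periods; the tolerance
   [ka / (2 * c1)] in the rotation number consumes half of it. *)
pose ka := eps * c0 - eps * (eta * c1).
have ka0 : 0 < ka by rewrite subr_gt0; exact: hc1.
have e0 : 0 < ka / (2 * c1) by rewrite divr_gt0 // mulr_gt0.
have [Y YP] := ThY _ e0.
pose Q := eps * (k%:~R * (2 * pi)) - eps * a 0 + eps * (eta * b 0) + ka / (2 * c1) * b 0.
have [n nP] := archi_bound (`|Y - b 0| / c1 + `|2 * Q / ka|).
have n1 : Y <= b 0 + n%:R * c1.
  have : `|Y - b 0| / c1 <= n%:R by have := normr_ge0 (2 * Q / ka); lra.
  rewrite ler_pdivrMr //; have := ler_norm (Y - b 0); lra.
have n2 : Q < n%:R * (ka / 2).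
  have : 2 * Q / ka < n%:R.
    have := ler_norm (2 * Q / ka); have : 0 <= `|Y - b 0| / c1 by rewrite divr_ge0 // ltW.
    lra.
  rewrite ltr_pdivrMr //; lra.
have := Dle n%:R (ler0n _ _); rewrite /D aN bN; have := YP _ n1; set y := b 0 + n%:R * c1 => hy.
have ky : ka / (2 * c1) * y = ka / (2 * c1) * b 0 + n%:R * (ka / 2) by rewrite /y; field; exact: lt0r_neq0.
have ey : eps * Th y <= eps * (eta * y) + ka / (2 * c1) * y.
  by move: hy; rewrite ler_norml => /andP[]; case: eps1 => ->; lra.
have y2 : eps * (eta * y) = eps * (eta * b 0) + n%:R * (eps * (eta * c1)) by rewrite /y; ring.
have Z : eps * (n%:R * c0) = n%:R * (eps * (eta * c1)) + n%:R * (ka / 2) + n%:R * (ka / 2) by rewrite /ka; field.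
rewrite ky y2 in ey; rewrite /Q in n2.
rewrite (mulrDr eps (a 0)) (mulrDr eps (Th y)) Z.
move: (n%:R * (eps * (eta * c1))) (n%:R * (ka / 2)) (ka / (2 * c1) * b 0) (eps * (k%:~R * (2 * pi))) ey n2.
by move=> X1 X2 X3 X4; lra.
Qed.

End Cases.
(** The two orderings of arguments as inequalities between slopes. In the first one a coordinate of
    [c] may be nonpositive, and the inequality it would multiply is then void. *)
Definition twist (eta0 eta1 c0 c1 : R) :=
  [/\ 0 < c0 \/ 0 < c1, 0 < c1 -> eta0 * c1 < c0 & 0 < c0 -> eta1 * c0 < c1] \/
  [/\ 0 < c0, 0 < c1, c0 < eta0 * c1 & c1 < eta1 * c0].

Theorem twist_orbit P c0 c1 eta0 eta1 : good P -> per3 (pU P) c0 c1 ->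
  boundary_rotation P eta0 -> boundary_rotation (swap P) eta1 -> twist eta0 eta1 c0 c1 ->
  exists (a b x : R -> R) (T : R), [/\ 0 < T, interior_orbit P a b x, forall t, a (t + T) = a t + c0,
    forall t, b (t + T) = b t + c1 & forall t, x (t + T) = x t].
Proof.
move=> g per br0 br1 tw; have [d [u0 [u1 h]]] := adm_exists g.
have h' := adm_swap h; have dd := adm_d h; have rho0 := rho_gt0 h.
have n0 := normr_ge0 c0; have n1 := normr_ge0 c1.
pose c (j : bool) := if j then c1 else c0.
pose B := (4 / u0 + 1) * (`|c0| + `|c1|); pose B' := (4 / u0 + `|c0| + `|c1|) * (`|c0| + `|c1|).
have B0 : 0 <= B by rewrite mulr_ge0 //; lra.
have B0' : 0 <= B' by rewrite mulr_ge0 //; lra.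
pose M := B + B' + 1; have M0 : 0 < M by rewrite /M; lra.
pose V := (2 * M / (4 * u1)^-1 ^+ 2 + 1) * ((c0 / c1) ^+ 2 + (c1 / c0) ^+ 2).
have V0 : 0 <= V.
  apply: mulr_ge0; last by rewrite addr_ge0 ?sqr_ge0.
  by rewrite addr_ge0 // divr_ge0 ?sqr_ge0 // mulr_ge0 // ltW.
have Md : 0 <= M / d ^+ 2 by rewrite divr_ge0 ?sqr_ge0 // ltW.
(* The sum of all lower bounds in use: 1, [8 * B] for the convex square, [V] for the concave line
   and [M / d ^+ 2] for the comparison along the link. *)
pose sg := 1 + 8 * B + V + M / d ^+ 2.
have sg1 : 1 <= sg by rewrite /sg; lra.
have BM : B <= M by rewrite /M; lra.
have BM' : B' <= M by rewrite /M; lra.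
have BM'' : (4 / u0 + `|c1| + `|c0|) * (`|c1| + `|c0|) <= M by rewrite [`|c1| + _]addrC addrAC.
have Bsg : 8 * B <= sg by rewrite /sg; lra.
have Vsg : V <= sg by rewrite /sg; lra.
have Msg : M / d ^+ 2 <= sg by rewrite /sg; lra.
have [eps [e1 orb cpos hc1 hc0]] : exists eps : R, [/\ eps = 1 \/ eps = -1, K_orbit P d u0 M (eps * sg) c0 c1,
    (0 < c0 \/ 0 < c1),
    (0 < c1 -> eps * (eta0 * c1) < eps * c0) /\ (0 < c0 -> eps * (eta1 * c0) < eps * c1) &
    (c1 <= 0 -> 0 < eps * c0) /\ (c0 <= 0 -> 0 < eps * c1)].
  case: tw => [[cp t1 t2]|[cp0 cp1 t1 t2]].
    exists 1; rewrite !mul1r; split => //; first by left.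
    - exact: (@convex_orbit _ _ _ _ _ h c per M sg).
    - by split=> k; case: cp => // cp; lra.
  exists (-1); rewrite !mulN1r; split => //; first by right.
  - exact: (@concave_orbit _ _ _ _ _ h c per M sg).
  - by left.
  - by split=> _; lra.
  - by split=> k; lra.
move: orb => [a [b [p [r [fl [ac bc pc rc] W]]]]].
have fls := flow_swap fl.
have W' : Gf (swap P) d M (b 0) (a 0) (r 0) (p 0) + kf u0 (eps * sg) (r 0) + kf u0 (eps * sg) (p 0) <
      r 0 * (GP (swap P) d M (b 0) (a 0) (r 0) (p 0) + dkf u0 (eps * sg) (r 0)) +
      p 0 * (GP (swap (swap P)) d M (a 0) (b 0) (p 0) (r 0) + dkf u0 (eps * sg) (p 0)).
  rewrite swapK Gf_swap addrAC; apply: lt_le_trans W _; lra.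
have [p0|p0] := flow_sign h (ltW M0) fl; have [r0|r0] := flow_sign h' (ltW M0) fls.
- exact: (interior_case h M0 sg1 e1 fl ac bc pc rc W BM' p0 r0 cpos).
- have [_ k1] := hc1; have [_ k2] := hc0.
  by have := mixed_case h' M0 sg1 e1 fls bc ac W' BM'' br1 r0 p0 Msg k1 k2.
- have [k1 _] := hc1; have [k2 _] := hc0.
  by have := mixed_case h M0 sg1 e1 fl ac bc W BM' br0 p0 r0 Msg k1 k2.
- by have := both_nonpos h sg1 e1 fl ac bc W p0 r0 (fun _ => cpos).
Qed.
End Dynamics.

(** * Toric coordinates on the unit tangent bundle *)

Section VectorCalculus.
Variable R : realType.
Implicit Types (W : normedModType R).

Lemma der_lim W (F : R -> W) (t : R) (w : W) :
  is_derive t (1 : R) F w <-> (fun h : R => h^-1 *: (F (t + h) - F t)) @ 0^' --> w.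
Proof.
have E : (fun h : R => h^-1 *: ((F \o shift t) (h *: (1 : R)) - F t)) = (fun h : R => h^-1 *: (F (t + h) - F t)).
  apply/funext => h; have -> // : (F \o shift t) (h *: (1 : R)) = F (t + h).
  by rewrite /= /shift /= [h *: (1 : R)]mulr1 addrC.
split=> [[dF <-]|cF]; first by rewrite /derive -E; exact: dF.
by split; [apply/cvg_ex; exists w; rewrite E|rewrite /derive E; apply: cvg_lim].
Qed.

Lemma der_scalev W (f : R -> R) (t l : R) (v : W) : is_derive t (1 : R) f l ->
  is_derive t (1 : R) (fun s => f s *: v) (l *: v).
Proof.
move=> /der_lim fl; apply/der_lim.
have -> : (fun h : R => h^-1 *: (f (t + h) *: v - f t *: v)) = (fun h : R => (h^-1 *: (f (t + h) - f t)) *: v).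
  by apply/funext => h; rewrite -scalerBl scalerA.
exact: cvgZr_tmp.
Qed.

Lemma der_vsum W (I : Type) (r : seq I) (F : I -> R -> W) (w : I -> W) (t : R) :
  (forall i, is_derive t (1 : R) (F i) (w i)) ->
  is_derive t (1 : R) (fun s => \sum_(i <- r) F i s) (\sum_(i <- r) w i).
Proof.
move=> Fd; elim: r => [|i r IH].
  rewrite big_nil (_ : (fun s => _) = (fun=> 0)); first exact: is_derive_cst.
  by apply/funext => s; rewrite big_nil.
rewrite big_cons (_ : (fun s => _) = F i + (fun s => \sum_(i <- r) F i s)); first exact: is_deriveD.
by apply/funext => s; rewrite big_cons.
Qed.

Lemma der_chain W (f : W -> R) (F : R -> W) (t : R) (w : W) : differentiable f (F t) ->
  is_derive t (1 : R) F w -> is_derive t (1 : R) (fun s => f (F s)) ('D_w f (F t)).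
Proof.
move=> fd Fw; have Fd : differentiable F t by apply/derivable1_diffP; case: Fw.
have wE : 'd F t 1 = w by rewrite -deriveE //; case: Fw.
have cd : differentiable (f \o F) t by exact: differentiable_comp.
split; first exact/derivable1_diffP.
by rewrite (deriveE _ cd) diff_comp // deriveE //= wE.
Qed.

Lemma D_add W (f : W -> R) p u v : differentiable f p -> 'D_(u + v) f p = 'D_u f p + 'D_v f p.
Proof. by move=> fd; rewrite !deriveE // linearD. Qed.

Lemma D_scale W (f : W -> R) p k u : differentiable f p -> 'D_(k *: u) f p = k * 'D_u f p.
Proof. by move=> fd; rewrite !deriveE // linearZ. Qed.

Lemma D_sum W (f : W -> R) p (I : Type) (r : seq I) (u : I -> W) : differentiable f p ->
  'D_(\sum_(i <- r) u i) f p = \sum_(i <- r) 'D_(u i) f p.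
Proof. by move=> fd; rewrite deriveE // linear_sum; apply: eq_bigr => i _; rewrite deriveE. Qed.
End VectorCalculus.

Section V6.
Variable R : realType.
Local Notation V6 := (V6 R).
Definition idx := (bool * 'I_3)%type.

Definition crd (p : V6) (j : idx) : R := if j.1 then p.2 0 j.2 else p.1 0 j.2.
Definition e6 (j : idx) : V6 := if j.1 then (0, delta_mx 0 j.2) else (delta_mx 0 j.2, 0).

Lemma sum_idx (W : nmodType) (F : idx -> W) : \sum_j F j = \sum_i F (false, i) + \sum_i F (true, i).
Proof.
rewrite addrC -(big_bool _ (fun b => \sum_i F (b, i))) pair_bigA.
by apply: eq_bigr => -[].
Qed.

Lemma pair_sum (I : Type) (r : seq I) (F : I -> V6) : \sum_(i <- r) F i = (\sum_(i <- r) (F i).1, \sum_(i <- r) (F i).2).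
Proof. by elim: r => [|i r IH]; rewrite ?big_nil // !big_cons IH. Qed.

Lemma V6_sum (p : V6) : p = \sum_j crd p j *: e6 j.
Proof.
rewrite sum_idx !pair_sum; case: p => x v; rewrite /crd /e6 /= [LHS]surjective_pairing /=.
congr (_, _).
  by rewrite -[RHS]/(_ + _) [X in _ + X]big1 => [|i _]; rewrite ?scaler0 ?addr0 // -row_sum_delta.
by rewrite -[RHS]/(_ + _) [X in X + _]big1 => [|i _]; rewrite ?scaler0 ?add0r // -row_sum_delta.
Qed.

Lemma crdD p q j : crd (p + q) j = crd p j + crd q j.
Proof. by rewrite /crd; case: ifP => _; rewrite mxE. Qed.

Lemma crdZ k p j : crd (k *: p) j = k * crd p j.
Proof. by rewrite /crd; case: ifP => _; rewrite mxE. Qed.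

Lemma crdN p j : crd (- p) j = - crd p j.
Proof. by rewrite /crd; case: ifP => _; rewrite mxE. Qed.

Lemma V6_eq p q : (forall j, crd p j = crd q j) -> p = q.
Proof. by move=> e; rewrite (V6_sum p) (V6_sum q); apply: eq_bigr => j _; rewrite e. Qed.

Lemma crd_diff p j : differentiable (fun p : V6 => crd p j) p.
Proof.
rewrite /crd; case: j => -[] i /=.
  apply: (differentiable_comp (f := @snd _ _) (g := fun M : 'rV[R]_3 => M 0 i)); last exact: differentiable_coord.
  by apply: (@linear_differentiable R _ _ (@snd 'rV[R]_3 'rV[R]_3 : {linear ('rV[R]_3 * 'rV[R]_3)%type -> 'rV[R]_3})) => x; exact: cvg_snd.
apply: (differentiable_comp (f := @fst _ _) (g := fun M : 'rV[R]_3 => M 0 i)); last exact: differentiable_coord.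
by apply: (@linear_differentiable R _ _ (@fst 'rV[R]_3 'rV[R]_3 : {linear ('rV[R]_3 * 'rV[R]_3)%type -> 'rV[R]_3})) => x; exact: cvg_fst.
Qed.

Lemma der_V6 (F : R -> V6) (t : R) (w : V6) :
  (forall j, is_derive t (1 : R) (fun s => crd (F s) j) (crd w j)) -> is_derive t (1 : R) F w.
Proof.
move=> h; rewrite (V6_sum w) (_ : F = (fun s => \sum_j crd (F s) j *: e6 j)); last by apply/funext => s; exact: V6_sum.
by apply: der_vsum => j; exact: der_scalev.
Qed.

Lemma D_crd p w j : 'D_w (fun p : V6 => crd p j) p = crd w j.
Proof.
apply: cvg_lim => //; apply: cvg_near_cst; near=> h.
rewrite /= crdD crdZ addrK /GRing.scale /= mulKf //.
near: h; exact: nbhs_dnbhs_neq.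
Unshelve. all: by end_near. Qed.

Lemma der_crd (F : R -> V6) (t : R) (w : V6) j : is_derive t (1 : R) F w -> is_derive t (1 : R) (fun s => crd (F s) j) (crd w j).
Proof. by move=> Fw; rewrite -(D_crd (F t)); apply: der_chain => //; exact: crd_diff. Qed.

Lemma cvg_V6 (u : nat -> V6) (l : V6) : (forall j, (fun n => crd (u n) j) @ ultra --> crd l j) -> u @ ultra --> l.
Proof.
move=> h; rewrite (V6_sum l) (_ : u = (fun n => \sum_j crd (u n) j *: e6 j)); last by apply/funext => s; exact: V6_sum.
elim: (index_enum _) => [|j r IH].
  rewrite big_nil (_ : (fun s => _) = (fun=> 0)); first exact: cvg_cst.
  by apply/funext => s; rewrite big_nil.
rewrite big_cons (_ : (fun s => _) = (fun n => crd (u n) j *: e6 j) + (fun s => \sum_(i <- r) crd (u s) i *: e6 i)).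
  by apply: cvgD => //; exact: cvgZr_tmp.
by apply/funext => s; rewrite big_cons.
Qed.

Lemma cvg_crd (u : nat -> V6) (l : V6) j : u @ ultra --> l -> (fun n => crd (u n) j) @ ultra --> crd l j.
Proof. move=> ul; have fc : {for l, continuous (fun p => crd p j)} := differentiable_continuous (crd_diff l j).
exact: cvg_comp ul fc. Qed.
End V6.

(** * Smooth functions of three angles *)

Section Smooth3.
Variable R : realType.
Implicit Types F G : R -> R -> R -> R.

(** The partial derivatives are given as witnesses; they become the fields of a profile. *)
Fixpoint Sm (k : nat) F : Prop := ucont3 F /\ if k is k'.+1 then exists Fa Fb Fx : R -> R -> R -> R,
  [/\ forall a b x, is_derive a (1 : R) (fun a => F a b x) (Fa a b x),
      forall a b x, is_derive b (1 : R) (fun b => F a b x) (Fb a b x),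
      forall a b x, is_derive x (1 : R) (fun x => F a b x) (Fx a b x)
    & [/\ Sm k' Fa, Sm k' Fb & Sm k' Fx]] else True.

Lemma Sm_ucont k F : Sm k F -> ucont3 F.
Proof. by case: k => [|k] []. Qed.

Lemma SmS k F : Sm k.+1 F -> Sm k F.
Proof.
elim: k F => [|k IH] F [Fc [Fa [Fb [Fx [h1 h2 h3 [s1 s2 s3]]]]]]; split => //.
by exists Fa, Fb, Fx; split => //; split; exact: IH.
Qed.

Lemma Sm_cst k c : Sm k (fun _ _ _ => c).
Proof.
elim: k c => [|k IH] c; split => //; try by move=> *; exact: cvg_cst.
by exists (fun _ _ _ => 0), (fun _ _ _ => 0), (fun _ _ _ => 0); split; try (split; exact: IH); move=> *; exact: der_cst.
Qed.

Lemma SmD k F G : Sm k F -> Sm k G -> Sm k (fun a b x => F a b x + G a b x).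
Proof.
elim: k F G => [|k IH] F G [Fc hF] [Gc hG]; split; try by move=> *; apply: cvgD; [exact: Fc|exact: Gc].
- by [].
move: hF hG => [Fa [Fb [Fx [h1 h2 h3 [s1 s2 s3]]]]] [Ga [Gb [Gx [h1' h2' h3' [s1' s2' s3']]]]].
exists (fun a b x => Fa a b x + Ga a b x), (fun a b x => Fb a b x + Gb a b x), (fun a b x => Fx a b x + Gx a b x).
by split; try (split; exact: IH); move=> *; exact: der_add.
Qed.

Lemma SmM k F G : Sm k F -> Sm k G -> Sm k (fun a b x => F a b x * G a b x).
Proof.
elim: k F G => [|k IH] F G sF sG.
  split => // a b x a0 b0 x0 ac bc xc; move: sF sG => [Fc _] [Gc _].
  by apply: cvgM; [exact: Fc|exact: Gc].
have sF' := SmS sF; have sG' := SmS sG.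
split; first by move=> *; apply: cvgM; [exact: (Sm_ucont sF)|exact: (Sm_ucont sG)].
move: sF sG => [_ [Fa [Fb [Fx [h1 h2 h3 [s1 s2 s3]]]]]] [_ [Ga [Gb [Gx [h1' h2' h3' [s1' s2' s3']]]]]].
exists (fun a b x => Fa a b x * G a b x + F a b x * Ga a b x), (fun a b x => Fb a b x * G a b x + F a b x * Gb a b x),
  (fun a b x => Fx a b x * G a b x + F a b x * Gx a b x).
by split; try (split; apply: SmD; exact: IH); move=> *; exact: der_mul.
Qed.

Lemma SmN k F : Sm k F -> Sm k (fun a b x => - F a b x).
Proof.
move=> sF; have := SmM (Sm_cst k (-1)) sF.
by congr (Sm k _); apply/funext => a; apply/funext => b; apply/funext => x; rewrite mulN1r.
Qed.

Lemma Sm_sum k (I : Type) (r : seq I) (F : I -> R -> R -> R -> R) : (forall i, Sm k (F i)) ->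
  Sm k (fun a b x => \sum_(i <- r) F i a b x).
Proof.
move=> h; elim: r => [|i r IH].
  rewrite (_ : (fun a b x => _) = (fun _ _ _ => 0)); first exact: Sm_cst.
  by apply/funext => a; apply/funext => b; apply/funext => x; rewrite big_nil.
rewrite (_ : (fun a b x => _) = (fun a b x => F i a b x + \sum_(i <- r) F i a b x)); first exact: SmD.
by apply/funext => a; apply/funext => b; apply/funext => x; rewrite big_cons.
Qed.

Lemma SmV k F : (forall a b x, F a b x != 0) -> Sm k F -> Sm k (fun a b x => (F a b x)^-1).
Proof.
move=> F0; elim: k => [|k IH] sF; first by split => // a b x a0 b0 x0 ac bc xc; move: sF => [Fc _]; apply: cvgV => //; exact: Fc.
have sF' := SmS sF; have sV := IH sF'.
split; first by move=> *; apply: cvgV => //; exact: (Sm_ucont sF).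
move: sF => [_ [Fa [Fb [Fx [h1 h2 h3 [s1 s2 s3]]]]]].
exists (fun a b x => - (Fa a b x * ((F a b x)^-1 * (F a b x)^-1))), (fun a b x => - (Fb a b x * ((F a b x)^-1 * (F a b x)^-1))),
  (fun a b x => - (Fx a b x * ((F a b x)^-1 * (F a b x)^-1))).
have D (f : R -> R) (s l : R) : f s != 0 -> is_derive s (1 : R) f l ->
    is_derive s (1 : R) (fun s => (f s)^-1) (- (l * ((f s)^-1 * (f s)^-1))).
  move=> fs fd; have dv : is_derive s (1 : R) (fun s => (f s)^-1) (- (f s) ^- 2 *: l) by apply: is_deriveV.
  by apply: (is_derive_conv dv) => //; rewrite /GRing.scale /=; field.
by split; try (by move=> *; apply: D); split; apply: SmN; (apply: SmM; [|exact: SmM]).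
Qed.

Lemma Sm_trig k : [/\ Sm k (fun a _ _ => cos a) /\ Sm k (fun a _ _ => sin a),
  Sm k (fun _ b _ => cos b) /\ Sm k (fun _ b _ => sin b) & Sm k (fun _ _ x => cos x) /\ Sm k (fun _ _ x => sin x)].
Proof.
have cc (u : nat -> R) l : u @ ultra --> l -> (fun n => cos (u n)) @ ultra --> cos l.
  by move=> ul; exact: ultra_cvg_comp (@continuous_cos R l) ul.
have cs (u : nat -> R) l : u @ ultra --> l -> (fun n => sin (u n)) @ ultra --> sin l.
  by move=> ul; exact: ultra_cvg_comp (@continuous_sin R l) ul.
have z := @Sm_cst _ 0.
elim: k => [|k [[ca sa] [cb sb] [cx sx]]].
  by do 2 split => //; (split; [move=> a b x a0 b0 x0 ac bc xc|]) => //; try exact: cc; exact: cs.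
split; split; split; try (by move=> a b x a0 b0 x0 ac bc xc; first [exact: cc|exact: cs]).
- exists (fun a _ _ => - sin a), (fun _ _ _ => 0), (fun _ _ _ => 0); split; try (by move=> *; first [exact: is_derive_cos|exact: der_cst]).
  by split => //; exact: SmN.
- exists (fun a _ _ => cos a), (fun _ _ _ => 0), (fun _ _ _ => 0); split; try (by move=> *; first [exact: is_derive_sin|exact: der_cst]).
  by split => //; exact: SmN.
- exists (fun _ _ _ => 0), (fun _ b _ => - sin b), (fun _ _ _ => 0); split; try (by move=> *; first [exact: is_derive_cos|exact: der_cst]).
  by split => //; exact: SmN.
- exists (fun _ _ _ => 0), (fun _ b _ => cos b), (fun _ _ _ => 0); split; try (by move=> *; first [exact: is_derive_sin|exact: der_cst]).
  by split => //; exact: SmN.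
- exists (fun _ _ _ => 0), (fun _ _ _ => 0), (fun _ _ x => - sin x); split; try (by move=> *; first [exact: is_derive_cos|exact: der_cst]).
  by split => //; exact: SmN.
- exists (fun _ _ _ => 0), (fun _ _ _ => 0), (fun _ _ x => cos x); split; try (by move=> *; first [exact: is_derive_sin|exact: der_cst]).
  by split => //; exact: SmN.
Qed.

(** The chain rule in the six coordinate directions: each directional derivative of [f] is again of
    class [Ck], so the induction applies to it. *)
Lemma Sm_comp k (f : V6 R -> R) (Q : R -> R -> R -> V6 R) : Ck k f ->
  (forall m j, Sm m (fun a b x => crd (Q a b x) j)) -> Sm k (fun a b x => f (Q a b x)).
Proof.
move=> fk Qs; have Qc (a b x : nat -> R) (a0 b0 x0 : R) : a @ ultra --> a0 -> b @ ultra --> b0 -> x @ ultra --> x0 ->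
    (fun n => Q (a n) (b n) (x n)) @ ultra --> Q a0 b0 x0.
  by move=> *; apply: cvg_V6 => j; exact: (Sm_ucont (Qs 0%N j)).
elim: k f fk => [|k IH] f fk.
  by split => // a b x a0 b0 x0 ac bc xc; exact: cvg_comp (Qc _ _ _ _ _ _ ac bc xc) (fk _).
move: fk => [fd fD]; split.
  move=> a b x a0 b0 x0 ac bc xc; have fc : {for Q a0 b0 x0, continuous f} := differentiable_continuous (fd (Q a0 b0 x0)).
  exact: cvg_comp (Qc _ _ _ _ _ _ ac bc xc) fc.
have /choice[q qP] : forall j, exists q : (R -> R -> R -> R) * (R -> R -> R -> R) * (R -> R -> R -> R),
  [/\ forall a b x, is_derive a (1 : R) (fun a => crd (Q a b x) j) (q.1.1 a b x),
      forall a b x, is_derive b (1 : R) (fun b => crd (Q a b x) j) (q.1.2 a b x),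
      forall a b x, is_derive x (1 : R) (fun x => crd (Q a b x) j) (q.2 a b x)
    & [/\ Sm k q.1.1, Sm k q.1.2 & Sm k q.2]].
  by move=> j; have [_ [qa [qb [qx h]]]] := Qs k.+1 j; exists (qa, qb, qx).
pose D (j : idx) a b x := 'D_(e6 R j) f (Q a b x).
have Ds j : Sm k (D j) := IH _ (fD (e6 R j)).
have key (c : R -> V6 R) (w : idx -> R) (s : R) : (forall j, is_derive s (1 : R) (fun s => crd (c s) j) (w j)) ->
    is_derive s (1 : R) (fun s => f (c s)) (\sum_j w j * 'D_(e6 R j) f (c s)).
  move=> hw; have cd : is_derive s (1 : R) c (\sum_j w j *: e6 R j).
    rewrite [X in is_derive _ _ X](_ : c = (fun s => \sum_j crd (c s) j *: e6 R j)); last by apply/funext => t; exact: V6_sum.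
    by apply: der_vsum => j; exact: der_scalev.
  apply: (is_derive_conv (der_chain (fd _) cd)) => //.
  by rewrite D_sum //; apply: eq_bigr => j _; rewrite D_scale.
exists (fun a b x => \sum_j (q j).1.1 a b x * D j a b x), (fun a b x => \sum_j (q j).1.2 a b x * D j a b x),
  (fun a b x => \sum_j (q j).2 a b x * D j a b x).
split.
- by move=> a b x; apply: (key (fun a => Q a b x)) => j; have [h _ _ _] := qP j; exact: h.
- by move=> a b x; apply: (key (fun b => Q a b x)) => j; have [_ h _ _] := qP j; exact: h.
- by move=> a b x; apply: (key (fun x => Q a b x)) => j; have [_ _ h _] := qP j; exact: h.
by split; apply: Sm_sum => j; (apply: SmM => //); have [_ _ _ []] := qP j.
Qed.
End Smooth3.

Section Vec3.
Variable R : realType.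
Implicit Types u v w : 'rV[R]_3.

Lemma row3 u v : u 0 0 = v 0 0 -> u 0 1 = v 0 1 -> u 0 2%:R = v 0 2%:R -> u = v.
Proof.
move=> e0 e1 e2; apply/rowP => -[[|[|[|//]]] h]; rewrite ?ord1.
- by rewrite (_ : Ordinal h = 0) //; exact: val_inj.
- by rewrite (_ : Ordinal h = 1) //; exact: val_inj.
- by rewrite (_ : Ordinal h = 2%:R) //; exact: val_inj.
Qed.

Lemma vec3E (a b c : R) : [/\ vec3 a b c 0 0 = a, vec3 a b c 0 1 = b & vec3 a b c 0 2%:R = c].
Proof. by split; rewrite mxE. Qed.

Lemma vec30 (a b c : R) : vec3 a b c 0 0 = a. Proof. by have [] := vec3E a b c. Qed.
Lemma vec31 (a b c : R) : vec3 a b c 0 1 = b. Proof. by have [] := vec3E a b c. Qed.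
Lemma vec32 (a b c : R) : vec3 a b c 0 2%:R = c. Proof. by have [] := vec3E a b c. Qed.

Lemma dotE u v : dot u v = u 0 0 * v 0 0 + u 0 1 * v 0 1 + u 0 2%:R * v 0 2%:R.
Proof.
rewrite /dot !big_ord_recl big_ord0 addr0 addrA; congr (_ + _ * _ + _ * _); congr (fun_of_matrix _ _ _); exact: val_inj.
Qed.

Definition simp3 := (vec30, vec31, vec32, dotE, @mxE).
End Vec3.

(** * The double cover in polar coordinates *)

Section Cover.
Variable R : realType.
Local Notation V6 := (V6 R).

(** The differential of the quadratic map [Dcov] at [z], applied to [w]. *)
Definition Bd (z w : C2 R) : V6 :=
  let: ((q0, p0), (q1, p1)) := z in let: ((a0, b0), (a1, b1)) := w in
  (vec3 (2 * (q0 * a0 - p0 * b0 + q1 * a1 - p1 * b1))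
        (2 * (- (q0 * b0 + p0 * a0) + (q1 * b1 + p1 * a1)))
        (2 * (q0 * b1 + p1 * a0 + p0 * a1 + q1 * b0)),
   vec3 (- 2 * (q0 * b0 + p0 * a0 + q1 * b1 + p1 * a1))
        (- 2 * (q0 * a0 - p0 * b0 - q1 * a1 + p1 * b1))
        (2 * (q0 * a1 + q1 * a0 - p0 * b1 - p1 * b0))).

Lemma Dcov_der (q0 p0 q1 p1 : R -> R) (t a0 b0 a1 b1 : R) :
  is_derive t (1 : R) q0 a0 -> is_derive t (1 : R) p0 b0 -> is_derive t (1 : R) q1 a1 -> is_derive t (1 : R) p1 b1 ->
  is_derive t (1 : R) (fun s => Dcov ((q0 s, p0 s), (q1 s, p1 s))) (Bd ((q0 t, p0 t), (q1 t, p1 t)) ((a0, b0), (a1, b1))).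
Proof.
move=> dq0 dp0 dq1 dp1.
have sq (f : R -> R) l : is_derive t (1 : R) f l -> is_derive t (1 : R) (fun s => f s ^+ 2) (2 * (f t * l)).
  by move=> fd; apply: (is_derive_conv (der_mul fd fd)) => //; ring.
have ml (f h : R -> R) l m : is_derive t (1 : R) f l -> is_derive t (1 : R) h m -> is_derive t (1 : R) (fun s => f s * h s) (l * h t + f t * m) := fun a b => der_mul a b.
have D1 := der_sub (der_add (der_sub (sq _ _ dq0) (sq _ _ dp0)) (sq _ _ dq1)) (sq _ _ dp1).
have D2 := der_cmul 2 (der_add (der_opp (ml _ _ _ _ dq0 dp0)) (ml _ _ _ _ dq1 dp1)).
have D3 := der_cmul 2 (der_add (ml _ _ _ _ dq0 dp1) (ml _ _ _ _ dp0 dq1)).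
have D4 := der_cmul (-2) (der_add (ml _ _ _ _ dq0 dp0) (ml _ _ _ _ dq1 dp1)).
have D5 := der_opp (der_add (der_sub (der_sub (sq _ _ dq0) (sq _ _ dp0)) (sq _ _ dq1)) (sq _ _ dp1)).
have D6 := der_cmul 2 (der_sub (ml _ _ _ _ dq0 dq1) (ml _ _ _ _ dp0 dp1)).
apply: der_V6 => -[[] [[|[|[|//]]] i]]; rewrite /crd /=.
- apply: (is_derive_conv D4) => [s|]; rewrite !mxE //=; ring.
- apply: (is_derive_conv D5) => [s|]; rewrite !mxE //=; ring.
- apply: (is_derive_conv D6) => [s|]; rewrite !mxE //=; ring.
- apply: (is_derive_conv D1) => [s|]; rewrite !mxE //=; ring.
- apply: (is_derive_conv D2) => [s|]; rewrite !mxE //=; ring.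
- apply: (is_derive_conv D3) => [s|]; rewrite !mxE //=; ring.
Qed.

(** For a unit quaternion [z], the two vectors of [Dcov z] together with [nz z] form the orthonormal
    frame of the rotation attached to [z]. *)
Definition nz (z : C2 R) : 'rV[R]_3 := let: ((q0, p0), (q1, p1)) := z in
  vec3 (2 * (p1 * q0 - q1 * p0)) (- 2 * (q0 * q1 + p0 * p1)) (q1 ^+ 2 + p1 ^+ 2 - q0 ^+ 2 - p0 ^+ 2).

Definition nrm (z : C2 R) : R := z.1.1 ^+ 2 + z.1.2 ^+ 2 + z.2.1 ^+ 2 + z.2.2 ^+ 2.

Lemma cover_dots z : [/\ dot (Dcov z).1 (Dcov z).1 = nrm z ^+ 2, dot (Dcov z).2 (Dcov z).2 = nrm z ^+ 2,
  dot (Dcov z).1 (Dcov z).2 = 0, cross (Dcov z).1 (Dcov z).2 = nrm z *: nz z & dot (Dcov z).2 (nz z) = 0].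
Proof.
case: z => -[q0 p0] [q1 p1]; rewrite /nrm /nz /Dcov /=; split; try (rewrite !simp3; ring).
by apply: row3; rewrite !simp3; ring.
Qed.

Lemma cover_expand z u : nrm z ^+ 2 *: u = dot (Dcov z).1 u *: (Dcov z).1 + dot (Dcov z).2 u *: (Dcov z).2 + dot (nz z) u *: nz z.
Proof.
by case: z => -[q0 p0] [q1 p1]; rewrite /nrm /nz /Dcov /=; apply: row3; rewrite !simp3; ring.
Qed.

(** [Bd_i], [Bd_j] and [Bd_k] are the images of the three quaternionic multiples of [z], a frame of
    the sphere at [z]: the geodesic, vertical and horizontal directions. *)
Lemma Bd_i z : Bd z ((- z.1.2, z.1.1), (- z.2.2, z.2.1)) = 2 *: ((Dcov z).2, - (Dcov z).1).
Proof.
case: z => -[q0 p0] [q1 p1]; rewrite /Bd /Dcov /=; congr pair; apply: row3; rewrite !simp3; ring.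
Qed.

Lemma Bd_j z : Bd z ((- z.2.1, z.2.2), (z.1.1, - z.1.2)) = - 2 *: ((0, nz z) : V6).
Proof.
case: z => -[q0 p0] [q1 p1]; rewrite /Bd /nz /=; congr pair; apply: row3; rewrite !simp3; ring.
Qed.

Lemma Bd_k z : Bd z ((- z.2.2, - z.2.1), (z.1.2, z.1.1)) = - 2 *: ((nz z, 0) : V6).
Proof.
case: z => -[q0 p0] [q1 p1]; rewrite /Bd /nz /=; congr pair; apply: row3; rewrite !simp3; ring.
Qed.

Lemma Bd_lin z (k l m : R) (u v w : C2 R) :
  Bd z ((k * u.1.1 + l * v.1.1 + m * w.1.1, k * u.1.2 + l * v.1.2 + m * w.1.2),
        (k * u.2.1 + l * v.2.1 + m * w.2.1, k * u.2.2 + l * v.2.2 + m * w.2.2)) = k *: Bd z u + l *: Bd z v + m *: Bd z w.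
Proof.
case: z u v w => -[q0 p0] [q1 p1] -[[u0 u1] [u2 u3]] -[[v0 v1] [v2 v3]] -[[w0 w1] [w2 w3]] /=.
by congr pair; apply: row3; rewrite !simp3; ring.
Qed.

Lemma sqr_inj (s t : R) : 0 <= s -> 0 <= t -> s ^+ 2 = t ^+ 2 -> s = t.
Proof. by move=> s0 t0 /eqP; rewrite eqrXn2 // => /eqP. Qed.

(** A complex square root of [u + i v] in polar form. *)
Lemma polar_sq (u v : R) : exists r phi : R, [/\ 0 <= r, u = r ^+ 2 * cos (phi + phi) & v = r ^+ 2 * sin (phi + phi)].
Proof.
pose s := Num.sqrt (u ^+ 2 + v ^+ 2).
have s2 : s ^+ 2 = u ^+ 2 + v ^+ 2 by rewrite sqr_sqrtr // addr_ge0 ?sqr_ge0.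
have s0 : 0 <= s by exact: sqrtr_ge0.
have rs : Num.sqrt s ^+ 2 = s by rewrite sqr_sqrtr.
have [sz|sn] := eqVneq s 0.
  have [u0 v0] : u = 0 /\ v = 0.
    have e : u ^+ 2 + v ^+ 2 = 0 by rewrite -s2 sz expr0n.
    have hu := sqr_ge0 u; have hv := sqr_ge0 v.
    by split; apply/eqP; rewrite -sqrf_eq0; apply/eqP; lra.
  by exists 0, 0; rewrite u0 v0 expr0n /= !mul0r.
have sp : 0 < s by rewrite lt_neqAle eq_sym sn.
have us : -1 <= u / s <= 1.
  have : (u / s) ^+ 2 <= 1 by rewrite expr_div_n s2 ler_pdivrMr ?mul1r ?lerDl ?sqr_ge0 // -s2 exprn_gt0.
  by move: (u / s) => y y1; apply/andP; split; nra.
have ca : cos (acos (u / s)) = u / s by rewrite acosK // in_itv.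
have sa : s * sin (acos (u / s)) = `|v|.
  apply: sqr_inj => //; first by rewrite mulr_ge0 // sin_acos // sqrtr_ge0.
  rewrite exprMn sin2cos2 ca real_normK ?num_real //.
  have -> : s ^+ 2 * (1 - (u / s) ^+ 2) = s ^+ 2 - u ^+ 2 by field.
  by rewrite s2 addrC addKr.
have half (y : R) : y / 2 + y / 2 = y by field.
have [v0|v0] := leP 0 v.
  by exists (Num.sqrt s), (acos (u / s) / 2); rewrite sqrtr_ge0 rs half ca sa ger0_norm // mulrC divfK.
by exists (Num.sqrt s), (- acos (u / s) / 2); rewrite sqrtr_ge0 rs half cosN sinN ca mulrN sa ltr0_norm // opprK mulrC divfK.
Qed.

Definition zpt (a b x : R) : C2 R := (polar (sin x) a, polar (cos x) b).
Definition pt (a b x : R) : V6 := Dcov (zpt a b x).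

Lemma nrm_zpt a b x : nrm (zpt a b x) = 1.
Proof.
rewrite /nrm /zpt /polar /= !exprMn -!mulrDr -addrA -mulrDr !cos2Dsin2 !mulr1 addrC; exact: cos2Dsin2.
Qed.

(** The numbers [(x1 - v2) / 2] and [(- v1 - x2) / 2] are the real and imaginary parts of [z0 ^+ 2],
    the other pair those of [z1 ^+ 2], and [v3 + i x3 = 2 z0 z1]. Square roots give [z0] and [z1] up
    to sign, and the last relation fixes the relative sign. *)
Lemma polar_onto p : T1S2 p -> exists a b x, 0 <= x <= pi / 2 /\ p = pt a b x.
Proof.
case: p => x v [/= hx hv hxv]; rewrite !dotE in hx hv hxv.
set x1 := x 0 0 in hx hxv; set x2 := x 0 1 in hx hxv; set x3 := x 0 2%:R in hx hxv.
set v1 := v 0 0 in hv hxv; set v2 := v 0 1 in hv hxv; set v3 := v 0 2%:R in hv hxv.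
have [r0 [f0 [r00 e1 e2]]] := polar_sq ((x1 - v2) / 2) ((- v1 - x2) / 2).
have [r1 [f1 [r10 e3 e4]]] := polar_sq ((x1 + v2) / 2) ((x2 - v1) / 2).
pose c1 (f : R) := 2 * r0 * r1 * (cos f * cos f1 - sin f * sin f1).
pose c2 (f : R) := 2 * r0 * r1 * (sin f * cos f1 + cos f * sin f1).
rewrite !cosD !sinD in e1 e2 e3 e4.
have s0 : sin f0 ^+ 2 = 1 - cos f0 ^+ 2 by rewrite sin2cos2.
have s1 : sin f1 ^+ 2 = 1 - cos f1 ^+ 2 by rewrite sin2cos2.
have R0 : r0 ^+ 2 * r0 ^+ 2 = ((x1 - v2) / 2) ^+ 2 + ((- v1 - x2) / 2) ^+ 2.
  rewrite e1 e2; transitivity (r0 ^+ 2 * r0 ^+ 2 * (cos f0 ^+ 2 + sin f0 ^+ 2) ^+ 2); [by rewrite cos2Dsin2 expr1n mulr1|ring].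
have R1 : r1 ^+ 2 * r1 ^+ 2 = ((x1 + v2) / 2) ^+ 2 + ((x2 - v1) / 2) ^+ 2.
  rewrite e3 e4; transitivity (r1 ^+ 2 * r1 ^+ 2 * (cos f1 ^+ 2 + sin f1 ^+ 2) ^+ 2); [by rewrite cos2Dsin2 expr1n mulr1|ring].
have C1 : c1 f0 ^+ 2 - c2 f0 ^+ 2 = v3 ^+ 2 - x3 ^+ 2.
  transitivity (4 * (((x1 - v2) / 2) * ((x1 + v2) / 2) - ((- v1 - x2) / 2) * ((x2 - v1) / 2))).
    by rewrite e1 e2 e3 e4 /c1 /c2; ring.
  by transitivity (x1 * x1 + x2 * x2 - v1 * v1 - v2 * v2); [field|lra].
have C2 : c1 f0 * c2 f0 = v3 * x3.
  transitivity (2 * (((x1 - v2) / 2) * ((x2 - v1) / 2) + ((- v1 - x2) / 2) * ((x1 + v2) / 2))).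
    by rewrite e1 e2 e3 e4 /c1 /c2; ring.
  by transitivity (- (x1 * v1 + x2 * v2)); [field|lra].
have C3 : 4 * r0 ^+ 2 * r1 ^+ 2 = v3 ^+ 2 + x3 ^+ 2.
  have k : (4 * r0 ^+ 2 * r1 ^+ 2) ^+ 2 = (v3 ^+ 2 + x3 ^+ 2) ^+ 2.
    have -> : (v3 ^+ 2 + x3 ^+ 2) ^+ 2 = (v3 ^+ 2 - x3 ^+ 2) ^+ 2 + 4 * (v3 * x3) ^+ 2 by ring.
    rewrite -C1 -C2; have -> : (c1 f0 ^+ 2 - c2 f0 ^+ 2) ^+ 2 + 4 * (c1 f0 * c2 f0) ^+ 2 = (c1 f0 ^+ 2 + c2 f0 ^+ 2) ^+ 2 by ring.
    congr (_ ^+ 2); transitivity (4 * r0 ^+ 2 * r1 ^+ 2 * ((cos f0 ^+ 2 + sin f0 ^+ 2) * (cos f1 ^+ 2 + sin f1 ^+ 2))).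
      by rewrite !cos2Dsin2; ring.
    by rewrite /c1 /c2; ring.
  by apply: sqr_inj k; [apply: mulr_ge0; [apply: mulr_ge0|]|apply: addr_ge0]; rewrite ?sqr_ge0.
have N1 : r0 ^+ 2 + r1 ^+ 2 = 1.
  have k : (r0 ^+ 2 + r1 ^+ 2) ^+ 2 = 1 ^+ 2.
    transitivity (r0 ^+ 2 * r0 ^+ 2 + r1 ^+ 2 * r1 ^+ 2 + (4 * r0 ^+ 2 * r1 ^+ 2) / 2); first by field.
    rewrite R0 R1 C3; transitivity ((x1 * x1 + x2 * x2 + x3 * x3 + (v1 * v1 + v2 * v2 + v3 * v3)) / 2); first by field.
    by rewrite hx hv; field.
  by apply: sqr_inj k => //; rewrite addr_ge0 ?sqr_ge0.
have fin f : cos f * cos f - sin f * sin f = cos f0 * cos f0 - sin f0 * sin f0 ->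
    sin f * cos f + cos f * sin f = sin f0 * cos f0 + cos f0 * sin f0 -> c1 f = v3 -> c2 f = x3 ->
    exists a b y, 0 <= y <= pi / 2 /\ (x, v) = pt a b y.
  move=> k1 k2 k3 k4; have pp := pi_gt0 R.
  have r1b : -1 <= r1 <= 1 by apply/andP; split; nra.
  have ca : cos (acos r1) = r1 by rewrite acosK // in_itv.
  have sa : sin (acos r1) = r0.
    by rewrite sin_acos // -N1 addrK sqrtr_sqr ger0_norm.
  exists f, f1, (acos r1); split.
    rewrite acos_ge0 //= leNgt; apply/negP => h.
    have : 0 < sin (acos r1 - pi / 2) by apply: sin_gt0_pi; have ap := acos_lepi r1b; apply/andP; split; lra.
    have : cos (acos r1) = - sin (acos r1 - pi / 2) by rewrite -cosDpihalf subrK.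
    rewrite ca; lra.
  rewrite -k1 -?k2 in e1 e2; rewrite /pt /zpt /polar ca sa /Dcov /=; congr pair; apply: row3; rewrite !simp3.
  - have := congr2 +%R e1 e3; rewrite -/x1 => k; transitivity ((x1 - v2) / 2 + (x1 + v2) / 2); [by field|rewrite k; ring].
  - have := congr2 (fun s t => t - s) e2 e4; rewrite -/x2 => k; transitivity ((x2 - v1) / 2 - (- v1 - x2) / 2); [by field|rewrite k; ring].
  - by rewrite -/x3 -k4 /c2; ring.
  - have := congr2 (fun s t => - t - s) e2 e4; rewrite -/v1 => k; transitivity (- ((x2 - v1) / 2) - (- v1 - x2) / 2); [by field|rewrite k; ring].
  - have := congr2 (fun s t => t - s) e1 e3; rewrite -/v2 => k; transitivity ((x1 + v2) / 2 - (x1 - v2) / 2); [by field|rewrite k; ring].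
  - by rewrite -/v3 -k3 /c1; ring.
have : ((c1 f0 - v3) ^+ 2 + (c2 f0 - x3) ^+ 2) * ((c1 f0 + v3) ^+ 2 + (c2 f0 + x3) ^+ 2) = 0.
  transitivity ((c1 f0 ^+ 2 - c2 f0 ^+ 2 - (v3 ^+ 2 - x3 ^+ 2)) ^+ 2 + 4 * (c1 f0 * c2 f0 - v3 * x3) ^+ 2); first ring.
  by rewrite C1 C2 !subrr expr0n /= mulr0 addr0.
have sum0 (s t : R) : s ^+ 2 + t ^+ 2 = 0 -> s = 0 /\ t = 0.
  move=> e; have hs := sqr_ge0 s; have ht := sqr_ge0 t.
  by split; apply/eqP; rewrite -sqrf_eq0; apply/eqP; lra.
move/eqP; rewrite mulf_eq0 => /orP[] /eqP /sum0[k1 k2].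
  by apply: (fin f0) => //; lra.
(* The wrong relative sign is repaired by adding [pi] to the angle of [z0]. *)
have cp : cos (f0 + pi) = - cos f0 by rewrite cosDpi.
have sp : sin (f0 + pi) = - sin f0 by rewrite sinDpi.
apply: (fin (f0 + pi)); rewrite /c1 /c2 cp sp; try ring.
- by move: k1; rewrite /c1 => k1; lra.
- by move: k2; rewrite /c2 => k2; lra.
Qed.
End Cover.

(** * The Reeb vector field in the moving frame *)

Section Reeb.
Variable R : realType.
Local Notation V6 := (V6 R).
Implicit Types (p w : V6) (f : V6 -> R).

(** The geodesic field, which is the Reeb field of the Euclidean form; the vertical [Vv] and the
    horizontal [Hv] complete it to a frame and span the contact planes. *)
Definition Gv p : V6 := (p.2, - p.1).
Definition Vv p : V6 := (0, vperp p).
Definition Hv p : V6 := (vperp p, 0).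

Lemma T1S2_cover p : T1S2 p -> exists2 z, nrm z = 1 & p = Dcov z.
Proof. by move=> /polar_onto[a [b [x [_ ->]]]]; exists (zpt a b x) => //; exact: nrm_zpt. Qed.

Lemma vperp_cover (z : C2 R) : nrm z = 1 -> vperp (Dcov z) = nz z.
Proof. by move=> n1; have [_ _ _ e _] := cover_dots z; rewrite /vperp e n1 scale1r. Qed.

Lemma T1S2_Dcov (z : C2 R) : nrm z = 1 -> T1S2 (Dcov z).
Proof. by move=> n1; have [e1 e2 e3 _ _] := cover_dots z; rewrite /T1S2 /= e1 e2 e3 n1 expr1n. Qed.

Lemma T1S2_pt (a b x : R) : T1S2 (pt a b x).
Proof. exact/T1S2_Dcov/nrm_zpt. Qed.

Lemma dotC (u v : 'rV[R]_3) : dot u v = dot v u.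
Proof. by rewrite !dotE; ring. Qed.

Lemma dotDr (u v w : 'rV[R]_3) : dot u (v + w) = dot u v + dot u w.
Proof. by rewrite !dotE !mxE; ring. Qed.

Lemma dotZr (u v : 'rV[R]_3) k : dot u (k *: v) = k * dot u v.
Proof. by rewrite !dotE !mxE; ring. Qed.

Lemma dotNr (u v : 'rV[R]_3) : dot u (- v) = - dot u v.
Proof. by rewrite !dotE !mxE; ring. Qed.

Lemma dot0r (u : 'rV[R]_3) : dot u 0 = 0.
Proof. by rewrite !dotE !mxE; ring. Qed.

Lemma dot0l (u : 'rV[R]_3) : dot 0 u = 0.
Proof. by rewrite dotC dot0r. Qed.

Lemma vperp_dots p : T1S2 p -> [/\ dot p.1 (vperp p) = 0, dot p.2 (vperp p) = 0 & dot (vperp p) (vperp p) = 1].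
Proof.
move=> hp; have [z z1 e] := T1S2_cover hp; have [h1 h2 h3] := hp.
have ev : vperp p = cross p.1 p.2 by [].
split; try by rewrite ev /cross !simp3; ring.
rewrite e vperp_cover //; have := cover_expand z (nz z); have [_ _ _ _ e2] := cover_dots z.
case: z z1 {e e2} => -[q0 p0] [q1 p1]; rewrite /nrm /= => n1 _.
rewrite /nz !simp3; transitivity ((q0 ^+ 2 + p0 ^+ 2 + q1 ^+ 2 + p1 ^+ 2) ^+ 2); [ring|by rewrite n1 expr1n].
Qed.

Lemma expand3 p (u : 'rV[R]_3) : T1S2 p ->
  u = dot p.1 u *: p.1 + dot p.2 u *: p.2 + dot (vperp p) u *: vperp p.
Proof.
move=> hp; have [z z1 ->] := T1S2_cover hp; rewrite vperp_cover // -cover_expand z1 expr1n scale1r //.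
Qed.

Lemma tangent_frame p w : T1S2 p -> tangent p w ->
  w = dot p.2 w.1 *: Gv p + dot (vperp p) w.2 *: Vv p + dot (vperp p) w.1 *: Hv p.
Proof.
case: w => w1 w2 hp [/= h1 h2 h3]; rewrite /Gv /Vv /Hv.
rewrite [LHS]surjective_pairing /=; congr pair => /=.
  by rewrite {1}(expand3 w1 hp) h1 scale0r add0r scaler0 addr0.
rewrite {1}(expand3 w2 hp) h2 scale0r addr0 scaler0 addr0; congr (_ + _).
by rewrite scalerN -scaleNr; congr (_ *: _); rewrite (dotC p.2); lra.
Qed.

Lemma tangent_G p : T1S2 p -> tangent p (Gv p).
Proof. by move=> [h1 h2 h3]; split; rewrite /= ?dotNr ?h1 ?h2 ?(dotC p.2) ?h3 ?oppr0 // subrr. Qed.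

Lemma tangent_V p : T1S2 p -> tangent p (Vv p).
Proof. by move=> hp; have [h1 h2 h3] := vperp_dots hp; split; rewrite /= ?dot0r ?dot0l ?h1 ?h2 ?addr0. Qed.

Lemma tangent_H p : T1S2 p -> tangent p (Hv p).
Proof. by move=> hp; have [h1 h2 h3] := vperp_dots hp; split; rewrite /= ?dot0r ?h1 // addr0 dotC h2. Qed.

Lemma tangent_comb p k l m u v w : tangent p u -> tangent p v -> tangent p w -> tangent p (k *: u + l *: v + m *: w).
Proof.
move=> [a1 a2 a3] [b1 b2 b3] [c1 c2 c3]; split => /=.
- by rewrite !dotDr !dotZr a1 b1 c1; ring.
- by rewrite !dotDr !dotZr a2 b2 c2; ring.
- rewrite dotC !dotDr !dotZr; rewrite dotC in a3; rewrite dotC in b3; rewrite dotC in c3.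
  transitivity (k * (dot p.2 u.1 + dot p.1 u.2) + l * (dot p.2 v.1 + dot p.1 v.2) + m * (dot p.2 w.1 + dot p.1 w.2)); first ring.
  by rewrite a3 b3 c3; ring.
Qed.

Lemma line_der f p u : differentiable f p -> is_derive (0 : R) (1 : R) (fun t => f (p + t *: u)) ('D_u f p).
Proof.
move=> fd; have e : p + 0 *: u = p by rewrite scale0r addr0.
have D : is_derive (0 : R) (1 : R) (fun t : R => p + t *: u) u.
  apply: der_V6 => j; apply: (is_derive_conv (der_add (der_cst (crd p j) 0) (der_mul (der_id 0) (der_cst (crd u j) 0)))) => [t|].
    by rewrite crdD crdZ.
  by rewrite mul1r mulr0 addr0 add0r.
by rewrite -{2}e; apply: der_chain => //; rewrite e.
Qed.

Lemma dext_conformal f p u w : differentiable f p -> dext (conformal_form f) p u w =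
  'D_u f p * dot p.2 w.1 + f p * dot u.2 w.1 - ('D_w f p * dot p.2 u.1 + f p * dot w.2 u.1).
Proof.
move=> fd; pose l (v : 'rV[R]_3) (y : V6) := dot y.2 v.
have ld v y : differentiable (l v) y.
  rewrite (_ : l v = (fun y => crd y (true, 0) * v 0 0 + crd y (true, 1) * v 0 1 + crd y (true, 2%:R) * v 0 2%:R)).
    apply: differentiableD; first apply: differentiableD; apply: differentiableM; try exact: crd_diff; exact: differentiable_cst.
  by apply/funext => q; rewrite /l dotE.
have key (u' v : V6) : 'D_u' (fun y => conformal_form f y v) p = 'D_u' f p * dot p.2 v.1 + f p * dot u'.2 v.1.
  have cd : differentiable (fun y => conformal_form f y v) p by apply: (differentiableM fd (ld v.1 p)).
  apply: derive_uniq (line_der u' cd) _.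
  have D2 : is_derive (0 : R) (1 : R) (fun t : R => dot (p + t *: u').2 v.1) (dot u'.2 v.1).
    apply: (is_derive_conv (der_add (der_cst (dot p.2 v.1) 0) (der_mul (der_id 0) (der_cst (dot u'.2 v.1) 0)))) => [t|].
      by rewrite /= !dotE !mxE; ring.
    by rewrite mul1r mulr0 addr0 add0r.
  apply: (is_derive_conv (der_mul (line_der u' fd) D2)) => //.
  by rewrite /= !scale0r !addr0.
by rewrite /dext !key.
Qed.

(** The contact vector field of [1 / f] for the Euclidean form. Its components along [Vv] and [Hv]
    are forced by evaluating the exterior derivative on [Hv] and on [Vv]. *)
Definition reebX f p : V6 := (f p)^-1 *: Gv p + ('D_(Hv p) f p / f p ^+ 2) *: Vv p + (- 'D_(Vv p) f p / f p ^+ 2) *: Hv p.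

Lemma comb_dots p k l m : T1S2 p -> let X := k *: Gv p + l *: Vv p + m *: Hv p in
  [/\ dot p.2 X.1 = k, dot (vperp p) X.2 = l & dot (vperp p) X.1 = m].
Proof.
move=> hp; have [h1 h2 h3] := hp; have [n1 n2 n3] := vperp_dots hp => /=; split.
- by rewrite !dotDr !dotZr dot0r h2 n2 mulr1 !mulr0 !addr0.
- by rewrite !dotDr !dotZr dotNr dot0r n3 dotC n1 oppr0 mulr1 !mulr0 add0r addr0.
- by rewrite !dotDr !dotZr dot0r n3 dotC n2 mulr1 !mulr0 !add0r.
Qed.

Lemma reebX_dots f p : T1S2 p -> [/\ dot p.2 (reebX f p).1 = (f p)^-1,
  dot (vperp p) (reebX f p).2 = 'D_(Hv p) f p / f p ^+ 2 & dot (vperp p) (reebX f p).1 = - 'D_(Vv p) f p / f p ^+ 2].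
Proof. by move=> hp; exact: comb_dots. Qed.

Lemma reeb_vectorP f p X : T1S2 p -> 0 < f p -> differentiable f p ->
  reeb_vector (conformal_form f) p X <-> X = reebX f p.
Proof.
move=> hp f0 fd; have [h1 h2 h3] := hp; have [n1 n2 n3] := vperp_dots hp.
have fn : f p != 0 by exact: lt0r_neq0.
have n2' : dot (vperp p) p.2 = 0 by rewrite dotC.
have n1' : dot (vperp p) p.1 = 0 by rewrite dotC.
have h3' : dot p.2 p.1 = 0 by rewrite dotC.
split=> [[tX lX dX]|->].
  have lX' : dot p.2 X.1 = (f p)^-1.
    by apply: (mulfI fn); rewrite divff //; exact: lX.
  have dV := dX _ (tangent_V hp); have dH := dX _ (tangent_H hp).
  rewrite (dext_conformal _ _ fd) /= dot0r dot0r lX' in dV.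
  rewrite (dext_conformal _ _ fd) /= n2 dot0l lX' in dH.
  rewrite (tangent_frame hp tX) /reebX lX'; congr (_ + _ *: _ + _ *: _).
    rewrite dotC; move: ('D_X f p) ('D_(Hv p) f p) (dot X.2 (vperp p)) (f p) fn dH => y1 y2 y3 y4 y40 e.
    by apply: (mulfI y40); have -> : y4 * y3 = y2 / y4; [lra|field].
  move: ('D_X f p) ('D_(Vv p) f p) (dot (vperp p) X.1) (f p) fn dV => y1 y2 y3 y4 y40 e.
  by apply: (mulfI y40); have -> : y4 * y3 = - y2 / y4; [lra|field].
have [e1 e2 e3] := reebX_dots f hp.
have tX : tangent p (reebX f p) by apply: tangent_comb; [exact: tangent_G|exact: tangent_V|exact: tangent_H].
split => //; first by rewrite /conformal_form /lambda_bar0 e1 divff.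
move=> w tw; rewrite (dext_conformal _ _ fd) e1.
have wE := tangent_frame hp tw.
set g := dot p.2 w.1 in wE *; set v := dot (vperp p) w.2 in wE; set h := dot (vperp p) w.1 in wE.
have Dw : 'D_w f p = g * 'D_(Gv p) f p + v * 'D_(Vv p) f p + h * 'D_(Hv p) f p by rewrite {1}wE !D_add // !D_scale.
have DX : 'D_(reebX f p) f p = 'D_(Gv p) f p / f p.
  rewrite /reebX !D_add // !D_scale //.
  by move: ('D_(Hv p) f p) ('D_(Vv p) f p) ('D_(Gv p) f p) => y1 y2 y3; field.
have d1 : dot (reebX f p).2 w.1 = - (f p)^-1 * dot p.1 w.1 + 'D_(Hv p) f p / f p ^+ 2 * h.
  rewrite dotC /reebX /= !dotDr !dotZr dotNr dot0r /h (dotC w.1 p.1) (dotC w.1).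
  by move: ('D_(Hv p) f p) ('D_(Vv p) f p) (f p)^-1 (dot _ _) (dot _ _) => y1 y2 y3 y4 y5; ring.
have d2 : dot w.2 (reebX f p).1 = (f p)^-1 * dot w.2 p.2 - 'D_(Vv p) f p / f p ^+ 2 * v.
  rewrite /reebX /= !dotDr !dotZr dot0r /v (dotC w.2 (vperp p)).
  by move: ('D_(Hv p) f p) ('D_(Vv p) f p) (f p)^-1 (dot _ _) (dot _ _) => y1 y2 y3 y4 y5; ring.
have [tw1 tw2 tw3] := tw.
rewrite DX Dw d1 d2 tw1 (dotC w.2) tw2.
by move: ('D_(Hv p) f p) ('D_(Vv p) f p) ('D_(Gv p) f p) (f p) fn => y1 y2 y3 y4 y40; field.
Qed.
End Reeb.

(** * Coordinate vector fields *)

Section PolarReeb.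
Variable R : realType.
Local Notation V6 := (V6 R).

(** [Px], [Pa] and [Pb] are the partial derivatives of [pt], expressed in the moving frame. *)
Definition Px (a b x : R) : V6 := let p := pt a b x in
  (2 * cos (a + b)) *: Vv p + (2 * sin (a + b)) *: Hv p.
Definition Pa (a b x : R) : V6 := let p := pt a b x in
  (2 * sin x ^+ 2) *: Gv p + (- (2 * sin x * cos x * sin (a + b))) *: Vv p + (2 * sin x * cos x * cos (a + b)) *: Hv p.
Definition Pb (a b x : R) : V6 := let p := pt a b x in
  (2 * cos x ^+ 2) *: Gv p + (2 * sin x * cos x * sin (a + b)) *: Vv p + (- (2 * sin x * cos x * cos (a + b))) *: Hv p.

Lemma pt_der (a b x : R -> R) (t a' b' x' : R) :
  is_derive t (1 : R) a a' -> is_derive t (1 : R) b b' -> is_derive t (1 : R) x x' ->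
  is_derive t (1 : R) (fun s => pt (a s) (b s) (x s))
    (a' *: Pa (a t) (b t) (x t) + b' *: Pb (a t) (b t) (x t) + x' *: Px (a t) (b t) (x t)).
Proof.
move=> ad bd xd; rewrite /pt /zpt /polar.
have sx := der_comp xd (is_derive_sin (x t)); have cx := der_comp xd (is_derive_cos (x t)).
have sa := der_comp ad (is_derive_sin (a t)); have ca := der_comp ad (is_derive_cos (a t)).
have sb := der_comp bd (is_derive_sin (b t)); have cb := der_comp bd (is_derive_cos (b t)).
have D := Dcov_der (der_mul sx ca) (der_mul sx sa) (der_mul cx cb) (der_mul cx sb).
apply: (is_derive_eq D).
have cs := cos2Dsin2 (x t); have csa := cos2Dsin2 (a t); have csb := cos2Dsin2 (b t).
set S := sin (x t) in cs *; set C := cos (x t) in cs *.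
pose ce := cos (a t + b t); pose se := sin (a t + b t).
have e1 : cos (a t) = ce * cos (b t) + se * sin (b t).
  by rewrite -[in LHS](addrK (b t) (a t)) cosB.
have e2 : sin (a t) = se * cos (b t) - ce * sin (b t).
  by rewrite -[in LHS](addrK (b t) (a t)) sinB.
have e3 : cos (b t) = ce * cos (a t) + se * sin (a t).
  by rewrite -[in LHS](addKr (a t) (b t)) addrC cosB.
have e4 : sin (b t) = se * cos (a t) - ce * sin (a t).
  by rewrite -[in LHS](addKr (a t) (b t)) addrC sinB.
pose z : C2 R := ((S * cos (a t), S * sin (a t)), (C * cos (b t), C * sin (b t))).
(* The velocity of the lift is [k], [l], [m] times the three quaternionic multiples of [z]. The four
   coordinates are checked below by eliminating one angle through [a + b], the only combination that
   enters the frame. *)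
pose k := a' * S ^+ 2 + b' * C ^+ 2; pose l := - x' * ce + (a' - b') * S * C * se; pose m := - x' * se - (a' - b') * S * C * ce.
have n1 : nrm z = 1 by rewrite -(nrm_zpt (a t) (b t) (x t)).
have := Bd_lin z k l m ((- z.1.2, z.1.1), (- z.2.2, z.2.1)) ((- z.2.1, z.2.2), (z.1.1, - z.1.2)) ((- z.2.2, - z.2.1), (z.1.2, z.1.1)).
rewrite Bd_i Bd_j Bd_k -/z => E.
rewrite [LHS](_ : _ = k *: (2 *: ((Dcov z).2, - (Dcov z).1)) + l *: (- 2 *: ((0, nz z) : V6)) + m *: (- 2 *: ((nz z, 0) : V6))).
  rewrite /Pa /Pb /Px /pt -/(zpt (a t) (b t) (x t)) -[zpt _ _ _]/z /Gv /Vv /Hv vperp_cover //.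
  rewrite -/S -/C -/ce -/se !scalerA.
  rewrite !scalerDr !scalerA.
  set G := (_, - _); set V := (0, nz z); set H := (nz z, 0).
  have -> : k * 2 = a' * (2 * S ^+ 2) + b' * (2 * C ^+ 2) by rewrite /k; ring.
  have -> : l * -2 = a' * - (2 * S * C * se) + b' * (2 * S * C * se) + x' * (2 * ce) by rewrite /l; ring.
  have -> : m * -2 = a' * (2 * S * C * ce) + b' * - (2 * S * C * ce) + x' * (2 * se) by rewrite /m; ring.
  by apply: V6_eq => j; rewrite !(crdD, crdZ); ring.
have E1 y : y = y * S ^+ 2 + y * C ^+ 2 by rewrite -mulrDr addrC cs mulr1.
rewrite -E; congr Bd; congr (_, _); congr (_, _); rewrite /z /=.
- transitivity ((a' * S ^+ 2 + a' * C ^+ 2) * (- S * (se * cos (b t) - ce * sin (b t))) + x' * C * (ce * cos (b t) + se * sin (b t))).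
    by rewrite -e1 -e2 -E1; ring.
  by rewrite {1}e2 /k /l /m; ring.
- transitivity ((a' * S ^+ 2 + a' * C ^+ 2) * (S * (ce * cos (b t) + se * sin (b t))) + x' * C * (se * cos (b t) - ce * sin (b t))).
    by rewrite -e1 -e2 -E1; ring.
  by rewrite {1}e1 /k /l /m; ring.
- transitivity ((b' * S ^+ 2 + b' * C ^+ 2) * (- C * (se * cos (a t) - ce * sin (a t))) - x' * S * (ce * cos (a t) + se * sin (a t))).
    by rewrite -e3 -e4 -E1; ring.
  by rewrite {1}e4 /k /l /m; ring.
- transitivity ((b' * S ^+ 2 + b' * C ^+ 2) * (C * (ce * cos (a t) + se * sin (a t))) - x' * S * (se * cos (a t) - ce * sin (a t))).
    by rewrite -e3 -e4 -E1; ring.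
  by rewrite {1}e3 /k /l /m; ring.
Qed.
End PolarReeb.

(** * The profile of a contact form and its Reeb equations *)

Section ProfileOf.
Variable R : realType.
Local Notation V6 := (V6 R).
Implicit Types (f : V6 -> R) (p : V6).

Lemma Sm_pt m j : Sm m (fun a b x : R => crd (pt a b x) j).
Proof.
have [[ca sa] [cb sb] [cx sx]] := Sm_trig R m.
have S0 := SmM sx ca; have S1 := SmM sx sa; have S2 := SmM cx cb; have S3 := SmM cx sb.
case: j => -[] [[|[|[|//]]] i]; rewrite /crd /pt /zpt /polar /=.
- rewrite (_ : (fun a b x => _) = (fun a b x => - 2 * ((sin x * cos a) * (sin x * sin a) + (cos x * cos b) * (cos x * sin b)))).
    by apply: SmM; [exact: Sm_cst|apply: SmD; apply: SmM].
  by apply/funext => a; apply/funext => b; apply/funext => x; rewrite mxE.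
- rewrite (_ : (fun a b x => _) = (fun a b x => - ((sin x * cos a) * (sin x * cos a) + - ((sin x * sin a) * (sin x * sin a)) + - ((cos x * cos b) * (cos x * cos b)) + (cos x * sin b) * (cos x * sin b)))).
    by apply: SmN; apply: SmD; [apply: SmD; [apply: SmD; [|apply: SmN]|apply: SmN]|]; apply: SmM.
  by apply/funext => a; apply/funext => b; apply/funext => x; rewrite mxE.
- rewrite (_ : (fun a b x => _) = (fun a b x => 2 * ((sin x * cos a) * (cos x * cos b) + - ((sin x * sin a) * (cos x * sin b))))).
    by apply: SmM; [exact: Sm_cst|apply: SmD; [|apply: SmN]; apply: SmM].
  by apply/funext => a; apply/funext => b; apply/funext => x; rewrite mxE.
- rewrite (_ : (fun a b x => _) = (fun a b x => ((sin x * cos a) * (sin x * cos a) + - ((sin x * sin a) * (sin x * sin a)) + (cos x * cos b) * (cos x * cos b) + - ((cos x * sin b) * (cos x * sin b))))).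
    by apply: SmD; [apply: SmD; [apply: SmD; [|apply: SmN]|]|apply: SmN]; apply: SmM.
  by apply/funext => a; apply/funext => b; apply/funext => x; rewrite mxE.
- rewrite (_ : (fun a b x => _) = (fun a b x => 2 * (- ((sin x * cos a) * (sin x * sin a)) + (cos x * cos b) * (cos x * sin b)))).
    by apply: SmM; [exact: Sm_cst|apply: SmD; [apply: SmN|]; apply: SmM].
  by apply/funext => a; apply/funext => b; apply/funext => x; rewrite mxE.
- rewrite (_ : (fun a b x => _) = (fun a b x => 2 * ((sin x * cos a) * (cos x * sin b) + (sin x * sin a) * (cos x * cos b)))).
    by apply: SmM; [exact: Sm_cst|apply: SmD; apply: SmM].
  by apply/funext => a; apply/funext => b; apply/funext => x; rewrite mxE.
Qed.

Definition Uof f (a b x : R) : R := (f (pt a b x))^-1.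

Section WithF.
Variables (f : V6 -> R) (fsm : smooth f) (f_gt0 : forall p, T1S2 p -> 0 < f p).

Lemma f_diff p : differentiable f p.
Proof. by have [h _] := fsm 1%N; exact: h. Qed.

Lemma fpt_gt0 (a b x : R) : 0 < f (pt a b x).
Proof. exact/f_gt0/T1S2_pt. Qed.

Lemma Sm_U m : Sm m (Uof f).
Proof.
apply: SmV; first by move=> a b x; exact: lt0r_neq0 (fpt_gt0 a b x).
by apply: Sm_comp; [exact: fsm|exact: Sm_pt].
Qed.

Lemma Uof_chain (a b x : R -> R) (t a' b' x' : R) :
  is_derive t (1 : R) a a' -> is_derive t (1 : R) b b' -> is_derive t (1 : R) x x' ->
  is_derive t (1 : R) (fun s => Uof f (a s) (b s) (x s))
   (- 'D_(a' *: Pa (a t) (b t) (x t) + b' *: Pb (a t) (b t) (x t) + x' *: Px (a t) (b t) (x t)) f (pt (a t) (b t) (x t)) / f (pt (a t) (b t) (x t)) ^+ 2).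
Proof.
move=> ad bd xd; have D := der_chain (f_diff _) (pt_der ad bd xd).
have n0 := lt0r_neq0 (fpt_gt0 (a t) (b t) (x t)).
have dv : is_derive t (1 : R) (fun s => (f (pt (a s) (b s) (x s)))^-1) (- (f (pt (a t) (b t) (x t))) ^- 2 *: 'D_(a' *: Pa (a t) (b t) (x t) + b' *: Pb (a t) (b t) (x t) + x' *: Px (a t) (b t) (x t)) f (pt (a t) (b t) (x t))).
  exact: is_deriveV.
by apply: (is_derive_conv dv) => //; rewrite /GRing.scale /= mulrC mulrN mulNr.
Qed.

Lemma Uof_dA (a b x : R) : is_derive a (1 : R) (fun a => Uof f a b x) (- 'D_(Pa a b x) f (pt a b x) / f (pt a b x) ^+ 2).
Proof. by have := Uof_chain (der_id a) (der_cst b a) (der_cst x a); rewrite scale1r !scale0r !addr0. Qed.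

Lemma Uof_dB (a b x : R) : is_derive b (1 : R) (fun b => Uof f a b x) (- 'D_(Pb a b x) f (pt a b x) / f (pt a b x) ^+ 2).
Proof. by have := Uof_chain (der_cst a b) (der_id b) (der_cst x b); rewrite scale1r !scale0r addr0 add0r. Qed.

Lemma Uof_dX (a b x : R) : is_derive x (1 : R) (fun x => Uof f a b x) (- 'D_(Px a b x) f (pt a b x) / f (pt a b x) ^+ 2).
Proof. by have := Uof_chain (der_cst a x) (der_cst b x) (der_id x); rewrite scale1r !scale0r !add0r. Qed.

Lemma pt_shift (a b x : R) : pt (a + 2 * pi) b x = pt a b x /\ pt a (b + 2 * pi) x = pt a b x /\ pt (a + pi) (b + pi) x = pt a b x.
Proof.
have c2 (y : R) : cos (y + 2 * pi) = cos y by rewrite mulrDl mul1r addrA !cosDpi opprK.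
have s2 (y : R) : sin (y + 2 * pi) = sin y by rewrite mulrDl mul1r addrA !sinDpi opprK.
rewrite /pt /zpt /polar !c2 !s2 !cosDpi !sinDpi; split => //; split => //.
by rewrite /Dcov; congr pair; apply: row3; rewrite !simp3; ring.
Qed.

Lemma pt_x0 (a a' b : R) : pt a b 0 = pt a' b 0.
Proof. by rewrite /pt /zpt /polar sin0 !mul0r. Qed.

Lemma pt_xpi (a b b' : R) : pt a b (pi / 2) = pt a b' (pi / 2).
Proof. by rewrite /pt /zpt /polar cos_pihalf !mul0r. Qed.

Hypothesis crit0 : forall a b : R, 'D_(Px a b 0) f (pt a b 0) = 0.
Hypothesis crit1 : forall a b : R, 'D_(Px a b (pi / 2)) f (pt a b (pi / 2)) = 0.

Lemma profile_exists : exists P : profile R, good P /\ pU P = Uof f.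
Proof.
have [Uc [Ua [Ub [Ux [ha hb hx [sa sb sx]]]]]] := Sm_U 3.
have [_ [_ [_ [Uxx [_ _ hxx [_ _ sxx]]]]]] := sx.
have [_ [UxxA [UxxB [_ [hA hB _ [sA sB _]]]]]] := sxx.
exists (Profile (Uof f) Ua Ub Ux Uxx UxxA UxxB); split => //; split => //=.
- exact: (@Sm_ucont _ 2 Ua sa).
- exact: (@Sm_ucont _ 2 Ub sb).
- exact: (@Sm_ucont _ 2 Ux sx).
- exact: (@Sm_ucont _ 1 Uxx sxx).
- exact: (@Sm_ucont _ 0 UxxA sA).
- exact: (@Sm_ucont _ 0 UxxB sB).
- by move=> a b x; rewrite /Uof addr0; have [-> _] := pt_shift a b x.
- by move=> a b x; rewrite /Uof addr0; have [_ [-> _]] := pt_shift a b x.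
- by move=> a b x; rewrite invr_gt0; exact: fpt_gt0.
- by move=> a b; rewrite (derive_uniq (hx a b 0) (Uof_dX a b 0)) crit0 oppr0 mul0r.
- by move=> a b; rewrite (derive_uniq (hx a b (pi / 2)) (Uof_dX a b (pi / 2))) crit1 oppr0 mul0r.
- by move=> a a' b; rewrite /Uof (pt_x0 a a').
- by move=> a b b'; rewrite /Uof (pt_xpi a b b').
Qed.
End WithF.

(** [al], [be] and [ga] are the derivatives of [f] along [Vv], [Hv] and [Gv]. The three identities
    say that the velocities in [interior_orbit], applied to the coordinate fields, reproduce the
    components of [reebX]. *)
Lemma trig_solve (s c ce se al be ga F : R) : s ^+ 2 + c ^+ 2 = 1 -> ce ^+ 2 + se ^+ 2 = 1 -> s != 0 -> c != 0 -> F != 0 ->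
  let Ux := - (2 * ce * al + 2 * se * be) / F ^+ 2 in
  let Ua := - (2 * s ^+ 2 * ga + - (2 * s * c * se) * al + 2 * s * c * ce * be) / F ^+ 2 in
  let Ub := - (2 * c ^+ 2 * ga + 2 * s * c * se * al + - (2 * s * c * ce) * be) / F ^+ 2 in
  let A := F^-1 / 2 + Ux * (c / s) / 4 in let B := F^-1 / 2 - Ux * (s / c) / 4 in
  let C := Ub * (s / c) / 4 - Ua * (c / s) / 4 in
  [/\ A * (2 * s ^+ 2) + B * (2 * c ^+ 2) = F^-1,
      A * - (2 * s * c * se) + B * (2 * s * c * se) + C * (2 * ce) = be / F ^+ 2 &
      A * (2 * s * c * ce) + B * - (2 * s * c * ce) + C * (2 * se) = - al / F ^+ 2].
Proof.
move=> sc cse s0 c0 F0 Ux Ua Ub A B C.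
have ABy (y : R) : (F^-1 / 2 + y * (c / s) / 4) - (F^-1 / 2 - y * (s / c) / 4) = y * (s ^+ 2 + c ^+ 2) / (4 * s * c).
  by field; rewrite s0 c0 F0.
have ABz (y : R) : (F^-1 / 2 + y * (c / s) / 4) * (2 * s ^+ 2) + (F^-1 / 2 - y * (s / c) / 4) * (2 * c ^+ 2) = (s ^+ 2 + c ^+ 2) * F^-1.
  by field; rewrite s0 c0 F0.
have AB : A - B = Ux / (4 * s * c).
  by rewrite /A /B ABy sc mulr1.
have CE : C = (ce * be - se * al) / (2 * F ^+ 2).
  transitivity ((s ^+ 2 + c ^+ 2) * (ce * be - se * al) / (2 * F ^+ 2)); last by rewrite sc mul1r.
  by rewrite /C /Ua /Ub; field; rewrite s0 c0 F0.
split.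
- by rewrite /A /B ABz sc mul1r.
- transitivity (- (A - B) * (2 * s * c * se) + C * (2 * ce)); first ring.
  rewrite AB CE; transitivity ((ce ^+ 2 + se ^+ 2) * be / F ^+ 2); last by rewrite cse mul1r.
  by rewrite /Ux; field; rewrite s0 c0 F0.
- transitivity ((A - B) * (2 * s * c * ce) + C * (2 * se)); first ring.
  rewrite AB CE; transitivity (- ((ce ^+ 2 + se ^+ 2) * al) / F ^+ 2); last by rewrite cse mul1r.
  by rewrite /Ux; field; rewrite s0 c0 F0.
Qed.

Lemma D_comb f p k l m (fd : differentiable f p) : 'D_(k *: Gv p + l *: Vv p + m *: Hv p) f p =
  k * 'D_(Gv p) f p + l * 'D_(Vv p) f p + m * 'D_(Hv p) f p.
Proof. by rewrite !D_add // !D_scale. Qed.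

Lemma reebX_pt f (a b x : R) : smooth f -> 0 < f (pt a b x) -> sin x != 0 -> cos x != 0 ->
  let F := f (pt a b x) in
  let Ux := - 'D_(Px a b x) f (pt a b x) / F ^+ 2 in
  let Ua := - 'D_(Pa a b x) f (pt a b x) / F ^+ 2 in
  let Ub := - 'D_(Pb a b x) f (pt a b x) / F ^+ 2 in
  reebX f (pt a b x) = (F^-1 / 2 + Ux * (cos x / sin x) / 4) *: Pa a b x + (F^-1 / 2 - Ux * (sin x / cos x) / 4) *: Pb a b x
    + (Ub * (sin x / cos x) / 4 - Ua * (cos x / sin x) / 4) *: Px a b x.
Proof.
move=> fsm F0 s0 c0 F Ux Ua Ub.
have fd := f_diff fsm (pt a b x).
pose al := 'D_(Vv (pt a b x)) f (pt a b x); pose be := 'D_(Hv (pt a b x)) f (pt a b x); pose ga := 'D_(Gv (pt a b x)) f (pt a b x).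
have cs : sin x ^+ 2 + cos x ^+ 2 = 1 by rewrite addrC cos2Dsin2.
have [e1 e2 e3] := trig_solve al be ga cs (cos2Dsin2 (a + b)) s0 c0 (lt0r_neq0 F0).
have UxE : Ux = - (2 * cos (a + b) * al + 2 * sin (a + b) * be) / F ^+ 2.
  by rewrite /Ux /Px !D_add // !D_scale.
have UaE : Ua = - (2 * sin x ^+ 2 * ga + - (2 * sin x * cos x * sin (a + b)) * al + 2 * sin x * cos x * cos (a + b) * be) / F ^+ 2.
  by rewrite /Ua /Pa D_comb.
have UbE : Ub = - (2 * cos x ^+ 2 * ga + 2 * sin x * cos x * sin (a + b) * al + - (2 * sin x * cos x * cos (a + b)) * be) / F ^+ 2.
  by rewrite /Ub /Pb D_comb.
rewrite -UxE -UaE -UbE -/F in e1 e2 e3.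
rewrite /reebX -/F -/al -/be /Pa /Pb /Px.
apply: V6_eq => j; rewrite !(crdD, crdZ).
move: e1 e2 e3; set A := F^-1 / 2 + _; set B := F^-1 / 2 - _; set C := Ub * _ / 4 - _ => e1 e2 e3.
move: (crd (Gv _) j) (crd (Vv _) j) (crd (Hv _) j) => g v h.
rewrite -e1 -e2 -e3; clear e1 e2 e3; clearbody A B C; move: A B C (cos x) (sin x) => A' B' C' c s.
by move: (cos (a + b)) (sin (a + b)) => c' s'; ring.
Qed.

Lemma interior_reeb f (P : profile R) (a b x : R -> R) : smooth f -> (forall p, T1S2 p -> 0 < f p) ->
  good P -> pU P = Uof f -> interior_orbit P a b x ->
  reeb_trajectory (conformal_form f) (fun t => pt (a t) (b t) (x t)).
Proof.
move=> fsm f0 g PU orb t; split; first exact: T1S2_pt.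
have [x0 x1 ad bd xd] := orb t; have pp := pi_gt0 R.
have s0 : sin (x t) != 0 by apply/lt0r_neq0/sin_gt0_pi; apply/andP; split; lra.
have c0 : cos (x t) != 0 by apply/lt0r_neq0/cos_gt0_pihalf; apply/andP; split; lra.
have fp := f0 _ (T1S2_pt (a t) (b t) (x t)).
exists (reebX f (pt (a t) (b t) (x t))); first by apply/reeb_vectorP => //; [exact: T1S2_pt|exact: f_diff].
rewrite reebX_pt //.
have AE : pA P (a t) (b t) (x t) = - 'D_(Pa (a t) (b t) (x t)) f (pt (a t) (b t) (x t)) / f (pt (a t) (b t) (x t)) ^+ 2.
  by apply: derive_uniq (dA g _ _ _) _; rewrite PU; exact: Uof_dA.
have BE : pB P (a t) (b t) (x t) = - 'D_(Pb (a t) (b t) (x t)) f (pt (a t) (b t) (x t)) / f (pt (a t) (b t) (x t)) ^+ 2.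
  by apply: derive_uniq (dB g _ _ _) _; rewrite PU; exact: Uof_dB.
have XE : pX P (a t) (b t) (x t) = - 'D_(Px (a t) (b t) (x t)) f (pt (a t) (b t) (x t)) / f (pt (a t) (b t) (x t)) ^+ 2.
  by apply: derive_uniq (dX g _ _ _) _; rewrite PU; exact: Uof_dX.
apply: (is_derive_eq (pt_der ad bd xd)).
by rewrite AE BE XE PU.
Qed.

Lemma vperp_pt (a b x : R) : vperp (pt a b x) = nz (zpt a b x).
Proof. exact: vperp_cover (nrm_zpt a b x). Qed.

Lemma row_unit p : T1S2 p -> p.1 0 2%:R ^+ 2 + p.2 0 2%:R ^+ 2 + vperp p 0 2%:R ^+ 2 = 1.
Proof.
move=> hp; have := congr1 (fun u : 'rV[R]_3 => u 0 2%:R) (expand3 (vec3 0 0 1) hp).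
rewrite !mxE !dotE !vec30 !vec31 !vec32 /= => ->; ring.
Qed.

(* On the link the third coordinates of x and v vanish, hence so do those of the Reeb vector. *)
Lemma link_critical f (l : R -> V6) : smooth f -> (forall p, T1S2 p -> 0 < f p) ->
  reeb_trajectory (conformal_form f) l -> (forall t, (l t).1 0 2%:R = 0 /\ (l t).2 0 2%:R = 0) ->
  forall t, 'D_(Vv (l t)) f (l t) = 0 /\ 'D_(Hv (l t)) f (l t) = 0.
Proof.
move=> fsm f0 tr l3 t; have [lt [X /reeb_vectorP XE ld]] := tr t.
have fp := f0 _ lt; have fd := f_diff fsm (l t).
have {}XE := XE lt fp fd.
have n3 : vperp (l t) 0 2%:R != 0.
  apply/eqP => n0; have := row_unit lt; have [-> ->] := l3 t; rewrite n0 expr0n /= !addr0 => /eqP.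
  by rewrite eq_sym oner_eq0.
have X1 : X.1 0 2%:R = 0.
  have := der_crd (false, 2%:R) ld; rewrite /crd /= => D.
  by apply: derive_uniq D _; apply: (is_derive_conv (der_cst 0 t)) => // s; have [-> _] := l3 s.
have X2 : X.2 0 2%:R = 0.
  have := der_crd (true, 2%:R) ld; rewrite /crd /= => D.
  by apply: derive_uniq D _; apply: (is_derive_conv (der_cst 0 t)) => // s; have [_ ->] := l3 s.
have [z1 z2] := l3 t.
move: X1 X2; rewrite XE /reebX; move: ('D_(Hv _) f (l t)) ('D_(Vv _) f (l t)) (f (l t)) fp => y1 y2 F F0.
rewrite /Gv /Vv /Hv; move: (vperp (l t)) n3 => w n0; rewrite /= !mxE z1 z2; move: (w 0 2%:R) n0 => n n0 k1 k2.
have Fn := lt0r_neq0 F0.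
split.
  have : y2 * n = 0.
    transitivity (- F ^+ 2 * (F^-1 * 0 + y1 / F ^+ 2 * 0 + - y2 / F ^+ 2 * n)); first by field.
    by rewrite k1 mulr0.
  by move/eqP; rewrite mulf_eq0 (negPf n0) orbF => /eqP.
have : y1 * n = 0.
  transitivity (F ^+ 2 * (F^-1 * - 0 + y1 / F ^+ 2 * n + - y2 / F ^+ 2 * 0)); first by field.
  by rewrite k2 mulr0.
by move/eqP; rewrite mulf_eq0 (negPf n0) orbF => /eqP.
Qed.
End ProfileOf.

(** * Rotation along the link *)

Section Antiderivative.
Variable R : realType.

Lemma antiderivative_right (g : R -> R) (n : R) : continuous g -> exists G : R -> R, forall t, n < t -> is_derive t (1 : R) G (g t).
Proof.
move=> gc; exists (fun x => \int[lebesgue_measure]_(t in [set` Interval (BLeft n) (BRight x)]) (g t))%R.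
move=> t nt; have ti : t < t + 1 by rewrite ltrDl.
have ni : lebesgue_measure.-integrable [set` Interval (BLeft n) (BRight (t + 1))] (EFin \o g).
  apply: continuous_compact_integrable; first exact: segment_compact.
  exact: continuous_subspaceT.
have := continuous_FTC1_closed ti ni nt (gc t).
by move: (fun x : R => _) => F [h1 <-]; rewrite derive1E; apply: DeriveDef.
Qed.

Lemma segment_const (f : R -> R) (x y : R) : (forall t, Num.min x y <= t -> t <= Num.max x y -> is_derive t (1 : R) f 0) -> f x = f y.
Proof.
wlog xy : x y / x <= y => [H|].
  have [xy|yx] := orP (le_total x y); first exact: H.
  by move=> h; apply/esym; apply: H => // t; rewrite minC maxC; exact: h.
rewrite min_l // max_r // => h.
move: xy; rewrite le_eqVlt => /predU1P[-> //|xy].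
have fd (t : R) : t \in `]x, y[ -> is_derive t (1 : R) f ((fun=> 0 : R) t).
  by rewrite in_itv /= => /andP[t1 t2]; apply: h; exact: ltW.
have fc : {within `[x, y], continuous f}.
  by apply: derivable_within_continuous => t; rewrite in_itv /= => /andP[t1 t2]; have [] := h t t1 t2.
have [c _ /eqP] := MVT xy fd fc.
by rewrite mul0r subr_eq0 => /eqP.
Qed.

(** Antiderivatives on half-lines, normalized to vanish at 0, agree wherever two of them are
    defined. *)
Lemma antiderivative (g : R -> R) : continuous g -> exists G : R -> R, forall t, is_derive t (1 : R) G (g t).
Proof.
move=> gc.
have /choice[H HP] : forall n : nat, exists G : R -> R, (forall t : R, - n%:R < t -> is_derive t (1 : R) G (g t)) /\ G 0 = 0.
  move=> n; have [G GP] := antiderivative_right (- n%:R) gc.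
  exists (fun t => G t - G 0); split; last by rewrite subrr.
  by move=> t nt; apply: (is_derive_conv (der_sub (GP t nt) (der_cst (G 0) t))) => //; rewrite subr0.
have /choice[m mP] : forall t : R, exists m : nat, `|t| + 1 < m%:R by move=> t; exact: archi_bound.
have agree (i j : nat) (t : R) : `|t| < i%:R -> `|t| < j%:R -> H i t = H j t.
  move=> ti' tj'; have nt := normr_ge0 t; have ti : - i%:R < t by have := ler_norm (- t); rewrite normrN; lra.
  have tj : - j%:R < t by have := ler_norm (- t); rewrite normrN; lra.
  have [Hi Hi0] := HP i; have [Hj Hj0] := HP j.
  have e : H i t - H j t = H i 0 - H j 0.
    apply: (@segment_const (fun t => H i t - H j t)) => s smin _.
    have [si sj] : - i%:R < s /\ - j%:R < s.
      by split; apply: lt_le_trans smin; rewrite lt_min; apply/andP; split => //; lra.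
    by apply: (is_derive_conv (der_sub (Hi s si) (Hj s sj))) => //; rewrite subrr.
  by rewrite Hi0 Hj0 subrr in e; apply/eqP; rewrite -subr_eq0 e.
exists (fun t => H (m t) t) => t.
have [Hm _] := HP (m t); have mt := mP t; have nt := normr_ge0 t.
have mtt : - (m t)%:R < t by have := ler_norm (- t); rewrite normrN; lra.
apply: (is_derive_local ltr01 _ (Hm t mtt)) => s st; apply: agree; last by have := mP s; lra.
have : `|t + (s - t)| <= `|t| + `|s - t| by exact: ler_normD.
by rewrite addrCA subrr addr0; lra.
Qed.
End Antiderivative.

Section Angles.
Variable R : realType.

Lemma cos_eq1 (w : R) : cos w = 1 -> exists k : int, w = k%:~R * (2 * pi).
Proof.
move=> cw; have [k /andP[k0 k2]] := red_angle w; set v := w + _ in k0 k2.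
have pp := pi_gt0 R.
have per (n : int) (y : R) : cos (y + n%:~R * (2 * pi)) = cos y.
  have c2 (y' : R) : cos (y' + 2 * pi) = cos y' by rewrite mulrDl mul1r addrA !cosDpi opprK.
  have P (j : nat) (y' : R) : cos (y' + j%:R * (2 * pi)) = cos y'.
    by elim: j => [|j IH]; [rewrite mul0r addr0|rewrite -natr1 mulrDl mul1r addrA c2 IH].
  case: n => j; first exact: P.
  by rewrite NegzE (_ : (- j.+1%:Z)%:~R = - j.+1%:R :> R) ?mulrNz // mulNr -(P j.+1 (_ - _)) subrK.
have cv : cos v = 1 by rewrite /v per.
have [vp|vp] := leP v pi.
  have v0 : v = 0 by apply: cos_inj; rewrite ?in_itv /= ?cos0 // ?lexx ?k0 ?vp ?ltW.
  by exists (- k); move: v0; rewrite /v mulrNz mulNr; lra.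
have v0 : 2 * pi - v = 0.
  apply: cos_inj; rewrite ?in_itv /= ?cos0 ?lexx ?(ltW pp) //; first by apply/andP; split; lra.
  have -> : 2 * pi - v = - v + 1%:~R * (2 * pi) by rewrite mul1r addrC.
  by rewrite per cosN.
exists (1 - k); rewrite intrD mulrNz mulr1z.
by have -> : w = 2 * pi - k%:~R * (2 * pi); [move: v0; rewrite /v; lra|ring].
Qed.

Lemma angle_eq (u v : R) : cos u = cos v -> sin u = sin v -> exists k : int, u = v + k%:~R * (2 * pi).
Proof.
move=> c s; have [|k e] := @cos_eq1 (u - v).
  by rewrite cosB c s -!expr2 cos2Dsin2.
by exists k; rewrite -e; ring.
Qed.

Lemma angle_eq_double (u v : R) : cos (2 * u) = cos (2 * v) -> sin (2 * u) = sin (2 * v) -> exists k : int, u = v + k%:~R * pi.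
Proof. by move=> c s; have [k e] := angle_eq c s; exists k; lra. Qed.

(* An angle function is differentiable as soon as the sine of its increments is. *)
Lemma angle_increment (th : R -> R) (t N : R) (h S : nat -> R) : {for t, continuous th} ->
  h @ ultra --> (0 : R) -> (forall n, h n != 0) ->
  (fun n => sin (th (t + h n) - th t) / h n) @ ultra --> N ->
  (fun n => (th (t + h n) - th t) / h n) @ ultra --> N.
Proof.
move=> thc h0 hn sN.
pose D n := th (t + h n) - th t.
have Dc : D @ ultra --> (0 : R).
  rewrite -(subrr (th t)); apply: cvgB; last exact: cvg_cst.
  apply: (ultra_cvg_comp (f := th) (u := fun n => t + h n)) => //.
  by rewrite -[X in _ --> X](addr0 t); apply: cvgD => //; exact: cvg_cst.
have /choice[c cP] : forall n, exists c, `|c| <= `|D n| /\ sin (D n) = cos c * D n.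
  move=> n; have [c hc e] := mean_value 0 (D n) (fun t => is_derive_sin t).
  by exists c; move: hc e; rewrite sin0 !subr0.
have cc : c @ ultra --> (0 : R).
  apply: (@ultra_squeeze0 _ (fun n => `|D n|)); first by move=> n; have [] := cP n.
  by have := ultra_cvg_comp (@norm_continuous R R _) Dc; rewrite normr0.
have cosc : (fun n => cos (c n)) @ ultra --> (1 : R).
  by rewrite -(@cos0 R); exact: ultra_cvg_comp (@continuous_cos R 0) cc.
have lim : (fun n => sin (D n) / h n / cos (c n)) @ ultra --> N / 1.
  by apply: cvgM => //; apply: cvgV => //; exact: oner_neq0.
rewrite divr1 in lim; apply: ultra_cvg_eq lim.
have near := ultra_cvg_gt cosc (ltr01 : 0 < (1 : R)).
apply: filterS near => n /= cn; have [_ ->] := cP n; rewrite -/(D n).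
by field; rewrite hn lt0r_neq0.
Qed.

Lemma is_derive_seq (f : R -> R) (t N : R) :
  (forall h : nat -> R, (forall n, h n != 0) -> (forall n, `|h n| <= n.+1%:R^-1) ->
    (fun n => (f (t + h n) - f t) / h n) @ ultra --> N) -> is_derive t (1 : R) f N.
Proof.
move=> H; apply: is_derive_eps => e e0; apply: contrapT => no.
have /choice[h hP] : forall n : nat, exists h : R, `|h| <= n.+1%:R^-1 /\ e * `|h| < `|f (t + h) - f t - h * N|.
  move=> n; apply: contrapT => non; apply: no; exists n.+1%:R^-1; first by rewrite invr_gt0.
  by move=> h /ltW hh; rewrite leNgt; apply/negP => k; apply: non; exists h.
have hn n : h n != 0.
  by apply/eqP => z; have [_] := hP n; rewrite z addr0 subrr mul0r subr0 normr0 mulr0 ltxx.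
have := H h hn (fun n => proj1 (hP n)) => /cvgrPdist_le /(_ e e0) /filter_ex[n /=].
have [_ k1] := hP n; have h0 : 0 < `|h n| by rewrite normr_gt0.
rewrite -(ler_pM2r h0) -normrM mulrBl divfK // (mulrC N) distrC leNgt => /negP; apply.
by [].
Qed.
End Angles.

Section Transverse.
Variable R : realType.
Local Notation V6 := (V6 R).
Local Notation V3 p := (crd p (true, 2%:R)).
Local Notation X3 p := (crd p (false, 2%:R)).

(** That is, [v3 + i x3 = 2 z0 z1]: a complex function vanishing exactly on the link, whose argument
    is [a + b]. *)
Lemma pt_third (a b x : R) : V3 (pt a b x) = 2 * sin x * cos x * cos (a + b) /\ X3 (pt a b x) = 2 * sin x * cos x * sin (a + b).
Proof. by rewrite /crd /pt /zpt /polar /= !simp3 sinD cosD; split; ring. Qed.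

Lemma pt_n3 (a b x : R) : vperp (pt a b x) 0 2%:R = cos x ^+ 2 - sin x ^+ 2.
Proof.
rewrite vperp_pt /nz /zpt /polar /= !simp3 !exprMn.
have h1 := cos2Dsin2 a; have h2 := cos2Dsin2 b.
by rewrite -mulrDr h2 mulr1 -addrA -opprD -mulrDr h1 mulr1.
Qed.

Lemma sin_eq0_quadrant (x : R) : 0 <= x <= pi / 2 -> sin x = 0 -> x = 0.
Proof.
move=> /andP[x0 x1] s0; have pp := pi_gt0 R; apply/eqP; apply/negPn/negP => xn.
have : 0 < sin x by apply: sin_gt0_pi; rewrite lt_neqAle eq_sym xn x0 /=; lra.
by rewrite s0 ltxx.
Qed.

Lemma cos_eq0_quadrant (x : R) : 0 <= x <= pi / 2 -> cos x = 0 -> x = pi / 2.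
Proof.
move=> /andP[x0 x1] c0; have : pi / 2 - x = 0; last by lra.
apply: sin_eq0_quadrant; first by apply/andP; split; lra.
by rewrite sinB sin_pihalf cos_pihalf c0; ring.
Qed.

Variables (f : V6 -> R) (P : profile R).
Hypotheses (fsm : smooth f) (f_gt0 : forall p, T1S2 p -> 0 < f p) (g : good P) (PU : pU P = Uof f).

Lemma D_Px (a b x : R) : 'D_(Px a b x) f (pt a b x) = - pX P a b x * f (pt a b x) ^+ 2.
Proof.
have h := dX g a b x; rewrite PU in h; rewrite (derive_uniq h (Uof_dX fsm f_gt0 a b x)).
by have := fpt_gt0 f_gt0 a b x; move: (f _) ('D__ _ _) => F D F0; field; exact: lt0r_neq0.
Qed.

(** A point of the link does not determine the collapsed angle, which can be chosen with [a + b = 0]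
    or [a + b = pi / 2]. Then [Px] is proportional to [Vv] or to [Hv], and [U_x = 0] kills both
    derivatives. *)
Lemma D_link p : T1S2 p -> V3 p = 0 -> X3 p = 0 -> 'D_(Vv p) f p = 0 /\ 'D_(Hv p) f p = 0.
Proof.
move=> /polar_onto[a [b [x [x01 ->]]]] z1 z2; have [e1 e2] := pt_third a b x; rewrite e1 e2 in z1 z2.
have sc : sin x * cos x = 0.
  have := cos2Dsin2 (a + b); move: (cos (a + b)) (sin (a + b)) z1 z2 => C S z1 z2 CS.
  have -> : sin x * cos x = (2 * sin x * cos x * C * C + 2 * sin x * cos x * S * S) / 2 by rewrite -!mulrA -!expr2 -!mulrDr CS; field.
  by rewrite z1 z2 !mul0r addr0 mul0r.
suff [u [v [pu pv [hu hv]]]] : exists u v : R * R, [/\ pt u.1 u.2 x = pt a b x, pt v.1 v.2 x = pt a b x &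
    'D_(Px u.1 u.2 x) f (pt u.1 u.2 x) = 0 /\ 'D_(Px v.1 v.2 x) f (pt v.1 v.2 x) = 0 /\ (u.1 + u.2 = 0 /\ v.1 + v.2 = pi / 2)].
  have fd := f_diff fsm (pt a b x); case: hv => hv [eu ev].
  rewrite /Px eu cos0 sin0 pu D_add // !D_scale // in hu; rewrite /Px ev cos_pihalf sin_pihalf pv D_add // !D_scale // in hv.
  by move: ('D__ f _) ('D__ f _) hu hv => u' v' hu hv; split; lra.
have X0 (c d y : R) : pX P c d y = 0 -> 'D_(Px c d y) f (pt c d y) = 0 by move=> h; rewrite D_Px h oppr0 mul0r.
move/eqP: sc; rewrite mulf_eq0 => /orP[/eqP/(sin_eq0_quadrant x01)|/eqP/(cos_eq0_quadrant x01)] ->.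
  exists (- b, b), (pi / 2 - b, b); split => /=; try exact: pt_x0.
  by split; [|split]; try (apply: X0; exact: (X_0 g)); split; ring.
exists (a, - a), (a, pi / 2 - a); split => /=; try exact: pt_xpi.
by split; [|split]; try (apply: X0; exact: (X_pi g)); split; ring.
Qed.

(** [stretch + i spin] is the logarithmic derivative of [v3 + i x3], which is [sin (2 x)] times the
    exponential of [i (a + b)], along the Reeb flow. *)
Definition stretch P (a b x : R) : R := (cos x ^+ 2 - sin x ^+ 2) * (pB P a b x / cos x ^+ 2 - pA P a b x / sin x ^+ 2) / 4.
Definition spin P (a b x : R) : R := pU P a b x + pX P a b x * (cos x / sin x - sin x / cos x) / 4.

Lemma reebX_profile (a b x : R) : sin x != 0 -> cos x != 0 ->
  reebX f (pt a b x) = (pU P a b x / 2 + pX P a b x * (cos x / sin x) / 4) *: Pa a b x +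
    (pU P a b x / 2 - pX P a b x * (sin x / cos x) / 4) *: Pb a b x +
    (pB P a b x * (sin x / cos x) / 4 - pA P a b x * (cos x / sin x) / 4) *: Px a b x.
Proof.
move=> s0 c0; rewrite reebX_pt //; last exact: fpt_gt0.
have AE : pA P a b x = - 'D_(Pa a b x) f (pt a b x) / f (pt a b x) ^+ 2.
  by apply: derive_uniq (dA g _ _ _) _; rewrite PU; exact: Uof_dA.
have BE : pB P a b x = - 'D_(Pb a b x) f (pt a b x) / f (pt a b x) ^+ 2.
  by apply: derive_uniq (dB g _ _ _) _; rewrite PU; exact: Uof_dB.
have XE : pX P a b x = - 'D_(Px a b x) f (pt a b x) / f (pt a b x) ^+ 2.
  by apply: derive_uniq (dX g _ _ _) _; rewrite PU; exact: Uof_dX.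
by rewrite AE BE XE PU.
Qed.

Lemma reebX_third (a b x : R) : let p := pt a b x in 0 <= x <= pi / 2 ->
  V3 (reebX f p) = stretch P a b x * V3 p - spin P a b x * X3 p /\ X3 (reebX f p) = stretch P a b x * X3 p + spin P a b x * V3 p.
Proof.
move=> p x01; have [e1 e2] := pt_third a b x; have fp := fpt_gt0 f_gt0 a b x.
(* On the link the quotients by 0 in [stretch] and [spin] do no harm: the third coordinates of the
   point and of the Reeb vector all vanish. *)
have [/eqP|] := boolP (sin x * cos x == 0).
  move=> sc; have z1 : V3 p = 0 by rewrite e1 -[2 * _ * _]mulrA sc mulr0 mul0r.
  have z2 : X3 p = 0 by rewrite e2 -[2 * _ * _]mulrA sc mulr0 mul0r.
  have [d1 d2] := D_link (T1S2_pt a b x) z1 z2.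
  rewrite /reebX d1 d2 !(crdD, crdZ) oppr0 !mul0r !addr0 z1 z2 !mulr0 subr0.
  have -> : X3 (Gv p) = V3 p by [].
  have -> : V3 (Gv p) = - X3 p by rewrite /crd /= mxE.
  by rewrite z1 z2 oppr0 mulr0 addr0.
rewrite mulf_eq0 negb_or => /andP[s0 c0].
rewrite reebX_profile // /stretch /spin.
have n3 := pt_n3 a b x.
rewrite /Pa /Pb /Px !(crdD, crdZ).
have -> : X3 (Gv p) = V3 p by [].
have -> : V3 (Gv p) = - X3 p by rewrite /crd /= mxE.
have -> : X3 (Vv p) = 0 by rewrite /crd /= mxE.
have -> : V3 (Vv p) = cos x ^+ 2 - sin x ^+ 2 by rewrite -n3.
have -> : V3 (Hv p) = 0 by rewrite /crd /= mxE.
have -> : X3 (Hv p) = cos x ^+ 2 - sin x ^+ 2 by rewrite -n3.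
rewrite e1 e2; have := cos2Dsin2 x; move: s0 c0.
move: (pX P a b x) (pA P a b x) (pB P a b x) (pU P a b x) (cos x) (sin x) (cos (a + b)) (sin (a + b)) => ux ua ub u c s ce se s0 c0 cs.
split.
  transitivity ((c ^+ 2 - s ^+ 2) * (ub / c ^+ 2 - ua / s ^+ 2) / 4 * (2 * s * c * ce) -
    (u + ux * (c / s - s / c) / 4) * (2 * s * c * se) * (c ^+ 2 + s ^+ 2)); first by field; rewrite s0 c0.
  by rewrite cs mulr1.
transitivity ((c ^+ 2 - s ^+ 2) * (ub / c ^+ 2 - ua / s ^+ 2) / 4 * (2 * s * c * se) +
  (u + ux * (c / s - s / c) / 4) * (2 * s * c * ce) * (c ^+ 2 + s ^+ 2)); first by field; rewrite s0 c0.
by rewrite cs mulr1.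
Qed.

(** The poles at both ends are compensated: [U_a] and [U_b] vanish to second order, and [U_x] to
    first order, at the end where they are divided. The end [pi / 2] is treated through [swap P]. *)
Lemma stretch_spin_bound : exists2 C : R, 0 <= C & forall a b x, 0 <= x <= pi / 2 -> `|stretch P a b x| <= C /\ `|spin P a b x| <= C.
Proof.
have [CA CA0 A1] := A_quadratic g; have [CB CB0 B1] := A_quadratic (good_swap g); have [C C0 C1] := profile_bounds g.
have [D D0 D1] := profile_bounds (good_swap g).
have X1 Q (K : R) : good Q -> (forall a b x, `|x| <= 2 -> `|pXX Q a b x| <= K) -> forall a b x, 0 <= x <= pi / 2 -> `|pX Q a b x| <= K * (4 * sin x).
  move=> gQ KP a b x x01; have x2 := small_angle x01; have [c hc e] := mean_value 0 x (fun t => dXX gQ a b t).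
  rewrite (X_0 gQ) !subr0 in hc e; rewrite e normrM; apply: ler_pM => //; first by apply: KP; lra.
  by have /andP[x0 _] := x01; rewrite ger0_norm //; exact: sin_jordan.
exists (4 * (CA + CB) + 3 * (C + D)) => // [|a b x x01]; first by lra.
have pp := pi_gt0 R; have x2 := small_angle x01; have [[u1 _ _] _ _ _] := C1 a b x x2.
have x01' : 0 <= pi / 2 - x <= pi / 2 by move/andP: x01 => [x0 x1]; apply/andP; split; lra.
have sx : sin (pi / 2 - x) = cos x by rewrite sinB sin_pihalf cos_pihalf; ring.
have cx : cos (pi / 2 - x) = sin x by rewrite cosB sin_pihalf cos_pihalf; ring.
have bX : `|pX P a b x| <= C * (4 * sin x) by apply: X1 => // c d y hy; have [] := C1 c d y hy.
have bX' : `|pX P a b x| <= D * (4 * cos x).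
  have := @X1 (swap P) D (good_swap g) _ b a (pi / 2 - x) x01'; rewrite sx /= /flip normrN opprB addrCA subrr addr0; apply.
  by move=> c d y hy; have [] := D1 c d y hy.
have x16 (y : R) : 0 <= y <= pi / 2 -> y ^+ 2 <= 16 * sin y ^+ 2.
  move=> y01; have := sin_jordan y01; have /andP[y0 _] := y01 => j.
  have -> : 16 * sin y ^+ 2 = (4 * sin y) ^+ 2 by ring.
  by rewrite ler_sqr ?nnegrE //; lra.
have bA : `|pA P a b x| <= CA * (16 * sin x ^+ 2).
  by apply: le_trans (A1 a b x x2) _; apply: ler_wpM2l => //; exact: x16.
have bB : `|pB P a b x| <= CB * (16 * cos x ^+ 2).
  have := B1 b a (pi / 2 - x) (small_angle x01'); rewrite /= /flip opprB addrCA subrr addr0 => h.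
  by apply: le_trans h _; apply: ler_wpM2l => //; rewrite -sx; exact: x16.
have [x0 x1] := andP x01; have s0 : 0 <= sin x.
  by clear -x0 x1 pp P g PU fsm f_gt0; apply: sin_ge0_pi; apply/andP; split; lra.
have c0 : 0 <= cos x.
  by rewrite -sx; clear -x0 x1 pp P g PU fsm f_gt0; apply: sin_ge0_pi; apply/andP; split; lra.
have s1 := sin_le1 x; have c1 := cos_le1 x.
clear A1 B1 C1 D1 X1 x16 sx cx x2 x01 x01' x0 x1 pp.
rewrite /stretch /spin; move: (pU P a b x) (pX P a b x) (pA P a b x) (pB P a b x) (cos x) (sin x) u1 bX bX' bA bB s0 c0 s1 c1 (cos2Dsin2 x) => u ux ua ub c s u1 bX bX' bA bB s0 c0 s1 c1 cs.
have q (y z K : R) : 0 <= K -> 0 <= z -> `|y| <= K * z -> `|y / z| <= K.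
  move=> K0 z0; have [->|zn] := eqVneq z 0; first by rewrite invr0 !mulr0 normr0.
  by rewrite normrM normfV (ger0_norm z0) ler_pdivrMr // lt_neqAle eq_sym zn z0.
have qB : `|ub / c ^+ 2| <= CB * 16 by apply: q; rewrite ?sqr_ge0 ?mulr_ge0 // -mulrA.
have qA : `|ua / s ^+ 2| <= CA * 16 by apply: q; rewrite ?sqr_ge0 ?mulr_ge0 // -mulrA.
have qX : `|ux / s| <= C * 4 by apply: q; rewrite ?mulr_ge0 // -mulrA.
have qY : `|ux / c| <= D * 4 by apply: q; rewrite ?mulr_ge0 // -mulrA.
have le1 : `|c ^+ 2 - s ^+ 2| <= 1 by clear -cs P g PU fsm f_gt0; rewrite ler_norml; apply/andP; split; have := sqr_ge0 c; have := sqr_ge0 s; lra.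
split.
  rewrite 2!normrM (ger0_norm (_ : 0 <= 4^-1)) //.
  have h : `|ub / c ^+ 2 - ua / s ^+ 2| <= CB * 16 + CA * 16.
    by apply: le_trans (ler_normB _ _) _; exact: lerD.
  have := ler_pM (normr_ge0 _) (normr_ge0 _) le1 h; rewrite mul1r.
  by move: (`|_| * `|_|) => w hw; lra.
have -> : u + ux * (c / s - s / c) / 4 = u + (ux / s * c - ux / c * s) / 4 by ring.
have h1 : `|ux / s * c| <= C * 4 * 1 by rewrite normrM; apply: ler_pM => //; rewrite ger0_norm.
have h2 : `|ux / c * s| <= D * 4 * 1 by rewrite normrM; apply: ler_pM => //; rewrite ger0_norm.
move: (ux / s * c) (ux / c * s) h1 h2 => w1 w2.
clear bX bX' bA bB s0 c0 s1 c1 cs qB qA qX qY le1; move: u1; rewrite !ler_norml => /andP[? ?] /andP[? ?] /andP[? ?].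
by apply/andP; split; lra.
Qed.

(** [spin] is the velocity of [a + b]; in the limit [U / 2] is the velocity of [b] and [b0] that of
    [a]. *)
Lemma spin_limit (a b x : nat -> R) (a0 c0 : R) : (forall n, 0 <= x n <= pi / 2) -> ultra [set n | x n != 0] ->
  a @ ultra --> a0 -> b @ ultra --> c0 -> x @ ultra --> (0 : R) ->
  (fun n => spin P (a n) (b n) (x n)) @ ultra --> pU P a0 c0 0 / 2 + b0 P a0 c0.
Proof.
move=> x01 xn ac bc xc; have [d [u0 [u1 h]]] := adm_exists g.
have qc := qx_ucont h x01 ac bc xc; have Uc := cU g ac bc xc; have Xc := cX g ac bc xc.
have cc := ultra_cvg_comp (@continuous_cos R 0) xc; have sc := ultra_cvg_comp (@continuous_sin R 0) xc.
rewrite /= in cc sc.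
have lim : (fun n => pU P (a n) (b n) (x n) + (qx P (a n) (b n) (x n) * cos (x n) - pX P (a n) (b n) (x n) * (sin (x n) / cos (x n))) / 4) @ ultra -->
    pU P a0 c0 0 + (qx P a0 c0 0 * cos 0 - pX P a0 c0 0 * (sin 0 / cos 0)) / 4.
  apply: cvgD => //; apply: cvgM; last exact: cvg_cst.
  apply: cvgB; first exact: cvgM.
  by apply: cvgM => //; apply: cvgM => //; apply: cvgV => //; rewrite cos0 oner_neq0.
have -> : pU P a0 c0 0 / 2 + b0 P a0 c0 = pU P a0 c0 0 + (qx P a0 c0 0 * cos 0 - pX P a0 c0 0 * (sin 0 / cos 0)) / 4.
  by rewrite /b0 /qx eqxx cos0 sin0; field.
apply: ultra_cvg_eq lim; apply: filterS xn => n /= xn.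
by rewrite /spin /qx (negPf xn); ring.
Qed.
End Transverse.

(** * Reeb trajectories on the link and near it *)

Section LinkDynamics.
Variable R : realType.
Local Notation V6 := (V6 R).
Local Notation V3 p := (crd p (true, 2%:R)).
Local Notation X3 p := (crd p (false, 2%:R)).

Lemma unit_coord (u : 'rV[R]_3) (i : 'I_3) : dot u u = 1 -> `|u 0 i| <= 1.
Proof.
move=> u1; have h : u 0 i ^+ 2 <= 1.
  by rewrite -u1 /dot (bigD1 i) //= expr2 lerDl sumr_ge0 // => j _; rewrite -expr2 sqr_ge0.
by rewrite -(@expr_le1 _ 2) // -normrX ger0_norm // sqr_ge0.
Qed.

Lemma pt_link (a b : R) : pt a b 0 = (vec3 (cos (2 * b)) (sin (2 * b)) 0, vec3 (- sin (2 * b)) (cos (2 * b)) 0).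
Proof.
have -> : 2 * b = b + b by ring.
by rewrite /pt /zpt /polar sin0 cos0 cosD sinD /=; congr pair; apply: row3; rewrite !simp3; ring.
Qed.

Lemma double_sqr_sum (u v : R) : u ^+ 2 + v ^+ 2 = 0 -> u = 0 /\ v = 0.
Proof.
move=> h; have hu := sqr_ge0 u; have hv := sqr_ge0 v.
by split; apply/eqP; rewrite -sqrf_eq0; apply/eqP; lra.
Qed.

Variables (f : V6 -> R) (P : profile R).
Hypotheses (fsm : smooth f) (f_gt0 : forall p, T1S2 p -> 0 < f p) (g : good P) (PU : pU P = Uof f).

Lemma trajectory_derive (p : R -> V6) : reeb_trajectory (conformal_form f) p ->
  forall t, T1S2 (p t) /\ is_derive t (1 : R) p (reebX f (p t)).
Proof.
move=> tr t; have [pt [X hX pd]] := tr t; split => //.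
have fp := f_gt0 pt; have fd := f_diff fsm (p t).
by have /(reeb_vectorP X pt fp fd) <- := hX.
Qed.

Lemma reebX_bounded : exists2 C : R, 0 <= C & forall p j, T1S2 p -> `|crd (reebX f p) j| <= C.
Proof.
have [CU CU0 UP] := profile_bounds g.
have /choice[K KP] : forall j : idx, exists K : R, 0 <= K /\ forall a b x, `|x| <= 2 -> `|'D_(e6 R j) f (pt a b x)| <= K.
  move=> j; have [_ Dsm] := fsm 1; have Dc : Ck 0 ('D_(e6 R j) f) by exact: Dsm.
  have [||K K0 KP] := compact3_bounded (Sm_ucont (Sm_comp Dc (@Sm_pt R))).
  - by move=> a b x; have [e _] := pt_shift a b x; rewrite addr0 e.
  - by move=> a b x; have [_ [e _]] := pt_shift a b x; rewrite addr0 e.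
  by exists K.
have S0 : 0 <= \sum_j K j by apply: sumr_ge0 => j _; have [] := KP j.
exists (CU + (\sum_j K j) * CU ^+ 2 + (\sum_j K j) * CU ^+ 2).
  by rewrite !addr_ge0 // mulr_ge0 ?sqr_ge0.
move=> p j hp; have [n1 n2 n3] := vperp_dots hp; have [h1 h2 h3] := hp.
have [a [b [x [x01 pE]]]] := polar_onto hp; have x2 := small_angle x01.
have fp := f_gt0 hp; have fV : `|(f p)^-1| <= CU by have [[h _ _] _ _ _] := UP a b x x2; rewrite PU /Uof -pE in h.
have fV2 : `|(f p ^+ 2)^-1| <= CU ^+ 2 by rewrite -exprVn normrX; rewrite ler_sqr ?nnegrE.
have D1 u : (forall i, `|crd u i| <= 1) -> `|'D_u f p| <= \sum_j K j.
  move=> hu; have fd := f_diff fsm p; rewrite (V6_sum u) D_sum //; apply: le_trans (ler_norm_sum _ _ _) _.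
  apply: ler_sum => i _; rewrite D_scale // normrM -[K i]mul1r; apply: ler_pM => //.
  by have [_ k] := KP i; rewrite pE; exact: k.
have cG i : `|crd (Gv p) i| <= 1 by case: i => -[] i; rewrite /crd /=; rewrite ?(mxE, normrN); exact: unit_coord.
have cV i : `|crd (Vv p) i| <= 1 by case: i => -[] i; rewrite /crd /=; [exact: unit_coord|rewrite mxE normr0].
have cH i : `|crd (Hv p) i| <= 1 by case: i => -[] i; rewrite /crd /=; [rewrite mxE normr0|exact: unit_coord].
have p1 (y z K1 : R) : `|y| <= K1 -> `|z| <= 1 -> `|y * z| <= K1 by move=> hy hz; rewrite normrM -[K1]mulr1; apply: ler_pM.
rewrite /reebX !(crdD, crdZ); apply: le_trans (ler_normD _ _) (lerD _ _).
  apply: le_trans (ler_normD _ _) (lerD _ _); apply: p1 => //.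
  by rewrite normrM; apply: ler_pM => //; exact: D1.
by apply: p1 => //; rewrite normrM normrN; apply: ler_pM => //; exact: D1.
Qed.

(** The angles are chosen at each time separately, without any continuity; the third coordinates
    still obey a linear equation whose coefficients have a bound common to all trajectories. *)
Lemma third_ode : exists2 C : R, 0 <= C & forall p : R -> V6, reeb_trajectory (conformal_form f) p ->
  exists a b x : R -> R, forall t, let M := stretch P (a t) (b t) (x t) in let N := spin P (a t) (b t) (x t) in
    [/\ 0 <= x t <= pi / 2, p t = pt (a t) (b t) (x t),
        is_derive t (1 : R) (fun s => V3 (p s)) (M * V3 (p t) - N * X3 (p t)),
        is_derive t (1 : R) (fun s => X3 (p s)) (M * X3 (p t) + N * V3 (p t)) & `|M| <= C /\ `|N| <= C].
Proof.
have [C C0 CP] := stretch_spin_bound g; exists C => // p tr.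
have /choice[u uP] : forall t : R, exists u : R * R * R, 0 <= u.2 <= pi / 2 /\ p t = pt u.1.1 u.1.2 u.2.
  by move=> t; have [/polar_onto[a [b [x h]]] _] := tr t; exists (a, b, x).
exists (fun t => (u t).1.1), (fun t => (u t).1.2), (fun t => (u t).2) => t M N.
have [x01 pE] := uP t; have [_ pd] := trajectory_derive tr t.
have [e1 e2] := reebX_third fsm f_gt0 g PU (u t).1.1 (u t).1.2 x01; rewrite -pE in e1 e2.
have d1 := der_crd (true, 2%:R) pd; have d2 := der_crd (false, 2%:R) pd; rewrite e1 in d1; rewrite e2 in d2.
by split => //; exact: CP.
Qed.

Lemma third_gronwall : exists2 C : R, 0 <= C & forall p : R -> V6, reeb_trajectory (conformal_form f) p ->
  let q t := V3 (p t) ^+ 2 + X3 (p t) ^+ 2 in forall s t, q t <= q s * expR (C * `|t - s|).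
Proof.
have [C C0 CP] := third_ode; exists (2 * C) => [|p tr q s t]; first by lra.
have [a [b [x h]]] := CP p tr.
have q0 u : 0 <= q u by rewrite addr_ge0 ?sqr_ge0.
have qd u : is_derive u (1 : R) q (2 * stretch P (a u) (b u) (x u) * q u).
  have [_ _ d1 d2 _] := h u; have D := der_add (der_mul d1 d1) (der_mul d2 d2).
  apply: (is_derive_conv D) => [w|]; first by rewrite /q !expr2.
  by rewrite /q; ring.
have H u : `|2 * stretch P (a u) (b u) (x u) * q u| <= 2 * C * `|q u|.
  by have [_ _ _ _ [m _]] := h u; rewrite normrM; apply: ler_wpM2r => //; rewrite normrM ger0_norm //; apply: ler_wpM2l.
by have := gronwall qd H s t; rewrite (ger0_norm (q0 t)) (ger0_norm (q0 s)).
Qed.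

(** By [third_gronwall] the third coordinates of [x] and [v] remain 0. That of the normal is
    continuous with square 1, so it remains 1 and the trajectory stays on this component. The angle
    is defined as an antiderivative of half of [1 / f] along the trajectory, and the squared
    distance [E] between the predicted and the actual point has derivative 0. *)
Lemma link_flow (p : R -> V6) (y0 : R) : reeb_trajectory (conformal_form f) p -> p 0 = pt 0 y0 0 ->
  exists2 y : R -> R, y 0 = y0 & forall t, is_derive t (1 : R) y (pU P 0 (y t) 0 / 2) /\ p t = pt 0 (y t) 0.
Proof.
move=> tr p0; have [C C0 CP] := third_gronwall.
have pd t : is_derive t (1 : R) p (reebX f (p t)) by have [] := trajectory_derive tr t.
have pT t : T1S2 (p t) by have [] := tr t.
have z t : V3 (p t) = 0 /\ X3 (p t) = 0.
  apply: double_sqr_sum; have := CP p tr 0 t; have [e1 e2] := pt_third 0 y0 0.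
  rewrite p0 e1 e2 sin0 !mulr0 !mul0r expr0n /= addr0 mul0r => h.
  by apply/eqP; rewrite eq_le h addr_ge0 ?sqr_ge0.
pose n3 t := vperp (p t) 0 2%:R.
have n1 t : n3 t ^+ 2 = 1.
  have := row_unit (pT t); have [e1 e2] := z t; rewrite /crd /= in e1 e2.
  by rewrite e1 e2 expr0n /= !add0r.
have n3E t : n3 t = crd (p t) (false, 0) * crd (p t) (true, 1) - crd (p t) (false, 1) * crd (p t) (true, 0).
  by rewrite /n3 /vperp /cross vec32.
have nc : continuous n3.
  move=> t; apply: (@derive_cont _ _ t _ (is_derive_conv (der_sub (der_mul (der_crd (false, 0) (pd t)) (der_crd (true, 1) (pd t)))
    (der_mul (der_crd (false, 1) (pd t)) (der_crd (true, 0) (pd t)))) _ erefl)) => s.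
  by rewrite n3E.
have n01 : n3 0 = 1 by rewrite /n3 p0 pt_n3 cos0 sin0; ring.
have n3p t : n3 t = 1.
  have /eqP := n1 t; rewrite sqrf_eq1 => /orP[/eqP //|/eqP nm].
  have [||c nc0] := @ivt R n3 t 0 0 nc; [by rewrite nm; lra|by rewrite n01; lra|].
  by have := n1 c; rewrite nc0 expr0n /= => /esym/eqP; rewrite oner_eq0.
have /choice[b bE] : forall t : R, exists b : R, p t = pt 0 b 0.
  move=> t; have [a [b [x [x01 pE]]]] := polar_onto (pT t); exists b.
  have := n3p t; rewrite /n3 pE pt_n3 => h; have cs := cos2Dsin2 x.
  have s0 : sin x ^+ 2 = 0 by lra.
  have x0 : x = 0 by apply: sin_eq0_quadrant => //; apply/eqP; rewrite -sqrf_eq0 s0.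
  by rewrite x0; exact: pt_x0.
pose U t := (f (p t))^-1.
have Uc : continuous U.
  move=> t; have fn : f (p t) != 0 by exact: lt0r_neq0 (f_gt0 (pT t)).
  have fc : {for t, continuous (fun s => f (p s))} := derive_cont (der_chain (f_diff fsm (p t)) (pd t)).
  exact: (cvgV fn fc).
have [Y Yd] := @antiderivative R (fun t => U t / 2) (fun t => cvgM (Uc t) (@cvg_cst _ _ _ _ _)).
pose y t := Y t - Y 0 + y0.
have yd t : is_derive t (1 : R) y (U t / 2).
  by apply: (is_derive_conv (der_add (der_sub (Yd t) (der_cst (Y 0) t)) (der_cst y0 t))) => //; rewrite subr0 addr0.
have y00 : y 0 = y0 by rewrite /y subrr add0r.
have X t : reebX f (p t) = U t *: Gv (p t).
  have [z1 z2] := z t; have [d1 d2] := D_link fsm f_gt0 g PU (pT t) z1 z2.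
  by rewrite /reebX d1 d2 oppr0 !mul0r !scale0r !addr0.
pose w1 t := crd (p t) (false, 0); pose w2 t := crd (p t) (false, 1).
have wE t : [/\ w1 t = cos (2 * b t), w2 t = sin (2 * b t) & crd (Gv (p t)) (false, 0) = - w2 t /\ crd (Gv (p t)) (false, 1) = w1 t].
  by rewrite /w1 /w2 bE pt_link /crd /= !simp3.
have w1d t : is_derive t (1 : R) w1 (- (U t * w2 t)).
  have := der_crd (false, 0) (pd t); rewrite X crdZ; have [_ _ [-> _]] := wE t; by rewrite mulrN.
have w2d t : is_derive t (1 : R) w2 (U t * w1 t).
  by have := der_crd (false, 1) (pd t); rewrite X crdZ; have [_ _ [_ ->]] := wE t.
have y2d t : is_derive t (1 : R) (fun t => 2 * y t) (U t).
  by apply: (is_derive_conv (der_cmul 2 (yd t))) => //; field.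
pose E t := (w1 t - cos (2 * y t)) ^+ 2 + (w2 t - sin (2 * y t)) ^+ 2.
have Ed t : is_derive t (1 : R) E 0.
  have D1 := der_sub (w1d t) (der_comp (y2d t) (is_derive_cos (2 * y t))).
  have D2 := der_sub (w2d t) (der_comp (y2d t) (is_derive_sin (2 * y t))).
  apply: (is_derive_conv (der_add (der_mul D1 D1) (der_mul D2 D2))) => [s|]; first by rewrite /E !expr2.
  by ring.
have E0 t : E t = 0.
  rewrite (derive0_cst Ed t 0) /E y00 /w1 /w2 p0 pt_link /crd /= !simp3 !subrr expr0n /= addr0 //.
have pE t : p t = pt 0 (y t) 0.
  have [e1 e2] := double_sqr_sum (E0 t); have [k1 k2 _] := wE t.
  by rewrite bE !pt_link -k1 -k2 (subr0_eq e1) (subr0_eq e2).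
by exists y => // t; split => //; rewrite PU /Uof -pE; exact: yd.
Qed.

Definition link_angle (y : R -> R) := forall t, is_derive t (1 : R) y (pU P 0 (y t) 0 / 2).

Lemma link_unique (y1 y2 : R -> R) : link_angle y1 -> link_angle y2 -> y1 0 = y2 0 -> forall t, y1 t = y2 t.
Proof.
move=> h1 h2 e0 t; have [C C0 CP] := profile_bounds (good_swap g).
have bB s : `|pB P 0 s 0| <= C.
  have [|[_ h _] _ _ _] := CP s 0 (pi / 2); last by rewrite /= /flip subrr in h.
  by rewrite ger0_norm ?pi_half_le2 //; have := pi_gt0 R; lra.
apply/eqP; rewrite -subr_eq0; apply/eqP.
apply: (gronwall0 (f := fun t => y1 t - y2 t) (fun t => der_sub (h1 t) (h2 t)) (C := C) (s := 0)); last by rewrite e0 subrr.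
move=> s; have [c _ e] := mean_value (y2 s) (y1 s) (fun t => dB g 0 t 0).
rewrite -mulrBl e normrM normrM [`|2^-1|]ger0_norm //; have := ler_wpM2r (normr_ge0 (y1 s - y2 s)) (bB c).
have := mulr_ge0 C0 (normr_ge0 (y1 s - y2 s)); move: (`|_| * `|_|) (C * _) => u v; lra.
Qed.

Lemma link_speed : exists2 c : R, 0 < c & forall y, c <= pU P 0 y 0 / 2.
Proof. by have [c c0 h] := U_lower g; exists (c / 2); [lra|move=> y; have := h 0 y 0; rewrite normr0 => /(_ _); lra]. Qed.

Lemma link_half_period (b : R) : pU P 0 (b + pi) 0 = pU P 0 b 0.
Proof. by rewrite PU /Uof; have [_ [_ <-]] := pt_shift 0 b 0; rewrite (pt_x0 _ 0). Qed.

(** A point of the link determines its angle modulo [pi], so [y] gains a positive multiple of [pi]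
    in time [T]. If the multiple were at least 2, the time at which [y] has gained [pi] would be a
    smaller period. *)
Lemma link_period (y : R -> R) (T : R) : link_angle y ->
  prime_closed_orbit (conformal_form f) (fun t => pt 0 (y t) 0) T -> forall t, y (t + T) = y t + pi.
Proof.
move=> yd [_ T0 per prime]; have [c c0 cP] := link_speed; have pp := pi_gt0 R.
have inc s t : s < t -> y s < y t.
  move=> st; have [m _ e] := mean_value s t yd.
  by rewrite -subr_gt0 e mulr_gt0 ?subr_gt0 //; have := cP (y m); lra.
have turn S : y S = y 0 + pi -> forall t, y (t + S) = y t + pi.
  move=> yS t; apply: (@link_unique (fun t => y (t + S)) (fun t => y t + pi)); last by rewrite add0r.
    exact: (is_derive_shift S yd).
  move=> s; rewrite link_half_period.
  by apply: (is_derive_conv (der_add (yd s) (der_cst pi s))) => //; rewrite addr0.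
refine (turn T _).
have [k yk] : exists k : int, y T = y 0 + k%:~R * pi.
  have := per 0; rewrite add0r !pt_link => -[e1 e2]; apply: angle_eq_double.
    by have := congr1 (fun u : 'rV[R]_3 => u 0 0) e1; rewrite !simp3.
  by have := congr1 (fun u : 'rV[R]_3 => u 0 1) e1; rewrite !simp3.
have y0T := inc 0 T T0.
have k0 : 0 < k by rewrite -(ltr0z R) -(pmulr_lgt0 _ pp); lra.
have [k2|k1] := leP 2 k; last by have -> : y T = y 0 + pi; [rewrite yk (_ : k = 1) ?mul1r //; lia|].
exfalso; have k2' : (2 : R) <= k%:~R by rewrite (ler_int R 2 k).
have yc : continuous y by move=> t; exact: derive_cont (yd t).
have [||S yS] := @ivt R y 0 T (y 0 + pi) yc; first by lra.
  by rewrite yk lerD2l -[X in X <= _]mul1r ler_pM2r //; lra.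
have yST : y S < y T by rewrite yS yk ltrD2l -[X in X < _]mul1r ltr_pM2r //; lra.
have S01 : 0 < S < T.
  apply/andP; split; rewrite ltNge; apply/negP; rewrite le_eqVlt => /predU1P[e|/inc h].
  - by move: yS; rewrite e; lra.
  - by lra.
  - by move: yST; rewrite e ltxx.
  by lra.
apply: (prime S S01) => t; rewrite (turn _ yS).
have [_ [_ h]] := pt_shift (- pi) (y t) 0.
by rewrite (pt_x0 0 (- pi + pi)) h (pt_x0 _ 0).
Qed.
End LinkDynamics.

Lemma ultra_cvg_ext (R : realType) (u v : nat -> R) (l : R) : (forall n, u n = v n) -> v @ ultra --> l -> u @ ultra --> l.
Proof. by move=> uv; apply: ultra_cvg_eq; exact: filterE. Qed.

Lemma cvgD_ultra (R : realType) (u v : nat -> R) (l m : R) : u @ ultra --> l -> v @ ultra --> m ->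
  (fun n => u n + v n) @ ultra --> l + m.
Proof. by move=> ul vm; exact: cvgD. Qed.

Lemma cvgM_ultra (R : realType) (u v : nat -> R) (l m : R) : u @ ultra --> l -> v @ ultra --> m ->
  (fun n => u n * v n) @ ultra --> l * m.
Proof. by move=> ul vm; exact: cvgM. Qed.

Section Lattice.
Variable R : realType.
Local Notation V6 := (V6 R).

Lemma pt_lattice (k m : int) (a b x : R) : pt (a + k%:~R * pi + m%:~R * (2 * pi)) (b + k%:~R * pi) x = pt a b x.
Proof.
apply: V6_eq => j; pose F (a b p r : R) := crd (pt a b p) j.
have h1 : per4 F pi pi by move=> c d p r; rewrite /F; have [_ [_ ->]] := pt_shift c d p.
have h2 : per4 F (2 * pi) 0 by move=> c d p r; rewrite /F addr0; have [-> _] := pt_shift c d p.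
have e1 := per4_int m h2 (a + k%:~R * pi) (b + k%:~R * pi) x 0; have e2 := per4_int k h1 a b x 0.
by rewrite mulr0 addr0 in e1; rewrite /F in e1 e2; rewrite e1 e2.
Qed.

Lemma U_lattice f (P : profile R) (k m : int) : pU P = Uof f -> per3 (pU P) (k%:~R * pi + m%:~R * (2 * pi)) (k%:~R * pi).
Proof. by move=> PU a b x; rewrite PU /Uof addrA pt_lattice. Qed.

Lemma reduce_angles (a b : R) : exists k m : int, 0 <= a + (k%:~R * pi + m%:~R * (2 * pi)) <= 2 * pi /\ 0 <= b + k%:~R * pi <= 2 * pi.
Proof.
have [l hl] := red_angle b; have [n hn] := red_angle a; exists (2 * l), (n - l).
have -> : (2 * l)%:~R * pi = l%:~R * (2 * pi) :> R by rewrite intrM; ring.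
by rewrite (_ : l%:~R * _ + _ = n%:~R * (2 * pi)) // intrB; ring.
Qed.
End Lattice.

(** * The linearized flow along the link *)

Section Rotation.
Variable R : realType.
Local Notation V6 := (V6 R).
Local Notation V3 p := (crd p (true, 2%:R)).
Local Notation X3 p := (crd p (false, 2%:R)).
Variables (f : V6 -> R) (P : profile R).
Hypotheses (fsm : smooth f) (f_gt0 : forall p, T1S2 p -> 0 < f p) (g : good P) (PU : pU P = Uof f).

(** The points tend to the link and the argument of the transverse coordinate tends to [th]; up to
    lattice translations, under which [spin] is invariant, [b] tends to [y] and [a] to [th - y].
    Positivity of [rho] keeps the points off the link, as [spin_limit] requires. *)
Lemma spin_near_link (a b x s : nat -> R) (y th rho : R) : 0 < rho -> (forall n, 0 < s n) -> (forall n, 0 <= x n <= pi / 2) ->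
  (forall j, (fun n => crd (pt (a n) (b n) (x n)) j) @ ultra --> crd (pt 0 y 0) j) ->
  (fun n => V3 (pt (a n) (b n) (x n)) / s n) @ ultra --> rho * cos th ->
  (fun n => X3 (pt (a n) (b n) (x n)) / s n) @ ultra --> rho * sin th ->
  (fun n => spin P (a n) (b n) (x n)) @ ultra --> pU P 0 y 0 / 2 + b0 P (th - y) y.
Proof.
move=> rho0 s0 x01 pl z1 z2.
have /choice[k kP] : forall n, exists k : int * int, 0 <= a n + (k.1%:~R * pi + k.2%:~R * (2 * pi)) <= 2 * pi /\ 0 <= b n + k.1%:~R * pi <= 2 * pi.
  by move=> n; have [k [m h]] := reduce_angles (a n) (b n); exists (k, m).
pose A n := a n + ((k n).1%:~R * pi + (k n).2%:~R * (2 * pi)); pose B n := b n + (k n).1%:~R * pi.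
have [al _ Ac] := ultra_bounded_cvg (fun n => proj1 (kP n)); have [be _ Bc] := ultra_bounded_cvg (fun n => proj2 (kP n)).
have [xi xi01 xc] := ultra_bounded_cvg x01; rewrite -/(A _) -/(B _) in Ac Bc.
have ptE n : pt (A n) (B n) (x n) = pt (a n) (b n) (x n) by rewrite /A /B addrA pt_lattice.
have ptlim : pt al be xi = pt 0 y 0.
  apply: V6_eq => j; apply: ultra_cvg_unique (pl j).
  by apply: ultra_cvg_ext (Sm_ucont (@Sm_pt R 0 j) Ac Bc xc) => n; rewrite -ptE.
have xi0 : xi = 0.
  apply: sin_eq0_quadrant => //; apply/eqP; rewrite -sqrf_eq0; apply/eqP.
  have := pt_n3 al be xi; rewrite ptlim pt_n3 sin0 cos0; have := cos2Dsin2 xi; lra.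
rewrite xi0 in ptlim xc.
have [i be_y] : exists i : int, be = y + i%:~R * pi.
  move: ptlim; rewrite !pt_link => -[e1 e2]; apply: angle_eq_double.
    by have := congr1 (fun u : 'rV[R]_3 => u 0 0) e1; rewrite !simp3.
  by have := congr1 (fun u : 'rV[R]_3 => u 0 1) e1; rewrite !simp3.
have ABc : (fun n => A n + B n) @ ultra --> al + be by exact: cvgD.
have cc : (fun n => cos (A n + B n)) @ ultra --> cos (al + be) := ultra_cvg_comp (@continuous_cos R (al + be)) ABc.
have sc : (fun n => sin (A n + B n)) @ ultra --> sin (al + be) := ultra_cvg_comp (@continuous_sin R (al + be)) ABc.
pose la n := 2 * sin (x n) * cos (x n) / s n.
have la0 n : 0 <= la n.
  have [x0 x1] := andP (x01 n); have pp := pi_gt0 R.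
  rewrite /la divr_ge0 ?(ltW (s0 n)) // !mulr_ge0 //; first by apply: sin_ge0_pi; apply/andP; split; lra.
  by apply: cos_ge0_pihalf; apply/andP; split; lra.
have zE n : V3 (pt (a n) (b n) (x n)) / s n = la n * cos (A n + B n) /\ X3 (pt (a n) (b n) (x n)) / s n = la n * sin (A n + B n).
  by rewrite -ptE; have [-> ->] := pt_third (A n) (B n) (x n); rewrite /la; split; ring.
have z1' : (fun n => la n * cos (A n + B n)) @ ultra --> rho * cos th.
  by apply: ultra_cvg_ext z1 => n; have [-> _] := zE n.
have z2' : (fun n => la n * sin (A n + B n)) @ ultra --> rho * sin th.
  by apply: ultra_cvg_ext z2 => n; have [_ ->] := zE n.
pose L := rho * cos th * cos (al + be) + rho * sin th * sin (al + be).
have lac : la @ ultra --> L.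
  have h : (fun n => la n * cos (A n + B n) * cos (A n + B n) + la n * sin (A n + B n) * sin (A n + B n)) @ ultra --> L.
    by apply: cvgD; exact: cvgM.
  apply: ultra_cvg_ext h => n.
  move: (la n) (A n + B n) => l w; rewrite -[LHS]mulr1 -(cos2Dsin2 w); ring.
have L0 : 0 <= L by apply: ultra_cvg_ge lac _; apply: filterE => n /=.
have e1 : L * cos (al + be) = rho * cos th by apply: ultra_cvg_unique z1'; exact: cvgM.
have e2 : L * sin (al + be) = rho * sin th by apply: ultra_cvg_unique z2'; exact: cvgM.
have Lr : L = rho.
  apply: sqr_inj => //; first exact: ltW.
  rewrite -[LHS]mulr1 -(cos2Dsin2 (al + be)) mulrDr -!exprMn e1 e2 !exprMn -mulrDr cos2Dsin2 mulr1 //.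
rewrite Lr in e1 e2; have rn := lt0r_neq0 rho0.
have [m abE] := angle_eq (mulfI rn e1) (mulfI rn e2).
have xn : ultra [set n | x n != 0].
  have := ultra_cvg_gt lac (_ : 0 < L); rewrite Lr => /(_ rho0); apply: filterS => n /=.
  by apply: contraTneq; rewrite /la => ->; rewrite sin0 mulr0 !mul0r ltxx.
have lim := spin_limit g x01 xn Ac Bc xc.
have spE n : spin P (a n) (b n) (x n) = spin P (A n) (B n) (x n).
  by rewrite /spin /A /B (U_lattice _ _ PU) (perX g (U_lattice _ _ PU)).
have lE : al = th - y + ((i%:~R * pi + (m - i)%:~R * (2 * pi))) by rewrite intrB; lra.
rewrite (U_0 g al 0) be_y lE in lim.
have -> : pU P 0 y 0 / 2 + b0 P (th - y) y = pU P 0 (y + i%:~R * pi) 0 / 2 + b0 P (th - y + (i%:~R * pi + (m - i)%:~R * (2 * pi))) (y + i%:~R * pi).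
  by rewrite (U_0 g 0 (0 + (i%:~R * pi + 0%:~R * (2 * pi))) (y + _)) /b0 !(U_lattice _ _ PU) (perXX g (U_lattice _ _ PU)).
exact: ultra_cvg_ext lim.
Qed.
Lemma le_1Dsqr (m k : R) : m ^+ 2 <= k -> m <= 1 + k.
Proof. by move=> mk; have := sqr_ge0 (m - 1); have := sqr_ge0 m; rewrite sqrrB expr1n; lra. Qed.

Lemma normD_le2 (a b d : R) : `|a| <= d -> `|b| <= d -> `|a + b| <= 2 * d.
Proof. by move=> ha hb; apply: le_trans (ler_normD _ _) _; lra. Qed.

(** The linearized solution is known only as the velocity of images of curves, with no
    differentiability in time. Its third coordinates are therefore approximated by the quotients
    [phi t (c s) / s], which obey the linear equation of [third_ode], with [s] so small that the
    error is negligible even after division by [h]. The cross product with the vector at time [t0]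
    extracts the angular velocity; the contribution of [stretch] disappears in the limit. *)
Lemma rotation_ode (l Y : R -> V6) (y r th : R -> R) (phi : R -> V6 -> V6) :
  reeb_flow (conformal_form f) phi -> (forall t, l t = pt 0 (y t) 0) -> link_angle P y ->
  (forall t, tangent_map (phi t) (l 0) (Y 0) (Y t)) -> continuous th ->
  (forall t, 0 < r t /\ Y t = r t *: (cos (th t) *: frame1 f (l t) + sin (th t) *: frame2 f (l t))) ->
  forall t, is_derive t (1 : R) th (pU P 0 (y t) 0 / 2 + b0 P (th t - y t) (y t)).
Proof.
move=> flow lE yd tm thc YE t0.
have T1l t : T1S2 (l t) by rewrite lE; exact: T1S2_pt.
have n3 t : vperp (l t) 0 2%:R = 1 by rewrite lE pt_n3 cos0 sin0; ring.
have dv t : dot (l t).2 (vperp (l t)) = 0 by have [] := vperp_dots (T1l t).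
have hE t : hlift (l t) (vperp (l t)) = Hv (l t) by rewrite /hlift dv oppr0 scale0r.
pose rho t := r t / Num.sqrt (f (l t)).
have rho0 t : 0 < rho t.
  by have [r0 _] := YE t; rewrite divr_gt0 // sqrtr_gt0; exact: f_gt0.
have YHV t : Y t = (rho t * cos (th t)) *: Vv (l t) + (rho t * sin (th t)) *: Hv (l t).
  by have [_ ->] := YE t; rewrite /frame1 /frame2 hE scalerDr !scalerA /rho; congr (_ *: _ + _ *: _); ring.
have YV t : V3 (Y t) = rho t * cos (th t) /\ X3 (Y t) = rho t * sin (th t).
  rewrite YHV !(crdZ, crdD).
  have -> : X3 (Vv (l t)) = 0 by rewrite /crd /= mxE.
  have -> : V3 (Hv (l t)) = 0 by rewrite /crd /= mxE.
  by rewrite -[V3 (Vv _)]/(vperp (l t) 0 2%:R) -[X3 (Hv _)]/(vperp (l t) 0 2%:R) n3; split; ring.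
(* A curve leaving the link with velocity [Y 0]: the angles satisfy [a + b = th 0], and the latitude
   grows at rate [rho 0 / 2] because [Px] carries a factor 2. *)
pose c s := pt (th 0 - y 0) (y 0) (rho 0 / 2 * s).
have c0 : c 0 = l 0 by rewrite /c mulr0 lE; exact: pt_x0.
have cd : is_derive (0 : R) (1 : R) c (Y 0).
  have D := pt_der (der_cst (th 0 - y 0) 0) (der_cst (y 0) 0) (der_cmul (rho 0 / 2) (der_id (0 : R))).
  apply: (is_derive_eq D); rewrite !scale0r !add0r mulr1 mulr0 /Px (pt_x0 _ 0) -lE subrK scalerDr !scalerA YHV.
  by congr (_ *: _ + _ *: _); field.
have tr s : reeb_trajectory (conformal_form f) (fun t => phi t (c s)).
  by have [_] := flow (c s) (T1S2_pt _ _ _).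
have ph0 t : phi t (l 0) = l t.
  have [p0 trl] := flow (l 0) (T1l 0); rewrite lE in p0 trl.
  have [y' y0' h] := link_flow fsm f_gt0 g PU trl p0.
  rewrite !lE; have [_ ->] := h t; congr (pt _ _ _).
  by apply: (link_unique g) => // s; have [] := h s.
have lz t : V3 (l t) = 0 /\ X3 (l t) = 0.
  by rewrite lE; have [-> ->] := pt_third 0 (y t) 0; rewrite sin0 !mulr0 !mul0r.
have F j t : is_derive (0 : R) (1 : R) (fun s => crd (phi t (c s)) j) (crd (Y t) j).
  by apply: der_crd; apply: (tm t) => // s; exact: T1S2_pt.
have est j t e : crd (l t) j = 0 -> 0 < e -> exists2 d : R, 0 < d & forall s, 0 < s -> s < d -> `|crd (phi t (c s)) j / s - crd (Y t) j| <= e.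
  move=> lj e0; have [d d0 hd] := is_derive_epsP (F j t) e0; exists d => // s s0 sd.
  have := hd s; rewrite gtr0_norm // => /(_ sd); rewrite add0r c0 ph0 lj subr0.
  have -> : crd (phi t (c s)) j - s * crd (Y t) j = (crd (phi t (c s)) j / s - crd (Y t) j) * s by field; exact: lt0r_neq0.
  by rewrite normrM (gtr0_norm s0) ler_pM2r.
apply: is_derive_seq => h hn hs.
have h0 : h @ ultra --> (0 : R).
  by apply: (@ultra_cvg_near _ (fun=> 0) _ _ 1); [exact: cvg_cst|move=> n; rewrite subr0 mul1r].
have hp n : 0 < `|h n| / n.+1%:R by rewrite divr_gt0 // normr_gt0.
(* The scale [s] is chosen after the time increment [h n], so that the error at both times is at
   most [|h n| / n.+1]. *)
have /choice[s sP] : forall n, exists s : R, [/\ 0 < s, s <= n.+1%:R^-1,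
    `|V3 (phi t0 (c s)) / s - V3 (Y t0)| <= `|h n| / n.+1%:R /\ `|X3 (phi t0 (c s)) / s - X3 (Y t0)| <= `|h n| / n.+1%:R &
    `|V3 (phi (t0 + h n) (c s)) / s - V3 (Y (t0 + h n))| <= `|h n| / n.+1%:R /\
    `|X3 (phi (t0 + h n) (c s)) / s - X3 (Y (t0 + h n))| <= `|h n| / n.+1%:R].
  move=> n; have [z1 z2] := lz t0; have [z3 z4] := lz (t0 + h n).
  have [d1 d10 e1] := est _ _ _ z1 (hp n); have [d2 d20 e2] := est _ _ _ z2 (hp n).
  have [d3 d30 e3] := est _ _ _ z3 (hp n); have [d4 d40 e4] := est _ _ _ z4 (hp n).
  have i0 : 0 < n.+1%:R^-1 :> R by rewrite invr_gt0.
  pose m := Num.min (Num.min (Num.min d1 d2) (Num.min d3 d4)) n.+1%:R^-1.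
  have m0 : 0 < m by rewrite !lt_min d10 d20 d30 d40 i0.
  have mm : m / 2 < m by lra.
  have [mn [m1 m2 m3 m4]] : m / 2 < n.+1%:R^-1 /\ [/\ m / 2 < d1, m / 2 < d2, m / 2 < d3 & m / 2 < d4].
    by move: mm; rewrite {2}/m !lt_min => /andP[/andP[/andP[-> ->] /andP[-> ->]] ->].
  have mp : 0 < m / 2 by lra.
  by exists (m / 2); split; rewrite ?(ltW mn) //; split; [exact: e1|exact: e2|exact: e3|exact: e4].
have [C C_0 CP] := third_ode fsm f_gt0 g PU; have [G G0 GP] := third_gronwall fsm f_gt0 g PU.
have [K K0 KP] := reebX_bounded fsm f_gt0 g PU.
set V := V3 (Y t0) in sP *; set X := X3 (Y t0) in sP *.
pose Z1 n t := V3 (phi t (c (s n))) / s n; pose Z2 n t := X3 (phi t (c (s n))) / s n.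
have s0 n : 0 < s n by have [] := sP n.
have hs1 n : `|h n| <= 1 by apply: le_trans (hs n) _; rewrite invf_le1 // ler1n.
have q0 n : Z1 n t0 ^+ 2 + Z2 n t0 ^+ 2 <= (`|V| + 1) ^+ 2 + (`|X| + 1) ^+ 2.
  have [_ _ [e1 e2] _] := sP n; have hn1 : `|h n| / n.+1%:R <= 1 by rewrite ler_pdivrMr // mul1r; apply: le_trans (hs1 n) _; rewrite ler1n.
  have B (u v : R) : `|u - v| <= `|h n| / n.+1%:R -> u ^+ 2 <= (`|v| + 1) ^+ 2.
    move=> uv; rewrite -(real_normK (num_real u)) ler_sqr ?nnegrE ?addr_ge0 //.
    have uv1 := le_trans uv hn1; have := ler_normD (u - v) v; rewrite subrK; lra.
  by apply: lerD; apply: B.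
set B0 := _ + _ in q0; pose B := 1 + B0 * expR G.
have qB n t : `|t - t0| <= `|h n| -> `|Z1 n t| <= B /\ `|Z2 n t| <= B.
  move=> ht; have := GP _ (tr (s n)) t0 t => /= gw; have sn := lt0r_neq0 (s0 n).
  have q1 : Z1 n t ^+ 2 + Z2 n t ^+ 2 <= (Z1 n t0 ^+ 2 + Z2 n t0 ^+ 2) * expR (G * `|t - t0|).
    have s2 : 0 < s n ^+ 2 by rewrite exprn_gt0.
    by rewrite -(ler_pM2r s2) /Z1 /Z2 !expr_div_n -!mulrDl divfK ?lt0r_neq0 // mulrAC divfK ?lt0r_neq0.
  have ex : expR (G * `|t - t0|) <= expR G.
    by rewrite ler_expR -[leRHS]mulr1; apply: ler_wpM2l => //; exact: le_trans ht (hs1 n).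
  have q2 : Z1 n t ^+ 2 + Z2 n t ^+ 2 <= B0 * expR G.
    apply: le_trans q1 _; by apply: ler_pM => //; rewrite addr_ge0 ?sqr_ge0.
  have z1 := sqr_ge0 (Z1 n t); have z2 := sqr_ge0 (Z2 n t).
  have S (u : R) : u ^+ 2 <= B0 * expR G -> `|u| <= B.
    rewrite /B -(real_normK (num_real u)); exact: le_1Dsqr.
  by split; apply: S; apply: le_trans q2; [rewrite lerDl|rewrite lerDr].
have Zder n t : exists a b x : R, [/\ 0 <= x <= pi / 2, phi t (c (s n)) = pt a b x,
    is_derive t (1 : R) (Z1 n) (stretch P a b x * Z1 n t - spin P a b x * Z2 n t),
    is_derive t (1 : R) (Z2 n) (stretch P a b x * Z2 n t + spin P a b x * Z1 n t) & `|stretch P a b x| <= C /\ `|spin P a b x| <= C].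
  have [a [b [x hh]]] := CP _ (tr (s n)); have [x01 pE D1 D2 bd] := hh t.
  exists (a t), (b t), (x t); split => //.
    by apply: (is_derive_conv (der_mul D1 (der_cst (s n)^-1 t))) => //; rewrite /Z1 /Z2; ring.
  by apply: (is_derive_conv (der_mul D2 (der_cst (s n)^-1 t))) => //; rewrite /Z1 /Z2; ring.
have lip n t : `|t - t0| <= `|h n| -> `|Z1 n t - Z1 n t0| <= 2 * C * B * `|h n| /\ `|Z2 n t - Z2 n t0| <= 2 * C * B * `|h n|.
  move=> ht.
  have /choice[u uP] : forall w, exists u : R * R * R, [/\ is_derive w (1 : R) (Z1 n) (stretch P u.1.1 u.1.2 u.2 * Z1 n w - spin P u.1.1 u.1.2 u.2 * Z2 n w),
    is_derive w (1 : R) (Z2 n) (stretch P u.1.1 u.1.2 u.2 * Z2 n w + spin P u.1.1 u.1.2 u.2 * Z1 n w) & `|stretch P u.1.1 u.1.2 u.2| <= C /\ `|spin P u.1.1 u.1.2 u.2| <= C].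
    by move=> w; have [a [b [x [_ _ D1 D2 bd]]]] := Zder n w; exists (a, b, x).
  have BB (m z k w : R) : `|m| <= C -> `|k| <= C -> `|z| <= B -> `|w| <= B -> `|m * z + k * w| <= 2 * C * B.
    move=> hm hk hz hw; apply: le_trans (ler_normD _ _) _; rewrite !normrM.
    by have := ler_pM (normr_ge0 m) (normr_ge0 z) hm hz; have := ler_pM (normr_ge0 k) (normr_ge0 w) hk hw; lra.
  split.
    have D w : is_derive w (1 : R) (Z1 n) (stretch P (u w).1.1 (u w).1.2 (u w).2 * Z1 n w - spin P (u w).1.1 (u w).1.2 (u w).2 * Z2 n w) by have [] := uP w.
    have [w hw ->] := mean_value t0 t D.
    have [_ _ [b1 b2]] := uP w; have [z1 z2] := qB n w (le_trans hw ht).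
    by rewrite normrM -mulNr; apply: ler_pM => //; apply: BB => //; rewrite normrN.
  have D w : is_derive w (1 : R) (Z2 n) (stretch P (u w).1.1 (u w).1.2 (u w).2 * Z2 n w + spin P (u w).1.1 (u w).1.2 (u w).2 * Z1 n w) by have [] := uP w.
  have [w hw ->] := mean_value t0 t D.
  have [_ _ [b1 b2]] := uP w; have [z1 z2] := qB n w (le_trans hw ht).
  by rewrite normrM; apply: ler_pM => //; apply: BB.
have KB0 : (fun n => 2 * C * B * `|h n|) @ ultra --> (0 : R).
  rewrite -(mulr0 (2 * C * B)); apply: cvgM; first exact: cvg_cst.
  by have := ultra_cvg_comp (@norm_continuous R R _) h0; rewrite normr0.
have hd0 : (fun n => `|h n| / n.+1%:R) @ ultra --> (0 : R).
  apply: (@ultra_squeeze0 _ (fun n => `|h n|)); last by have := ultra_cvg_comp (@norm_continuous R R _) h0; rewrite normr0.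
  by move=> n; rewrite normrM normr_id normfV (ger0_norm (ler0n _ _)) ler_pdivrMr // ler_peMr // ler1n.
have sub0 (u : nat -> R) (v : nat -> R) (w : R) : (fun n => u n - v n) @ ultra --> (0 : R) -> v @ ultra --> w -> u @ ultra --> w.
  move=> uv vw; have h' : (fun n => u n - v n + v n) @ ultra --> 0 + w by exact: cvgD.
  by rewrite add0r in h'; apply: ultra_cvg_ext h' => n; rewrite subrK.
have Zt0 : (fun n => Z1 n t0) @ ultra --> V /\ (fun n => Z2 n t0) @ ultra --> X.
  split; apply: (sub0 _ (fun=> _)) (cvg_cst _); apply: ultra_squeeze0 hd0 => n; by have [_ _ []] := sP n.
have Zc (t : nat -> R) : (forall n, `|t n - t0| <= `|h n|) -> (fun n => Z1 n (t n)) @ ultra --> V /\ (fun n => Z2 n (t n)) @ ultra --> X.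
  move=> ht; have [k1 k2] := Zt0; split.
    by apply: (sub0 _ _ _ _ k1); apply: ultra_squeeze0 KB0 => n; have [] := lip n (t n) (ht n).
  by apply: (sub0 _ _ _ _ k2); apply: ultra_squeeze0 KB0 => n; have [] := lip n (t n) (ht n).
(* The mean value theorem for the cross product of the fixed vector [(V, X)] with the approximating
   one; [w n] holds the intermediate time and the angles there. *)
have /choice[w wP] : forall n, exists w : R * (R * R * R), let a := w.2.1.1 in let b := w.2.1.2 in let x := w.2.2 in
    [/\ `|w.1 - t0| <= `|h n|, 0 <= x <= pi / 2, phi w.1 (c (s n)) = pt a b x, `|stretch P a b x| <= C &
    V * (Z2 n (t0 + h n) - Z2 n t0) - X * (Z1 n (t0 + h n) - Z1 n t0) =
      (stretch P a b x * (V * Z2 n w.1 - X * Z1 n w.1) + spin P a b x * (V * Z1 n w.1 + X * Z2 n w.1)) * h n].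
  move=> n.
  have /choice[u uP] : forall w, exists u : R * R * R, [/\ is_derive w (1 : R) (fun w => V * Z2 n w - X * Z1 n w)
       (stretch P u.1.1 u.1.2 u.2 * (V * Z2 n w - X * Z1 n w) + spin P u.1.1 u.1.2 u.2 * (V * Z1 n w + X * Z2 n w)), 0 <= u.2 <= pi / 2,
       phi w (c (s n)) = pt u.1.1 u.1.2 u.2 & `|stretch P u.1.1 u.1.2 u.2| <= C].
    move=> w; have [a [b [x [x01 pE D1 D2 [bd _]]]]] := Zder n w; exists (a, b, x); split => //=.
    by apply: (is_derive_conv (der_sub (der_cmul V D2) (der_cmul X D1))) => //; ring.
  have D w : is_derive w (1 : R) (fun w => V * Z2 n w - X * Z1 n w)
      (stretch P (u w).1.1 (u w).1.2 (u w).2 * (V * Z2 n w - X * Z1 n w) + spin P (u w).1.1 (u w).1.2 (u w).2 * (V * Z1 n w + X * Z2 n w)) by have [] := uP w.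
  have [w hw e] := mean_value t0 (t0 + h n) D.
  have [_ x01 pE bd] := uP w; exists (w, u w); split => //=; first by rewrite addrAC subrr add0r in hw.
  have th' : t0 + h n - t0 = h n by ring.
  by rewrite th' in e; rewrite -e; ring.
have wh n : `|(w n).1 - t0| <= `|h n| by have [] := wP n.
have [W1 W2] := Zc _ wh.
have sc0 : (fun n => s n) @ ultra --> (0 : R).
  apply: (@ultra_cvg_near _ (fun=> 0) _ _ 1); first exact: cvg_cst.
  by move=> n; have [sn sn1 _ _] := sP n; rewrite subr0 mul1r gtr0_norm.
have loc j : (fun n => crd (pt (w n).2.1.1 (w n).2.1.2 (w n).2.2) j) @ ultra --> crd (pt 0 (y t0) 0) j.
  have k1 : (fun n => crd (phi t0 (c (s n))) j) @ ultra --> crd (pt 0 (y t0) 0) j.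
    have := ultra_cvg_comp (derive_cont (F j t0)) sc0; by rewrite c0 ph0 lE.
  apply: (sub0 _ _ _ _ k1); apply: (@ultra_squeeze0 _ (fun n => K * `|h n|)); last first.
    rewrite -(mulr0 K); apply: cvgM; first exact: cvg_cst.
    by have := ultra_cvg_comp (@norm_continuous R R _) h0; rewrite normr0.
  move=> n; have [_ _ <- _ _] := wP n.
  have pd t := trajectory_derive fsm f_gt0 (tr (s n)) t.
  have D t : is_derive t (1 : R) (fun t => crd (phi t (c (s n))) j) (crd (reebX f (phi t (c (s n)))) j) by exact: der_crd (proj2 (pd t)).
  have [v _ ->] := mean_value t0 (w n).1 D.
  by rewrite normrM; apply: ler_pM => //; apply: KP; have [] := pd v.
have [VE XE] := YV t0; rewrite -/V in VE; rewrite -/X in XE.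
have spc : (fun n => spin P (w n).2.1.1 (w n).2.1.2 (w n).2.2) @ ultra --> pU P 0 (y t0) 0 / 2 + b0 P (th t0 - y t0) (y t0).
  apply: (spin_near_link (rho0 t0) s0 _ loc).
  - by move=> n; have [] := wP n.
  - by rewrite -VE; apply: ultra_cvg_ext W1 => n; have [_ _ <- _ _] := wP n.
  - by rewrite -XE; apply: ultra_cvg_ext W2 => n; have [_ _ <- _ _] := wP n.
set N := _ + _ in spc *.
pose v n := V3 (Y (t0 + h n)); pose x n := X3 (Y (t0 + h n)).
have [Z1h Z2h] : (fun n => Z1 n (t0 + h n)) @ ultra --> V /\ (fun n => Z2 n (t0 + h n)) @ ultra --> X.
  by apply: (Zc (fun n => t0 + h n)) => n; rewrite addrAC subrr add0r.
have vc : v @ ultra --> V.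
  apply: (sub0 _ _ _ _ Z1h); apply: ultra_squeeze0 hd0 => n; by rewrite distrC; have [_ _ _ []] := sP n.
have xc : x @ ultra --> X.
  apply: (sub0 _ _ _ _ Z2h); apply: ultra_squeeze0 hd0 => n; by rewrite distrC; have [_ _ _ []] := sP n.
have thn : (fun n => th (t0 + h n)) @ ultra --> th t0.
  have tn : (fun n => t0 + h n) @ ultra --> t0 by rewrite -[X in _ --> X](addr0 t0); apply: cvgD => //; exact: cvg_cst.
  exact: (ultra_cvg_comp (thc t0) tn).
have rc : (fun n => rho (t0 + h n)) @ ultra --> rho t0.
  have lim : (fun n => v n * cos (th (t0 + h n)) + x n * sin (th (t0 + h n))) @ ultra --> V * cos (th t0) + X * sin (th t0).
    apply: cvgD_ultra; [apply: (cvgM_ultra vc)|apply: (cvgM_ultra xc)].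
      exact: ultra_cvg_comp (@continuous_cos R (th t0)) thn.
    exact: ultra_cvg_comp (@continuous_sin R (th t0)) thn.
  have id (r' a : R) : r' * cos a * cos a + r' * sin a * sin a = r' by rewrite -[RHS]mulr1 -(cos2Dsin2 a); ring.
  rewrite VE XE id in lim; apply: ultra_cvg_ext lim => n; rewrite /v /x.
  by have [-> ->] := YV (t0 + h n); rewrite id.
pose J n := V * Z2 n (w n).1 - X * Z1 n (w n).1.
have Jc : J @ ultra --> (0 : R).
  rewrite -(subrr (V * X)) {2}(mulrC V).
  by apply: cvgB; [exact: (cvgM_ultra (cvg_cst V) W2)|exact: (cvgM_ultra (cvg_cst X) W1)].
have MJ : (fun n => stretch P (w n).2.1.1 (w n).2.1.2 (w n).2.2 * J n) @ ultra --> (0 : R).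
  apply: (@ultra_squeeze0 _ (fun n => C * `|J n|)) => [n|].
    by rewrite normrM; apply: ler_wpM2r => //; have [] := wP n.
  rewrite -(mulr0 C); apply: cvgM; first exact: cvg_cst.
  by have := ultra_cvg_comp (@norm_continuous R R _) Jc; rewrite normr0.
have NJ : (fun n => spin P (w n).2.1.1 (w n).2.1.2 (w n).2.2 * (V * Z1 n (w n).1 + X * Z2 n (w n).1)) @ ultra --> N * rho t0 ^+ 2.
  have -> : rho t0 ^+ 2 = V * V + X * X by rewrite VE XE -[LHS]mulr1 -(cos2Dsin2 (th t0)); ring.
  exact: (cvgM_ultra spc (cvgD_ultra (cvgM_ultra (cvg_cst V) W1) (cvgM_ultra (cvg_cst X) W2))).
have Ec : (fun n => (V * x n - X * v n) / h n) @ ultra --> N * rho t0 ^+ 2.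
  have MNJ := cvgD_ultra MJ NJ; rewrite add0r in MNJ; apply: (sub0 _ _ _ _ MNJ).
  apply: (@ultra_cvg_near _ (fun=> 0) _ _ (2 * (`|V| + `|X|))); first exact: cvg_cst.
  move=> n; rewrite subr0; have [_ _ _ _ e] := wP n.
  have -> : (V * x n - X * v n) / h n - (stretch P (w n).2.1.1 (w n).2.1.2 (w n).2.2 * J n +
      spin P (w n).2.1.1 (w n).2.1.2 (w n).2.2 * (V * Z1 n (w n).1 + X * Z2 n (w n).1)) =
    (V * (x n - Z2 n (t0 + h n) + (Z2 n t0 - X)) - X * (v n - Z1 n (t0 + h n) + (Z1 n t0 - V))) / h n.
    apply: (mulIf (hn n)); rewrite mulrBl -/(J n) -e !divfK //; rewrite /=; ring.
  have [_ _ [e1 e2] [e3 e4]] := sP n; rewrite -/(v n) in e3; rewrite -/(x n) in e4.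
  have hn0 : 0 < `|h n| by rewrite normr_gt0.
  rewrite normrM normfV ler_pdivrMr //.
  have k1 : `|x n - Z2 n (t0 + h n) + (Z2 n t0 - X)| <= 2 * (`|h n| / n.+1%:R) by apply: normD_le2 => //; rewrite distrC.
  have k2 : `|v n - Z1 n (t0 + h n) + (Z1 n t0 - V)| <= 2 * (`|h n| / n.+1%:R) by apply: normD_le2 => //; rewrite distrC.
  apply: le_trans (ler_normB _ _) _; rewrite !normrM.
  have m1 := ler_wpM2l (normr_ge0 V) k1; have m2 := ler_wpM2l (normr_ge0 X) k2.
  apply: le_trans (lerD m1 m2) _; rewrite le_eqVlt; apply/orP; left; apply/eqP; ring.
apply: angle_increment => //; first exact: thc.
have lim : (fun n => (V * x n - X * v n) / h n / (rho t0 * rho (t0 + h n))) @ ultra --> N * rho t0 ^+ 2 / (rho t0 * rho t0).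
  have rr : rho t0 * rho t0 != 0 by rewrite mulf_neq0 // lt0r_neq0.
  apply: (cvgM_ultra Ec); apply: (cvgV rr); exact: (cvgM_ultra (cvg_cst (rho t0)) rc).
have r0n := lt0r_neq0 (rho0 t0).
have NE : N * rho t0 ^+ 2 / (rho t0 * rho t0) = N by rewrite -expr2 mulfK // sqrf_eq0.
rewrite NE in lim; apply: ultra_cvg_ext lim => n.
have [a1 a2] := YV (t0 + h n); rewrite /v /x a1 a2 VE XE sinB.
move: (lt0r_neq0 (rho0 (t0 + h n))) r0n (hn n); move: (rho (t0 + h n)) (rho t0) (h n) (sin (th (t0 + _))) (cos (th (t0 + _))) (sin (th t0)) (cos (th t0)) => a b d u1 u2 u3 u4 ha hb hd.
by field; rewrite ha hb hd.
Qed.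
End Rotation.

Section LinkRotation.
Variable R : realType.
Local Notation V6 := (V6 R).
Variables (f : V6 -> R) (P : profile R).
Hypotheses (fsm : smooth f) (f_gt0 : forall p, T1S2 p -> 0 < f p) (g : good P) (PU : pU P = Uof f).

Lemma link_angle_mono (y : R -> R) : link_angle P y -> forall s t, s < t -> y s < y t.
Proof.
move=> yd s t st; have [c c0 cP] := link_speed g; have [m _ e] := mean_value s t yd.
by rewrite -subr_gt0 e mulr_gt0 ?subr_gt0 //; have := cP (y m); lra.
Qed.

Lemma link_angle_inverse (y : R -> R) : link_angle P y -> exists Yi : R -> R, forall v, y (Yi v) = v /\ is_derive v (1 : R) Yi (pU P 0 v 0 / 2)^-1.
Proof.
move=> yd; have [c c0 cP] := link_speed g; have inc := link_angle_mono yd.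
have yc : continuous y by move=> t; exact: derive_cont (yd t).
have far t : 0 <= t -> c * t <= y t - y 0 /\ c * t <= y 0 - y (- t).
  move=> t0; have [m _ e1] := mean_value 0 t yd; have [m' _ e2] := mean_value (- t) 0 yd.
  by rewrite e1 e2 subr0 opprK add0r; split; apply: ler_wpM2r.
have /choice[Yi YiP] : forall v, exists t : R, y t = v.
  move=> v; pose t := `|v - y 0| / c; have t0 : 0 <= t by rewrite divr_ge0 // ltW.
  have ct : c * t = `|v - y 0| by rewrite mulrC divfK // lt0r_neq0.
  have [h1 h2] := far t t0; rewrite ct in h1 h2.
  have n1 := ler_norm (v - y 0); have n2 := ler_norm (- (v - y 0)); rewrite normrN in n2.
  have [||u yu] := @ivt R y (- t) t v yc; [lra|lra|by exists u].
have inj : injective y.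
  by move=> s t e; have [/inc|/inc|//] := ltgtP s t; rewrite e ltxx.
exists Yi => v; split => //.
have YK : cancel y Yi by move=> t; apply: inj; rewrite YiP.
have nE (Q : R -> Prop) : (forall t, Q t) -> \forall t \near Yi v, Q t by move=> h; apply: filterE.
rewrite -{1}(YiP v); apply: is_derive_inverse; [exact: nE|exact: nE|by have := yd (Yi v); rewrite YiP|].
by apply: lt0r_neq0; have := cP v; lra.
Qed.

(** The difference [y t - pi * t / T] is periodic, so it suffices to bound it over one period. *)
Lemma link_mean_speed (y : R -> R) (T : R) : 0 < T -> link_angle P y -> (forall t, y (t + T) = y t + pi) ->
  forall t, 0 <= t -> `|y t - pi * t / T| <= `|y 0| + pi.
Proof.
move=> T0 yd per t t0; have pp := pi_gt0 R.
have perN (n : nat) s : y (s + n%:R * T) = y s + n%:R * pi.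
  elim: n => [|n IH]; first by rewrite !mul0r !addr0.
  have -> : s + n.+1%:R * T = s + n%:R * T + T by rewrite -natr1; ring.
  by rewrite per IH -natr1; ring.
pose n := Num.trunc (t / T); have tT : 0 <= t / T by rewrite divr_ge0 // ltW.
have /andP[n1 n2] : n%:R <= t / T < n.+1%:R by exact: trunc_itv.
pose s := t - n%:R * T; have s0 : 0 <= s by rewrite subr_ge0 -ler_pdivlMr.
have s1 : s < T by rewrite /s ltrBlDl -[X in _ < _ + X]mul1r -mulrDl natr1 -ltr_pdivrMr.
have mono u v : u <= v -> y u <= y v by rewrite le_eqVlt => /predU1P[->//|/(link_angle_mono yd)/ltW].
have y0 := mono _ _ s0; have y1 := mono _ _ (ltW s1); have pT := perN 1%N 0; rewrite !mul1r add0r in pT.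
have -> : y t = y s + n%:R * pi by rewrite -perN /s subrK.
have -> : pi * t / T = n%:R * pi + pi * (s / T) by rewrite /s; field; exact: lt0r_neq0.
have sT0 : 0 <= s / T by rewrite divr_ge0 // ltW.
have sT1 : s / T <= 1 by rewrite ler_pdivrMr // mul1r ltW.
have q1 : 0 <= pi * (s / T) <= pi by rewrite mulr_ge0 ?(ltW pp) //= -[leRHS]mulr1 ler_wpM2l // ltW.
have := ler_norm (y 0); have := ler_norm (- y 0); rewrite normrN => k1 k2.
by move: q1 => /andP[]; move: (pi * (s / T)) => q q1 q2; rewrite ler_norml; apply/andP; split; lra.
Qed.

(** [Th] is the transverse angle minus the link angle, as a function of the latter, in accordance
    with [a = (a + b) - b]. In one period the link angle grows by [pi] and the transverse angle by
    [2 pi rho] on average, so the ratio of their growths is [2 rho]. *)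
Theorem link_rotation (l : R -> V6) (T rho : R) : prime_closed_orbit (conformal_form f) l T -> range l = Dcov @` L0 ->
  is_rotation_number f l T rho -> boundary_rotation P (2 * rho - 1).
Proof.
move=> lper lran [Y [r [th [[phi flow tm] _ thc YE lim]]]]; have [ltr T0 _ _] := lper; have pp := pi_gt0 R.
have [y0 l0E] : exists y0, l 0 = pt 0 y0 0.
  have : range l (l 0) by exists 0.
  rewrite lran => -[z [zS z0] <-]; have [a [b [x [x01 pE]]]] : exists a b x, 0 <= x <= pi / 2 /\ Dcov z = pt a b x.
    by apply/polar_onto/T1S2_Dcov.
  exists b; rewrite pE (_ : x = 0); first exact: pt_x0.
  apply: sin_eq0_quadrant => //; apply/eqP; rewrite -sqrf_eq0; apply/eqP.
  have n1 : nrm z = 1 by [].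
  have := pt_n3 a b x; have := cos2Dsin2 x; rewrite -pE vperp_cover //.
  have : nz z 0 2%:R = 1.
    by move: n1 z0; case: (z) => -[q0 p0] [q1 p1] /= n1 [e0 e1]; rewrite vec32 -n1 /nrm /= e0 e1; ring.
  by move=> ->; lra.
have [y _ yP] := link_flow fsm f_gt0 g PU ltr l0E.
have yd : link_angle P y by move=> t; have [] := yP t.
have lE t : l t = pt 0 (y t) 0 by have [] := yP t.
have yper : forall t, y (t + T) = y t + pi.
  by apply: (link_period g PU yd); have <- : l = (fun t => pt 0 (y t) 0) by exact/funext.
have thd := rotation_ode fsm f_gt0 g PU flow lE yd tm thc YE.
have [Yi YiP] := link_angle_inverse yd; have inc := link_angle_mono yd; have [c c0 cP] := link_speed g.
exists (fun v => th (Yi v) - v); split => [v|e e0].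
  have [yv Yd] := YiP v; have D := der_sub (der_comp Yd (thd (Yi v))) (der_id v); rewrite yv in D.
  apply: (is_derive_conv D) => //; have := cP v; move: (pU P 0 v 0 / 2) (b0 _ _ _) => u b hu.
  by field; apply: lt0r_neq0; lra.
have Kb := link_mean_speed T0 yd yper; set K := `|y 0| + pi in Kb.
have K0 : 0 <= K by rewrite addr_ge0 // ltW.
have e4 : 0 < e / 4 by lra.
have /cvgrPdist_le /(_ _ e4) [M [_ MP]] := lim.
pose w := Num.max 1 (M + 1).
have wM : M < w by rewrite lt_max; apply/orP; right; lra.
have w1 : 1 <= w by rewrite le_max lexx.
(* Beyond this bound the terms not growing with [v] amount to at most half of [e * v]; the tolerance
   [e / 4] in the limit accounts for the other half. *)
exists (Num.max (Num.max 0 (y w)) (2 * (2 * `|rho| * K + K * e / 2) / e)) => v; rewrite !ge_max => /andP[/andP[v0 vw] vb].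
have [yv _] := YiP v; set t := Yi v in yv *.
have wt : w <= t by rewrite leNgt; apply/negP => /inc; rewrite yv; lra.
have t0 : 0 < t by lra.
have Mt : M < t by lra.
have := MP t Mt; set d := rho - _ => /= hd.
have thE : th t = 2 * (pi * t / T) * (rho - d).
  have [tn pn Tn] := And3 (lt0r_neq0 t0) (lt0r_neq0 pp) (lt0r_neq0 T0).
  by rewrite /d; move: (th t) (t) tn (@pi R) pn => A B tn p pn; field; rewrite ?tn ?pn ?Tn.
have := Kb t (ltW t0); rewrite yv; set s := pi * t / T => hs.
have -> : th t - v - (2 * rho - 1) * v = - (2 * rho * (v - s)) - 2 * s * d by rewrite thE -/s; ring.
have s0 : 0 <= s by rewrite /s divr_ge0 ?mulr_ge0 // ltW.
clearbody s d.
have h1 : `|2 * rho * (v - s)| <= 2 * `|rho| * K.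
  rewrite !normrM (ger0_norm (ler0n _ 2)); apply: ler_wpM2l => //; by rewrite mulr_ge0.
have h2 : `|2 * s * d| <= 2 * (v + K) * (e / 4).
  rewrite !normrM (ger0_norm (ler0n _ 2)) (ger0_norm s0); apply: ler_pM => //; first by rewrite mulr_ge0.
  by move: hs; rewrite ler_norml => /andP[]; lra.
have h3 : 2 * (2 * `|rho| * K + K * e / 2) <= v * e by rewrite -ler_pdivrMr.
apply: le_trans (ler_normB _ _) _; rewrite normrN; move: (2 * `|rho| * K) (`|_ * (v - s)|) (`|2 * s * d|) h1 h2 h3 => u1 u2 u3 h1 h2 h3.
by lra.
Qed.
End LinkRotation.

(** * Exchanging the components of the link *)

Section Reflection.
Variable R : realType.
Local Notation V6 := (V6 R).
Implicit Types (f : V6 -> R) (p u w : V6).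

Definition refl3 (u : 'rV[R]_3) : 'rV[R]_3 := vec3 (u 0 0) (- u 0 1) (u 0 2%:R).

(* An isometry of the sphere exchanging the two components of the link; it preserves the contact form, and the frame of
   the contact planes up to sign. *)
Definition refl p : V6 := (refl3 p.1, refl3 p.2).

Definition refl_sign (j : idx) : R := if j.2 == 1 then -1 else 1.

Lemma crd_refl p j : crd (refl p) j = refl_sign j * crd p j.
Proof.
have m3 (u : 'rV[R]_3) i : refl3 u 0 i = (if i == 1 then -1 else 1) * u 0 i.
  rewrite mxE; case: i => -[|[|[|//]]] h.
  - rewrite (_ : Ordinal h = 0) /= ?mul1r //; exact: val_inj.
  - rewrite (_ : Ordinal h = 1) /= ?mulN1r //; exact: val_inj.
  - rewrite (_ : Ordinal h = 2%:R) /= ?mul1r //; exact: val_inj.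
by case: j => -[] i; rewrite /crd /= m3.
Qed.

Lemma reflK p : refl (refl p) = p.
Proof. by apply: V6_eq => j; rewrite !crd_refl mulrA /refl_sign; case: ifP => _; rewrite ?mulrNN !mul1r. Qed.

Lemma refl_comb (k l m : R) u v w : refl (k *: u + l *: v + m *: w) = k *: refl u + l *: refl v + m *: refl w.
Proof. by apply: V6_eq => j; rewrite !(crdD, crdZ, crd_refl); ring. Qed.

Lemma reflD (k : R) u v : refl (k *: u + v) = k *: refl u + refl v.
Proof. by apply: V6_eq => j; rewrite !(crdD, crdZ, crd_refl); ring. Qed.

Lemma refl_derive (F : R -> V6) (t : R) w : is_derive t (1 : R) F w -> is_derive t (1 : R) (fun s => refl (F s)) (refl w).
Proof.
move=> Fw; apply: der_V6 => j; rewrite crd_refl.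
by apply: (is_derive_conv (der_cmul (refl_sign j) (der_crd j Fw))) => // s; rewrite crd_refl.
Qed.

Lemma refl_diff p : differentiable refl p.
Proof.
have -> : refl = (fun p => \sum_j (refl_sign j * crd p j) *: e6 R j).
  by apply/funext => q; rewrite [LHS]V6_sum; apply: eq_bigr => j _; rewrite crd_refl.
elim: (index_enum _) => [|j r IH].
  by have -> : (fun q => \sum_(i <- [::]) (refl_sign i * crd q i) *: e6 R i) = cst 0 by apply/funext => q; rewrite big_nil.
have -> : (fun q => \sum_(i <- j :: r) (refl_sign i * crd q i) *: e6 R i) =
    (fun q => (refl_sign j * crd q j) *: e6 R j) + (fun q => \sum_(i <- r) (refl_sign i * crd q i) *: e6 R i).
  by apply/funext => q; rewrite big_cons.
apply: differentiableD => //; apply: differentiableZl.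
by apply: differentiableM; [exact: differentiable_cst|exact: crd_diff].
Qed.

Lemma D_refl f p v : 'D_v (f \o refl) p = 'D_(refl v) f (refl p).
Proof.
have e : (fun h : R => h^-1 *: (((f \o refl) \o shift p) (h *: v) - (f \o refl) p)) =
    (fun h => h^-1 *: ((f \o shift (refl p)) (h *: refl v) - f (refl p))).
  by apply/funext => h /=; rewrite reflD.
by rewrite /derive e.
Qed.

Lemma smooth_refl f : smooth f -> smooth (f \o refl).
Proof.
move=> fsm k; elim: k f {fsm}(fsm k) => [|k IH] f /= fk.
  by move=> p; apply: continuous_comp; [exact: differentiable_continuous (refl_diff p)|exact: fk].
case: fk => fd fk; split => [p|v]; first by apply: differentiable_comp; [exact: refl_diff|exact: fd].
by have -> : 'D_v (f \o refl) = ('D_(refl v) f) \o refl; [apply/funext => p; exact: D_refl|exact: IH].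
Qed.

Lemma dot_refl (u v : 'rV[R]_3) : dot (refl3 u) (refl3 v) = dot u v.
Proof. by rewrite /refl3 !simp3; ring. Qed.

Lemma T1S2_refl p : T1S2 p -> T1S2 (refl p).
Proof. by move=> [h1 h2 h3]; split; rewrite /= dot_refl. Qed.

Lemma vperp_refl p : vperp (refl p) = - refl3 (vperp p).
Proof. by rewrite /vperp /cross /refl3 /=; apply: row3; rewrite !simp3; ring. Qed.

Lemma refl3N (u : 'rV[R]_3) : refl3 (- u) = - refl3 u.
Proof. by apply: row3; rewrite !simp3. Qed.

Lemma refl30 : refl3 0 = 0.
Proof. by apply: row3; rewrite !simp3 ?oppr0. Qed.

Lemma refl_frame p : [/\ Gv (refl p) = refl (Gv p), Vv (refl p) = - refl (Vv p) & Hv (refl p) = - refl (Hv p)].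
Proof.
rewrite /Gv /Vv /Hv vperp_refl /refl /= refl3N refl30; split => //; congr pair; by rewrite oppr0.
Qed.

Lemma reebX_refl f p : smooth f -> reebX (f \o refl) (refl p) = refl (reebX f p).
Proof.
move=> fsm; have fd := f_diff fsm p; have [e1 e2 e3] := refl_frame p.
have rN u : refl (- u) = - refl u by apply: V6_eq => j; rewrite !(crdN, crd_refl); ring.
have DN u : 'D_(- u) f p = - 'D_u f p by rewrite -scaleN1r D_scale // mulN1r.
rewrite /reebX !D_refl /= !reflK e1 e2 e3 !rN !reflK !DN refl_comb.
move: ('D_(Hv p) f p) ('D_(Vv p) f p) (f p) => d1 d2 F.
by apply: V6_eq => j; rewrite !(crdD, crdZ, crdN); ring.
Qed.

Section WithF.
Variables (f : V6 -> R) (fsm : smooth f) (f_gt0 : forall p, T1S2 p -> 0 < f p).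

Lemma f_refl_gt0 p : T1S2 p -> 0 < (f \o refl) p.
Proof. by move=> hp; apply/f_gt0/T1S2_refl. Qed.

Lemma trajectory_refl (l : R -> V6) : reeb_trajectory (conformal_form f) l -> reeb_trajectory (conformal_form (f \o refl)) (refl \o l).
Proof.
move=> tr t; have [lt ld] := trajectory_derive fsm f_gt0 tr t; have rt := T1S2_refl lt.
split => //; exists (refl (reebX f (l t))); last exact: refl_derive.
apply/reeb_vectorP => //; [exact: f_refl_gt0|exact: f_diff (smooth_refl fsm) _|by rewrite reebX_refl].
Qed.

Lemma prime_orbit_refl (l : R -> V6) (T : R) : prime_closed_orbit (conformal_form f) l T ->
  prime_closed_orbit (conformal_form (f \o refl)) (refl \o l) T.
Proof.
move=> [tr T0 per pr]; split => //; [exact: trajectory_refl|by move=> t /=; rewrite per|].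
by move=> S S0 h; apply: (pr S S0) => t; rewrite -(reflK (l (t + S))) -(reflK (l t)); congr refl; exact: h.
Qed.

(** The frame of the contact plane is taken to minus the frame at the image point. The angle is
    therefore shifted by [pi], and this shift disappears in the limit. *)
Lemma rotation_refl (l : R -> V6) (T rho : R) : is_rotation_number f l T rho -> is_rotation_number (f \o refl) (refl \o l) T rho.
Proof.
move=> [Y [r [th [[phi flow tm] xi thc YE lim]]]].
exists (refl \o Y), r, (fun t => th t + pi); split.
- exists (fun t p => refl (phi t (refl p))) => [p hp|t c cT c0 cd].
    have [p0 tr] := flow _ (T1S2_refl hp); rewrite p0 reflK; split => //; exact: trajectory_refl tr.
  have h : is_derive (0 : R) (1 : R) (phi t \o (refl \o c)) (Y t).
    apply: tm => [s||]; [exact: T1S2_refl|by rewrite /= c0 /= reflK|].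
    by have := refl_derive cd; rewrite /= reflK.
  exact: refl_derive h.
- move=> t; have [[tg lam] Yn] := xi t; split; last first.
    by apply: contra_neq Yn => /= h; rewrite -(reflK (Y t)) h; apply: V6_eq => j; rewrite crd_refl /crd; case: ifP; rewrite mxE mulr0.
  case: tg => t1 t2 t3; split; last by rewrite /lambda_bar0 /= dot_refl.
  by split; rewrite /= !dot_refl.
- by move=> t; apply: cvgD; [exact: thc|exact: cvg_cst].
- move=> t; have [r0 YEt] := YE t; split => //=; rewrite {}YEt cosDpi sinDpi.
  have f1 : frame1 (f \o refl) (refl (l t)) = - refl (frame1 f (l t)).
    rewrite /frame1 /= reflK; have [_ e _] := refl_frame (l t).
    have -> : vlift (refl (l t)) (vperp (refl (l t))) = Vv (refl (l t)) by [].
    by rewrite e; apply: V6_eq => j; rewrite !(crdZ, crdN, crd_refl); ring.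
  have f2 : frame2 (f \o refl) (refl (l t)) = - refl (frame2 f (l t)).
    rewrite /frame2 /= reflK /hlift vperp_refl /=; apply: V6_eq => j; rewrite !(crdZ, crdN, crd_refl).
    have -> : crd (- refl3 (vperp (l t)), - dot (refl3 (l t).2) (- refl3 (vperp (l t))) *: refl3 (l t).1) j =
       crd (- refl (vperp (l t), - dot (l t).2 (vperp (l t)) *: (l t).1)) j.
      congr crd; rewrite dotNr dot_refl opprK; congr pair => /=; apply: row3; rewrite !simp3; ring.
    by rewrite crdN crd_refl; ring.
  by rewrite f1 f2; apply: V6_eq => j; rewrite !(crdZ, crdD, crdN, crd_refl); ring.
have -> : rho = rho + 0 by rewrite addr0.
have -> : (fun t => T * ((th t + pi) / (2 * pi * t))) = (fun t => T * (th t / (2 * pi * t)) + T / 2 * t^-1).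
  apply/funext => t; have [->|tn] := eqVneq t 0; first by rewrite mulr0 invr0 !mulr0 addr0.
  by have := lt0r_neq0 (pi_gt0 R); move: (@pi R) => p pn; field; rewrite tn pn.
apply: cvgD => //; rewrite -(mulr0 (T / 2)); apply: cvgM; [exact: cvg_cst|].
apply/cvgrPdist_le => e e0; exists (Num.max 1 e^-1); split; first exact: num_real.
move=> t; rewrite gt_max => /andP[t1 te]; have t0 : 0 < t by lra.
by rewrite sub0r normrN gtr0_norm ?invr_gt0 // -[e]invrK lef_pV2 ?posrE ?invr_gt0 // ltW.
Qed.

(** On the sphere upstairs the reflection is the exchange of [z0] and [z1]. *)
Lemma Dcov_swap (z : C2 R) : Dcov (z.2, z.1) = refl (Dcov z).
Proof. by case: z => -[q0 p0] [q1 p1]; rewrite /refl /refl3 /=; congr pair; apply: row3; rewrite !simp3; ring. Qed.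

Lemma pt_swap (a b x : R) : refl (pt a b x) = pt b a (pi / 2 - x).
Proof.
rewrite /pt -Dcov_swap /zpt /=; congr (Dcov (polar _ _, polar _ _)).
  by rewrite sinB sin_pihalf cos_pihalf; ring.
by rewrite cosB sin_pihalf cos_pihalf; ring.
Qed.

Lemma link_refl (l : R -> V6) : range l = Dcov @` L1 -> range (refl \o l) = Dcov @` L0.
Proof.
move=> lran; rewrite eqEsubset; split => [_ [t _ <-]|_ [z [zS z0] <-]].
  have : range l (l t) by exists t.
  rewrite lran => -[z [zS z0] /= <-]; exists (z.2, z.1); last exact: Dcov_swap.
  by split => //; move: zS; rewrite /S3 /= => <-; ring.
have : (Dcov @` L1) (refl (Dcov z)).
  exists (z.2, z.1); last exact: Dcov_swap.
  by split => //; move: zS; rewrite /S3 /= => <-; ring.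
by rewrite -lran => -[t _ e]; exists t => //=; rewrite e reflK.
Qed.

Theorem link_rotation_swap (P : profile R) (l : R -> V6) (T rho : R) : good P -> pU P = Uof f ->
  prime_closed_orbit (conformal_form f) l T -> range l = Dcov @` L1 -> is_rotation_number f l T rho ->
  boundary_rotation (swap P) (2 * rho - 1).
Proof.
move=> g PU lper lran lrot.
have PU' : pU (swap P) = Uof (f \o refl).
  apply/funext => a; apply/funext => b; apply/funext => x.
  by rewrite /= PU /flip /Uof /= pt_swap.
exact: (link_rotation (smooth_refl fsm) f_refl_gt0 (good_swap g) PU' (prime_orbit_refl lper) (link_refl lran) (rotation_refl lrot)).
Qed.
End WithF.
End Reflection.

(** * Lifts of loops to the three-sphere *)

Section Lifting.
Variable R : realType.
Local Notation V6 := (V6 R).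
Implicit Types (z w : C2 R).

Definition dot4 z w : R := z.1.1 * w.1.1 + z.1.2 * w.1.2 + z.2.1 * w.2.1 + z.2.2 * w.2.2.

(* The trace of the rotation taking one frame to another in terms of the lifts of the frames to the unit quaternions. *)
Lemma frame_trace z w : dot (Dcov z).1 (Dcov w).1 + dot (Dcov z).2 (Dcov w).2 + dot (nz z) (nz w) = 4 * dot4 z w ^+ 2 - nrm z * nrm w.
Proof.
case: z => -[a b] [c d]; case: w => -[a' b'] [c' d'].
by rewrite /Dcov /nz /dot4 /nrm /= !simp3; ring.
Qed.

(** With [k] and [l] the signs of the two given products, the squared length of [k z - 2 w + l u] is
    nonnegative; its expansion forces the product of [z] and [u] to have the sign [k * l]. *)
Lemma dot4_sg z w u : nrm z = 1 -> nrm w = 1 -> nrm u = 1 -> 9 / 10 < dot4 z w ^+ 2 -> 9 / 10 < dot4 w u ^+ 2 ->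
  Num.sg (dot4 z w) * Num.sg (dot4 w u) = Num.sg (dot4 z u).
Proof.
move=> z1 w1 u1; set d := dot4 z w; set e := dot4 w u => hd he.
pose k : R := Num.sg d; pose l : R := Num.sg e.
have big (y : R) : 9 / 10 < y ^+ 2 -> 9 / 10 < Num.sg y * y /\ Num.sg y * Num.sg y = 1.
  move=> hy; have y0 : y != 0 by apply: contraTneq hy => ->; rewrite expr0n /= -leNgt; lra.
  rewrite -normrEsg -expr2 sqr_sg y0; split => //.
  by rewrite ltNge; apply/negP => h; move: hy; rewrite -(real_normK (num_real y)) ltNge => /negP; apply; have := normr_ge0 y; nra.
have [hk kk] := big d hd; have [hl ll] := big e he; rewrite -/k in hk kk; rewrite -/l in hl ll.
suff h : 0 < k * l * dot4 z u.
  have : Num.sg (k * l * dot4 z u) = 1 by rewrite gtr0_sg.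
  rewrite !sgrM /k /l !sgr_id => e'; have := congr1 (fun y => k * l * y) e'.
  by rewrite -/k -/l mulr1 => <-; rewrite mulrA (mulrACA k l) kk ll mul1r; rewrite mul1r.
have q : 0 <= (k * z.1.1 - 2 * w.1.1 + l * u.1.1) ^+ 2 + (k * z.1.2 - 2 * w.1.2 + l * u.1.2) ^+ 2 +
   (k * z.2.1 - 2 * w.2.1 + l * u.2.1) ^+ 2 + (k * z.2.2 - 2 * w.2.2 + l * u.2.2) ^+ 2 by rewrite !addr_ge0 ?sqr_ge0.
have E : (k * z.1.1 - 2 * w.1.1 + l * u.1.1) ^+ 2 + (k * z.1.2 - 2 * w.1.2 + l * u.1.2) ^+ 2 +
   (k * z.2.1 - 2 * w.2.1 + l * u.2.1) ^+ 2 + (k * z.2.2 - 2 * w.2.2 + l * u.2.2) ^+ 2 =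
   k * k * nrm z + 4 * nrm w + l * l * nrm u - 4 * (k * d) - 4 * (l * e) + 2 * (k * l * dot4 z u).
  by rewrite /nrm /d /e /dot4; ring.
rewrite E kk ll z1 w1 u1 in q; lra.
Qed.

Lemma within_ultra (H : R * R -> V6) (A : set (R * R)) (s t : nat -> R) (s0 t0 : R) : {within A, continuous H} ->
  (forall n, A (s n, t n)) -> A (s0, t0) -> s @ ultra --> s0 -> t @ ultra --> t0 ->
  (fun n => H (s n, t n)) @ ultra --> H (s0, t0).
Proof.
move=> /subspace_continuousP Hc An A0 sc tc B /(Hc _ A0) => hB.
have uc : (fun n => (s n, t n)) @ ultra --> (s0, t0) by exact: (@cvg_pair _ _ _ ultra (nbhs s0) (nbhs t0) _ _ _ s t sc tc).
have := uc _ hB; rewrite /nbhs /=; apply: filterS => n /=; apply; exact: An.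
Qed.

Lemma V6_continuous (T : topologicalType) (F : T -> V6) : (forall j, continuous (fun u => crd (F u) j)) -> continuous F.
Proof.
move=> Fc; rewrite (_ : F = (fun u => \sum_j crd (F u) j *: e6 R j)); last by apply/funext => v; exact: V6_sum.
elim: (index_enum _) => [|j r IH] u.
  by rewrite (_ : (fun _ => _) = (fun=> 0)); [exact: cvg_cst|apply/funext => v; rewrite big_nil].
rewrite (_ : (fun _ => _) = (fun v => crd (F v) j *: e6 R j + \sum_(i <- r) crd (F v) i *: e6 R i)); last by apply/funext => v; rewrite big_cons.
by apply: cvgD; [apply: cvgZr_tmp; exact: Fc|exact: IH].
Qed.

Lemma dot_cvg (u v : nat -> 'rV[R]_3) (a b : 'rV[R]_3) : (forall i, (fun n => u n 0 i) @ ultra --> a 0 i) ->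
  (forall i, (fun n => v n 0 i) @ ultra --> b 0 i) -> (fun n => dot (u n) (v n)) @ ultra --> dot a b.
Proof.
move=> uc vc; rewrite dotE; apply: (@ultra_cvg_ext _ _ (fun n => u n 0 0 * v n 0 0 + u n 0 1 * v n 0 1 + u n 0 2%:R * v n 0 2%:R)).
  by move=> n; rewrite dotE.
by apply: cvgD; [apply: cvgD|]; apply: cvgM.
Qed.

Lemma vperp_cvg (u : nat -> V6) (p : V6) i : u @ ultra --> p -> (fun n => vperp (u n) 0 i) @ ultra --> vperp p 0 i.
Proof.
move=> up; have c j : (fun n => crd (u n) j) @ ultra --> crd p j := @cvg_crd _ _ _ j up.
have X k (l m : idx) (l' m' : idx) : (forall q : V6, vperp q 0 k = crd q l * crd q m - crd q l' * crd q m') ->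
    (fun n => vperp (u n) 0 k) @ ultra --> vperp p 0 k.
  move=> e; rewrite e; apply: (@ultra_cvg_ext _ _ (fun n => crd (u n) l * crd (u n) m - crd (u n) l' * crd (u n) m')) => //.
  by apply: cvgB; apply: cvgM.
case: i => -[|[|[|//]]] h.
- by apply: (X _ (false, 1) (true, 2%:R) (false, 2%:R) (true, 1)) => q; rewrite /vperp /cross mxE.
- by apply: (X _ (false, 2%:R) (true, 0) (false, 0) (true, 2%:R)) => q; rewrite /vperp /cross mxE.
- by apply: (X _ (false, 0) (true, 1) (false, 1) (true, 0)) => q; rewrite /vperp /cross mxE.
Qed.

(** The relative rotation of two nearby frames has trace near 3. A trace above [26 / 10] gives the
    bound [9 / 10] through [frame_trace]. *)
Lemma lift_close (p q : nat -> V6) (P : V6) (z w : nat -> C2 R) : T1S2 P -> p @ ultra --> P -> q @ ultra --> P ->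
  (forall n, [/\ nrm (z n) = 1, nrm (w n) = 1, p n = Dcov (z n) & q n = Dcov (w n)]) -> ultra [set n | 9 / 10 < dot4 (z n) (w n) ^+ 2].
Proof.
move=> TP pc qc h; have [h1 h2 h3] := TP; have [_ _ n3] := vperp_dots TP.
have lim : (fun n => dot (p n).1 (q n).1 + dot (p n).2 (q n).2 + dot (vperp (p n)) (vperp (q n))) @ ultra --> (3 : R).
  have -> : (3 : R) = dot P.1 P.1 + dot P.2 P.2 + dot (vperp P) (vperp P) by rewrite h1 h2 n3; ring.
  apply: cvgD; [apply: cvgD|]; apply: dot_cvg => i.
  - exact: (@cvg_crd _ _ _ (false, i) pc).
  - exact: (@cvg_crd _ _ _ (false, i) qc).
  - exact: (@cvg_crd _ _ _ (true, i) pc).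
  - exact: (@cvg_crd _ _ _ (true, i) qc).
  - exact: vperp_cvg pc.
  - exact: vperp_cvg qc.
have := ultra_cvg_gt lim (_ : 26 / 10 < 3); have d : (26 : R) / 10 < 3 by lra.
move=> /(_ d); apply: filterS => n /=; have [z1 w1 -> ->] := h n.
by rewrite !vperp_cover // frame_trace z1 w1; lra.
Qed.

Section Loop.
Variables (q0 p0 q1 p1 : R -> R).
Hypotheses (q0c : continuous q0) (p0c : continuous p0) (q1c : continuous q1) (p1c : continuous p1).
Let ze s : C2 R := ((q0 s, p0 s), (q1 s, p1 s)).
Hypothesis ze1 : forall s, nrm (ze s) = 1.

(** [Dcov] is homogeneous of degree 2, so dividing its value by the squared length [nrm w] replaces
    normalization of the lift. *)
Lemma closed_lift_contractible : ze 1 = ze 0 -> (forall s, q0 s != 0 \/ p0 s != 0) -> contractible (fun s => Dcov (ze s)).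
Proof.
move=> zc zn.
(* The segment from a point with non-zero first coordinate to (0, 1) avoids the origin. *)
pose w (u : R * R) : C2 R := (((1 - u.1) * q0 u.2, (1 - u.1) * p0 u.2), ((1 - u.1) * q1 u.2 + u.1, (1 - u.1) * p1 u.2)).
have w0 u : nrm (w u) != 0.
  apply/eqP; rewrite /nrm /w /= => h.
  have h1 := sqr_ge0 ((1 - u.1) * q0 u.2); have h2 := sqr_ge0 ((1 - u.1) * p0 u.2).
  have h3 := sqr_ge0 ((1 - u.1) * q1 u.2 + u.1); have h4 := sqr_ge0 ((1 - u.1) * p1 u.2).
  have [e1 e2 e3] : [/\ (1 - u.1) * q0 u.2 = 0, (1 - u.1) * p0 u.2 = 0 & (1 - u.1) * q1 u.2 + u.1 = 0].
    by split; apply/eqP; rewrite -sqrf_eq0; apply/eqP; lra.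
  have [u1|u1] := eqVneq (1 - u.1) 0; first by move: e3; rewrite u1 mul0r; lra.
  by move: e1 e2 => /eqP; rewrite mulf_eq0 (negPf u1) /= => /eqP e1 /eqP; rewrite mulf_eq0 (negPf u1) /= => /eqP e2; have := zn u.2; rewrite e1 e2 eqxx; case.
exists (fun u => (nrm (w u))^-1 *: Dcov (w u)), (Dcov ((0, 0), (1, 0))); split.
- apply: continuous_subspaceT; apply: V6_continuous => j.
  have fc : continuous (fun u : R * R => u.1) by move=> u; exact: cvg_fst.
  have sc (k : R -> R) : continuous k -> continuous (fun u : R * R => k u.2).
    by move=> kc u; apply: continuous_comp; [exact: cvg_snd|exact: kc].
  have cD (k l : R * R -> R) : continuous k -> continuous l -> continuous (fun u => k u + l u) by move=> kc lc u; apply: cvgD; [exact: kc|exact: lc].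
  have cM (k l : R * R -> R) : continuous k -> continuous l -> continuous (fun u => k u * l u) by move=> kc lc u; apply: cvgM; [exact: kc|exact: lc].
  have cC (k : R) : continuous (fun _ : R * R => k) by move=> u; exact: cvg_cst.
  have cN (k : R * R -> R) : continuous k -> continuous (fun u => - k u) by move=> kc u; apply: cvgN; exact: kc.
  have c1 : continuous (fun u : R * R => 1 - u.1) by apply: cD => //; exact: cN.
  have a1 := cM _ _ c1 (sc _ q0c); have a2 := cM _ _ c1 (sc _ p0c).
  have a3 := cD _ _ (cM _ _ c1 (sc _ q1c)) fc; have a4 := cM _ _ c1 (sc _ p1c).
  have nc : continuous (fun u => (nrm (w u))^-1).
    by move=> u; apply: cvgV; [exact: w0|]; exact: (cD _ _ (cD _ _ (cD _ _ (cM _ _ a1 a1) (cM _ _ a2 a2)) (cM _ _ a3 a3)) (cM _ _ a4 a4) u).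
  have -> : (fun u => crd ((nrm (w u))^-1 *: Dcov (w u)) j) = (fun u => (nrm (w u))^-1 * crd (Dcov (w u)) j) by apply/funext => u; rewrite crdZ.
  have Dc : continuous (fun u => crd (Dcov (w u)) j).
    pose A u := (w u).1.1; pose B u := (w u).1.2; pose C u := (w u).2.1; pose D u := (w u).2.2.
    have c (k : R * R -> R) : continuous k -> (forall u, crd (Dcov (w u)) j = k u) -> continuous (fun u => crd (Dcov (w u)) j).
      by move=> kc e; have -> : (fun u => crd (Dcov (w u)) j) = k by exact/funext.
    pose cS k l m n (kc : continuous k) (lc : continuous l) (mc : continuous m) (nc' : continuous n) := cD _ _ (cM k l kc lc) (cM m n mc nc').
    case: j c => -[] [[|[|[|//]]] i] c; rewrite /crd /= in c.
    - apply: (c _ (cM _ _ (cC (-2)) (cS _ _ _ _ a1 a2 a3 a4))) => u; rewrite mxE /=; ring.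
    - apply: (c _ (cD _ _ (cS _ _ _ _ a2 a2 a3 a3) (cN _ (cS _ _ _ _ a1 a1 a4 a4)))) => u; rewrite mxE /=; ring.
    - apply: (c _ (cM _ _ (cC 2) (cD _ _ (cM _ _ a1 a3) (cN _ (cM _ _ a2 a4))))) => u; rewrite mxE /=; ring.
    - apply: (c _ (cD _ _ (cS _ _ _ _ a1 a1 a3 a3) (cN _ (cS _ _ _ _ a2 a2 a4 a4)))) => u; rewrite mxE /=; ring.
    - apply: (c _ (cM _ _ (cC 2) (cD _ _ (cM _ _ a3 a4) (cN _ (cM _ _ a1 a2))))) => u; rewrite mxE /=; ring.
    - apply: (c _ (cM _ _ (cC 2) (cS _ _ _ _ a1 a4 a2 a3))) => u; rewrite mxE /=; ring.
  exact: cM.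
- move=> s t _ _; have [k1 k2 k3 _ _] := cover_dots (w (s, t)); have wn := w0 (s, t).
  move: k1 k2 k3; set N := nrm _; set Z := Dcov _ => k1 k2 k3.
  have sm (u v : 'rV[R]_3) : dot (N^-1 *: u) (N^-1 *: v) = N^-1 ^+ 2 * dot u v by rewrite dotZr dotC dotZr dotC; ring.
  by split; rewrite /= sm ?k1 ?k2 ?k3 ?mulr0 // -exprMn mulVf // expr1n.
- move=> t _; have -> : w (0, t) = ze t by rewrite /w /= subr0 !mul1r addr0.
  by rewrite ze1 invr1 scale1r.
- move=> t _; have -> : w (1, t) = ((0, 0), (1, 0)) by rewrite /w /= subrr !mul0r add0r.
  by rewrite /nrm /= !expr0n /= expr1n !add0r addr0 invr1 scale1r.
move=> s _; congr (_^-1 *: Dcov _); rewrite /w /=; move: zc; rewrite /ze => -[-> -> -> ->] //.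
Qed.

(** A discrete monodromy argument. Lifts [L] are chosen arbitrarily on a fine grid of the homotopy,
    and each edge carries the sign of the product of the lifts at its ends. The signs around a cell
    multiply to 1, so the product along a row is the same for all rows. It is 1 on the constant row,
    but -1 on the initial row, because the continuous lift ends at the antipode. *)
Lemma odd_lift_not_contractible : ze 1 = ((- q0 0, - p0 0), (- q1 0, - p1 0)) -> ~ contractible (fun s => Dcov (ze s)).
Proof.
move=> zo [H [c [Hc HT H0 H1 Hper]]].
pose sq : set (R * R) := `[0, 1] `*` `[0, 1].
have /choice[L LP] : forall p : V6, exists z : C2 R, T1S2 p -> nrm z = 1 /\ p = Dcov z.
  move=> p; have [/T1S2_cover[z z1 zE]|no] := pselect (T1S2 p); first by exists z.
  by exists ((0, 0), (0, 0)) => /no.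
have near : exists N : nat, forall s t s' t' : R, 0 <= s <= 1 -> 0 <= t <= 1 -> 0 <= s' <= 1 -> 0 <= t' <= 1 ->
   `|s - s'| <= N.+1%:R^-1 -> `|t - t'| <= N.+1%:R^-1 -> 9 / 10 < dot4 (L (H (s, t))) (L (H (s', t'))) ^+ 2 /\ 99 / 100 < dot4 (ze t) (ze t').
  apply: contrapT => no.
  have /choice[u uP] : forall N : nat, exists u : (R * R) * (R * R), [/\ 0 <= u.1.1 <= 1 /\ 0 <= u.1.2 <= 1, 0 <= u.2.1 <= 1 /\ 0 <= u.2.2 <= 1,
     `|u.1.1 - u.2.1| <= N.+1%:R^-1, `|u.1.2 - u.2.2| <= N.+1%:R^-1 &
     ~ (9 / 10 < dot4 (L (H u.1)) (L (H u.2)) ^+ 2 /\ 99 / 100 < dot4 (ze u.1.2) (ze u.2.2))].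
    move=> N; apply: contrapT => non; apply: no; exists N => s t s' t' h1 h2 h3 h4 h5 h6.
    by apply: contrapT => h; apply: non; exists ((s, t), (s', t')).
  have [s0 s01 sc] := @ultra_bounded_cvg R (fun n => (u n).1.1) 0 1 (fun n => let: And5 (conj h _) _ _ _ _ := uP n in h).
  have [t0 t01 tc] := @ultra_bounded_cvg R (fun n => (u n).1.2) 0 1 (fun n => let: And5 (conj _ h) _ _ _ _ := uP n in h).
  have sc' : (fun n => (u n).2.1) @ ultra --> s0.
    by apply: (ultra_cvg_near sc (C := 1)) => n; rewrite mul1r distrC; have [_ _ h _ _] := uP n.
  have tc' : (fun n => (u n).2.2) @ ultra --> t0.
    by apply: (ultra_cvg_near tc (C := 1)) => n; rewrite mul1r distrC; have [_ _ _ h _] := uP n.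
  have sqE (v : R * R) : 0 <= v.1 <= 1 -> 0 <= v.2 <= 1 -> sq v by move=> h1 h2; split; rewrite /= in_itv.
  have sq1 n : sq ((u n).1.1, (u n).1.2) by have [[? ?] _ _ _ _] := uP n; exact: sqE.
  have sq2 n : sq ((u n).2.1, (u n).2.2) by have [_ [? ?] _ _ _] := uP n; exact: sqE.
  have k1 := within_ultra Hc sq1 (sqE (s0, t0) s01 t01) sc tc.
  have k2 := within_ultra Hc sq2 (sqE (s0, t0) s01 t01) sc' tc'.
  have near1 : ultra [set n | 9 / 10 < dot4 (L (H (u n).1)) (L (H (u n).2)) ^+ 2].
    apply: (lift_close (HT s0 t0 s01 t01) k1 k2) => n; have [[a1 a2] [b1 b2] _ _ _] := uP n.
    by have [e1 e2] := LP _ (HT _ _ a1 a2); have [e3 e4] := LP _ (HT _ _ b1 b2); move: e1 e2 e3 e4; rewrite -!surjective_pairing.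
  have near2 : ultra [set n | 99 / 100 < dot4 (ze (u n).1.2) (ze (u n).2.2)].
    have lim : (fun n => dot4 (ze (u n).1.2) (ze (u n).2.2)) @ ultra --> (1 : R).
      have -> : 1 = dot4 (ze t0) (ze t0) by rewrite -(ze1 t0) /nrm /dot4 !expr2.
      have cc (k : R -> R) : continuous k -> (fun n => k (u n).1.2 * k (u n).2.2) @ ultra --> k t0 * k t0.
        by move=> kc; apply: cvgM; [exact: ultra_cvg_comp (kc t0) tc|exact: ultra_cvg_comp (kc t0) tc'].
      by rewrite /dot4 /=; apply: cvgD; [apply: cvgD; [apply: cvgD|]|]; apply: cc.
    by apply: (ultra_cvg_gt lim); lra.
  by have [n [/= n1 n2]] := filter_ex (filterI near1 near2); have [_ _ _ _] := uP n; apply.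
case: near => N0 nearP; set N := N0.+1 in nearP.
pose gr (i : nat) : R := i%:R / N%:R.
have N0' : 0 < N%:R :> R by rewrite ltr0n.
have gr01 i : (i <= N)%N -> 0 <= gr i <= 1.
  by move=> iN; rewrite divr_ge0 ?ler0n //= ler_pdivrMr // mul1r ler_nat.
have grS i : `|gr i - gr i.+1| <= N%:R^-1.
  by rewrite distrC /gr -mulrBl -natr1 addrAC subrr add0r mul1r ger0_norm // invr_ge0 ltW.
have gr0 : gr 0%N = 0 by rewrite /gr mul0r.
have grN : gr N = 1 by rewrite /gr divff // lt0r_neq0.
have grr i : `|gr i - gr i| <= N%:R^-1 by rewrite subrr normr0 invr_ge0 ltW.
pose z i j := L (H (gr i, gr j)).
have zP i j : (i <= N)%N -> (j <= N)%N -> nrm (z i j) = 1 /\ H (gr i, gr j) = Dcov (z i j).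
  by move=> iN jN; apply: LP; apply: HT; exact: gr01.
have zN i : (i <= N)%N -> z i N = z i 0%N by move=> iN; rewrite /z gr0 grN (Hper _ (gr01 i iN)).
pose h i j := Num.sg (dot4 (z i j) (z i j.+1)).
pose v i j := Num.sg (dot4 (z i j) (z i.+1 j)).
pose row i j := \prod_(k < j) h i k.
have cell i j : (i < N)%N -> (j < N)%N -> v i j * h i.+1 j = h i j * v i j.+1.
  move=> iN jN; have [i1 j1] := (ltnW iN, ltnW jN).
  have [u1 _] := zP i j i1 j1; have [u2 _] := zP i.+1 j iN j1; have [u3 _] := zP i j.+1 i1 jN; have [u4 _] := zP i.+1 j.+1 iN jN.
  have n1 i' j' i'' j'' : (i' <= N)%N -> (j' <= N)%N -> (i'' <= N)%N -> (j'' <= N)%N -> `|gr i' - gr i''| <= N%:R^-1 -> `|gr j' - gr j''| <= N%:R^-1 ->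
      9 / 10 < dot4 (z i' j') (z i'' j'') ^+ 2.
    by move=> k1 k2 k3 k4 k5 k6; have [] := nearP _ _ _ _ (gr01 _ k1) (gr01 _ k2) (gr01 _ k3) (gr01 _ k4) k5 k6.
  by rewrite /v /h (dot4_sg u1 u2 u4) ?(dot4_sg u1 u3 u4) //; apply: n1.
have sweep i j : (i < N)%N -> (j <= N)%N -> v i 0%N * row i.+1 j = row i j * v i j.
  move=> iN; elim: j => [|j IH] jN; first by rewrite /row !big_ord0 mulr1 mul1r.
  by rewrite /row !big_ord_recr /= -/(row _ j) -/(row _ j) mulrA IH ?(ltnW jN) // -mulrA cell // mulrA.
have rowS i : (i < N)%N -> row i.+1 N = row i N.
  move=> iN; have e := sweep i N iN (leqnn _).
  have vN : v i N = v i 0%N by rewrite /v !zN // ltnW.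
  have v0 : v i 0%N != 0.
    rewrite /v sgr_eq0; apply/eqP => d0.
    have [] := nearP (gr i) (gr 0%N) (gr i.+1) (gr 0%N) (gr01 _ (ltnW iN)) (gr01 _ (leq0n _)) (gr01 _ iN) (gr01 _ (leq0n _)) (grS i) (grr _).
    by rewrite -/(z i 0%N) -/(z i.+1 0%N) d0 expr0n /=; lra.
  by rewrite vN mulrC in e; exact: (mulIf v0 e).
have row0N i : (i <= N)%N -> row i N = row 0%N N.
  by elim: i => [//|i IH] iN; rewrite rowS // IH // ltnW.
have rowN : row N N = 1.
  rewrite /row big1 // => -[j jN] _; rewrite /h /z /= grN.
  have [g1 g2] := (gr01 j (ltnW jN), gr01 j.+1 jN); rewrite !H1 //.
  have [c1 _] : nrm (L c) = 1 /\ c = Dcov (L c) by apply: LP; rewrite -(H1 _ g1); apply: HT => //; rewrite ler01 lexx.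
  have -> : dot4 (L c) (L c) = 1 by rewrite -c1 /dot4 /nrm !expr2.
  by rewrite sgr1.
(* At each grid point the arbitrary lift and the continuous one cover the same frame, hence agree up
   to the sign [s j]. *)
have same j : (j <= N)%N -> 9 / 10 < dot4 (z 0%N j) (ze (gr j)) ^+ 2.
  move=> jN; have [z1 zE] := zP 0%N j (leq0n _) jN; have := H0 _ (gr01 j jN); rewrite -gr0 zE => e.
  have := frame_trace (z 0%N j) (ze (gr j)); rewrite -(vperp_cover z1) -(vperp_cover (ze1 (gr j))) z1 ze1 e.
  have [h1 h2 _] := T1S2_Dcov (ze1 (gr j)); have [_ _ n3] := vperp_dots (T1S2_Dcov (ze1 (gr j))).
  by rewrite h1 h2 n3; lra.
pose s j := Num.sg (dot4 (z 0%N j) (ze (gr j))).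
have step0 j : (j < N)%N -> h 0%N j * s j.+1 = s j.
  move=> jN; have [z1 _] := zP 0%N j (leq0n _) (ltnW jN); have [z2 _] := zP 0%N j.+1 (leq0n _) jN.
  have g0 := gr01 0%N (leq0n _); have [n1 n2] := nearP _ _ _ _ g0 (gr01 j (ltnW jN)) g0 (gr01 j.+1 jN) (grr _) (grS j).
  rewrite /h /s (dot4_sg z1 z2 (ze1 _) n1 (same _ jN)).
  rewrite -(dot4_sg z1 (ze1 (gr j)) (ze1 (gr j.+1)) (same _ (ltnW jN))); last by nra.
  by rewrite [Num.sg (dot4 (ze _) _)]gtr0_sg ?mulr1 //; lra.
have row0 j : (j <= N)%N -> row 0%N j * s j = s 0%N.
  elim: j => [|j IH] jN; first by rewrite /row big_ord0 mul1r.
  by rewrite /row big_ord_recr /= -/(row _ j) -mulrA step0 // IH // ltnW.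
have sN : s N = - s 0%N.
  rewrite /s (zN 0%N) // grN gr0 zo -sgrN; congr Num.sg; rewrite /dot4 /=; ring.
have := row0 N (leqnn _); rewrite -(row0N N (leqnn _)) rowN mul1r sN => e.
have s0 : s 0%N = 0 by lra.
move/eqP: s0; rewrite sgr_eq0 => /eqP d0; have := same 0%N (leq0n _); rewrite d0 expr0n /=; lra.
Qed.
End Loop.
End Lifting.

(** * Periods and winding numbers *)

Section Arguments.
Variable R : realType.

Lemma sin_gt0_arg (t : R) : - pi < t < pi -> 0 < sin t -> 0 < t.
Proof.
move=> /andP[t1 t2] st; rewrite ltNge; apply/negP => t0.
have : 0 <= sin (- t) by apply: sin_ge0_pi; apply/andP; split; lra.
by rewrite sinN; lra.
Qed.

Lemma cos_gt0_arg (t : R) : - pi < t < pi -> 0 < cos t -> - (pi / 2) < t < pi / 2.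
Proof.
move=> t12 ct.
have h (u : R) : - pi < u < pi -> 0 < cos u -> u < pi / 2.
  move=> /andP[u1 u2] cu; rewrite ltNge; apply/negP => u0.
  have : 0 <= sin (u - pi / 2) by apply: sin_ge0_pi; apply/andP; split; lra.
  by rewrite sinB sin_pihalf cos_pihalf; lra.
have h1 := h t t12 ct; have : - t < pi / 2.
  by apply: h; [move: t12 => /andP[? ?]; apply/andP; split; lra|rewrite cosN].
by move=> h2; apply/andP; split; lra.
Qed.

Lemma arg_cross (u v : R * R) (s t : R) : is_arg u s -> is_arg v t -> 0 < t - s < pi -> 0 < u.1 * v.2 - u.2 * v.1.
Proof.
move=> [_ [r r0 ->]] [_ [r' r0' ->]] st; rewrite /polar /=.
have -> : r * cos s * (r' * sin t) - r * sin s * (r' * cos t) = r * r' * sin (t - s) by rewrite sinB; ring.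
by rewrite !mulr_gt0 // sin_gt0_pi.
Qed.

Lemma is_arg_sin (u : R * R) (t : R) : is_arg u t -> 0 < u.2 -> 0 < t < pi.
Proof.
move=> [t12 [r r0 ->]]; rewrite /polar /= pmulr_rgt0 // => /(sin_gt0_arg t12) ->.
by have /andP[] := t12.
Qed.

Lemma is_arg_cos (u : R * R) (t : R) : is_arg u t -> 0 < u.1 -> - (pi / 2) < t < pi / 2.
Proof. by move=> [t12 [r r0 ->]]; rewrite /polar /= pmulr_rgt0 // => /(cos_gt0_arg t12). Qed.

(** For arguments less than [pi] apart, the order is the sign of the cross product of the
    vectors. *)
Lemma arg_lt_twist (p q e0 e1 : R) : (arg_lt (1, e1) (p, q) /\ arg_lt (p, q) (e0, 1)) \/ (arg_lt (e0, 1) (p, q) /\ arg_lt (p, q) (1, e1)) ->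
  twist e0 e1 p q.
Proof.
have pp := pi_gt0 R.
move=> [[[_ dom [s [t [hs ht st]]]] [_ _ [s' [t' [hs' ht' st']]]]]|[[_ _ [s [t [hs ht st]]]] [_ _ [s' [t' [hs' ht' st']]]]]].
  left; split; first by move: dom => /orP[]; [left|right].
    move=> q0; have /andP[k1 k2] := is_arg_sin hs' q0; have /andP[k3 k4] := is_arg_sin ht' ltr01.
    have := @arg_cross _ _ _ _ hs' ht'; rewrite /= => /(_ _)/=; rewrite mulr1 mulrC => h.
    by have : 0 < p - e0 * q; [apply: h; apply/andP; split; lra|lra].
  move=> p0; have /andP[k1 k2] := is_arg_cos hs ltr01; have /andP[k3 k4] := is_arg_cos ht p0.
  have := @arg_cross _ _ _ _ hs ht; rewrite /= mul1r => h.
  by have : 0 < q - e1 * p; [apply: h; apply/andP; split; lra|lra].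
right; have /andP[k1 k2] := is_arg_sin hs ltr01; have [/andP[t1 t2] tq] := ht.
have q0 : 0 < q by case: tq => r r0 [_ ->]; rewrite mulr_gt0 // sin_gt0_pi //; apply/andP; split; lra.
have /andP[k3 k4] := is_arg_cos ht' ltr01; have /andP[k5 k6] := is_arg_sin hs' q0.
have p0 : 0 < p by case: hs' => _ [r r0 [-> _]]; rewrite mulr_gt0 // cos_gt0_pihalf //; apply/andP; split; lra.
have h1 := @arg_cross _ _ _ _ hs ht; have h2 := @arg_cross _ _ _ _ hs' ht'; rewrite /= mul1r in h1 h2.
have : 0 < e0 * q - p by apply: h1; apply/andP; split; lra.
have : 0 < p * e1 - q * 1 by apply: h2; apply/andP; split; lra.
by split => //; lra.
Qed.

Lemma twist_scale (k p q e0 e1 : R) : 0 < k -> twist e0 e1 p q -> twist e0 e1 (k * p) (k * q).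
Proof.
move=> k0; rewrite /twist !(pmulr_rgt0 _ k0) !(mulrCA _ k) !(ltr_pM2l k0) //.
Qed.
End Arguments.

Section Periods.
Variable R : realType.

(** Between two distinct values the function would take one halfway between consecutive multiples of
    [pi]. *)
Lemma pi_multiples_cst (h : R -> R) : continuous h -> (forall t, exists k : int, h t = k%:~R * pi) -> forall s t, h s = h t.
Proof.
move=> hc hk; have pp := pi_gt0 R.
have le s t : h s <= h t -> h s = h t.
  rewrite le_eqVlt => /predU1P[//|st]; have [i hi] := hk s; have [j hj] := hk t.
  have ij : i < j by rewrite -(ltr_int R) -(ltr_pM2r pp) -hi -hj.
  have ij1 : i%:~R + 1 <= j%:~R :> R by rewrite -(intrD _ i 1) ler_int; lia.
  have ij2 := ler_wpM2r (ltW pp) ij1.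
  have [||c hcE] := @ivt R h s t (i%:~R * pi + pi / 2) hc; [by rewrite hi; lra|by rewrite hj; lra|].
  have [k hk'] := hk c; rewrite hk' in hcE.
  have e : k%:~R * 2 = i%:~R * 2 + 1 :> R by apply: (mulIf (lt0r_neq0 pp)); lra.
  have /eqP : (k * 2)%:~R = (i * 2 + 1)%:~R :> R by rewrite intrD !intrM.
  by rewrite eqr_int => /eqP; lia.
by move=> s t; have [/le|/le] := orP (le_total (h s) (h t)).
Qed.

(* Otherwise the periodic function [a t - c * (t / T)] would have no minimum. *)
Lemma quasi_period (a : R -> R) (S T d c : R) : 0 < T -> continuous a -> (forall t, a (t + T) = a t + c) ->
  (forall t, a (t + S) = a t + d) -> d = c * (S / T).
Proof.
move=> T0 ac aT aS; pose D t := a t - c * (t / T).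
have Tn := lt0r_neq0 T0.
have DT t : D (t + T) = D t by rewrite /D aT; field.
have Dc : continuous D.
  move=> t; apply: cvgB; first exact: ac.
  by apply: cvgM; [exact: cvg_cst|apply: cvgM; [exact: cvg_id|exact: cvg_cst]].
have [m _ mP] : exists2 m, m \in `[0, T] & forall t, t \in `[0, T] -> D m <= D t.
  by apply: EVT_min; [exact: ltW|exact: continuous_subspaceT].
have Dm t : D m <= D t.
  have perN (n : nat) s : D (s + n%:R * T) = D s.
    elim: n => [|n IH]; first by rewrite mul0r addr0.
    by have -> : s + n.+1%:R * T = s + n%:R * T + T; [rewrite -natr1; ring|rewrite DT].
  have perZ (n : int) s : D (s + n%:~R * T) = D s.
    by case: n => n; [exact: perN|rewrite NegzE -(perN n.+1); congr D; rewrite mulrNz; ring].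
  rewrite -(perZ (- Num.floor (t / T)) t); apply: mP; rewrite in_itv /=.
  have h1 := floor_le (t / T); have h2 := floorD1_gt (t / T); rewrite mulrNz.
  move: h1 h2; rewrite ler_pdivlMr // ltr_pdivrMr // intrD mulrDl mul1r => h1 h2.
  by apply/andP; split; lra.
have DS t : D (t + S) = D t + (d - c * (S / T)) by rewrite /D aS; field.
have h1 := Dm (m + S); have h2 := Dm (m - S).
have h3 := DS (m - S); rewrite subrK in h3; rewrite DS in h1; lra.
Qed.

(** With [u * p + v * q = 1], the number [k * r] is [u * i + v * j]. *)
Lemma bezout_ratio (p q i j : int) (k r : R) : relatively_prime p q -> i%:~R = k * p%:~R * r -> j%:~R = k * q%:~R * r ->
  exists n : int, k * r = n%:~R.
Proof.
move=> pq ip jq; have [u [v uv]] := Bezoutz p q.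
have g1 : gcdz p q = 1.
  have g0 : 0 <= gcdz p q by [].
  have := pq (gcdz p q); rewrite dvdz_gcdl dvdz_gcdr => h.
  have [g|g] := ltP 1 (gcdz p q); first by case: (h g).
  have [/eqP|] := eqVneq (gcdz p q) 0; last by lia.
  by rewrite gcdz_eq0 => /andP[/eqP p0 /eqP q0]; case: (pq 2 isT); rewrite p0 q0 !dvdz0.
exists (u * i + v * j); rewrite intrD !intrM ip jq.
have : (u * p + v * q)%:~R = 1 :> R by rewrite uv g1.
rewrite intrD !intrM => e; transitivity (k * r * (u%:~R * p%:~R + v%:~R * q%:~R)); first by rewrite e mulr1.
by ring.
Qed.

(** The point determines [z0 ^+ 2], [z1 ^+ 2] and [z0 z1]; the squares give the angles modulo [pi],
    and the product makes [i + j] even. *)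
Lemma pt_inj (a b x a' b' x' : R) : 0 < x < pi / 2 -> 0 < x' < pi / 2 -> pt a b x = pt a' b' x' ->
  x = x' /\ exists i j m : int, [/\ a' = a + i%:~R * pi, b' = b + j%:~R * pi & i + j = 2 * m].
Proof.
move=> x01 x01' e; have pp := pi_gt0 R.
have quad (y : R) : 0 < y < pi / 2 -> [/\ 0 < sin y, 0 < cos y & 0 <= y <= pi / 2].
  move=> /andP[y0 y1]; split; [apply: sin_gt0_pi|apply: cos_gt0_pihalf|]; apply/andP; split; lra.
have [s0 c0 y01] := quad x x01; have [s0' c0' y01'] := quad x' x01'.
have n3 := pt_n3 a b x; rewrite e pt_n3 in n3; have cs := cos2Dsin2 x; have cs' := cos2Dsin2 x'.
have se : sin x = sin x' by apply: sqr_inj; [exact: ltW|exact: ltW|lra].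
have ce : cos x = cos x' by apply: sqr_inj; [exact: ltW|exact: ltW|lra].
have xx : x = x'.
  by apply: cos_inj => //; rewrite in_itv /=; [move: x01|move: x01'] => /andP[? ?]; apply/andP; split; lra.
split => //; rewrite -{}xx in e.
have co k (i : 'I_3) : crd (pt a b x) (k, i) = crd (pt a' b' x) (k, i) by rewrite e.
have x1 := co false 0; have x2 := co false 1; have v1 := co true 0; have v2 := co true 1.
rewrite /crd /pt /zpt /polar /= !simp3 in x1 x2 v1 v2.
have s2 : sin x ^+ 2 != 0 by rewrite sqrf_eq0 lt0r_neq0.
have c2 : cos x ^+ 2 != 0 by rewrite sqrf_eq0 lt0r_neq0.
have dc (y : R) : cos (2 * y) = cos y ^+ 2 - sin y ^+ 2 by rewrite (_ : 2 * y = y + y) ?cosD -?expr2 //; ring.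
have ds (y : R) : sin (2 * y) = 2 * (sin y * cos y) by rewrite (_ : 2 * y = y + y) ?sinD //; ring.
have [i ia] : exists i : int, a' = a + i%:~R * pi.
  by apply: angle_eq_double; apply: (mulfI s2); rewrite ?dc ?ds; lra.
have [j jb] : exists j : int, b' = b + j%:~R * pi.
  by apply: angle_eq_double; apply: (mulfI c2); rewrite ?dc ?ds; lra.
have v3 := co true 2%:R; have x3 := co false 2%:R.
have [t1 t2] := pt_third a b x; have [t1' t2'] := pt_third a' b' x; rewrite t1 t1' in v3; rewrite t2 t2' in x3.
have k0 : 2 * sin x * cos x != 0 by rewrite !mulf_neq0 // lt0r_neq0.
have [m me] := angle_eq (esym (mulfI k0 v3)) (esym (mulfI k0 x3)).
exists i, j, m; split => //; apply/eqP; rewrite -(eqr_int R) intrD intrM; apply/eqP.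
by apply: (mulIf (lt0r_neq0 pp)); rewrite -[2%:~R]/(2 : R); lra.
Qed.


(** If [S < T] were a period, the angles would advance by [i * pi] and [j * pi] in time [S] with
    [i + j] even, and Bezout would make [k * (S / T)] an integer. This is impossible for [k = 1];
    for [k = 2] it gives [S = T / 2], hence [i = p] and [j = q], whose sum is odd. *)
Lemma minimal_orbit (P : profile R) (a b x : R -> R) (T : R) (p q : int) (k : R) : interior_orbit P a b x -> 0 < T -> relatively_prime p q ->
  k = 1 \/ k = 2 /\ ~~ (2 %| p + q)%Z ->
  (forall t, a (t + T) = a t + k * p%:~R * pi) -> (forall t, b (t + T) = b t + k * q%:~R * pi) ->
  forall S, 0 < S < T -> ~ (forall t, pt (a (t + S)) (b (t + S)) (x (t + S)) = pt (a t) (b t) (x t)).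
Proof.
move=> orb T0 pq kk aT bT S /andP[S0 ST] h; have pp := pi_gt0 R.
have x01 t : 0 < x t < pi / 2 by have [x0 x1 _ _ _] := orb t; rewrite x0 x1.
have ac : continuous a by move=> t; have [_ _ D _ _] := orb t; exact: derive_cont D.
have bc : continuous b by move=> t; have [_ _ _ D _] := orb t; exact: derive_cont D.
have inj t := pt_inj (x01 t) (x01 (t + S)) (esym (h t)).
have sc (u : R -> R) : continuous u -> continuous (fun t => u (t + S) - u t).
  move=> uc t; apply: cvgB; last exact: uc.
  apply: (continuous_comp (f := fun t => t + S)); [by apply: cvgD; [exact: cvg_id|exact: cvg_cst]|exact: uc].
have [_ [i [j [m [ia jb ij]]]]] := inj 0.
have aS t : a (t + S) = a t + i%:~R * pi.
  have e := pi_multiples_cst (sc _ ac) _ t 0; rewrite ia in e.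
  have : a (t + S) - a t = a 0 + i%:~R * pi - a 0 by apply: e => s; have [_ [i' [_ [_ [-> _ _]]]]] := inj s; exists i'; ring.
  by lra.
have bS t : b (t + S) = b t + j%:~R * pi.
  have e := pi_multiples_cst (sc _ bc) _ t 0; rewrite jb in e.
  have : b (t + S) - b t = b 0 + j%:~R * pi - b 0 by apply: e => s; have [_ [_ [j' [_ [_ -> _]]]]] := inj s; exists j'; ring.
  by lra.
have ri : i%:~R = k * p%:~R * (S / T) by apply: (mulIf (lt0r_neq0 pp)); rewrite (quasi_period T0 ac aT aS); ring.
have rj : j%:~R = k * q%:~R * (S / T) by apply: (mulIf (lt0r_neq0 pp)); rewrite (quasi_period T0 bc bT bS); ring.
have [n nE] := bezout_ratio pq ri rj.
have r0 : 0 < S / T by rewrite divr_gt0.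
have r1 : S / T < 1 by rewrite ltr_pdivrMr // mul1r.
move: (S / T) r0 r1 ri rj nE => r r0 r1 ri rj nE.
case: kk => [k1|[k2 odd]].
  rewrite k1 mul1r in nE; rewrite nE ltr0z in r0; rewrite nE (ltr_int R n 1) in r1; lia.
rewrite k2 in nE ri rj; have n0 : 0 < n by rewrite -(ltr0z R) -nE; lra.
have n2 : n < 2 by rewrite -(ltr_int R) -nE; rewrite -[2%:~R]/(2 : R); lra.
have n1 : n = 1 by lia.
have rr : r = 2^-1 by move: nE; rewrite n1 => e; lra.
have ip : i = p by apply/eqP; rewrite -(eqr_int R) ri rr; apply/eqP; field.
have jq : j = q by apply/eqP; rewrite -(eqr_int R) rj rr; apply/eqP; field.
by move: odd; rewrite -ip -jq ij dvdz_mulr.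
Qed.
End Periods.

Section Assembly.
Variable R : realType.
Local Notation V6 := (V6 R).

Lemma trig_int_period (n : int) (y : R) : cos (y + n%:~R * (2 * pi)) = cos y /\ sin (y + n%:~R * (2 * pi)) = sin y.
Proof.
have c2 (z : R) : cos (z + 2 * pi) = cos z by rewrite mulrDl mul1r addrA !cosDpi opprK.
have s2 (z : R) : sin (z + 2 * pi) = sin z by rewrite mulrDl mul1r addrA !sinDpi opprK.
have hc : per4 (fun a _ _ _ : R => cos a) (2 * pi) 0 by move=> a b p r; exact: c2.
have hs : per4 (fun a _ _ _ : R => sin a) (2 * pi) 0 by move=> a b p r; exact: s2.
by split; [exact: (per4_int n hc y 0 0 0)|exact: (per4_int n hs y 0 0 0)].
Qed.

Lemma trig_odd_half_period (n : int) (y : R) : ~~ (2 %| n)%Z -> cos (y + n%:~R * pi) = - cos y /\ sin (y + n%:~R * pi) = - sin y.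
Proof.
move=> nodd; have [m ->] : exists m : int, n = m * 2 + 1 by exists ((n %/ 2)%Z); lia.
have -> : y + (m * 2 + 1)%:~R * pi = y + pi + m%:~R * (2 * pi) by rewrite intrD intrM; ring.
by have [-> ->] := trig_int_period m (y + pi); rewrite cosDpi sinDpi.
Qed.

Lemma Dcov_link_third (z : C2 R) : z.1 = (0, 0) \/ z.2 = (0, 0) ->
  crd (Dcov z) (true, 2%:R) = 0 /\ crd (Dcov z) (false, 2%:R) = 0.
Proof.
by case: z => -[a b] [c d] /= [] [-> ->]; rewrite /crd /= !vec32; split; ring.
Qed.

Lemma interior_off_link (a b x : R) : 0 < x < pi / 2 -> ~ hopf_link (pt a b x).
Proof.
move=> /andP[x0 x1] hl; have pp := pi_gt0 R.
have [z1 z2] : crd (pt a b x) (true, 2%:R) = 0 /\ crd (pt a b x) (false, 2%:R) = 0.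
  by case: hl => -[z [_ z0] <-]; apply: Dcov_link_third; [left|right].
have [e1 e2] := pt_third a b x; rewrite e1 in z1; rewrite e2 in z2.
have s0 : 0 < sin x by apply: sin_gt0_pi; apply/andP; split; lra.
have c0 : 0 < cos x by apply: cos_gt0_pihalf; apply/andP; split; lra.
have k0 : 2 * sin x * cos x != 0 by rewrite !mulf_neq0 // lt0r_neq0.
have := cos2Dsin2 (a + b); move/eqP: z1; move/eqP: z2; rewrite !mulf_eq0.
rewrite !mulf_eq0 !negb_or in k0; move: k0 => /andP[/andP[k1 k2] k3].
rewrite (negPf k1) (negPf k2) (negPf k3) /= => /eqP -> /eqP ->; rewrite expr0n /= addr0 => /esym/eqP.
by rewrite oner_eq0.
Qed.

Variables (f : V6 -> R) (fsm : smooth f) (f_gt0 : forall p, T1S2 p -> 0 < f p).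

Lemma link_crit (l : R -> V6) (t a b x : R) : reeb_trajectory (conformal_form f) l ->
  (forall t, crd (l t) (true, 2%:R) = 0 /\ crd (l t) (false, 2%:R) = 0) -> l t = pt a b x -> 'D_(Px a b x) f (pt a b x) = 0.
Proof.
move=> tr l3 lt; have [|d1 d2] := link_critical fsm f_gt0 tr _ t; first by move=> s; have [? ?] := l3 s.
by rewrite lt in d1 d2; rewrite /Px D_add ?D_scale ?d1 ?d2 ?mulr0 ?addr0 //; exact: f_diff.
Qed.

Lemma interior_closed_orbit (P : profile R) (a b x : R -> R) (T : R) (p q : int) (k : R) : good P -> pU P = Uof f ->
  interior_orbit P a b x -> 0 < T -> relatively_prime p q -> k = 1 \/ k = 2 /\ ~~ (2 %| p + q)%Z ->
  (forall u v w : R, pt (u + k * p%:~R * pi) (v + k * q%:~R * pi) w = pt u v w) ->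
  (forall t, a (t + T) = a t + k * p%:~R * pi) -> (forall t, b (t + T) = b t + k * q%:~R * pi) -> (forall t, x (t + T) = x t) ->
  let g t := pt (a t) (b t) (x t) in
  [/\ prime_closed_orbit (conformal_form f) g T, range g `&` hopf_link = set0 &
      has_winds (loop_of g T) (k * p%:~R / 2) (k * q%:~R / 2)].
Proof.
move=> gd PU orb T0 pq kk lat aT bT xT g; have pp := pi_gt0 R.
have ac : continuous a by move=> t; have [_ _ D _ _] := orb t; exact: derive_cont D.
have bc : continuous b by move=> t; have [_ _ _ D _] := orb t; exact: derive_cont D.
have xc : continuous x by move=> t; have [_ _ _ _ D] := orb t; exact: derive_cont D.
have x01 t : 0 < x t < pi / 2 by have [x0 x1 _ _ _] := orb t; rewrite x0 x1.
split.
- split => //; first exact: (interior_reeb fsm f_gt0 gd PU orb).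
    by move=> t; rewrite /g aT bT xT lat.
  exact: (minimal_orbit orb T0 pq kk aT bT).
- rewrite -subset0 => _ [[t _ <-]]; exact: interior_off_link.
have sc (u : R -> R) : continuous u -> {within `[0, 1], continuous (fun s => u (T * s))}.
  move=> uc; apply: continuous_subspaceT => s.
  by apply: (continuous_comp (f := fun s => T * s)); [apply: cvgM; [exact: cvg_cst|exact: cvg_id]|exact: uc].
have sinxc : continuous (fun t => sin (x t)) by move=> t; apply: continuous_comp; [exact: xc|exact: continuous_sin].
have cosxc : continuous (fun t => cos (x t)) by move=> t; apply: continuous_comp; [exact: xc|exact: continuous_cos].
exists (fun s => sin (x (T * s))), (fun s => a (T * s)), (fun s => cos (x (T * s))), (fun s => b (T * s)); split.
- by split; [exact: (sc (fun t => sin (x t)))|exact: sc].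
- by split; [exact: (sc (fun t => cos (x t)))|exact: sc].
- move=> s _ z; have /andP[x0 x1] := x01 (T * s); split => //.
  + by apply: sin_gt0_pi; apply/andP; split; lra.
  + by apply: cos_gt0_pihalf; apply/andP; split; lra.
  + exact: (nrm_zpt (a (T * s)) (b (T * s)) (x (T * s))).
- have := aT 0; rewrite add0r mulr0 mulr1 => ->; move: (@pi R) (lt0r_neq0 pp) => w wn; by field.
- have := bT 0; rewrite add0r mulr0 mulr1 => ->; move: (@pi R) (lt0r_neq0 pp) => w wn; by field.
Qed.
End Assembly.

Theorem theorem1p9 (R : realType) (f : V6 R -> R)
    (f_smooth : smooth f) (f_gt0 : forall p, T1S2 p -> 0 < f p)
    (l0 l1 : R -> V6 R) (T0 T1 : R)
    (l0_orbit : prime_closed_orbit (conformal_form f) l0 T0)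
    (l1_orbit : prime_closed_orbit (conformal_form f) l1 T1)
    (l0_normal : range l0 = Dcov @` L0) (l1_normal : range l1 = Dcov @` L1)
    (rho0 rho1 : R)
    (rho0P : is_rotation_number f l0 T0 rho0)
    (rho1P : is_rotation_number f l1 T1 rho1)
    (p q : int) (pq_prime : relatively_prime p q) :
  let eta0 := 2 * rho0 - 1 in
  let eta1 := 2 * rho1 - 1 in
  let pq := (p%:~R, q%:~R) : R * R in
  (arg_lt (1, eta1) pq /\ arg_lt pq (eta0, 1)) \/
  (arg_lt (eta0, 1) pq /\ arg_lt pq (1, eta1)) ->
  ((2 %| p + q)%Z ->
     exists (g : R -> V6 R) (T : R),
       [/\ prime_closed_orbit (conformal_form f) g T,
           range g `&` hopf_link = set0,
           ~ contractible (loop_of g T)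
         & has_winds (loop_of g T) (p%:~R / 2) (q%:~R / 2)]) /\
  (~~ (2 %| p + q)%Z ->
     exists (g : R -> V6 R) (T : R),
       [/\ prime_closed_orbit (conformal_form f) g T,
           range g `&` hopf_link = set0,
           contractible (loop_of g T)
         & has_winds (loop_of g T) p%:~R q%:~R]).
Proof.
move=> eta0 eta1 pq order; have pp := pi_gt0 R.
have third0 t : crd (l0 t) (true, 2%:R) = 0 /\ crd (l0 t) (false, 2%:R) = 0.
  have : range l0 (l0 t) by exists t.
  by rewrite l0_normal => -[z [_ z0] <-]; apply: Dcov_link_third; left.
have third1 t : crd (l1 t) (true, 2%:R) = 0 /\ crd (l1 t) (false, 2%:R) = 0.
  have : range l1 (l1 t) by exists t.
  by rewrite l1_normal => -[z [_ z0] <-]; apply: Dcov_link_third; right.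
have crit0 a b : 'D_(Px a b 0) f (pt a b 0) = 0.
  have : (Dcov @` L0) (pt a b 0).
    by exists (zpt a b 0) => //; split; [exact: nrm_zpt|rewrite /zpt /polar /= sin0 !mul0r].
  by rewrite -l0_normal => -[t _ lt]; case: l0_orbit => tr _ _ _; exact: (link_crit f_smooth f_gt0 tr third0 lt).
have crit1 a b : 'D_(Px a b (pi / 2)) f (pt a b (pi / 2)) = 0.
  have : (Dcov @` L1) (pt a b (pi / 2)).
    by exists (zpt a b (pi / 2)) => //; split; [exact: nrm_zpt|rewrite /zpt /polar /= cos_pihalf !mul0r].
  by rewrite -l1_normal => -[t _ lt]; case: l1_orbit => tr _ _ _; exact: (link_crit f_smooth f_gt0 tr third1 lt).
have [P [gd PU]] := profile_exists f_smooth f_gt0 crit0 crit1.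
have rot0 := link_rotation f_smooth f_gt0 gd PU l0_orbit l0_normal rho0P.
have rot1 := link_rotation_swap f_smooth f_gt0 gd PU l1_orbit l1_normal rho1P.
have tw := arg_lt_twist order.
(* Shifting both angles by [pi] is the deck transformation, so the translation by [p * pi] and
   [q * pi] closes up downstairs exactly when [p + q] is even ([k = 1]). Otherwise it has to be
   doubled ([k = 2]), and the orbit lifts to a closed curve. *)
have core (k : R) : 0 < k -> k = 1 \/ k = 2 /\ ~~ (2 %| p + q)%Z ->
    (forall u v w : R, pt (u + k * p%:~R * pi) (v + k * q%:~R * pi) w = pt u v w) ->
    exists (a b x : R -> R) (T : R), let g t := pt (a t) (b t) (x t) in
      [/\ prime_closed_orbit (conformal_form f) g T, range g `&` hopf_link = set0,
          has_winds (loop_of g T) (k * p%:~R / 2) (k * q%:~R / 2), interior_orbit P a b x &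
          [/\ a T = a 0 + k * p%:~R * pi, b T = b 0 + k * q%:~R * pi & x T = x 0]].
  move=> k0 kk lat; have per : per3 (pU P) (k * p%:~R * pi) (k * q%:~R * pi) by move=> u v w; rewrite PU /Uof lat.
  have tw' : twist eta0 eta1 (k * p%:~R * pi) (k * q%:~R * pi).
    by rewrite ![k * _ * pi]mulrAC; apply: twist_scale => //; exact: mulr_gt0.
  have [a [b [x [T [T_gt0 orb aT bT xT]]]]] := twist_orbit gd per rot0 rot1 tw'.
  have [h1 h2 h3] := interior_closed_orbit f_smooth f_gt0 gd PU orb T_gt0 pq_prime kk lat aT bT xT.
  exists a, b, x, T; split => //; split.
  - by have := aT 0; rewrite add0r.
  - by have := bT 0; rewrite add0r.
  - by have := xT 0; rewrite add0r.
have lift (a b x : R -> R) (T : R) : interior_orbit P a b x -> exists q0 p0 q1 p1 : R -> R,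
    [/\ continuous q0 /\ continuous p0, continuous q1 /\ continuous p1,
     (forall s, ((q0 s, p0 s), (q1 s, p1 s)) = zpt (a (T * s)) (b (T * s)) (x (T * s))) & forall s, q0 s != 0 \/ p0 s != 0].
  move=> orb.
  have ac : continuous a by move=> t; have [_ _ D _ _] := orb t; exact: derive_cont D.
  have bc : continuous b by move=> t; have [_ _ _ D _] := orb t; exact: derive_cont D.
  have xc : continuous x by move=> t; have [_ _ _ _ D] := orb t; exact: derive_cont D.
  have c (u v : R -> R) (F G : R -> R) : continuous u -> continuous v -> continuous F -> continuous G -> continuous (fun s => F (u (T * s)) * G (v (T * s))).
    move=> uc vc Fc Gc s; have Tc : {for s, continuous (fun s => T * s)} by apply: cvgM; [exact: cvg_cst|exact: cvg_id].
    have h (w H : R -> R) : continuous w -> continuous H -> {for s, continuous (fun s => H (w (T * s)))}.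
      by move=> wc Hc; apply: (continuous_comp (f := fun s => w (T * s))); [apply: (continuous_comp Tc); exact: wc|exact: Hc].
    exact: (cvgM (h u F uc Fc) (h v G vc Gc)).
  have sc := @continuous_sin R; have cc := @continuous_cos R.
  exists (fun s => sin (x (T * s)) * cos (a (T * s))), (fun s => sin (x (T * s)) * sin (a (T * s))),
    (fun s => cos (x (T * s)) * cos (b (T * s))), (fun s => cos (x (T * s)) * sin (b (T * s))); split => //.
  - by split; [exact: (c x a sin cos)|exact: (c x a sin sin)].
  - by split; [exact: (c x b cos cos)|exact: (c x b cos sin)].
  move=> s; have [x0 x1 _ _ _] := orb (T * s).
  have s0 : sin (x (T * s)) != 0 by apply/lt0r_neq0/sin_gt0_pi; apply/andP; split; lra.
  have [c0|c0] := eqVneq (cos (a (T * s))) 0; last by left; rewrite mulf_neq0.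
  right; rewrite mulf_neq0 //; apply/eqP => s1; have := cos2Dsin2 (a (T * s)).
  by rewrite c0 s1 expr0n /= addr0 => /esym/eqP; rewrite oner_eq0.
split=> [even|odd].
  have [m pqm] : exists m : int, p = q + 2 * m.
    by exists (((p + q) %/ 2)%Z - q); lia.
  have [podd qodd] : ~~ (2 %| p)%Z /\ ~~ (2 %| q)%Z.
    have no : ~ ((2 %| p)%Z /\ (2 %| q)%Z) by exact: pq_prime.
    by split; apply/negP => d; apply: no; split => //; lia.
  have [||u v w|a [b [x [T [h1 h2 h3 orb [aT bT xT]]]]]] := core 1; rewrite ?ltr01 //; first by left.
    rewrite !mul1r pqm intrD intrM mulrDl addrA -(pt_lattice q m u v w); congr (pt (_ + _) _ _); ring.
  exists (fun t => pt (a t) (b t) (x t)), T; rewrite !mul1r in h3 aT bT; split => //.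
  have [q0 [p0 [q1 [p1 [[q0c p0c] [q1c p1c] zE _]]]]] := lift a b x T orb.
  have -> : loop_of (fun t => pt (a t) (b t) (x t)) T = (fun s => Dcov ((q0 s, p0 s), (q1 s, p1 s))).
    by apply/funext => s; rewrite zE.
  apply: odd_lift_not_contractible => //; first by move=> s; rewrite zE nrm_zpt.
  have e0 := zE 0; have e1 := zE 1; rewrite mulr0 /zpt /polar in e0; rewrite mulr1 /zpt /polar aT bT xT in e1.
  have [c1 s1] := trig_odd_half_period (a 0) podd; have [c2 s2] := trig_odd_half_period (b 0) qodd.
  by rewrite e1 c1 s1 c2 s2 !mulrN; case: e0 => -> -> -> ->.
have [|||a [b [x [T [h1 h2 h3 orb [aT bT xT]]]]]] := core 2; rewrite ?ltr0n //; first by right.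
  move=> u v w; rewrite -(pt_lattice (2 * q) (p - q) u v w); congr (pt _ _ _); rewrite ?intrB intrM; ring.
exists (fun t => pt (a t) (b t) (x t)), T; rewrite ![2 * _ / 2]mulrAC divff ?mul1r // in h3; split => //.
have [q0 [p0 [q1 [p1 [[q0c p0c] [q1c p1c] zE zn]]]]] := lift a b x T orb.
have -> : loop_of (fun t => pt (a t) (b t) (x t)) T = (fun s => Dcov ((q0 s, p0 s), (q1 s, p1 s))).
  by apply/funext => s; rewrite zE.
apply: closed_lift_contractible => //; first by move=> s; rewrite zE nrm_zpt.
rewrite !zE mulr0 mulr1 /zpt /polar aT bT xT.
have per2 (n : int) (y : R) : cos (y + 2 * n%:~R * pi) = cos y /\ sin (y + 2 * n%:~R * pi) = sin y.
  by have -> : 2 * n%:~R * pi = n%:~R * (2 * pi) :> R; [ring|exact: trig_int_period].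
by have [-> ->] := per2 p (a 0); have [-> ->] := per2 q (b 0).
Qed.
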